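(* Suppose there exist a non-integer constant $p^*\in[1,\infty)$ and constants $\alpha_1>0$, $\kappa\ge 1$, $c_1>0$, $\beta_1>0$ such that for all $x,y\in\mathbb{R}^d$ $$\langle x-y, f(x)-f(y)\rangle+\tfrac{2p^*-1}{2}\|g(x)-g(y)\|^2\le-\alpha_1|x-y|^2,$$ $$|f(x)-f(y)|^2\le c_1\big(1+|x|^{2\kappa-2}+|y|^{2\kappa-2}\big)|x-y|^2,\qquad \|g(x)-g(y)\|^2\le\beta_1|x-y|^2,$$ and $\mathbb{E}[|X_0|^{2p^*}]<\infty$. Then for any $1\le p\le\frac{\lfloor p^*\rfloor}{2\kappa-1}$ and $0<h\le h_1:=\min\{\frac{1}{p\alpha_1},h_0\}$, with $h_0\in(0,1]$, the backward Euler method has a strong convergence rate of order $\frac12$ over infinite time, namely, there is a constant $K$, independent of $t,h,k$, such that $$\Big(\mathbb{E}\big[|X_k-Z_k|^{2p}\big]\Big)^{\frac1{2p}}\le K\Big(\mathbb{E}\big[1+|X_0|^{(5\kappa-3)p}\big]\Big)^{\frac1{2p}}h^{\frac12}.$$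
   Context: $|\cdot|$ and $\langle\cdot,\cdot\rangle$ are the Euclidean norm and inner product on $\mathbb{R}^d$; $\|M\|:=\sqrt{\mathrm{trace}(M^TM)}$ for matrices; $\lfloor\cdot\rfloor$ is the integer part. On a complete probability space, $W$ is an $m$-dimensional Wiener process and $X_0$ is an $\mathbb{R}^d$-valued random variable independent of $W$. For $f:\mathbb{R}^d\to\mathbb{R}^d$ and $g:\mathbb{R}^d\to\mathbb{R}^{d\times m}$, $X(t)$, $t\ge0$, denotes the solution of the Itô SDE $dX(t)=f(X(t))\,dt+g(X(t))\,dW(t)$, $X(0)=X_0$. The step size is $h=1/N$ with $N\ge1$ an integer, $t_k=kh$, $k\ge0$, and $X_k:=X(t_k)$. The backward Euler method is $Z_0=X_0$, $Z_k=Z_{k-1}+f(Z_k)h+g(Z_{k-1})\Delta W_{k-1}$, $\Delta W_{k-1}:=W(t_k)-W(t_{k-1})$, $k\ge1$. The constant $h_0$ is the step-size threshold below which the local-error and moment bounds of the scheme hold. *)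

(* Defs.v *)
From HB Require Import structures.
From mathcomp Require Import all_boot all_order all_algebra.
From mathcomp Require Import all_classical all_reals all_analysis.
From mathcomp Require Import measurable_realfun.
Import Order.TTheory GRing.Theory Num.Theory.
Import numFieldNormedType.Exports.
Set Implicit Arguments.
Unset Strict Implicit.
Unset Printing Implicit Defensive.
Local Open Scope classical_set_scope.
Local Open Scope ring_scope.

Definition inner (R : realType) (n : nat) (x y : 'cV[R]_n) : R :=
  \sum_(i < n) x i 0 * y i 0.

(* The norm [`|x|] that the library puts on matrices is the max norm. *)
Definition enorm (R : realType) (n : nat) (x : 'cV[R]_n) : R :=
  Num.sqrt (inner x x).

Definition hsnorm (R : realType) (n m : nat) (M : 'M[R]_(n, m)) : R :=
  Num.sqrt (\tr (M^T *m M)).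

Section stochastic.
Context {R : realType} {disp : measure_display} {T : measurableType disp}.
Variable P : probability T R.

Definition random_vector (n : nat) (Y : T -> 'cV[R]_n) : Prop :=
  forall i, measurable_fun setT (fun w => Y w i 0).

(* Generating class of sigma(Y s : s in D). *)
Definition gen_of (n : nat) (I : Type) (D : set I) (Y : I -> T -> 'cV[R]_n) :
    set (set T) :=
  \bigcup_(s in D) \bigcup_(i in [set: 'I_n])
    preimage_set_system setT (fun w => Y s w i 0) measurable.

Definition indep_of_process (n m : nat) (Y : T -> 'cV[R]_n)
    (W : R -> T -> 'cV[R]_m) : Prop :=
  forall A B, <<s gen_of [set: unit] (fun=> Y) >> A ->
    <<s gen_of [set t | 0 <= t] W >> B ->
    P (A `&` B) = (P A * P B)%E.

(* In the last clause, taking A := setT says that W t - W s has law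
   N(0, (t - s) Id); the second parameter of normal_prob is the standard
   deviation. *)
Record is_wiener (m : nat) (W : R -> T -> 'cV[R]_m) : Prop := {
  wiener_rv : forall t, 0 <= t -> random_vector (W t);
  wiener_start : {ae P, forall w, W 0 w = 0};
  wiener_cont : {ae P, forall w, forall j : 'I_m,
    {within `[0, +oo[%classic, continuous (fun t : R => W t w j 0)}};
  wiener_increments : forall (s t : R), 0 <= s -> s < t ->
    forall (A : set T) (B : 'I_m -> set R),
      <<s gen_of [set r | 0 <= r <= s] W >> A ->
      (forall j, measurable (B j)) ->
      P (A `&` [set w | forall j, B j ((W t w - W s w) j 0)])
      = (P A * \prod_(j < m) normal_prob 0 (Num.sqrt (t - s)) (B j))%E }.

(* sigma(X0, W s : s <= t), augmented by the P-negligible sets. *)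
Definition filtration (n m : nat) (X0 : T -> 'cV[R]_n)
    (W : R -> T -> 'cV[R]_m) (t : R) : set (set T) :=
  <<s gen_of [set: unit] (fun=> X0) `|` gen_of [set s | 0 <= s <= t] W
      `|` P.-negligible >>.

Definition measurable_wrt (F : set (set T)) (xi : T -> R) : Prop :=
  forall B : set R, measurable B -> F (xi @^-1` B).

(* sum_(i < n) xi_i 1_(s_i, s_(i+1)] with 0 = s_0 <= ... <= s_n = t and xi_i
   bounded and F(s_i)-measurable. *)
Record simple_process (F : R -> set (set T)) (t : R) := SimpleProcess {
  sp_size : nat;
  sp_time : nat -> R;
  sp_val : nat -> T -> R;
  sp_time0 : sp_time 0%N = 0;
  sp_time_size : sp_time sp_size = t;
  sp_time_le : forall i, (i < sp_size)%N -> sp_time i <= sp_time i.+1;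
  sp_meas : forall i, (i < sp_size)%N ->
    measurable_wrt (F (sp_time i)) (sp_val i);
  sp_bound : forall i, (i < sp_size)%N ->
    exists M : R, forall w, `|sp_val i w| <= M }.

Definition sp_fun F t (H : simple_process F t) (r : R) (w : T) : R :=
  \sum_(i < sp_size H) sp_val H i w *
    \1_(`]sp_time H i, sp_time H i.+1]%classic) r.

Definition sp_integral F t (H : simple_process F t) (B : R -> T -> R)
    (w : T) : R :=
  \sum_(i < sp_size H) sp_val H i w *
    (B (sp_time H i.+1) w - B (sp_time H i) w).

(* The values of P on non-measurable sets are arbitrary, hence the
   measurability requirement. *)
Definition cvg_to0_in_probability (U : nat -> T -> \bar R) : Prop :=
  (forall n, measurable_fun setT (U n)) /\
  forall e : R, 0 < e ->
    (fun n => P [set w | (e%:E <= U n w)%E]) @ \oo --> 0%E.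

(* J is (a version of) the Ito integral of Y against B over [0, t], for an
   integrand Y with int_0^t |Y|^2 < oo a.s. *)
Definition is_ito_integral (F : R -> set (set T)) (B Y : R -> T -> R) (t : R)
    (J : T -> R) : Prop :=
  measurable_fun setT J /\
  exists H : nat -> simple_process F t,
    cvg_to0_in_probability (fun n w =>
      \int[lebesgue_measure]_(r in `[0%R, t]%classic)
        ((sp_fun (H n) r w - Y r w) ^+ 2)%:E)%E /\
    cvg_to0_in_probability (fun n w => `|sp_integral (H n) B w - J w|%:E).

(* X solves dX = f(X) dt + g(X) dW on [0, oo), X(0) = X0. *)
Record is_sde_solution (d m : nat) (f : 'cV[R]_d -> 'cV[R]_d)
    (g : 'cV[R]_d -> 'M[R]_(d, m)) (W : R -> T -> 'cV[R]_m)
    (X0 : T -> 'cV[R]_d) (X : R -> T -> 'cV[R]_d) : Prop := {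
  sde_adapted : forall t, 0 <= t -> forall i,
    measurable_wrt (filtration X0 W t) (fun w => X t w i 0);
  sde_cont : {ae P, forall w, forall i : 'I_d,
    {within `[0, +oo[%classic, continuous (fun t : R => X t w i 0)}};
  sde_start : {ae P, forall w, X 0 w = X0 w};
  sde_drift_integrable : forall t, 0 <= t -> forall i,
    {ae P, forall w, lebesgue_measure.-integrable `[0, t]%classic
      (EFin \o (fun s : R => f (X s w) i 0))};
  sde_diffusion_integrable : forall t, 0 <= t -> forall i j,
    {ae P, forall w, lebesgue_measure.-integrable `[0, t]%classic
      (EFin \o (fun s : R => g (X s w) i j ^+ 2))};
  sde_eq : forall t, 0 <= t -> exists J : 'I_d -> 'I_m -> T -> R,
    (forall i j, is_ito_integral (filtration X0 W)
       (fun s w => W s w j 0) (fun s w => g (X s w) i j) t (J i j)) /\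
    {ae P, forall w, forall i,
      X t w i 0 = X0 w i 0
        + (\int[lebesgue_measure]_(s in `[0%R, t]%classic) f (X s w) i 0)
        + \sum_(j < m) J i j w} }.

Definition is_backward_euler (d m : nat) (f : 'cV[R]_d -> 'cV[R]_d)
    (g : 'cV[R]_d -> 'M[R]_(d, m)) (W : R -> T -> 'cV[R]_m)
    (X0 : T -> 'cV[R]_d) (h : R) (Z : nat -> T -> 'cV[R]_d) : Prop :=
  (forall w, Z 0%N w = X0 w) /\
  forall k w, Z k.+1 w = Z k w + h *: f (Z k.+1 w)
    + g (Z k w) *m (W (k.+1%:R * h) w - W (k%:R * h) w).

End stochastic.

(* Main.v *)
Require Import Defs.
From HB Require Import structures.
From mathcomp Require Import all_boot all_order all_algebra.
From mathcomp Require Import all_classical all_reals all_analysis.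
From mathcomp Require Import measurable_realfun ring lra.
Import Order.TTheory GRing.Theory Num.Theory.
Import numFieldNormedType.Exports.
Set Implicit Arguments.
Unset Strict Implicit.
Unset Printing Implicit Defensive.
Local Open Scope classical_set_scope.
Local Open Scope ring_scope.

(* The scheme with step [h] is compared not with the solution but with the backward Euler
   scheme [Y] of step [h / n] on a refinement of the grid, so that no Ito formula is needed.
   Let [e] be the difference of two such schemes, or of a scheme and [0], and [G] the
   corresponding difference of diffusion coefficients. By the monotonicity condition
   [V = (1 + 2 alpha1 h) |e|^2 + (2 pstar - 1) h |G|^2] satisfies, for [q < pstar],
   [E V_(k+1)^q <= E V_k^q / (1 + alpha1 h) + defects], because in the Taylor expansion of
   [|e + G dW|^(2q)] the Hessian term is at most [q (2 q - 1) |e|^(2q-2) |G|^2 h]. The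
   recursion gives moment bounds uniform in time, and then
   [E |Y_(k n) - Z_k|^(2p) <= C h^p], uniformly in [k] and [n].

   As [n] tends to infinity, [Y_(k n)] tends to [X (k h)] in probability, without rate: by
   Lenglart's inequality the Riemann and Ito sums of the coefficients along [X] converge in
   probability to their integrals, and while [X] stays in a ball the case [q = 1] of the
   recursion compares these sums with [Y]. Fatou's lemma transfers the bound to [X]. *)

(** * Inequalities for vectors *)

(** The strict gap between [q] and [pstar] drives the recursion: [2 q - 1 < 2 pstar - 1] leaves room
    for the Taylor remainder and for the factor [1 + alpha1 h]. In the end [q] is the integer part
    of [pstar], and the gap is what non-integrality provides.

    The order 1/2 comes from two defects. Over a coarse step the noise defect has mean zero against
    the past and enters with weight [h^(1 - p)], the drift defect with weight [h^(1 - 2 p)]. Their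
    [2 p]-th moments are of size [h^(2 p)] and [h^(3 p)], so each contributes [h^(1 + p)] per step,
    and the contraction by [1 / (1 + alpha1 h)] turns this into [h^p] at all times.

    The exponent [(2 kappa - 1) p] is what Young's inequality asks for when the growth
    [|x|^(2 kappa - 2)] multiplies a squared increment, whose moments are controlled with exponent
    [q / kappa].

    Two orders of quantifiers shape the statements: constants come before [X0], and [h0] comes
    before [p]. Because of the second, the error bound is proved at the largest admissible exponent,
    and smaller ones are reached through a weight. *)

Section scalar_inequalities.
Context {R : realType}.
Implicit Types a b c q r s t x y eps eta : R.

(** The leading factor [c] encodes two inequalities, an upper bound of [(1 + c)^r] for [c > 0] and a
    lower bound for [c < 0]; this is the sign pattern needed for the derivative of the remainder in
    [powR1D_taylor]. They rest on [ln (1 + c) <= c] and on [c / (1 + c) <= ln (1 + c)]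
    respectively. *)
Lemma powR1D_secant r eps : 0 <= r -> 0 < eps -> exists2 eta : R, 0 < eta < 1 &
  forall c, `|c| <= eta -> 0 <= c * (1 + r * (1 + eps) * c - (1 + c) `^ r).
Proof.
move=> r0 e0; pose eta := eps / ((1 + eps) * (r + 1)).
have den0 : 0 < (1 + eps) * (r + 1) by apply: mulr_gt0; lra.
have etaE : eta * ((1 + eps) * (r + 1)) = eps by rewrite /eta divfK ?gt_eqF.
have eta0 : 0 < eta by rewrite divr_gt0.
have eta1 : eta < 1 by nra.
exists eta; first by rewrite eta0.
move=> c; rewrite ler_norml => /andP[c1 c2].
have c10 : 0 < 1 + c by lra.
have -> : (1 + c) `^ r = expR (r * ln (1 + c)) by rewrite /powR gt_eqF.
have [c0|c0] := leP 0 c.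
  rewrite mulr_ge0// subr_ge0.
  have h1 : expR (r * ln (1 + c)) <= expR (r * c).
    by rewrite ler_expR ler_wpM2l// le_ln1Dx//; lra.
  have h2 : 1 - r * c <= expR (- (r * c)) by apply: expR_ge1Dx.
  have h3 : r * c * (1 + eps) <= eps by nra.
  have h4 : expR (- (r * c)) * expR (r * c) = 1 by rewrite mulrC expRxMexpNx_1.
  have h5 := expR_gt0 (r * c).
  have h6 : 0 <= r * c by nra.
  have h7 : 1 <= (1 - r * c) * (1 + r * (1 + eps) * c) by nra.
  apply: (le_trans h1).
  have h8 : (1 - r * c) * expR (r * c) <= 1 by nra.
  have h9 : 0 < 1 - r * c by nra.
  by rewrite -(ler_pM2l h9); lra.
have h1 : c / (1 + c) <= ln (1 + c).
  have : ln (1 + (- (c / (1 + c)))) <= - (c / (1 + c)).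
    apply: le_ln1Dx; rewrite ltrN2 ltr_pdivrMr//; lra.
  have -> : 1 + - (c / (1 + c)) = (1 + c)^-1 by field; rewrite gt_eqF.
  by rewrite lnV ?posrE// lerN2.
have h2 : (1 + eps) * c <= c / (1 + c).
  rewrite ler_pdivlMr//.
  have : - eps <= (1 + eps) * c by nra.
  nra.
have h3 := expR_ge1Dx (r * ln (1 + c)).
rewrite -mulrNN mulr_ge0; [by []|lra|].
rewrite oppr_ge0 subr_le0 (le_trans _ h3)// lerD2l -mulrA ler_wpM2l//.
exact: le_trans h2 h1.
Qed.

Lemma is_derive_powR1D q c : -1 < c ->
  is_derive c 1 (fun x : R => (1 + x) `^ q) (q * (1 + c) `^ (q - 1)).
Proof.
move=> c1.
have h1 := @is_derive1_powR R q (1 + c) ltac:(lra).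
have h2 := is_deriveD (@is_derive_cst R R R 1 c 1) (@is_derive_id R R c 1).
by have := is_derive1_comp h1 h2; rewrite add0r mulr1.
Qed.

(** The remainder [psi] vanishes at 0, and by [powR1D_secant] with exponent [q - 1] its derivative
    has the sign of its argument, so the mean value theorem gives [psi >= 0] on both sides of 0. The
    slack [eps] absorbs all orders beyond the second. *)
Lemma powR1D_taylor q eps : 1 <= q -> 0 < eps -> exists2 eta : R, 0 < eta < 1 &
  forall x, `|x| <= eta ->
    (1 + x) `^ q <= 1 + q * x + q * (q - 1) / 2 * (1 + eps) * x ^+ 2.
Proof.
move=> q1 e0; have [|eta /andP[eta0 eta1] etaP] := @powR1D_secant (q - 1) eps _ e0.
  lra.
exists eta; first by rewrite eta0.
move=> x; rewrite ler_norml => /andP[x1 x2].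
pose K := q * (q - 1) / 2 * (1 + eps).
pose psi (y : R) := 1 + q * y + K * y ^+ 2 - (1 + y) `^ q.
pose dpsi (y : R) := q * (1 + (q - 1) * (1 + eps) * y - (1 + y) `^ (q - 1)).
have dP c : -1 < c -> is_derive c 1 psi (dpsi c).
  move=> c1.
  have h1 := is_derive_powR1D q c1.
  have h2 : is_derive c 1 (fun y : R => 1 + q * y + K * y ^+ 2) (q + 2 * K * c).
    have hi := @is_derive_id R R c 1.
    have hq := is_deriveD (@is_derive_cst R R R 1 c 1) (is_deriveZ q hi).
    have hK := is_deriveD hq (is_deriveZ K (is_deriveX 2 hi)).
    by apply: (is_derive_eq hK); rewrite /GRing.scale/=; ring.
  have := is_deriveB h2 h1.
  have -> : q + 2 * K * c - q * (1 + c) `^ (q - 1) = dpsi c by rewrite /dpsi /K; field.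
  by [].
have cP c : -1 < c -> {for c, continuous psi}.
  move=> /dP[dc _]; apply: differentiable_continuous.
  exact/derivable1_diffP.
have psi0 : psi 0 = 0 by rewrite /psi addr0 powR1 expr0n/= !mulr0 !addr0 subrr.
have psiP a b : -1 < a -> a <= b ->
    exists2 c, a <= c <= b & psi b - psi a = dpsi c * (b - a).
  move=> a1 ab; have [||c] := @MVT_segment R psi dpsi a b ab.
  - by move=> y; rewrite in_itv/= => /andP[ay _]; apply: dP; lra.
  - apply/continuous_in_subspaceT => y; rewrite inE/= in_itv/= => /andP[ay _].
    by apply: cP; lra.
  by rewrite in_itv/= => cab psiE; exists c.
suff : 0 <= psi x by rewrite /psi /K; lra.
have [x0|x0] := leP 0 x.
  have [||c /andP[c0 cx] E] := psiP 0 x; [lra|lra|].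
  rewrite psi0 !subr0 in E; rewrite E.
  have := etaP c; rewrite ger0_norm// => /(_ ltac:(lra)) H.
  have [c0'|c0'] := eqVneq c 0.
    by rewrite /dpsi c0' mulr0 !addr0 powR1 subrr mulr0 mul0r.
  have {}c0 : 0 < c by rewrite lt_def c0'.
  rewrite pmulr_rge0// in H.
  by rewrite mulr_ge0// mulr_ge0//; lra.
have [||c /andP[c0 cx] E] := psiP x 0; [lra|lra|].
rewrite psi0 !sub0r in E.
have := etaP c; rewrite ler0_norm// => /(_ ltac:(lra)) H.
have [c0'|c0'] := eqVneq c 0.
  by move: E; rewrite /dpsi c0' mulr0 !addr0 powR1 subrr mulr0 mul0r; lra.
have {}cx : c < 0 by rewrite lt_neqAle c0'.
have dle : dpsi c <= 0.
  by rewrite /dpsi pmulr_rle0; [nra|lra].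
nra.
Qed.

(** Convexity of the power, obtained from Young's inequality for [s] and [t^(q - 1)] with exponents
    [q] and [q / (q - 1)], which also covers [t = 0]. The case [q = 1] is apart because its
    conjugate exponent is infinite. *)
Lemma powR_tangent q s t : 1 <= q -> 0 <= s -> 0 <= t ->
  t `^ q + q * t `^ (q - 1) * (s - t) <= s `^ q.
Proof.
move=> q1 s0 t0.
have [->|q1'] := eqVneq q 1.
  by rewrite subrr powRr0 !powRr1// mulr1 mul1r; lra.
have {}q1 : 1 < q by rewrite lt_def q1'.
have q0 : 0 < q by lra.
have := @conjugate_powR R s (t `^ (q - 1)) q (q / (q - 1)) s0 (powR_ge0 _ _) q0.
have -> : (t `^ (q - 1)) `^ (q / (q - 1)) = t `^ q.
  by rewrite -powRrM; congr (_ `^ _); field; lra.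
move=> /(_ _ _)H.
have h0 : 0 < q / (q - 1) by apply: divr_gt0; lra.
have h1 : q^-1 + (q / (q - 1))^-1 = 1 by field; apply/andP; split; lra.
have {}H := H h0 h1.
have h2 : t * t `^ (q - 1) = t `^ q by rewrite mulr_powRB1.
have h3 : t `^ q / (q / (q - 1)) = t `^ q - t `^ q / q.
  by field; apply/andP; split; lra.
rewrite h3 in H.
have : q * (s * t `^ (q - 1)) <= s `^ q + q * t `^ q - t `^ q.
  have -> : s `^ q + q * t `^ q - t `^ q = q * (s `^ q / q + (t `^ q - t `^ q / q)).
    by field; lra.
  by rewrite ler_pM2l.
by rewrite -h2; lra.
Qed.

(** The tangent inequality at the point [eta a], evaluated at [b] and divided by [eta^(q - 1)]; the
    constants [1 / q] and [(q - 1) / q] are rounded up to 1. *)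
Lemma young_powR q eta a b : 1 <= q -> 0 < eta -> 0 <= a -> 0 <= b ->
  a `^ (q - 1) * b <= eta * a `^ q + eta `^ (1 - q) * b `^ q.
Proof.
move=> q1 e0 a0 b0.
have := @powR_tangent q b (eta * a) q1 b0 ltac:(by rewrite mulr_ge0// ltW).
rewrite !powRM ?(ltW e0)// => H.
have h1 : eta * eta `^ (q - 1) = eta `^ q by rewrite mulr_powRB1// ?ltW//; lra.
have h2 : a * a `^ (q - 1) = a `^ q by rewrite mulr_powRB1//; lra.
have h3 : eta `^ (1 - q) * eta `^ (q - 1) = 1.
  rewrite -powRD; last by rewrite (gt_eqF e0) implybT.
  by rewrite (_ : 1 - q + (q - 1) = 0) ?powRr0//; ring.
set E := eta `^ (q - 1) in H h1 h3; set A := a `^ (q - 1) in H h2 *.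
set F := eta `^ (1 - q) in h3 *; set B := b `^ q in H *.
have F0 : 0 <= F by apply: powR_ge0.
have A0 : 0 <= A by apply: powR_ge0.
have B0 : 0 <= B by apply: powR_ge0.
rewrite -h1 -h2 in H; rewrite -h2.
have : F * (eta * E * (a * A) + q * (E * A) * (b - eta * a)) <= F * B.
  by rewrite ler_wpM2l.
have -> : F * (eta * E * (a * A) + q * (E * A) * (b - eta * a)) =
  (F * E) * (eta * (a * A) * (1 - q) + q * (A * b)) by ring.
rewrite h3 mul1r.
have Aa : 0 <= eta * (a * A) by rewrite !mulr_ge0// ltW.
have Ab : 0 <= A * b by rewrite mulr_ge0.
have FB : 0 <= F * B by rewrite mulr_ge0.
nra.
Qed.

Lemma powRD_le q a b : 0 <= q -> 0 <= a -> 0 <= b ->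
  (a + b) `^ q <= 2 `^ q * (a `^ q + b `^ q).
Proof.
move=> q0; wlog ab : a b / a <= b.
  move=> H a0 b0; have [ab|/ltW ab] := leP a b; first exact: H.
  by rewrite addrC (addrC (a `^ q)); apply: H.
move=> a0 b0; apply: (@le_trans _ _ ((2 * b) `^ q)).
  by apply: ge0_ler_powR; rewrite ?nnegrE//; lra.
by rewrite powRM// ler_wpM2l ?powR_ge0// lerDr powR_ge0.
Qed.

(** The coefficients 2, 4, 4 are those of two applications of [sqnD_le] to a sum of three
    vectors. *)
Lemma powRD3_le q a b c : 0 <= q -> 0 <= a -> 0 <= b -> 0 <= c ->
  (2 * a + (4 * b + 4 * c)) `^ q <=
  2 `^ q * 2 `^ q * a `^ q + 2 `^ q * 2 `^ q * 4 `^ q * (b `^ q + c `^ q).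
Proof.
move=> q0 a0 b0 c0.
have h1 : (2 * a + (4 * b + 4 * c)) `^ q <= 2 `^ q * (2 `^ q * a `^ q + (4 * b + 4 * c) `^ q).
  by rewrite -powRM//; apply: powRD_le => //; lra.
have h2 : (4 * b + 4 * c) `^ q <= 2 `^ q * (4 `^ q * b `^ q + 4 `^ q * c `^ q).
  by rewrite -!powRM//; apply: powRD_le => //; lra.
have h3 := ler_wpM2l (powR_ge0 2 q) h2.
lra.
Qed.

Lemma powRD_ge q a b : 1 <= q -> 0 <= a -> 0 <= b ->
  a `^ q + q * a `^ (q - 1) * b <= (a + b) `^ q.
Proof.
move=> q1 a0 b0; have := @powR_tangent q (a + b) a q1 ltac:(lra) a0.
by rewrite (addrC a) addrK.
Qed.

End scalar_inequalities.

(** * Euclidean and Hilbert-Schmidt norms *)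

Section euclidean.
Context {R : realType}.

Definition sqn n (x : 'cV[R]_n) : R := inner x x.

Definition hs2 n m (M : 'M[R]_(n, m)) : R := \sum_i \sum_j M i j ^+ 2.

Lemma hsnorm_sqr n m (M : 'M[R]_(n, m)) : hsnorm M ^+ 2 = hs2 M.
Proof.
have trE : \tr (M^T *m M) = hs2 M.
  rewrite /mxtrace /hs2 exchange_big; apply: eq_bigr => i _ /=.
  by rewrite mxE; apply: eq_bigr => j _; rewrite mxE expr2.
rewrite /hsnorm trE sqr_sqrtr// sumr_ge0// => i _.
by rewrite sumr_ge0// => j _; rewrite sqr_ge0.
Qed.

Section vectors.
Context {n : nat}.
Implicit Types x y z : 'cV[R]_n.

Lemma sqnE x : sqn x = \sum_i x i 0 ^+ 2.
Proof. by apply: eq_bigr => i _; rewrite expr2. Qed.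

Lemma sqn_ge0 x : 0 <= sqn x.
Proof. by rewrite sqnE sumr_ge0// => i _; rewrite sqr_ge0. Qed.

Lemma enorm_sqr x : enorm x ^+ 2 = sqn x.
Proof. by rewrite /enorm sqr_sqrtr ?sqn_ge0. Qed.

Lemma enorm_ge0 x : 0 <= enorm x. Proof. exact: sqrtr_ge0. Qed.

Lemma enorm_powR x (q : R) : enorm x `^ (2 * q) = sqn x `^ q.
Proof. by rewrite powRrM (powR_mulrn 2 (enorm_ge0 x)) enorm_sqr. Qed.

Lemma innerC x y : inner x y = inner y x.
Proof. by apply: eq_bigr => i _; rewrite mulrC. Qed.

Lemma innerDl x y z : inner (x + y) z = inner x z + inner y z.
Proof. by rewrite /inner -big_split/=; apply: eq_bigr => i _; rewrite mxE mulrDl. Qed.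

Lemma innerDr x y z : inner z (x + y) = inner z x + inner z y.
Proof. by rewrite innerC innerDl !(innerC z). Qed.

Lemma innerZl c x y : inner (c *: x) y = c * inner x y.
Proof. by rewrite /inner mulr_sumr; apply: eq_bigr => i _; rewrite mxE mulrA. Qed.

Lemma innerZr c x y : inner y (c *: x) = c * inner y x.
Proof. by rewrite innerC innerZl innerC. Qed.

Lemma innerNl x y : inner (- x) y = - inner x y.
Proof. by rewrite -scaleN1r innerZl mulN1r. Qed.

Lemma innerNr x y : inner y (- x) = - inner y x.
Proof. by rewrite innerC innerNl innerC. Qed.

Lemma sqnD x y : sqn (x + y) = sqn x + 2 * inner x y + sqn y.
Proof. rewrite /sqn innerDl !innerDr (innerC y x); ring. Qed.

Lemma sqnN x : sqn (- x) = sqn x.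
Proof. by rewrite /sqn innerNl innerNr opprK. Qed.

Lemma sqnB x y : sqn (x - y) = sqn x - 2 * inner x y + sqn y.
Proof. by rewrite sqnD sqnN innerNr; ring. Qed.

Lemma sqnZ c x : sqn (c *: x) = c ^+ 2 * sqn x.
Proof. by rewrite /sqn innerZl innerZr mulrA expr2. Qed.

Lemma sqn0 : sqn (0 : 'cV[R]_n) = 0.
Proof. by rewrite -(scale0r 0) sqnZ expr0n mul0r. Qed.

Lemma sqn_eq0 x : sqn x = 0 -> x = 0.
Proof.
rewrite sqnE => /eqP; rewrite psumr_eq0; last by move=> i _; rewrite sqr_ge0.
move=> /allP x0; apply/colP => i; rewrite mxE; apply/eqP.
by have := x0 i (mem_index_enum _); rewrite sqrf_eq0.
Qed.

Lemma inner_young x y (c : R) : 0 < c -> 2 * `|inner x y| <= c * sqn x + sqn y / c.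
Proof.
move=> c0.
have h (s : R) : s ^+ 2 = 1 -> 2 * (s * inner x y) <= c * sqn x + sqn y / c.
  move=> s2; have := sqn_ge0 (c *: x - s *: y).
  rewrite sqnB !sqnZ innerZl innerZr s2 mul1r => H.
  rewrite -(ler_pM2l c0).
  have -> : c * (c * sqn x + sqn y / c) = c ^+ 2 * sqn x + sqn y by field; rewrite gt_eqF.
  by move: H; rewrite !mulrA; lra.
have [h0|h0] := leP 0 (inner x y).
  by rewrite ger0_norm//; have := h 1 (expr1n _ _); rewrite mul1r.
by rewrite ltr0_norm//; have := h (-1) ltac:(ring); rewrite mulN1r.
Qed.

Lemma inner_CS x y : inner x y ^+ 2 <= sqn x * sqn y.
Proof.
have [/eqP x0|x0] := boolP (sqn x == 0).
  rewrite (sqn_eq0 x0) sqn0 -(scale0r 0) innerZl.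
  by rewrite !mul0r expr0n.
have {}x0 : 0 < sqn x by rewrite lt_def x0 sqn_ge0.
have := sqn_ge0 (sqn x *: y - inner x y *: x).
rewrite sqnB !sqnZ innerZl innerZr (innerC y x) => H.
by rewrite -(ler_pM2l x0); nra.
Qed.

Lemma sqnD_eps x y (eps : R) : 0 < eps -> sqn (x + y) <= (1 + eps) * sqn x + (1 + eps^-1) * sqn y.
Proof.
move=> e0; have := inner_young x y e0; have := ler_norm (inner x y).
rewrite sqnD [_ / eps]mulrC; lra.
Qed.

Lemma sqnD_le x y : sqn (x + y) <= 2 * sqn x + 2 * sqn y.
Proof. by have := sqnD_eps x y ltr01; rewrite invr1. Qed.

Lemma sqn_sum (I : Type) (r : seq I) (F : I -> 'cV[R]_n) :
  sqn (\sum_(i <- r) F i) <= (size r)%:R * \sum_(i <- r) sqn (F i).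
Proof.
elim: r => [|i r IH]; first by rewrite !big_nil sqn0 mulr0.
rewrite !big_cons/=.
have [r0|r0] := posnP (size r).
  by rewrite (size0nil r0) !big_nil !addr0 mul1r.
have s0 : 0 < (size r)%:R :> R by rewrite ltr0n.
have := sqnD_eps (F i) (\sum_(j <- r) F j) s0.
have h : (1 + (size r)%:R^-1) * sqn (\sum_(j <- r) F j) <=
   (1 + (size r)%:R^-1) * ((size r)%:R * \sum_(j <- r) sqn (F j)).
  by rewrite ler_wpM2l// addr_ge0// invr_ge0 ltW.
have -> : (size r).+1%:R = 1 + (size r)%:R :> R by rewrite -natr1 addrC.
have e : (1 + (size r)%:R^-1) * ((size r)%:R * \sum_(j <- r) sqn (F j)) =
  (1 + (size r)%:R) * \sum_(j <- r) sqn (F j).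
  by rewrite mulrA mulrDl mul1r mulVf ?gt_eqF// addrC.
rewrite e in h; lra.
Qed.

End vectors.

Lemma hs2_ge0 n m (M : 'M[R]_(n, m)) : 0 <= hs2 M.
Proof. by rewrite sumr_ge0// => i _; rewrite sumr_ge0// => j _; rewrite sqr_ge0. Qed.

Lemma sqn_mulmx n m (M : 'M[R]_(n, m)) (v : 'cV[R]_m) :
  sqn (M *m v) <= hs2 M * sqn v.
Proof.
rewrite sqnE mulr_suml ler_sum// => i _.
have := inner_CS (row i M)^T v.
rewrite sqnE.
have -> : inner (row i M)^T v = (M *m v) i 0.
  by rewrite mxE; apply: eq_bigr => j _; rewrite !mxE.
have -> // : \sum_j (row i M)^T j 0 ^+ 2 = \sum_j M i j ^+ 2.
by apply: eq_bigr => j _; rewrite !mxE.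
Qed.

Lemma hs2D_le n m (M N : 'M[R]_(n, m)) : hs2 (M + N) <= 2 * hs2 M + 2 * hs2 N.
Proof.
rewrite /hs2 !mulr_sumr -big_split/=; apply: ler_sum => i _.
rewrite !mulr_sumr -big_split/=; apply: ler_sum => j _; rewrite !mxE.
have := sqr_ge0 (M i j - N i j); nra.
Qed.

Lemma sqn_entry n (x : 'cV[R]_n) i : x i 0 ^+ 2 <= sqn x.
Proof.
rewrite sqnE (bigD1 i)//= lerDl sumr_ge0// => j _; exact: sqr_ge0.
Qed.

Lemma hs2_entry n m (M : 'M[R]_(n, m)) i j : M i j ^+ 2 <= hs2 M.
Proof.
rewrite /hs2 (bigD1 i)//= (bigD1 j)//= -addrA lerDl addr_ge0// sumr_ge0// => k _.
  exact: sqr_ge0.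
by rewrite sumr_ge0// => l _; exact: sqr_ge0.
Qed.

End euclidean.

(** * Expansion of powers of the norm over one step *)

Section moment_inequality.
Context {R : realType}.
Implicit Types q eps eta : R.

(* Second-order Taylor expansion of [|x|^(2q)]: its Hessian is at most
   [2q(2q-1)|x|^(2q-2)]. *)
Lemma sqn_powR_taylor q eps : 1 <= q -> 0 < eps -> exists C : R,
  [/\ 0 <= C, q = 1 -> C = 0 & forall n (a x : 'cV[R]_n),
   sqn (a + x) `^ q <= sqn a `^ q + 2 * q * sqn a `^ (q - 1) * inner a x
     + q * (2 * q - 1) * (1 + eps) * sqn a `^ (q - 1) * sqn x + C * sqn x `^ q].
Proof.
move=> q1 e0; have [->|q1'] := eqVneq q 1.
  exists 0; split=> // n a x.
  have := mulr_ge0 (ltW e0) (sqn_ge0 x).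
  by rewrite subrr powRr0 !powRr1 ?sqn_ge0// sqnD; lra.
have {q1'}q1 : 1 < q by rewrite lt_def q1'.
have q0 : 0 <= q := ltW (lt_trans ltr01 q1).
have q10 : 0 <= q - 1 by rewrite subr_ge0 ltW.
have q2 : 0 <= 2 * q - 1 by clear -q0 q10; lra.
pose e := Num.min eps 1.
have e_gt0 : 0 < e by rewrite lt_min e0 ltr01.
have e_le1 : e <= 1 by rewrite ge_min lexx orbT.
have e_eps : e <= eps by rewrite ge_min lexx.
have [||eta /andP[eta0 eta1] etaP] := @powR1D_taylor R q (e / 4); [lra|lra|].
(* [th] separates two regimes. If [|x| >= th |a|], every term is bounded by a multiple of
   [|x|^(2 q)], which fixes [C]. Otherwise [|a + x|^2 = |a|^2 (1 + y)] with [|y| <= 3 th <= eta],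
   and [powR1D_taylor] applies; [th <= e / 5] keeps the second-order constant within [1 + eps]. *)
pose th := Num.min (eta / 3) (e / 5).
have th0 : 0 < th by rewrite lt_min !divr_gt0.
have th_eta : th <= eta / 3 by rewrite ge_min lexx.
have th_e : th <= e / 5 by rewrite ge_min lexx orbT.
pose c1 := 2 / th ^+ 2 + 2.
pose C := c1 `^ q + q * c1 * (th ^+ 2)^-1 `^ (q - 1).
have th20 : 0 < th ^+ 2 by rewrite exprn_gt0.
have c10 : 0 < c1 by rewrite addr_gt0// divr_gt0.
have C0 : 0 <= C by rewrite addr_ge0 ?mulr_ge0 ?powR_ge0 ?(ltW c10).
exists C; split=> [//|q1''|n a x]; first by rewrite q1'' ltxx in q1.
have CS := inner_CS a x; have IY := inner_young a x (@ltr01 R).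
have E := sqnD a x; have E2 := sqnD_le a x.
have ax0 := sqn_ge0 (a + x).
set i := inner a x in CS IY E *.
set s := sqn a in CS IY E E2 *; set t := sqn x in CS IY E E2 *.
have s0 : 0 <= s by apply: sqn_ge0.
have t0 : 0 <= t by apply: sqn_ge0.
set A := s `^ (q - 1).
have A0 : 0 <= A by apply: powR_ge0.
have B0 : 0 <= q * (2 * q - 1) * (1 + eps) * A * t by rewrite !mulr_ge0// addr_ge0// ltW.
have [st|st] := leP (th ^+ 2 * s) t.
  have st' : s <= t / th ^+ 2 by rewrite ler_pdivlMr// mulrC.
  have c1t : c1 * t = 2 * (t / th ^+ 2) + 2 * t by rewrite /c1 mulrDl mulrAC mulrA.
  have le1 : sqn (a + x) <= c1 * t by clear -E2 c1t st'; lra.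
  have h1 : sqn (a + x) `^ q <= c1 `^ q * t `^ q.
    by rewrite -powRM ?(ltW c10)//; apply: ge0_ler_powR; rewrite ?nnegrE ?mulr_ge0 ?(ltW c10).
  have h2 : A <= (th ^+ 2)^-1 `^ (q - 1) * t `^ (q - 1).
    rewrite -powRM ?invr_ge0 ?(ltW th20)// mulrC.
    by apply: ge0_ler_powR; rewrite ?nnegrE ?mulr_ge0 ?invr_ge0 ?(ltW th20).
  have h3 : 2 * `|i| <= c1 * t.
    by rewrite mul1r divr1 in IY; clear -IY c1t st' t0 s0; lra.
  have h4 : - (2 * q * A * i) <= q * c1 * (th ^+ 2)^-1 `^ (q - 1) * t `^ q.
    apply: (@le_trans _ _ (q * A * (2 * `|i|))).
      have ni := ler_norm (- i); rewrite normrN in ni.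
      by have := ler_wpM2l (mulr_ge0 q0 A0) ni; clear; lra.
    have -> : t `^ q = t * t `^ (q - 1) by rewrite mulr_powRB1// (lt_trans ltr01 q1).
    have -> : q * c1 * (th ^+ 2)^-1 `^ (q - 1) * (t * t `^ (q - 1)) =
      q * ((th ^+ 2)^-1 `^ (q - 1) * t `^ (q - 1)) * (c1 * t) by ring.
    by apply: ler_pM; rewrite ?mulr_ge0// ler_wpM2l.
  have := powR_ge0 s q.
  by rewrite /C mulrDl; clear -h1 h4 B0; lra.
have {}s0 : 0 < s.
  by rewrite lt_def s0 andbT; apply/eqP => s00; move: st; rewrite s00 mulr0 ltNge t0.
pose y := (2 * i + t) / s.
have ys : y * s = 2 * i + t by rewrite /y divfK ?gt_eqF.
have i_le : `|i| <= th * s.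
  have h : `|i| ^+ 2 <= (th * s) ^+ 2 by rewrite real_normK ?num_real//; nra.
  by move: h; rewrite ler_sqr ?nnegrE ?mulr_ge0// ltW.
move: (i_le); rewrite ler_norml => /andP[i1 i2].
have t_le : t <= th * s by nra.
have y_le : `|y| <= eta.
  rewrite /y normrM normfV (ger0_norm (ltW s0)) ler_pdivrMr//.
  by rewrite ler_norml; apply/andP; split; clear -i1 i2 t_le t0 th_eta th0 s0 eta0; nra.
(* Cauchy-Schwarz bounds the square of [2 <a, x>] by [4 |a|^2 |x|^2]. The 4 turns [q (q - 1) / 2]
   into [2 q (q - 1)], which together with the first-order term [q |x|^2] makes [q (2 q - 1)]. *)
have y2 : s * y ^+ 2 <= (4 + 5 * th) * t.
  rewrite -(ler_pM2r s0).
  have -> : s * y ^+ 2 * s = (y * s) ^+ 2 by ring.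
  rewrite ys.
  have h1 : i * t <= th * s * t by rewrite ler_wpM2r.
  have h2 : t * t <= th * s * t by rewrite ler_wpM2r.
  by clear -h1 h2 CS; lra.
have := etaP y y_le => H.
have : s `^ q * (1 + y) `^ q <= s `^ q * (1 + q * y + q * (q - 1) / 2 * (1 + e / 4) * y ^+ 2).
  by rewrite ler_wpM2l ?powR_ge0.
rewrite -powRM ?(ltW s0)//; last first.
  by move: y_le; rewrite ler_norml; clear -eta1; lra.
have -> : s * (1 + y) = sqn (a + x) by rewrite E mulrDr mulr1 (mulrC s) ys; ring.
have sA : s `^ q = s * A by rewrite mulr_powRB1 ?(ltW s0)// (lt_trans ltr01 q1).
move=> /le_trans; apply.
rewrite sA.
have -> : s * A * (1 + q * y + q * (q - 1) / 2 * (1 + e / 4) * y ^+ 2) =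
  s * A + q * A * (y * s) + q * (q - 1) / 2 * (1 + e / 4) * A * (s * y ^+ 2) by ring.
rewrite ys.
have e40 : 0 <= 1 + e / 4 by rewrite addr_ge0// divr_ge0// ltW.
have K0 : 0 <= q * (q - 1) / 2 * (1 + e / 4) * A by rewrite !mulr_ge0.
have h1 : q * (q - 1) / 2 * (1 + e / 4) * A * (s * y ^+ 2) <=
   q * (q - 1) / 2 * (1 + e / 4) * A * ((4 + 5 * th) * t) by rewrite ler_wpM2l.
have h2 : (1 + e / 4) * (4 + 5 * th) <= 4 * (1 + eps) by clear -e_gt0 e_le1 e_eps th0 th_e; nra.
have h3 : q * (q - 1) / 2 * (1 + e / 4) * A * ((4 + 5 * th) * t) <=
  q * (q - 1) / 2 * A * t * (4 * (1 + eps)).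
  have -> : q * (q - 1) / 2 * (1 + e / 4) * A * ((4 + 5 * th) * t) =
    q * (q - 1) / 2 * A * t * ((1 + e / 4) * (4 + 5 * th)) by ring.
  by rewrite ler_wpM2l// !mulr_ge0.
have h4 : 0 <= q * A * t * eps by rewrite !mulr_ge0// ltW.
have h5 : 0 <= C * t `^ q by rewrite mulr_ge0// powR_ge0.
by clear -h1 h3 h4 h5; lra.
Qed.

Lemma moment_step_arith (X E a0 a1 q5 c4 B5 kN kr u f1 F K q D D' Mq y z e : R) :
  X <= E + (a0 + a1) + q5 + c4 -> a1 <= 2 * q * u + f1 * y ->
  kN <= K * (u + F * z) -> kr <= K * (u + F * y) ->
  c4 <= D * Mq + D' * (y + z) -> q5 <= B5 + kN + kr ->
  u * (2 * q + 2 * K) = e -> 0 <= f1 * z ->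
  X <= E + e + a0 + B5 + D * Mq + (f1 + K * F + D') * (y + z).
Proof. by move=> H b1 b2 b3 b4 b5 <- f1z; lra. Qed.

(** [M] is meant for the noise with frozen coefficient, [N] for a mean-zero noise defect and [r] for
    a drift defect. The product of [e] with [M + N] is kept, since its expectation will vanish; [N]
    then enters only quadratically and costs [h^(1 - q)], while the product of [e] with [r] is
    estimated and costs [h^(1 - 2 q)]. [C1] has to vanish for [q = 1], where its term would be of
    the same order [h] as the dissipation. *)
Lemma moment_step q eps : 1 <= q -> 0 < eps -> exists C1 : R,
  [/\ 0 <= C1, q = 1 -> C1 = 0 & forall eta : R, 0 < eta ->
  exists2 C2 : R, 0 <= C2 & forall n (e M N r : 'cV[R]_n) (h : R), 0 < h <= 1 ->
   sqn (e + (M + N + r)) `^ q <= (1 + eta * h) * sqn e `^ q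
     + 2 * q * sqn e `^ (q - 1) * inner e (M + N)
     + q * (2 * q - 1) * (1 + eps) * sqn e `^ (q - 1) * sqn M + C1 * sqn M `^ q
     + C2 * (h `^ (1 - 2 * q) * sqn r `^ q + h `^ (1 - q) * sqn N `^ q)].
Proof.
move=> q1 e0; pose e1 := Num.min eps 1 / 4.
have q0 : 0 <= q := le_trans ler01 q1.
have q2 : 0 <= 2 * q - 1 by clear -q1; lra.
have m0 : 0 < Num.min eps 1 by rewrite lt_min e0 ltr01.
have m1 : Num.min eps 1 <= 1 by rewrite ge_min lexx orbT.
have m2 : Num.min eps 1 <= eps by rewrite ge_min lexx.
have e10 : 0 < e1 by rewrite divr_gt0.
have e1e : (1 + e1) * (1 + e1) <= 1 + eps by rewrite /e1; nra.
have [C [C0 Cq1 CP]] := sqn_powR_taylor q1 e10.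
have p20 : 0 <= 2 `^ q :> R by apply: powR_ge0.
have p40 : 0 <= 4 `^ q :> R by apply: powR_ge0.
exists (C * 2 `^ q * 2 `^ q); split.
- by rewrite !mulr_ge0.
- by move=> /Cq1 ->; rewrite !mul0r.
move=> eta eta0.
pose Q := q * (2 * q - 1) * (1 + e1).
have Q0 : 0 <= Q by rewrite !mulr_ge0// addr_ge0// ltW.
pose K := 2 * Q * (1 + e1^-1).
have K0 : 0 <= K.
  by apply: mulr_ge0; [exact: mulr_ge0|rewrite addr_ge0// invr_ge0 ltW].
have den0 : 0 < 2 * q + 2 * K by clear -q1 K0; lra.
(* The three uses of Young's inequality below contribute [2 q], [K] and [K] times
   [eta1 h |e|^(2 q)], in total [eta h |e|^(2 q)]. *)
pose eta1 := eta / (2 * q + 2 * K).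
have eta10 : 0 < eta1 by rewrite divr_gt0.
have eta1E : eta1 * (2 * q + 2 * K) = eta by rewrite divfK// gt_eqF.
pose C2 := q * eta1 `^ (1 - 2 * q) + K * eta1 `^ (1 - q) + C * 2 `^ q * 2 `^ q * 4 `^ q.
have C20 : 0 <= C2.
  apply: addr_ge0; first apply: addr_ge0.
  - by rewrite mulr_ge0 ?powR_ge0.
  - by rewrite mulr_ge0 ?powR_ge0.
  - by rewrite !mulr_ge0.
exists C2 => // n e M N r h /andP[h0 h1].
have H := CP n e (M + N + r).
set A := sqn e `^ (q - 1) in H *.
have A0 : 0 <= A by apply: powR_ge0.
have innerE : inner e (M + N + r) = inner e (M + N) + inner e r by rewrite innerDr.
have sM := sqn_ge0 M; have sN := sqn_ge0 N; have sr := sqn_ge0 r.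
have se := sqn_ge0 e.
have AeE : sqn e * A = sqn e `^ q by rewrite mulr_powRB1// (lt_le_trans ltr01 q1).
have u_le : sqn (N + r) <= 2 * sqn N + 2 * sqn r := sqnD_le N r.
have x_le : sqn (M + N + r) <= (1 + e1) * sqn M + (1 + e1^-1) * (2 * sqn N + 2 * sqn r).
  rewrite -addrA; apply: (le_trans (sqnD_eps M (N + r) e10)).
  by rewrite lerD2l ler_wpM2l// addr_ge0// invr_ge0 ltW.
have x_le2 : sqn (M + N + r) <= 2 * sqn M + (4 * sqn N + 4 * sqn r).
  by rewrite -addrA; have := sqnD_le M (N + r); clear -u_le; lra.
pose c := eta1 * h.
have c0 : 0 < c by rewrite mulr_gt0.
set hr := h `^ (1 - 2 * q); set hN := h `^ (1 - q).
have hN_ge1 : 1 <= hN.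
  by rewrite -[leLHS](powRr0 h); apply: ger_powR; rewrite ?h0 ?h1// subr_le0.
have hNr : hN <= hr by apply: ger_powR; rewrite ?h0 ?h1//; clear -q1; lra.
set rq := sqn r `^ q; set Nq := sqn N `^ q; set Mq := sqn M `^ q.
have rq0 : 0 <= rq by apply: powR_ge0.
have Nq0 : 0 <= Nq by apply: powR_ge0.
have Mq0 : 0 <= Mq by apply: powR_ge0.
set eq' := sqn e `^ q in H AeE *.
(* Young twice: the inner product with weight [c], then [|e|^(2 q - 2) |r|^2] with weight [c^2]. The
   factors [c^(-1)] and [c^(2 - 2 q)] combine to [c^(1 - 2 q)]. *)
have b1 : 2 * q * A * inner e r <= 2 * q * (eta1 * h * eq') + q * eta1 `^ (1 - 2 * q) * (hr * rq).
  have := inner_young e r c0; have := ler_norm (inner e r) => n1 n2.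
  have n3 : 2 * inner e r <= c * sqn e + sqn r / c by clear -n1 n2; lra.
  have n4 : q * A * (2 * inner e r) <= q * A * (c * sqn e + sqn r / c).
    by rewrite ler_wpM2l// mulr_ge0.
  have := @young_powR _ q (c ^+ 2) (sqn e) (sqn r) q1 (exprn_gt0 _ c0) se sr.
  rewrite -/A -/eq' -/rq => n5.
  have n6 : q / c * (A * sqn r) <= q / c * (c ^+ 2 * eq' + (c ^+ 2) `^ (1 - q) * rq).
    by rewrite ler_wpM2l// divr_ge0 ?(ltW c0).
  have n7 : c^-1 * (c ^+ 2) `^ (1 - q) = eta1 `^ (1 - 2 * q) * hr.
    rewrite /hr -powRM ?(ltW eta10) ?(ltW h0)// -/c -powR_inv1 ?(ltW c0)//.
    rewrite -(powR_mulrn 2 (ltW c0)) -powRrM -powRD ?(gt_eqF c0) ?implybT//.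
    by congr (_ `^ _); ring.
  apply: (@le_trans _ _ (q * A * (c * sqn e + sqn r / c))); first by clear -n4; lra.
  have -> : q * A * (c * sqn e + sqn r / c) = q * c * eq' + q / c * (A * sqn r).
    by rewrite -AeE; ring.
  have n8 : q / c * (c ^+ 2 * eq' + (c ^+ 2) `^ (1 - q) * rq) =
    q * c * eq' + q * (eta1 `^ (1 - 2 * q) * hr) * rq.
    by rewrite -n7; field; rewrite gt_eqF.
  rewrite n8 in n6; rewrite /c in n6 *; clear -n6; lra.
have cpow : c `^ (1 - q) = eta1 `^ (1 - q) * hN by rewrite powRM// ltW.
have F0 : 0 <= eta1 `^ (1 - q) by apply: powR_ge0.
have b2 : K * (A * sqn N) <= K * (eta1 * h * eq' + eta1 `^ (1 - q) * (hN * Nq)).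
  rewrite ler_wpM2l// [_ * (hN * Nq)]mulrA -cpow; exact: young_powR.
have b3 : K * (A * sqn r) <= K * (eta1 * h * eq' + eta1 `^ (1 - q) * (hr * rq)).
  rewrite ler_wpM2l//; apply: (le_trans (@young_powR _ q c _ _ q1 c0 se sr)).
  by rewrite -/eq' -/rq cpow lerD2l [leRHS]mulrA ler_wpM2r// ler_wpM2l.
have b4 : C * sqn (M + N + r) `^ q <= C * 2 `^ q * 2 `^ q * Mq +
    C * 2 `^ q * 2 `^ q * 4 `^ q * (hr * rq + hN * Nq).
  have k1 : sqn (M + N + r) `^ q <= (2 * sqn M + (4 * sqn N + 4 * sqn r)) `^ q.
    by apply: ge0_ler_powR => //; rewrite nnegrE ?sqn_ge0// !addr_ge0// mulr_ge0.
  have k2 := le_trans k1 (powRD3_le q0 sM sN sr).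
  have k4 : rq <= hr * rq by rewrite ler_peMl// (le_trans hN_ge1).
  have k5 : Nq <= hN * Nq by rewrite ler_peMl.
  have k6 : Nq + rq <= hr * rq + hN * Nq by rewrite addrC lerD.
  apply: (@le_trans _ _ (C * (2 `^ q * 2 `^ q * Mq + 2 `^ q * 2 `^ q * 4 `^ q * (Nq + rq)))).
    by rewrite ler_wpM2l.
  rewrite mulrDr !mulrA lerD2l ler_wpM2l// !mulr_ge0//.
have b5 : Q * A * sqn (M + N + r) <=
    q * (2 * q - 1) * (1 + eps) * A * sqn M + K * (A * sqn N) + K * (A * sqn r).
  have := ler_wpM2l (mulr_ge0 Q0 A0) x_le => k1.
  apply: (le_trans k1).
  have k2 : q * (2 * q - 1) * A * sqn M * ((1 + e1) * (1 + e1)) <=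
    q * (2 * q - 1) * A * sqn M * (1 + eps).
    by rewrite ler_wpM2l ?mulr_ge0.
  rewrite /K /Q in k1 *; clear -k1 k2; lra.
rewrite innerE mulrDr in H.
have etaE : eta1 * h * eq' * (2 * q + 2 * K) = eta * h * eq' by rewrite -eta1E; ring.
have z0 : 0 <= q * eta1 `^ (1 - 2 * q) * (hN * Nq).
  by rewrite !mulr_ge0 ?powR_ge0.
rewrite mulrDl mul1r.
exact: (moment_step_arith H b1 b2 b3 b4 b5 etaE z0).
Qed.

End moment_inequality.

(** * Expectations and independence *)

Section expectation.
Context {R : realType} {disp : measure_display} {T : measurableType disp}.
Variable P : probability T R.
Implicit Types U V : T -> R.

Definition L1 U := P.-integrable setT (EFin \o U).

Definition EE U : R := (\int[P]_w U w)%R.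

Lemma L1_meas U : L1 U -> measurable_fun setT U.
Proof. by move=> /integrableP[/measurable_EFinP]. Qed.

Lemma L1_le U V : measurable_fun setT U -> L1 V -> (forall w, `|U w| <= V w) -> L1 U.
Proof.
move=> mU V1 UV; apply: (le_integrable _ _ _ V1) => //; first exact/measurable_EFinP.
by move=> w _; rewrite /= lee_fin (le_trans (UV w))// ler_norm.
Qed.

Lemma L1_norm U : L1 U -> L1 (fun w => `|U w|).
Proof. by move=> /integrable_norm. Qed.

Lemma L1_cst (c : R) : L1 (fun=> c).
Proof. exact: finite_measure_integrable_cst. Qed.

Lemma L1D U V : L1 U -> L1 V -> L1 (fun w => U w + V w).
Proof. by move=> U1 V1; exact: (integrableD _ U1 V1). Qed.

Lemma L1Z (c : R) U : L1 U -> L1 (fun w => c * U w).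
Proof. by move=> U1; exact: (integrableZl _ c U1). Qed.

Lemma L1_sum (I : Type) (s : seq I) (F : I -> T -> R) :
  (forall i, L1 (F i)) -> L1 (fun w => \sum_(i <- s) F i w).
Proof.
move=> F1; elim: s => [|i s IH].
  rewrite (_ : (fun _ => _) = fun=> 0); first exact: L1_cst.
  by apply/funext => w; rewrite big_nil.
rewrite (_ : (fun _ => _) = fun w => F i w + \sum_(j <- s) F j w); first exact: L1D.
by apply/funext => w; rewrite big_cons.
Qed.

Lemma EE_ge0 U : (forall w, 0 <= U w) -> 0 <= EE U.
Proof. by move=> U0; apply: Rintegral_ge0. Qed.

Lemma EE_le U V : L1 U -> L1 V -> (forall w, U w <= V w) -> EE U <= EE V.
Proof. by move=> U1 V1 UV; apply: le_Rintegral. Qed.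

Lemma EED U V : L1 U -> L1 V -> EE (fun w => U w + V w) = EE U + EE V.
Proof. by move=> U1 V1; apply: RintegralD. Qed.

Lemma EEZ (c : R) U : L1 U -> EE (fun w => c * U w) = c * EE U.
Proof. by move=> U1; apply: RintegralZl. Qed.

Lemma EE_cst (c : R) : EE (fun=> c) = c.
Proof. rewrite /EE Rintegral_cst//.
apply: etrans (mulr1 c); congr (_ * _).
exact: (congr1 fine (probability_setT P)). Qed.

Lemma EE_sum (I : Type) (s : seq I) (F : I -> T -> R) :
  (forall i, L1 (F i)) -> EE (fun w => \sum_(i <- s) F i w) = \sum_(i <- s) EE (F i).
Proof.
move=> F1; elim: s => [|i s IH].
  rewrite big_nil -[RHS](EE_cst 0); congr EE.
  by apply/funext => w; rewrite big_nil.
rewrite big_cons -IH -EED//; last exact: L1_sum.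
by congr EE; apply/funext => w; rewrite big_cons.
Qed.

Lemma EFin_EE U : L1 U -> (EE U)%:E = (\int[P]_w (U w)%:E)%E.
Proof. by move=> U1; rewrite fineK//; apply: integrable_fin_num. Qed.

Lemma L1_fin_ge0 U : measurable_fun setT U -> (forall w, 0 <= U w) ->
  (\int[P]_w (U w)%:E < +oo)%E -> L1 U.
Proof.
move=> mU U0 Uoo; apply/integrableP; split; first exact/measurable_EFinP.
by under eq_integral => w _ do rewrite /= ger0_norm//.
Qed.

Lemma prob_fin A : measurable A -> P A = (fine (P A))%:E.
Proof. by move=> mA; rewrite fineK// fin_num_measure. Qed.

Lemma L1_indic A : measurable A -> L1 (\1_A : T -> R).
Proof. by move=> mA; exact: integrable_indic. Qed.

Lemma EE_indic A : measurable A -> EE (\1_A : T -> R) = fine (P A).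
Proof. by move=> mA; rewrite /EE /Rintegral integral_indic// setIT. Qed.

Lemma EE_indep (X Y : T -> R) : L1 X -> L1 Y ->
  (forall A B, measurable A -> measurable B ->
     P (X @^-1` A `&` Y @^-1` B) = (P (X @^-1` A) * P (Y @^-1` B))%E) ->
  L1 (fun w => X w * Y w) /\ EE (fun w => X w * Y w) = EE X * EE Y.
Proof.
move=> X1 Y1 XY.
have mX := L1_meas X1; have mY := L1_meas Y1.
have mXY : measurable_fun setT (fun w => (X w, Y w)) by exact: measurable_fun_pair.
pose X' : {mfun T >-> R} := HB.pack X (isMeasurableFun.Build _ _ _ _ _ mX).
pose Y' : {mfun T >-> R} := HB.pack Y (isMeasurableFun.Build _ _ _ _ _ mY).
pose XY' : {mfun T >-> (R * R)%type} :=
  HB.pack (fun w => (X w, Y w)) (isMeasurableFun.Build _ _ _ _ _ mXY).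
pose m1 := distribution P X'; pose m2 := distribution P Y'.
pose m12 := distribution P XY'.
have m12E A : measurable A -> (m1 \x m2)%E A = m12 A.
  move=> mA; have H B C : measurable B -> measurable C ->
      m12 (B `*` C) = (m1 B * m2 C)%E by exact: XY.
  exact: (product_measure_unique H).
have mf : measurable_fun setT (fun z : R * R => (z.1 * z.2)%:E).
  by apply/measurable_EFinP; apply: measurable_funM.
have mabs : measurable_fun setT (fun x : R => `|x|%:E).
  by apply/measurable_EFinP; exact: normr_measurable.
have absE : (\int[m1]_x \int[m2]_y `|(x * y)%:E| =
    (\int[P]_w `|X w|%:E) * (\int[P]_w `|Y w|%:E))%E.
  have -> : (\int[m1]_x \int[m2]_y `|(x * y)%:E| =
      \int[m1]_x (`|x|%:E * \int[P]_w `|Y w|%:E))%E.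
    apply: eq_integral => x _.
    under eq_integral => y _ do rewrite /= normrM EFinM.
    by rewrite ge0_integralZl//=; congr (_ * _)%E; rewrite ge0_integral_distribution.
  rewrite ge0_integralZr//=; last by apply: integral_ge0 => w _; rewrite lee_fin.
  by congr (_ * _)%E; rewrite ge0_integral_distribution.
have Xn : (\int[P]_w `|X w|%:E)%E = (EE (fun w => `|X w|))%:E by rewrite EFin_EE//; exact: L1_norm.
have Yn : (\int[P]_w `|Y w|%:E)%E = (EE (fun w => `|Y w|))%:E by rewrite EFin_EE//; exact: L1_norm.
have if12 : (m1 \x m2)%E.-integrable setT (fun z : R * R => (z.1 * z.2)%:E).
  by apply/integrable12ltyP => //=; rewrite absE Xn Yn -EFinM ltry.
have XYL1 : L1 (fun w => X w * Y w).
  apply/integrableP; split; first by apply/measurable_EFinP; exact: measurable_funM.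
  have /integrableP[_] := if12.
  rewrite (eq_measure_integral m12) => [|A mA _]; last exact: m12E.
  by rewrite ge0_integral_distribution//; apply: measurableT_comp.
split => //.
apply: EFin_inj; rewrite EFinM !EFin_EE//.
have -> : (\int[P]_w (X w * Y w)%:E = \int[m12]_z (z.1 * z.2)%:E)%E.
  by rewrite integral_distribution.
rewrite (eq_measure_integral (m1 \x m2)%E) => [|A mA _]; last exact/esym/m12E.
rewrite -integral12_prod_meas1//.
have -> : (\int[m1]_x fubini_F m2 (fun z : R * R => (z.1 * z.2)%:E) x =
    \int[m1]_x (x%:E * (EE Y)%:E))%E.
  apply: eq_integral => x _; rewrite /fubini_F/=.
  under eq_integral => y _ do rewrite EFinM.
  have iY : m2.-integrable setT EFin by apply: integrable_pushforward.
  by rewrite integralZl// EFin_EE// integral_distribution.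
have iX : m1.-integrable setT EFin by apply: integrable_pushforward.
by rewrite integralZr// integral_distribution// EFin_EE.
Qed.

End expectation.

(** * Independence of joined and augmented sigma-algebras *)

Section independence.
Context {R : realType} {disp : measure_display} {T : measurableType disp}.
Variable P : probability T R.

(** The intersections of members of [A] and [B] form a pi-system that generates the join. On it the
    finite measures that send [C] to the probability of its intersection with [E] and to [P C * P E]
    agree, so they agree on the join. *)
Lemma indep_join (A B : set (set T)) (E : set T) :
  setI_closed A -> setI_closed B -> A setT -> B setT ->
  A `<=` measurable -> B `<=` measurable -> measurable E ->
  (forall a b, A a -> B b -> P (a `&` b `&` E) = (P (a `&` b) * P E)%E) ->
  forall C, <<s A `|` B >> C -> P (C `&` E) = (P C * P E)%E.
Proof.
move=> IA IB AT BT mA mB mE AB C sC.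
pose G := [set a `&` b | a in A & b in B].
have GC : <<s G >> C.
  have sG : sigma_algebra setT <<s G >> by exact: smallest_sigma_algebra.
  apply: (smallest_sub sG _ sC) => X [AX|BX]; apply: sub_sigma_algebra.
  - by exists X => //; exists setT => //; rewrite setIT.
  - by exists setT => //; exists X => //; rewrite setTI.
have PE : 0 <= fine (P E) by rewrite fine_ge0.
pose m1 : {measure set T -> \bar R} := mrestr P mE.
pose m2 : {measure set T -> \bar R} := mscale (NngNum PE) P.
have m2E X : m2 X = (P X * P E)%E.
  have -> : m2 X = ((fine (P E))%:E * P X)%E by [].
  by rewrite muleC -(prob_fin P mE).
rewrite -m2E -[LHS]/(m1 C).
apply: (@g_sigma_algebra_measure_unique _ R T G _ (fun=> setT)) => //.
- by move=> _ [a Aa [b Bb <-]]; apply: measurableI; [exact: mA|exact: mB].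
- by move=> _; exists setT => //; exists setT => //; rewrite setIT.
- by rewrite bigcup_const//; exists 0%N.
- move=> _ _ [a Aa [b Bb <-]] [a' Aa' [b' Bb' <-]].
  by rewrite setIACA; exists (a `&` a'); [exact: IA|exists (b `&` b') => //; exact: IB].
- by move=> _ [a Aa [b Bb <-]]; rewrite [RHS]m2E -AB.
- move=> _; apply: (@le_lt_trans _ _ 1%E); last exact: ltry.
  by apply: probability_le1; exact: measurableI.
Qed.

(** The hypothesis that [X0] and [W] are independent concerns sigma-algebras without null sets,
    whereas the filtration is augmented; this lemma bridges the two. The events with the stated
    property form a sigma-algebra that contains the generators. *)
Lemma sigma_augmented (G : set (set T)) (A : set T) :
  <<s G `|` P.-negligible >> A -> exists A' N,
  [/\ <<s G >> A', measurable N, P N = 0%E & A `&` ~` N = A' `&` ~` N].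
Proof.
move: A; apply: smallest_sub.
  split=> [|A [A' [N [sA mN N0 AN]]]|F HF].
  - by exists set0, set0; split => //; exact: sigma_algebra0.
  - exists (~` A'), N; split=> //; first exact: sigma_algebraC.
    rewrite setTD; apply/seteqP; split => w [Aw Nw]; split => // A'w.
    + by have : (A' `&` ~` N) w by []; rewrite -AN => -[].
    + by have : (A `&` ~` N) w by []; rewrite AN => -[].
  - have /choice[A' /choice[N HN]] := HF.
    exists (\bigcup_k A' k), (\bigcup_k N k); split.
    + by apply: sigma_algebra_bigcup => k; case: (HN k).
    + by apply: bigcup_measurable => k _; case: (HN k).
    + apply: measure_negligible.
        by apply: bigcup_measurable => k _; case: (HN k).
      apply: negligible_bigcup => k; have [_ mN N0 _] := HN k.
      exact/negligibleP.
    + have E w : (~` \bigcup_k N k) w -> forall k, F k w <-> A' k w.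
        move=> Nw k; have [_ _ _ FN] := HN k.
        have nk : (~` N k) w by move=> Nk; apply: Nw; exists k.
          split=> h.
          by have : (F k `&` ~` N k) w by []; rewrite FN => -[].
        by have : (A' k `&` ~` N k) w by []; rewrite -FN => -[].
      apply/seteqP; split => w [[k _ Fk] Nw]; split => //; exists k => //; exact/E.
move=> A [GA|[N [mN N0 AN]]].
  by exists A, set0; split => //; exact: sub_sigma_algebra.
exists set0, N; split => //; first exact: sigma_algebra0.
by rewrite set0I; apply/seteqP; split => // w [/AN].
Qed.

Lemma eq_prob_off_null (A B N : set T) : measurable A -> measurable B ->
  measurable N -> P N = 0%E -> A `&` ~` N = B `&` ~` N -> P A = P B.
Proof.
move=> mA mB mN N0 AB.
have H C : measurable C -> P C = P (C `&` ~` N).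
  move=> mC; rewrite -[C in LHS](setIT C) -(setUv N) setIUr measureU//.
  - rewrite [X in (X + _)%E](_ : _ = 0%E) ?add0e//.
    apply/eqP; rewrite eq_le measure_ge0 andbT -N0.
    by apply: le_measure; rewrite ?inE//; exact: measurableI.
  - exact: measurableI.
  - by apply: measurableI => //; exact: measurableC.
  - by rewrite setIACA setICr setI0.
by rewrite (H A)// (H B)// AB.
Qed.

End independence.

(** * Gaussian moments *)

Section gaussian_moments.
Context {R : realType}.
Notation mu := (@lebesgue_measure R).
Implicit Types s x : R.

Local Notation N0 s := (normal_prob (0 : R) s : probability _ R).

(** The Radon-Nikodym derivative of the law, for which the change of variables holds, has the same
    integral over every measurable set as the Gaussian density, hence equals it almost
    everywhere. *)
Lemma ge0_integral_normal_prob (m s : R) (f : R -> R) :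
  measurable_fun setT f -> (forall x, 0 <= f x) ->
  (\int[normal_prob m s]_x (f x)%:E = \int[mu]_x (f x * normal_pdf m s x)%:E)%E.
Proof.
move=> mf f0.
have dom := normal_prob_dominates m s.
pose nu : {finite_measure set (measurableTypeR R) -> \bar R} := (normal_prob m s : probability _ R).
pose mu' : {sigma_finite_measure set (measurableTypeR R) -> \bar R} := mu.
have dom' : nu `<< mu' by exact: dom.
rewrite -[LHS](Radon_Nikodym_SigmaFinite.change_of_variables dom') //; last exact/measurable_EFinP.
set g := Radon_Nikodym_SigmaFinite.f _ _.
have gi : mu'.-integrable setT g by exact: Radon_Nikodym_SigmaFinite.f_integrable.
have mp : measurable_fun setT (fun x => (normal_pdf m s x)%:E).
  by apply/measurable_EFinP; exact: measurable_normal_pdf.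
have gE : ae_eq mu' setT g (fun x => (normal_pdf m s x)%:E).
  apply: integral_ae_eq => // E _ mE.
  by rewrite -Radon_Nikodym_SigmaFinite.f_integral.
apply: ae_eq_integral => //.
- apply: emeasurable_funM; first exact/measurable_EFinP.
  exact: measurable_int gi.
- by apply/measurable_EFinP; apply: measurable_funM => //; exact: measurable_normal_pdf.
- by apply: filterS gE => x gx _; rewrite EFinM gx.
Qed.

Lemma powR_le_expR (q : R) : 0 <= q -> exists2 C : R, 0 <= C & forall v : R, 0 <= v ->
  v `^ q <= C * expR (3 / 8 * v).
Proof.
move=> q0; pose n := Num.bound q.
have qn : q <= n.+1%:R.
  by rewrite (le_trans (ltW (archi_boundP q0)))// ler_nat.
pose C : R := 1 + (8 / 3) ^+ n.+1 * n.+1`!%:R.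
have C0 : 0 <= (8 / 3) ^+ n.+1 * n.+1`!%:R :> R by rewrite mulr_ge0// exprn_ge0//; lra.
exists C; first by rewrite /C; lra.
move=> v v0.
have h1 : v `^ q <= 1 + v ^+ n.+1.
  have [v1|v1] := leP v 1.
    apply: (@le_trans _ _ 1); last by rewrite lerDl exprn_ge0.
    have := @ge0_ler_powR _ q q0 v 1; rewrite !nnegrE powR1; apply => //.
  apply: (@le_trans _ _ (v ^+ n.+1)); last by rewrite lerDr.
  by rewrite -powR_mulrn//; apply: ler_powR => //; lra.
set z := 3 / 8 * v.
have z0 : 0 <= z by rewrite /z; lra.
have h2 := @expR_ge1Dxn R z n z0.
have h3 : v = 8 / 3 * z by rewrite /z; field.
have f0 : 0 < n.+1`!%:R :> R by rewrite ltr0n fact_gt0.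
have h4 : 1 <= expR z by have := expR_ge1Dx z; lra.
have h5 : z ^+ n.+1 <= n.+1`!%:R * expR z.
  by rewrite mulrC -ler_pdivrMr//; lra.
apply: (le_trans h1); rewrite /C mulrDl mul1r lerD//.
have -> : v ^+ n.+1 = (8 / 3) ^+ n.+1 * z ^+ n.+1 by rewrite -exprMn -h3.
rewrite -[leRHS]mulrA ler_wpM2l// exprn_ge0//; lra.
Qed.

(** Doubling the standard deviation leaves the factor [exp (- (1/2 - 1/8) (x / s)^2)], whence 3/8.
    It absorbs any power of [x / s] by [powR_le_expR], so moments of every order, with the right
    scaling in [s], follow from the total mass of a normal law. *)
Lemma normal_pdf_scale s x : 0 < s ->
  normal_pdf 0 s x = 2 * expR (- (3 / 8 * (x / s) ^+ 2)) * normal_pdf 0 (2 * s) x.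
Proof.
move=> s0; have s20 : 2 * s != 0 by rewrite gt_eqF// mulr_gt0.
rewrite !normal_pdfE ?gt_eqF// ?mulr_gt0// /normal_fun !subr0.
have -> : normal_peak s = 2 * normal_peak (2 * s).
  rewrite /normal_peak.
  have E (c : R) : (2 * s) ^+ 2 * c *+ 2 = 2 ^+ 2 * (s ^+ 2 * c *+ 2) by ring.
  by rewrite E sqrtrM ?sqr_ge0// sqrtr_sqr ger0_norm// invfM mulrA mulfV ?mul1r.
rewrite -!mulrA; congr (_ * _); rewrite [RHS]mulrCA; congr (_ * _).
rewrite -expRD; congr expR; field.
by rewrite gt_eqF.
Qed.

Lemma normal_moment (q : R) : 0 <= q -> exists2 C : R, 0 <= C & forall s, 0 < s ->
  L1 (N0 s) (fun x => (x ^+ 2) `^ q) /\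
  EE (N0 s) (fun x => (x ^+ 2) `^ q) <= C * (s ^+ 2) `^ q.
Proof.
move=> q0; have [C C0 CP] := powR_le_expR q0.
exists (2 * C); first by rewrite mulr_ge0.
move=> s s0.
have mf : measurable_fun setT (fun x : R => (x ^+ 2) `^ q).
  by apply: (measurableT_comp (f := fun y : R => y `^ q)).
have pt x : (x ^+ 2) `^ q * normal_pdf 0 s x <= 2 * C * (s ^+ 2) `^ q * normal_pdf 0 (2 * s) x.
  have {1}-> : x ^+ 2 = s ^+ 2 * (x / s) ^+ 2 by field; rewrite gt_eqF.
  rewrite normal_pdf_scale// powRM ?sqr_ge0//.
  have h := CP ((x / s) ^+ 2) (sqr_ge0 _).
  set e := expR (3 / 8 * (x / s) ^+ 2) in h.
  have -> : expR (- (3 / 8 * (x / s) ^+ 2)) = e^-1 by rewrite expRN.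
  have e0 : 0 < e by apply: expR_gt0.
  have -> : (s ^+ 2) `^ q * ((x / s) ^+ 2) `^ q * (2 / e * normal_pdf 0 (2 * s) x) =
    2 * (((x / s) ^+ 2) `^ q / e) * (s ^+ 2) `^ q * normal_pdf 0 (2 * s) x by ring.
  rewrite ler_wpM2r ?normal_pdf_ge0// ler_wpM2r ?powR_ge0// ler_wpM2l//.
  by rewrite ler_pdivrMr.
have fin : (\int[mu]_x ((x ^+ 2) `^ q * normal_pdf 0 s x)%:E <= (2 * C * (s ^+ 2) `^ q)%:E)%E.
  apply: (@le_trans _ _ (\int[mu]_x ((2 * C * (s ^+ 2) `^ q)%:E * (normal_pdf 0 (2 * s) x)%:E))%E).
    apply: ge0_le_integral => //=.
    - by move=> x _; rewrite lee_fin mulr_ge0 ?powR_ge0 ?normal_pdf_ge0.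
    - by apply/measurable_EFinP; apply: measurable_funM => //; exact: measurable_normal_pdf.
    - apply: measurable_funeM; apply/measurable_EFinP; exact: measurable_normal_pdf.
    - by move=> x _; rewrite -EFinM lee_fin.
  rewrite ge0_integralZl//=.
  - by rewrite integral_normal_pdf mule1.
  - by apply/measurable_EFinP; exact: measurable_normal_pdf.
  - by move=> x _; rewrite lee_fin normal_pdf_ge0.
  - by rewrite lee_fin !mulr_ge0// powR_ge0.
have l1 : L1 (N0 s) (fun x => (x ^+ 2) `^ q).
  apply: L1_fin_ge0 => //; first by move=> x; exact: powR_ge0.
  rewrite ge0_integral_normal_prob//; last by move=> x; exact: powR_ge0.
  by rewrite (le_lt_trans fin)// ltry.
split => //; rewrite -lee_fin EFin_EE// ge0_integral_normal_prob//.
by move=> x; exact: powR_ge0.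
Qed.


Lemma normal_integrable2 s : 0 < s -> L1 (N0 s) (fun x => x ^+ 2).
Proof.
move=> s0; have [C _ /(_ s s0)[h _]] := @normal_moment 1 ler01.
by apply: (L1_le _ h) => // x; rewrite ger0_norm ?sqr_ge0// powRr1// sqr_ge0.
Qed.

Lemma normal_integrable1 s : 0 < s -> L1 (N0 s) (fun x => x).
Proof.
move=> s0; apply: (L1_le _ (L1D (L1_cst _ 1) (normal_integrable2 s0))) => // x.
by rewrite ler_norml; apply/andP; split; nra.
Qed.

Lemma integral_normal_fun_gen (m s : R) : 0 < s ->
  (\int[mu]_x (normal_fun m s x)%:E = (normal_peak s)^-1%:E)%E.
Proof.
move=> s0; have s1 : s != 0 by rewrite gt_eqF.
have p0 := normal_peak_gt0 s1.
have -> : (\int[mu]_x (normal_fun m s x)%:E =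
   \int[mu]_x ((normal_peak s)^-1%:E * (normal_pdf m s x)%:E))%E.
  apply: eq_integral => x _; rewrite normal_pdfE// -EFinM mulrA mulVf ?mul1r//.
  by rewrite gt_eqF.
rewrite ge0_integralZl//=.
- by rewrite integral_normal_pdf mule1.
- by apply/measurable_EFinP; exact: measurable_normal_pdf.
- by move=> x _; rewrite lee_fin normal_pdf_ge0.
- by rewrite lee_fin invr_ge0 ltW.
Qed.

(* [normal_fun m t] is [expR y] times [normal_fun 0 s], with [y] quadratic in
   [x]: bounding [expR y] below by [1 + y] and integrating gives linear
   inequalities between the moments. *)
Lemma normal_moment_variational (m s t : R) : 0 < s -> 0 < t ->
  1 + (s ^- 2 / 2 - t ^- 2 / 2) * EE (N0 s) (fun x => x ^+ 2)
    + m / t ^+ 2 * EE (N0 s) (fun x => x) - m ^+ 2 / (2 * t ^+ 2) <= t / s.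
Proof.
move=> s0 t0; have s1 : s != 0 by rewrite gt_eqF.
have t1 : t != 0 by rewrite gt_eqF.
pose y (x : R) := (s ^- 2 / 2 - t ^- 2 / 2) * x ^+ 2 + (m / t ^+ 2 * x + - (m ^+ 2 / (2 * t ^+ 2))).
have i2 := normal_integrable2 s0; have i1 := normal_integrable1 s0.
have iy0 : L1 (N0 s) y by apply: L1D; [exact: L1Z|apply: L1D; [exact: L1Z|exact: L1_cst]].
have iy : L1 (N0 s) (fun x => 1 + y x) by apply: L1D => //; exact: L1_cst.
have Ey : EE (N0 s) (fun x => 1 + y x) = 1 + (s ^- 2 / 2 - t ^- 2 / 2) * EE (N0 s) (fun x => x ^+ 2)
    + m / t ^+ 2 * EE (N0 s) (fun x => x) - m ^+ 2 / (2 * t ^+ 2).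
  rewrite EED//; last exact: L1_cst.
  rewrite EED; [|exact: L1Z|by apply: L1D; [exact: L1Z|exact: L1_cst]].
  rewrite EED; [|exact: L1Z|exact: L1_cst].
  by rewrite !EE_cst !EEZ//; ring.
rewrite -Ey.
have mexp : measurable_fun setT (fun x : R => expR (y x)).
  by apply: measurableT_comp => //; exact: (L1_meas iy0).
have expE x : expR (y x) * normal_pdf 0 s x = normal_peak s * normal_fun m t x.
  rewrite normal_pdfE// mulrCA /normal_fun -expRD; congr (_ * expR _).
  rewrite /y; field; apply/andP; split => //.
have peakE : normal_peak s / normal_peak t = t / s.
  have h (u : R) : 0 < u -> normal_peak u = u^-1 * normal_peak 1.
    move=> u0; rewrite /normal_peak.
    have E (c : R) : u ^+ 2 * c *+ 2 = u ^+ 2 * (1 ^+ 2 * c *+ 2) by ring.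
    by rewrite E sqrtrM ?sqr_ge0// sqrtr_sqr ger0_norm ?(ltW u0)// invfM.
  rewrite (h s)// (h t)//; field.
  by rewrite t1 s1 gt_eqF// normal_peak_gt0.
have expI : (\int[N0 s]_x (expR (y x))%:E = (t / s)%:E)%E.
  rewrite ge0_integral_normal_prob//.
  under eq_integral => x _ do rewrite expE EFinM.
  rewrite ge0_integralZl//=.
  - by rewrite integral_normal_fun_gen// -EFinM peakE.
  - by apply/measurable_EFinP; exact: measurable_normal_fun.
  - by move=> x _; rewrite lee_fin normal_fun_ge0.
  - by rewrite lee_fin normal_peak_ge0.
have iexp : L1 (N0 s) (fun x => expR (y x)).
  by apply: L1_fin_ge0 => //; rewrite expI ltry.
have -> : t / s = EE (N0 s) (fun x => expR (y x)) by rewrite /EE /Rintegral expI.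
by apply: EE_le => // x; exact: expR_ge1Dx.
Qed.

(** The shift [m] is free and enters the variational inequality linearly on one side and
    quadratically on the other; taking [m] equal to the mean forces the mean to vanish. *)
Lemma normal_mean s : 0 < s -> EE (N0 s) (fun x => x) = 0.
Proof.
move=> s0; set E1 := EE _ _.
have h (m : R) : m * E1 <= m ^+ 2 / 2.
  have := @normal_moment_variational m s s s0 s0.
  rewrite subrr mul0r addr0 divff ?gt_eqF// -/E1 => H.
  have s20 : 0 < s ^+ 2 by rewrite exprn_gt0.
  have : m / s ^+ 2 * E1 <= m ^+ 2 / (2 * s ^+ 2) by lra.
  rewrite -(ler_pM2r s20).
  have -> : m / s ^+ 2 * E1 * s ^+ 2 = m * E1 by field; rewrite gt_eqF.
  by have -> : m ^+ 2 / (2 * s ^+ 2) * s ^+ 2 = m ^+ 2 / 2 by field; rewrite gt_eqF.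
have := h E1; have := sqr_ge0 E1 => h1 h2.
have : E1 ^+ 2 <= 0 by nra.
by move=> h3; apply/eqP; rewrite -sqrf_eq0 eq_le h3 h1.
Qed.

(** For [m = 0] and [t = s (1 + th)] the variational inequality is an equality at [th = 0].
    Comparing first-order terms for small [th] of either sign gives the two inequalities. *)
Lemma normal_variance s : 0 < s -> EE (N0 s) (fun x => x ^+ 2) = s ^+ 2.
Proof.
move=> s0; set E2 := EE _ _.
have s20 : 0 < s ^+ 2 by rewrite exprn_gt0.
pose M := E2 / s ^+ 2.
have E2M : E2 = M * s ^+ 2 by rewrite /M divfK// gt_eqF.
have h (th : R) : -1 < th -> M * th * (2 + th) <= th * (2 * (1 + th) ^+ 2).
  move=> th1; have t0 : 0 < s * (1 + th) by rewrite mulr_gt0//; lra.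
  have th0 : 1 + th != 0 by lra.
  have := @normal_moment_variational 0 s (s * (1 + th)) s0 t0.
  rewrite -/E2 E2M !mul0r expr0n/= mul0r addr0 subr0 => H.
  have p2 : 0 < 2 * (1 + th) ^+ 2 by rewrite mulr_gt0// exprn_even_gt0.
  have : 1 + M * th * (2 + th) / (2 * (1 + th) ^+ 2) <= 1 + th.
    move: H; have -> : s * (1 + th) / s = 1 + th by field; rewrite gt_eqF.
    apply: le_trans; rewrite le_eqVlt; apply/orP; left; apply/eqP; field.
    by rewrite th0 gt_eqF.
  by rewrite lerD2l ler_pdivrMr.
have M1 : M <= 1.
  rewrite leNgt; apply/negP => M1.
  pose th := Num.min 1 ((M - 1) / 4).
  have th0 : 0 < th by rewrite lt_min; apply/andP; split; lra.
  have th1 : th <= 1 by rewrite ge_min lexx.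
  have th2 : th <= (M - 1) / 4 by rewrite ge_min lexx orbT.
  have := h th ltac:(lra).
  rewrite mulrAC mulrC ler_pM2l//; nra.
have M2 : 1 <= M.
  rewrite leNgt; apply/negP => M2.
  have M0 : 0 <= M by rewrite divr_ge0 ?(ltW s20)//; apply: EE_ge0 => x; exact: sqr_ge0.
  pose th := (1 - M) / 4.
  have th0 : 0 < th by rewrite /th; lra.
  have th1 : th <= 1 / 4 by rewrite /th; lra.
  have thM : M = 1 - 4 * th by rewrite /th; field.
  have := h (- th) ltac:(lra).
  move=> H; have : th * (2 * (1 - th) ^+ 2) <= th * (M * (2 - th)) by lra.
  rewrite ler_pM2l//; nra.
by rewrite E2M (_ : M = 1) ?mul1r//; lra.
Qed.

End gaussian_moments.

(** * Wiener increments *)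

Section adapted.
Context {R : realType} {disp : measure_display} {T : measurableType disp}.
Implicit Types (G : set (set T)) (U V : T -> R).

Lemma sigma_setT G : <<s G >> setT.
Proof. exact: (@measurableT _ (g_sigma_algebraType G)). Qed.

Lemma sigma_setI G : setI_closed <<s G >>.
Proof.
by move=> A B sA sB; exact: (@measurableI _ (g_sigma_algebraType G)).
Qed.

Lemma measurable_wrtP G U : measurable_wrt <<s G >> U <->
  measurable_fun setT (U : g_sigma_algebraType G -> R).
Proof.
split=> [mU _ B mB|mU B mB]; first by rewrite setTI; exact: mU.
by have := mU measurableT B mB; rewrite setTI.
Qed.

End adapted.

Section increments.
Context {R : realType} {disp : measure_display} {T : measurableType disp}.
Variable P : probability T R.
Context {d m : nat} {X0 : T -> 'cV[R]_d} {W : R -> T -> 'cV[R]_m}.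
Hypothesis hP : measure_is_complete P.
Hypothesis hW : is_wiener P W.
Hypothesis hX0 : random_vector X0.
Hypothesis hind : indep_of_process P X0 W.

Notation F := (filtration P X0 W).

Lemma gen_of_mem (n : nat) (I : Type) (D : set I) (Y : I -> T -> 'cV[R]_n) s i (B : set R) :
  D s -> measurable B -> gen_of D Y ((fun w => Y s w i 0) @^-1` B).
Proof. by move=> Ds mB; exists s => //; exists i => //; exists B => //; rewrite setTI. Qed.

Lemma gen_of_measurable (n : nat) (I : Type) (D : set I) (Y : I -> T -> 'cV[R]_n) :
  (forall s, D s -> random_vector (Y s)) -> gen_of D Y `<=` measurable.
Proof. by move=> mY A [s Ds [i _ [B mB <-]]]; exact: mY. Qed.

Lemma sigma_sub_measurable (G : set (set T)) : G `<=` measurable -> <<s G >> `<=` measurable.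
Proof.
move=> Gm; apply: smallest_sub => //; split=> [|A mA|A mA].
- exact: measurable0.
- by rewrite setTD; exact: measurableC.
- by apply: bigcup_measurable => k _; exact: mA.
Qed.

Lemma filtration_measurable t A : F t A -> measurable A.
Proof.
apply: sigma_sub_measurable => {}A [[]|].
- by apply: gen_of_measurable => _ _.
- apply: gen_of_measurable => s /= /andP[s0 _]; exact: (wiener_rv hW).
- exact: hP.
Qed.

Lemma filtration_mono s t : s <= t -> F s `<=` F t.
Proof.
move=> st; apply: sub_smallest2r; first exact: smallest_sigma_algebra.
move=> A [[A0|[r /= /andP[r0 rs] h]]|AN].
- by left; left.
- by left; right; exists r => //=; rewrite r0 (le_trans rs st).
- by right.
Qed.

Lemma adapted_mono s t (U : T -> R) : s <= t -> measurable_wrt (F s) U -> measurable_wrt (F t) U.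
Proof. by move=> st mU B mB; apply: (filtration_mono st); exact: mU. Qed.

Lemma adapted_measurable t (U : T -> R) : measurable_wrt (F t) U -> measurable_fun setT U.
Proof. by move=> mU _ B mB; rewrite setTI; apply: filtration_measurable; exact: mU. Qed.

Lemma adapted_X0 t i : measurable_wrt (F t) (fun w => X0 w i 0).
Proof.
move=> B mB; apply: sub_sigma_algebra; left; left.
exact: (@gen_of_mem _ _ _ (fun=> X0) tt).
Qed.

Lemma adapted_W s t j : 0 <= s <= t -> measurable_wrt (F t) (fun w => W s w j 0).
Proof. by move=> st B mB; apply: sub_sigma_algebra; left; right; exact: gen_of_mem. Qed.

Definition dW (s t : R) (j : 'I_m) (w : T) : R := (W t w - W s w) j 0.

Lemma adapted_dW s t j : 0 <= s <= t -> measurable_wrt (F t) (dW s t j).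
Proof.
move=> /andP[s0 st]; apply/measurable_wrtP.
rewrite (_ : dW s t j = fun w => W t w j 0 - W s w j 0); last first.
  by apply/funext => w; rewrite /dW !mxE.
by apply: measurable_funB; apply/measurable_wrtP; apply: adapted_W; rewrite ?lexx ?andbT ?s0 ?(le_trans s0 st).
Qed.

Lemma dW_measurable s t j : 0 <= s <= t -> measurable_fun setT (dW s t j).
Proof. by move=> st; apply: (@adapted_measurable t); exact: adapted_dW. Qed.

Lemma increment_law s t (B : 'I_m -> set R) : 0 <= s -> s < t ->
  (forall j, measurable (B j)) ->
  P [set w | forall j, B j (dW s t j w)] =
  (\prod_(j < m) normal_prob 0 (Num.sqrt (t - s)) (B j))%E.
Proof.
move=> s0 st mB.
have := wiener_increments hW s0 st (@sigma_setT _ _ _) mB.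
rewrite setTI => ->.
rewrite (_ : P setT = 1%E); last exact: probability_setT.
by rewrite mul1e.
Qed.

Lemma increment_event (G : set (set T)) s t (B : 'I_m -> set R) :
  (forall j, measurable (B j)) -> (forall j, measurable_wrt <<s G >> (dW s t j)) ->
  <<s G >> [set w | forall j, B j (dW s t j w)].
Proof.
move=> mB mD.
have -> : [set w | forall j, B j (dW s t j w)] =
   \bigcap_(j in [set: 'I_m]) (dW s t j @^-1` B j).
  by apply/seteqP; split => [w h j _|w h j]; exact: h.
by apply: (@fin_bigcap_measurable _ (g_sigma_algebraType G)) => // j _; exact: mD.
Qed.

(** For [a] in the sigma-algebra of [X0] and [b] in the past of [W], independence of [X0] from the
    whole of [W] splits off [a], and the Wiener property then separates [b] from the increment.
    [indep_join] extends this to the join; null sets are removed beforehand by [sigma_augmented]. *)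
Lemma filtration_indep s t A (B : 'I_m -> set R) : 0 <= s -> s < t -> F s A ->
  (forall j, measurable (B j)) ->
  P (A `&` [set w | forall j, B j (dW s t j w)]) =
  (P A * \prod_(j < m) normal_prob 0 (Num.sqrt (t - s)) (B j))%E.
Proof.
move=> s0 st FA mB; set E := [set w | _].
have st' : 0 <= s <= t by rewrite s0 ltW.
have GWt : <<s gen_of [set r | 0 <= r] W >> E.
  apply: increment_event => // j; apply/measurable_wrtP.
  rewrite (_ : dW s t j = fun w => W t w j 0 - W s w j 0); last first.
    by apply/funext => w; rewrite /dW !mxE.
  apply: measurable_funB; apply/measurable_wrtP => C mC; apply: sub_sigma_algebra.
    by apply: gen_of_mem => //=; rewrite (le_trans s0)// ltW.
  exact: gen_of_mem.
have mE : measurable E.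
  apply: sigma_sub_measurable GWt; apply: gen_of_measurable => r.
  exact: (wiener_rv hW).
rewrite -(increment_law s0 st mB) -/E.
have [A' [N [sA' mN N0 AN]]] := sigma_augmented FA.
have mA : measurable A by exact: filtration_measurable FA.
have mG : gen_of [set: unit] (fun=> X0) `|` gen_of [set r | 0 <= r <= s] W `<=` measurable.
  move=> C [|]; first exact: gen_of_measurable.
  by apply: gen_of_measurable => r /= /andP[r0 _]; exact: (wiener_rv hW).
have mA' : measurable A' by exact: sigma_sub_measurable sA'.
rewrite (eq_prob_off_null mA mA' mN N0 AN).
rewrite (@eq_prob_off_null _ _ _ P (A `&` E) (A' `&` E) N)//; first last.
- by rewrite setIAC AN setIAC.
- exact: measurableI.
- exact: measurableI.
set GX := gen_of [set: unit] (fun=> X0) in sA' mG *.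
set GW := gen_of [set r | 0 <= r <= s] W in sA' mG *.
apply: (@indep_join _ _ _ P <<s GX >> <<s GW >>) => //.
- exact: sigma_setI.
- exact: sigma_setI.
- exact: sigma_setT.
- exact: sigma_setT.
- by apply: sigma_sub_measurable => C h; apply: mG; left.
- by apply: sigma_sub_measurable => C h; apply: mG; right.
- move=> a b sa sb.
  have sb' : <<s gen_of [set r | 0 <= r] W >> b.
    move: b sb; apply: sub_smallest2r; first exact: smallest_sigma_algebra.
    by move=> C [r /= /andP[r0 _] h]; exists r.
  rewrite -setIA (hind sa (sigma_setI sb' GWt)) (hind sa sb').
  by rewrite (wiener_increments hW s0 st sb mB) -(increment_law s0 st mB) muleA.
- move: A' sA' {mA' AN}; apply: sub_smallest2r; first exact: smallest_sigma_algebra.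
  by move=> C [h|h]; [left|right]; exact: sub_sigma_algebra.
Qed.


Lemma adapted_indep s t (U : T -> R) (j : 'I_m) (C B : set R) : 0 <= s -> s < t ->
  measurable_wrt (F s) U -> measurable C -> measurable B ->
  P (U @^-1` C `&` dW s t j @^-1` B) = (P (U @^-1` C) * P (dW s t j @^-1` B))%E.
Proof.
move=> s0 st FU mC mB.
pose B' := fun i : 'I_m => if i == j then B else setT.
have mB' i : measurable (B' i) by rewrite /B'; case: ifP.
have BE : dW s t j @^-1` B = [set w | forall i, B' i (dW s t i w)].
  apply/seteqP; split=> [w Bw i|w /(_ j)]; rewrite /B'; last by rewrite eqxx.
  by case: eqP => [->|].
rewrite BE (filtration_indep s0 st (FU _ mC) mB').
by rewrite -(increment_law s0 st mB').
Qed.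

(** For the mixed terms of the covariance. [U dW_i] is measurable for the join of [F s] and the
    sigma-algebra of [dW_i], and the product form of the law of the increment makes this join
    independent of [dW_j]. *)
Lemma adapted_indep2 s t (U : T -> R) (i j : 'I_m) (C B : set R) : 0 <= s -> s < t ->
  i != j -> measurable_wrt (F s) U -> measurable C -> measurable B ->
  P ((fun w => (U w * dW s t i w)%R) @^-1` C `&` dW s t j @^-1` B) =
  (P ((fun w => (U w * dW s t i w)%R) @^-1` C) * P (dW s t j @^-1` B))%E.
Proof.
move=> s0 st ij FU mC mB.
have st' : 0 <= s <= t by rewrite s0 ltW.
have mD k := dW_measurable k st'.
pose H := [set dW s t i @^-1` D | D in (measurable : set (set R))].
have mH : H `<=` measurable.
  by move=> _ [D mm <-]; rewrite -[X in measurable X]setTI; exact: mD.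
apply: (@indep_join _ _ _ P (F s) H) => //.
- exact: sigma_setI.
- move=> _ _ [D1 m1 <-] [D2 m2 <-]; exists (D1 `&` D2) => //; exact: measurableI.
- exact: sigma_setT.
- by exists setT.
- exact: filtration_measurable.
- by rewrite -[X in measurable X]setTI; exact: mD.
- move=> a _ Fa [D mDD <-].
  pose B1 := fun k : 'I_m => if k == i then D else setT.
  pose B2 := fun k : 'I_m => if k == j then B else setT.
  pose B3 := fun k : 'I_m => B1 k `&` B2 k.
  have mB1 k : measurable (B1 k) by rewrite /B1; case: ifP.
  have mB2 k : measurable (B2 k) by rewrite /B2; case: ifP.
  have mB3 k : measurable (B3 k) by apply: measurableI.
  have E1 : dW s t i @^-1` D = [set w | forall k, B1 k (dW s t k w)].
    apply/seteqP; split=> [w Bw k|w /(_ i)]; rewrite /B1; last by rewrite eqxx.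
    by case: eqP => [->|].
  have E2 : dW s t j @^-1` B = [set w | forall k, B2 k (dW s t k w)].
    apply/seteqP; split=> [w Bw k|w /(_ j)]; rewrite /B2; last by rewrite eqxx.
    by case: eqP => [->|].
  rewrite -setIA {1}E1 {1}E2.
  have -> : [set w | forall k, B1 k (dW s t k w)] `&` [set w | forall k, B2 k (dW s t k w)] =
      [set w | forall k, B3 k (dW s t k w)].
    by apply/seteqP; split => [w [h1 h2] k|w h]; [split; [exact: h1|exact: h2]|split => k; case: (h k)].
  rewrite (filtration_indep s0 st Fa mB3) E1 (filtration_indep s0 st Fa mB1) E2.
  rewrite (increment_law s0 st mB2) -muleA; congr (_ * _)%E.
  rewrite -big_split/=; apply: eq_bigr => k _; rewrite /B3 /B1 /B2.
  have N1 : normal_prob (0 : R) (Num.sqrt (t - s)) [set: R] = 1%E by exact: probability_setT.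
  case: eqP => [->|_]; last by rewrite setTI N1 mul1e.
  by rewrite (negbTE ij) setIT N1 mule1.
- pose G := F s `|` H.
  have : measurable_wrt <<s G >> (fun w => U w * dW s t i w).
    apply/measurable_wrtP; apply: measurable_funM; apply/measurable_wrtP => D mDD.
      by apply: sub_sigma_algebra; left; exact: FU.
    by apply: sub_sigma_algebra; right; exists D.
  by apply.
Qed.

Lemma dW_L1 s t j (f : R -> R) : 0 <= s -> s < t -> measurable_fun setT f ->
  L1 (normal_prob 0 (Num.sqrt (t - s)) : probability _ R) f ->
  L1 P (fun w => f (dW s t j w)) /\
  EE P (fun w => f (dW s t j w)) = EE (normal_prob 0 (Num.sqrt (t - s)) : probability _ R) f.
Proof.
move=> s0 st mf fL.
have st' : 0 <= s <= t by rewrite s0 ltW.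
have mD := dW_measurable j st'.
have mD' : measurable_fun setT (dW s t j : T -> measurableTypeR R) by exact: mD.
pose D' : {mfun T >-> measurableTypeR R} :=
  HB.pack (dW s t j : T -> measurableTypeR R) (isMeasurableFun.Build _ _ _ _ _ mD').
set N := (normal_prob 0 _ : probability _ R).
have NE A : measurable A -> distribution P D' A = N A.
  move=> mA; pose B' := fun i : 'I_m => if i == j then A else setT.
  have mB' i : measurable (B' i) by rewrite /B'; case: ifP.
  rewrite /distribution /pushforward.
  have -> : D' @^-1` A = [set w | forall i, B' i (dW s t i w)].
    apply/seteqP; split=> [w Bw i|w /(_ j)]; rewrite /B'; last by rewrite eqxx.
    by case: eqP => [->|].
  rewrite (increment_law s0 st mB') (bigD1 j)//= big1 => [|i ij].
    by rewrite mule1 /B' eqxx.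
  by rewrite /B' (negbTE ij); exact: probability_setT.
have L : L1 P (fun w => f (dW s t j w)).
  apply/integrableP; split.
    by apply/measurable_EFinP; exact: (measurableT_comp mf mD).
  have /integrableP[_ fin] := fL.
  move: (fin : (\int[N]_x `|(f x)%:E| < +oo)%E).
  have -> : (\int[N]_x `|(f x)%:E| = \int[distribution P D']_x `|(f x)%:E|)%E.
    by apply: eq_measure_integral => A mA _; exact/esym/NE.
  rewrite ge0_integral_distribution//.
  by apply: measurableT_comp => //; exact/measurable_EFinP.
split => //; rewrite /EE /Rintegral; congr fine.
have -> : (\int[N]_x (f x)%:E = \int[distribution P D']_x (f x)%:E)%E.
  by apply: eq_measure_integral => A mA _; exact/esym/NE.
by rewrite integral_distribution//; exact/measurable_EFinP.
Qed.

Lemma dW_refl s j : dW s s j = fun=> 0.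
Proof. by apply/funext => w; rewrite /dW subrr mxE. Qed.

Lemma EE_adapted_fdW s t j (f : R -> R) (U : T -> R) : 0 <= s -> s < t ->
  measurable_fun setT f ->
  L1 (normal_prob 0 (Num.sqrt (t - s)) : probability _ R) f ->
  measurable_wrt (F s) U -> L1 P U ->
  L1 P (fun w => U w * f (dW s t j w)) /\
  EE P (fun w => U w * f (dW s t j w)) =
  EE P U * EE (normal_prob 0 (Num.sqrt (t - s)) : probability _ R) f.
Proof.
move=> s0 st mf fL FU UL; have [dL dE] := dW_L1 j s0 st mf fL.
rewrite -dE; apply: EE_indep => // A B mA mB.
have := adapted_indep j s0 st FU mA (_ : measurable (f @^-1` B)); apply.
by rewrite -[X in measurable X]setTI; exact: mf.
Qed.

Lemma sqrt_gt0_sub (s t : R) : s < t -> 0 < Num.sqrt (t - s).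
Proof. by move=> st; rewrite sqrtr_gt0 subr_gt0. Qed.

Lemma EE_adapted_dW s t j (U : T -> R) : 0 <= s <= t ->
  measurable_wrt (F s) U -> L1 P U ->
  L1 P (fun w => U w * dW s t j w) /\ EE P (fun w => U w * dW s t j w) = 0.
Proof.
move=> /andP[s0]; rewrite le_eqVlt => /predU1P[<-|st] FU UL.
  rewrite dW_refl (_ : (fun _ => _) = fun=> 0); first by split; [exact: L1_cst|exact: EE_cst].
  by apply/funext => w; rewrite mulr0.
have sg := sqrt_gt0_sub st.
have [] := EE_adapted_fdW j s0 st (@measurable_id _ _ setT) (normal_integrable1 sg) FU UL.
by rewrite normal_mean// mulr0.
Qed.

Lemma EE_adapted_dW2 s t i j (U : T -> R) : 0 <= s <= t ->
  measurable_wrt (F s) U -> L1 P U ->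
  L1 P (fun w => U w * (dW s t i w * dW s t j w)) /\
  EE P (fun w => U w * (dW s t i w * dW s t j w)) = (i == j)%:R * (t - s) * EE P U.
Proof.
move=> /andP[s0]; rewrite le_eqVlt => /predU1P[<-|st] FU UL.
  rewrite !dW_refl (_ : (fun _ => _) = fun=> 0).
    by rewrite subrr mulr0 mul0r; split; [exact: L1_cst|exact: EE_cst].
  by apply/funext => w; rewrite !mulr0.
have sg := sqrt_gt0_sub st.
have st' : 0 <= s <= t by rewrite s0 ltW.
have [<-|ij] := eqVneq i j.
  have [] := EE_adapted_fdW i s0 st (@exprn_measurable _ setT 2) (normal_integrable2 sg) FU UL.
  rewrite normal_variance// sqr_sqrtr ?subr_ge0 ?(ltW st)// => h1 h2.
  rewrite (_ : (fun w => U w * (_ * _)) = fun w => U w * dW s t i w ^+ 2).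
    by rewrite h2 mul1r mulrC; split.
  by apply/funext => w; rewrite expr2.
have [UiL UiE] := EE_adapted_dW i st' FU UL.
have [jL jE] := dW_L1 j s0 st (@measurable_id _ _ setT) (normal_integrable1 sg).
have [] := @EE_indep _ _ _ P _ _ UiL jL.
  by move=> A B mA mB; exact: adapted_indep2.
rewrite UiE !mul0r => h1 h2.
rewrite (_ : (fun w => U w * (_ * _)) = fun w => U w * dW s t i w * dW s t j w); first by split.
by apply/funext => w; rewrite mulrA.
Qed.

End increments.

Section increment_moments.
Context {R : realType} {disp : measure_display} {T : measurableType disp}.
Variable P : probability T R.
Context {d m : nat} {W : R -> T -> 'cV[R]_m}.
Hypothesis hP : measure_is_complete P.
Hypothesis hW : is_wiener P W.

(** The constant is found before [X0] is given, because in the theorem one [K] serves all initial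
    values. Hence [X0] is quantified inside the statement, here and in the later lemmas that produce
    constants. *)
Lemma EE_adapted_dWq (q : R) : 0 <= q -> exists2 C : R, 0 <= C &
  forall X0 : T -> 'cV[R]_d, random_vector X0 -> indep_of_process P X0 W ->
  forall (s t : R) (j : 'I_m) (U : T -> R), 0 <= s < t ->
  measurable_wrt (filtration P X0 W s) U -> L1 P U -> (forall w, 0 <= U w) ->
  L1 P (fun w => U w * (dW (W := W) s t j w ^+ 2) `^ q) /\
  EE P (fun w => U w * (dW (W := W) s t j w ^+ 2) `^ q) <= C * (t - s) `^ q * EE P U.
Proof.
move=> q0; have [C C0 CP] := @normal_moment R q q0.
exists C => // X0 hX0 hind s t j U /andP[s0 st] FU UL U0.
have sg := sqrt_gt0_sub st.
have [L B] := CP _ sg.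
have mf : measurable_fun setT (fun x : R => (x ^+ 2) `^ q) := L1_meas L.
have [h1 h2] := EE_adapted_fdW hP hW hX0 hind j s0 st mf L FU UL.
split => //; rewrite h2 mulrC ler_wpM2r//; first exact: EE_ge0.
by rewrite sqr_sqrtr ?subr_ge0 ?(ltW st)// in B.
Qed.

End increment_moments.

(** * Measurability of continuous functions of random vectors *)

Section continuous_composition.
Context {R : realType}.

(* Stated with [sqn] because the library's topology on matrices comes from the max norm. *)
Definition econt (n : nat) (phi : 'cV[R]_n -> R) :=
  forall x (e : R), 0 < e -> exists2 r : R, 0 < r &
    forall y, sqn (y - x) < r -> `|phi y - phi x| < e.

Definition grid_point (n : nat) (k : nat) (z : 'I_n -> int) : 'cV[R]_n :=
  \col_i ((z i)%:~R / k.+1%:R).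

Lemma grid_point_close n k (y : 'cV[R]_n) :
  sqn (grid_point k (fun i => Num.floor (k.+1%:R * y i 0)) - y) <= n%:R / k.+1%:R ^+ 2.
Proof.
have k0 : 0 < k.+1%:R :> R by rewrite ltr0n.
have -> : n%:R / k.+1%:R ^+ 2 = \sum_(i < n) k.+1%:R ^- 2 :> R.
  by rewrite sumr_const card_ord mulr_natl.
rewrite sqnE; apply: ler_sum => i _; rewrite !mxE.
set x := y i 0; have := Num.Theory.floor_itv (k.+1%:R * x) => /andP[h1 h2].
set z := Num.floor _ in h1 h2 *.
have -> : z%:~R / k.+1%:R - x = (z%:~R - k.+1%:R * x) / k.+1%:R :> R.
  by field; rewrite gt_eqF.
rewrite exprMn exprVn ler_piMl ?invr_ge0 ?exprn_ge0 ?(ltW k0)//.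
rewrite intrD in h2; nra.
Qed.

(** Rounding the coordinates of [Y] down to multiples of [1 / (k + 1)] gives vectors with countably
    many values, each taken on a measurable set; continuity of [phi] makes its values at the rounded
    vectors converge pointwise. *)
Lemma measurable_econt (disp : measure_display) (T : measurableType disp) (n : nat)
    (phi : 'cV[R]_n -> R) (Y : T -> 'cV[R]_n) :
  (forall i, measurable_fun setT (fun w => Y w i 0)) -> econt phi ->
  measurable_fun setT (fun w => phi (Y w)).
Proof.
move=> mY cphi.
pose fl k w : {ffun 'I_n -> int} := [ffun i => Num.floor (k.+1%:R * Y w i 0)].
apply: (@measurable_fun_cvg _ _ _ _ (fun k w => phi (grid_point k (fl k w)))).
- move=> k _ B mB; rewrite setTI.
  pose A (l : nat) : set T := if unpickle l is Some z then
    [set w | B (phi (grid_point k (z : {ffun 'I_n -> int}))) /\ fl k w = z] else set0.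
  have -> : (fun w => phi (grid_point k (fl k w))) @^-1` B = \bigcup_l A l.
    apply/seteqP; split => w.
      by move=> Bw; exists (pickle (fl k w)) => //; rewrite /A pickleK.
    by move=> [l _]; rewrite /A; case: unpickle => [z [Bz E]|//]; rewrite /= E.
  apply: bigcup_measurable => l _; rewrite /A; case: unpickle => [z|]; last exact: measurable0.
  have [Bz|Bz] := pselect (B (phi (grid_point k z))); last first.
    by rewrite (_ : [set _ | _] = set0)//; apply/seteqP; split => // w [].
  have -> : [set w | B (phi (grid_point k z)) /\ fl k w = z] =
     \bigcap_(i in [set: 'I_n]) ((fun w => k.+1%:R * Y w i 0) @^-1` `[(z i)%:~R, (z i + 1)%:~R[%classic).
    apply/seteqP; split=> w.
      move=> [_ <-] i _; rewrite /= ffunE in_itv/=.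
      exact: Num.Theory.floor_itv.
    move=> h; split => //; apply/ffunP => i; rewrite ffunE.
    by apply: Num.Theory.floor_def; have := h i I; rewrite /= in_itv.
  apply: fin_bigcap_measurable => // i _.
  rewrite -[X in measurable X]setTI.
  have : measurable_fun setT (fun w => k.+1%:R * Y w i 0) by apply: measurable_funM.
  by apply.
- move=> w _; apply/cvgrPdist_lt => e e0.
  have [r r0 H] := cphi (Y w) e e0.
  near=> k; rewrite distrC; apply: H.
  rewrite (_ : grid_point k (fl k w) = grid_point k (fun i => Num.floor (k.+1%:R * Y w i 0))); last first.
    by apply/colP => i; rewrite !mxE ffunE.
  apply: (le_lt_trans (grid_point_close _ _)).
  have k0 : 0 < k.+1%:R :> R by rewrite ltr0n.
  have k1 : 1 <= k.+1%:R :> R by rewrite ler1n.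
  have : n%:R / r < k.+1%:R.
    apply: (@lt_trans _ _ k%:R); last by rewrite ltr_nat.
    by near: k; exact: nbhs_infty_gtr.
  rewrite ltr_pdivrMr// => h1.
  rewrite ltr_pdivrMr ?exprn_gt0//; nra.
Unshelve. all: by end_near. Qed.

End continuous_composition.

Ltac vec := (apply/colP => ?; rewrite !mxE; ring).

(** * The implicit equation *)

Section implicit_equation.
Context {R : realType} {d : nat}.
Variable f : 'cV[R]_d -> 'cV[R]_d.
Hypothesis fmono : forall x y, inner (x - y) (f x - f y) <= 0.
Hypothesis flip : forall M : R, exists2 L : R, 0 <= L &
  forall x y, sqn x <= M -> sqn y <= M -> sqn (f x - f y) <= L * sqn (x - y).

Lemma geometric_cvg (u : nat -> R) (C r : R) : 0 <= C -> 0 <= r < 1 ->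
  (forall k, `|u k.+1 - u k| <= C * r ^+ k) -> cvgn u.
Proof.
move=> C0 /andP[r0 r1] uP.
have h : cvgn [normed series (telescope u)].
  apply: (@series_le_cvg _ _ (geometric C r)) => [n|n|n|].
  - by rewrite /= normr_ge0.
  - by rewrite /geometric/= mulr_ge0// exprn_ge0.
  - exact: uP.
  - by apply: is_cvg_geometric_series; rewrite ger0_norm.
have := normed_cvg h; rewrite telescopeK => h2.
rewrite (_ : u = (fun n => u n - u 0%N + u 0%N)); last by apply/funext => n; rewrite subrK.
by apply: is_cvgD => //; exact: is_cvg_cst.
Qed.

Lemma sqn_cvg0 (z : nat -> 'cV[R]_d) (C r : R) : 0 <= C -> 0 <= r < 1 ->
  (forall k, sqn (z k.+1 - z k) <= C * (r ^+ 2) ^+ k) ->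
  exists l : 'cV[R]_d, sqn (z k - l) @[k --> \oo] --> (0 : R).
Proof.
move=> C0 r01 zP.
have c i : cvgn (fun k => z k i 0).
  apply: (@geometric_cvg _ (Num.sqrt C) r (sqrtr_ge0 _) r01).
  move=> k; have := sqn_entry (z k.+1 - z k) i; rewrite !mxE => h.
  have h2 := le_trans h (zP k).
  have r0 : 0 <= r ^+ k by rewrite exprn_ge0//; case/andP: r01.
  rewrite -(@ler_sqr _ _ _) ?nnegrE ?mulr_ge0 ?sqrtr_ge0//.
  rewrite real_normK ?num_real// exprMn sqr_sqrtr//.
  by rewrite -exprM mulnC exprM in h2.
exists (\col_i limn (fun k => z k i 0)).
rewrite (_ : (fun k => _) = fun k => \sum_i (z k i 0 - limn (fun k => z k i 0)) ^+ 2); last first.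
  by apply/funext => k; rewrite sqnE; apply: eq_bigr => i _; rewrite !mxE.
rewrite -[X in _ --> X](_ : \sum_(i < d) (0 : R) = 0); last by rewrite big1.
apply: cvg_big => [|i _]; first exact: add_continuous.
have h : z k i 0 - limn (fun k => z k i 0) @[k --> \oo] --> (0 : R).
  by apply/subr_cvg0/c.
by rewrite -[X in _ --> X](mulr0 0); under eq_cvg do rewrite expr2; exact: cvgM.
Qed.

(** Monotonicity gives [|u|^2 <= <u, v>], so the map [x - h f x] does not decrease distances. Hence
    uniqueness, and the 1-Lipschitz dependence of the solution on the data that makes the scheme
    measurable. *)
Lemma implicit_contract (h : R) x y : 0 < h ->
  sqn (x - y) <= sqn ((x - h *: f x) - (y - h *: f y)).
Proof.
move=> h0; set u := _ - _; set v := (_ - _) - _.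
have uv : sqn u <= inner u v.
  have -> : v = u - h *: (f x - f y) by vec.
  rewrite innerDr innerNr innerZr -/(sqn u).
  have := fmono x y; rewrite -/u; nra.
have := inner_young u v (@ltr01 R); have := ler_norm (inner u v).
rewrite mul1r divr1; lra.
Qed.

Lemma implicit_unique (h : R) x y : 0 < h -> x - h *: f x = y - h *: f y -> x = y.
Proof.
move=> h0 E; apply/eqP; rewrite -subr_eq0; apply/eqP; apply: sqn_eq0.
apply: le_anti; rewrite sqn_ge0 andbT (le_trans (implicit_contract _ _ h0))//.
by rewrite E subrr sqn0.
Qed.

(* Picard iteration [z - lam (A z - b)], [A z = z - h f z], a contraction of the
   ball of radius [2|A 0 - b|] for small [lam]. *)
Lemma implicit_exists (h : R) b : 0 < h -> exists z, z - h *: f z = b.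
Proof.
move=> h0; pose A z := z - h *: f z.
pose rho := sqn (A 0 - b).
have rho0 : 0 <= rho by exact: sqn_ge0.
have [Lf Lf0 fL] := flip (4 * rho).
pose L := 2 + 2 * h ^+ 2 * Lf.
have L2 : 2 <= L by rewrite /L lerDl !mulr_ge0// ltW.
have AL x y : sqn x <= 4 * rho -> sqn y <= 4 * rho -> sqn (A x - A y) <= L * sqn (x - y).
  move=> hx hy; have -> : A x - A y = (x - y) + - (h *: (f x - f y)).
    by vec.
  apply: (le_trans (sqnD_le _ _)); rewrite sqnN sqnZ.
  have := fL x y hx hy; have h2 : 0 <= h ^+ 2 by rewrite exprn_ge0// ltW.
  by rewrite /L => H; have := ler_wpM2l h2 H; lra.
have Amono x y : sqn (x - y) <= inner (x - y) (A x - A y).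
  have -> : A x - A y = (x - y) - h *: (f x - f y).
    by vec.
  by rewrite innerDr innerNr innerZr -/(sqn (x - y)); have := fmono x y; nra.
(* On the ball [|S x - S y|^2] is at most [(1 - 2 lam + lam^2 L) |x - y|^2], and [lam = 1 / L] makes
   the factor [1 - lam]. *)
pose lam := L^-1.
have lam0 : 0 < lam by rewrite invr_gt0; lra.
have lamL : lam * L = 1 by rewrite mulVf//; lra.
have lam2 : lam <= 1 / 2 by nra.
pose S z := z - lam *: (A z - b).
have SB x y : sqn x <= 4 * rho -> sqn y <= 4 * rho -> sqn (S x - S y) <= (1 - lam) * sqn (x - y).
  move=> hx hy; have -> : S x - S y = (x - y) - lam *: (A x - A y).
    by vec.
  rewrite (sqnB (x - y)) innerZr sqnZ.
  have := AL x y hx hy; have := Amono x y; have := sqn_ge0 (x - y).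
  set s := sqn (x - y); set i := inner _ _; set a := sqn (A x - A y) => s0 hi ha.
  have h1 : lam ^+ 2 * a <= lam ^+ 2 * (L * s) by rewrite ler_wpM2l// exprn_ge0// ltW.
  have h2 : lam ^+ 2 * (L * s) = lam * s by rewrite expr2 -mulrA [lam * (L * s)]mulrA lamL mul1r.
  by rewrite h2 in h1; nra.
have Sball x : sqn x <= 4 * rho -> sqn (S x) <= 4 * rho.
  move=> hx; have -> : S x = (S x - S 0) + - (lam *: (A 0 - b)).
    by vec.
  have l2 : 0 < lam / 2 by rewrite divr_gt0.
  apply: (le_trans (sqnD_eps _ _ l2)); rewrite sqnN sqnZ -/rho.
  have h0' : sqn (0 : 'cV[R]_d) <= 4 * rho by rewrite sqn0 mulr_ge0.
  have := SB x 0 hx h0'; rewrite subr0 => h1.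
  have l1 : 0 <= 1 - lam by lra.
  have h2 := ler_wpM2l l1 hx.
  have h3 : (1 + lam / 2) * sqn (S x - S 0) <= (1 + lam / 2) * ((1 - lam) * (4 * rho)).
    by rewrite ler_wpM2l//; [lra|exact: le_trans h1 h2].
  have h4 : (1 + (lam / 2)^-1) * (lam ^+ 2 * rho) = lam ^+ 2 * rho + 2 * lam * rho.
    by field; rewrite gt_eqF.
  rewrite h4; have : 0 <= lam ^+ 2 * rho by rewrite mulr_ge0// exprn_ge0// ltW.
  nra.
pose z k := iter k S 0.
have zball k : sqn (z k) <= 4 * rho.
  by elim: k => [|k IH]; rewrite /z/= ?sqn0 ?mulr_ge0//; exact: Sball.
have zstep k : sqn (z k.+1 - z k) <= (sqn (z 1%N - z 0%N)) * (1 - lam) ^+ k.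
  elim: k => [|k IH]; first by rewrite expr0 mulr1.
  rewrite (le_trans (SB _ _ (zball k.+1) (zball k)))// exprS mulrCA ler_wpM2l//; lra.
have l1 : 0 <= 1 - lam by lra.
have r2 : Num.sqrt (1 - lam) ^+ 2 = 1 - lam by rewrite sqr_sqrtr.
have r01 : 0 <= Num.sqrt (1 - lam) < 1.
  rewrite sqrtr_ge0/= -[ltRHS]sqrtr1 ltr_sqrt//; lra.
have zstep' k : sqn (z k.+1 - z k) <= (sqn (z 1%N - z 0%N)) * (Num.sqrt (1 - lam) ^+ 2) ^+ k.
  by rewrite r2.
have [l zl] := sqn_cvg0 (sqn_ge0 _) r01 zstep'.
exists l; rewrite -/(A l).
(* The limit is located only in a larger ball, by comparison with a single iterate; a second
   Lipschitz constant, on that ball, suffices for passing to the limit in the equation. *)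
have lball : sqn l <= 4 * (4 * rho) + 2.
  have /cvgrPdist_lt/(_ 1 ltr01)[k _ /(_ k (leqnn k))] := zl.
  rewrite sub0r normrN ger0_norm ?sqn_ge0// => h1.
  have E : z k + (l - z k) = l by vec.
  have := sqnD_le (z k) (l - z k); rewrite E -(sqnN (l - z k)) opprB.
  by have := zball k; lra.
have [L' L'0 fL'] := flip (4 * (4 * rho) + 2).
apply/eqP; rewrite -subr_eq0; apply/eqP; apply: sqn_eq0; apply/eqP.
rewrite eq_le sqn_ge0 andbT; apply/ler_addgt0Pl => e e0; rewrite addr0.
pose K := 2 * (2 + 2 * h ^+ 2 * L') + 2 * lam ^- 2 * 4.
have K0 : 0 < K.
  have : 0 <= h ^+ 2 * L' by rewrite mulr_ge0// exprn_ge0// ltW.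
  have : 0 <= lam ^- 2 by rewrite invr_ge0 exprn_ge0// ltW.
  by rewrite /K; lra.
have /cvgrPdist_lt/(_ (e / K) (divr_gt0 e0 K0))[k _ kP] := zl.
have h1 := kP k (leqnn k); have h2 := kP k.+1 (leqnSn k).
rewrite sub0r normrN ger0_norm ?sqn_ge0// ltr_pdivlMr// in h1.
rewrite sub0r normrN ger0_norm ?sqn_ge0// ltr_pdivlMr// in h2.
have zk : sqn (z k) <= 4 * (4 * rho) + 2 by have := zball k; lra.
have a1 : sqn (A l - A (z k)) <= (2 + 2 * h ^+ 2 * L') * sqn (z k - l).
  have -> : A l - A (z k) = (l - z k) + - (h *: (f l - f (z k))).
    by vec.
  apply: (le_trans (sqnD_le _ _)); rewrite sqnN sqnZ.
  have := fL' _ _ lball zk; rewrite -[sqn (z k - l)]sqnN opprB.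
  have hh : 0 <= h ^+ 2 by rewrite exprn_ge0// ltW.
  by move=> H; have := ler_wpM2l hh H; lra.
have a2 : sqn (A (z k) - b) <= lam ^- 2 * (2 * sqn (z k.+1 - l) + 2 * sqn (z k - l)).
  have -> : A (z k) - b = lam^-1 *: (z k - z k.+1).
    by rewrite /z/= /S opprB addrCA subrr addr0 scalerA mulVf ?scale1r ?gt_eqF.
  rewrite sqnZ exprVn ler_wpM2l ?invr_ge0 ?exprn_ge0 ?(ltW lam0)//.
  have -> : z k - z k.+1 = (z k - l) + - (z k.+1 - l) by vec.
  by rewrite (le_trans (sqnD_le _ _))// sqnN; lra.
have -> : A l - b = (A l - A (z k)) + (A (z k) - b) by rewrite addrA subrK.
apply: (le_trans (sqnD_le _ _)).
set s1 := sqn (z k - l) in h1 a1 a2; set s2 := sqn (z k.+1 - l) in h2 a2.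
have s10 : 0 <= s1 by exact: sqn_ge0.
have s20 : 0 <= s2 by exact: sqn_ge0.
have b1 : 0 <= h ^+ 2 * L' by rewrite mulr_ge0// exprn_ge0// ltW.
have b2 : 0 <= lam ^- 2 by rewrite invr_ge0 exprn_ge0// ltW.
pose sm := Num.max s1 s2.
have sm1 : s1 <= sm by rewrite le_max lexx.
have sm2 : s2 <= sm by rewrite le_max lexx orbT.
have smK : sm * K <= e by rewrite /sm; case: (leP s1 s2) => _; clear -h1 h2; lra.
have c1 : (2 + 2 * h ^+ 2 * L') * s1 <= (2 + 2 * h ^+ 2 * L') * sm by rewrite ler_wpM2l// addr_ge0// -mulrA mulr_ge0.
have c2 : lam ^- 2 * (2 * s2 + 2 * s1) <= lam ^- 2 * (4 * sm) by rewrite ler_wpM2l//; clear -sm1 sm2; lra.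
by move: smK; rewrite /K; clear -a1 a2 c1 c2; lra.
Qed.

Definition implicit_solve (h : R) (b : 'cV[R]_d) : 'cV[R]_d :=
  xget 0 [set z | z - h *: f z = b].

Lemma implicit_solveP (h : R) b : 0 < h ->
  implicit_solve h b - h *: f (implicit_solve h b) = b.
Proof. by move=> h0; have [z zP] := implicit_exists b h0; rewrite /implicit_solve; case: xgetP => [_ _ //|/(_ z)]. Qed.

Lemma implicit_solve_econt (h : R) i : 0 < h -> econt (fun b => implicit_solve h b i 0).
Proof.
move=> h0 x e e0; exists (e ^+ 2); first exact: exprn_gt0.
move=> y xy; have := implicit_contract (implicit_solve h y) (implicit_solve h x) h0.
rewrite !implicit_solveP// => H.
have := sqn_entry (implicit_solve h y - implicit_solve h x) i; rewrite !mxE => H2.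
have : `|implicit_solve h y i 0 - implicit_solve h x i 0| ^+ 2 < e ^+ 2.
  by rewrite real_normK ?num_real//; lra.
by rewrite ltr_sqr ?nnegrE// ltW.
Qed.

End implicit_equation.

(** * Adapted vectors *)

Section measurable_vectors.
Context {R : realType} {disp : measure_display} {T : measurableType disp}.

Definition measM n m (G : T -> 'M[R]_(n, m)) := forall i j, measurable_fun setT (fun w => G w i j).

Lemma meas_inner n (x y : T -> 'cV[R]_n) : random_vector x -> random_vector y ->
  measurable_fun setT (fun w => inner (x w) (y w)).
Proof. by move=> mx my; apply: measurable_sum => i; apply: measurable_funM. Qed.

Lemma meas_sqn n (x : T -> 'cV[R]_n) : random_vector x -> measurable_fun setT (fun w => sqn (x w)).
Proof. by move=> mx; exact: meas_inner. Qed.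

Lemma meas_hs2 n m (G : T -> 'M[R]_(n, m)) : measM G -> measurable_fun setT (fun w => hs2 (G w)).
Proof.
move=> mG; apply: measurable_sum => i; apply: measurable_sum => j.
exact: measurable_funX.
Qed.

Lemma meas_powR (U : T -> R) (q : R) : measurable_fun setT U -> measurable_fun setT (fun w => U w `^ q).
Proof. by move=> mU; exact: (measurableT_comp (measurable_powR q)). Qed.

Lemma meas_mulmx n m (G : T -> 'M[R]_(n, m)) (x : T -> 'cV[R]_m) :
  measM G -> random_vector x -> random_vector (fun w => G w *m x w).
Proof.
move=> mG mx i.
rewrite (_ : (fun w => _) = fun w => \sum_j G w i j * x w j 0).
  by apply: measurable_sum => j; apply: measurable_funM.
by apply/funext => w; rewrite mxE.
Qed.

Lemma meas_vadd n (x y : T -> 'cV[R]_n) : random_vector x -> random_vector y ->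
  random_vector (fun w => x w + y w).
Proof.
move=> mx my i; rewrite (_ : (fun w => _) = fun w => x w i 0 + y w i 0).
  exact: measurable_funD.
by apply/funext => w; rewrite mxE.
Qed.

Lemma meas_vsub n (x y : T -> 'cV[R]_n) : random_vector x -> random_vector y ->
  random_vector (fun w => x w - y w).
Proof.
move=> mx my i; rewrite (_ : (fun w => _) = fun w => x w i 0 - y w i 0).
  exact: measurable_funB.
by apply/funext => w; rewrite !mxE.
Qed.

Lemma meas_vscale n (c : R) (x : T -> 'cV[R]_n) : random_vector x ->
  random_vector (fun w => c *: x w).
Proof.
move=> mx i; rewrite (_ : (fun w => _) = fun w => c * x w i 0).
  exact: measurable_funM.
by apply/funext => w; rewrite mxE.
Qed.

Lemma meas_vsum n (I : Type) (s : seq I) (x : I -> T -> 'cV[R]_n) :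
  (forall i, random_vector (x i)) -> random_vector (fun w => \sum_(i <- s) x i w).
Proof.
move=> mx i; rewrite (_ : (fun w => _) = fun w => \sum_(k <- s) x k w i 0).
  by apply: measurable_sum => k; exact: mx.
by apply/funext => w; rewrite summxE.
Qed.

Lemma meas_Msub n m (x y : T -> 'M[R]_(n, m)) : measM x -> measM y ->
  measM (fun w => x w - y w).
Proof.
move=> mx my i j; rewrite (_ : (fun w => _) = fun w => x w i j - y w i j).
  exact: measurable_funB.
by apply/funext => w; rewrite !mxE.
Qed.

Lemma meas_Mcst n m (x : 'M[R]_(n, m)) : measM (fun=> x).
Proof. by move=> i j; exact: measurable_cst. Qed.

End measurable_vectors.

Section adapted_vectors.
Context {R : realType} {disp : measure_display} {T : measurableType disp}.
Implicit Types G : set (set T).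

(* Measurability with respect to the sigma-algebra generated by [G], phrased so
   that the lemmas on measurable functions apply. *)
Definition advec n G (Y : T -> 'cV[R]_n) := random_vector (Y : g_sigma_algebraType G -> _).
Definition admat n m G (Y : T -> 'M[R]_(n, m)) := measM (Y : g_sigma_algebraType G -> _).
Definition adreal G (Y : T -> R) := measurable_fun setT (Y : g_sigma_algebraType G -> R).

Lemma adrealP G (Y : T -> R) : adreal G Y <-> measurable_wrt <<s G >> Y.
Proof. by split=> /measurable_wrtP. Qed.

Lemma advecP n G (Y : T -> 'cV[R]_n) : advec G Y <->
  forall i, measurable_wrt <<s G >> (fun w => Y w i 0).
Proof. by split => h i; apply/adrealP; exact: h. Qed.

Lemma advec_econt n m G (Y : T -> 'cV[R]_n) (phi : 'cV[R]_n -> 'cV[R]_m) : advec G Y ->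
  (forall i, econt (fun x => phi x i 0)) -> advec G (fun w => phi (Y w)).
Proof. by move=> mY cp i; exact: (@measurable_econt _ _ (g_sigma_algebraType G) _ _ _ mY (cp i)). Qed.

Lemma admat_econt n m k G (Y : T -> 'cV[R]_n) (phi : 'cV[R]_n -> 'M[R]_(m, k)) : advec G Y ->
  (forall i j, econt (fun x => phi x i j)) -> admat G (fun w => phi (Y w)).
Proof. by move=> mY cp i j; exact: (@measurable_econt _ _ (g_sigma_algebraType G) _ _ _ mY (cp i j)). Qed.

End adapted_vectors.

Section vector_increments.
Context {R : realType} {disp : measure_display} {T : measurableType disp}.
Variable P : probability T R.
Context {d m : nat} {X0 : T -> 'cV[R]_d} {W : R -> T -> 'cV[R]_m}.
Hypothesis hP : measure_is_complete P.
Hypothesis hW : is_wiener P W.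
Hypothesis hX0 : random_vector X0.
Hypothesis hind : indep_of_process P X0 W.

Definition filt_gen (t : R) : set (set T) :=
  gen_of [set: unit] (fun=> X0) `|` gen_of [set s | 0 <= s <= t] W `|` P.-negligible.

Definition incr (s t : R) (w : T) : 'cV[R]_m := W t w - W s w.

Lemma ad_meas t (U : T -> R) : adreal (filt_gen t) U -> measurable_fun setT U.
Proof. by move=> /adrealP; exact: (adapted_measurable hP hW hX0). Qed.

Lemma adv_meas n t (Y : T -> 'cV[R]_n) : advec (filt_gen t) Y -> random_vector Y.
Proof. by move=> h i; exact: (ad_meas (h i)). Qed.

Lemma adm_meas n k t (Y : T -> 'M[R]_(n, k)) : admat (filt_gen t) Y -> measM Y.
Proof. by move=> h i j; exact: (ad_meas (h i j)). Qed.

Lemma ad_mono s t (U : T -> R) : s <= t -> adreal (filt_gen s) U -> adreal (filt_gen t) U.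
Proof. by move=> st /adrealP h; apply/adrealP; exact: (adapted_mono st h). Qed.

Lemma adv_mono n s t (Y : T -> 'cV[R]_n) : s <= t -> advec (filt_gen s) Y -> advec (filt_gen t) Y.
Proof. by move=> st h i; exact: (ad_mono st (h i)). Qed.

Lemma adm_mono n k s t (Y : T -> 'M[R]_(n, k)) : s <= t -> admat (filt_gen s) Y -> admat (filt_gen t) Y.
Proof. by move=> st h i j; exact: (ad_mono st (h i j)). Qed.

Lemma adv_X0 t : advec (filt_gen t) X0.
Proof. by apply/advecP => i; exact: adapted_X0. Qed.

Lemma adv_incr s t : 0 <= s <= t -> advec (filt_gen t) (incr s t).
Proof. by move=> st; apply/advecP => j; exact: adapted_dW. Qed.

Lemma incr_meas s t : 0 <= s <= t -> random_vector (incr s t).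
Proof. by move=> st; exact: (adv_meas (adv_incr st)). Qed.

Lemma L1_le0 (U V : T -> R) : measurable_fun setT U -> L1 P V ->
  (forall w, 0 <= U w <= V w) -> L1 P U.
Proof.
move=> mU LV UV; apply: (L1_le mU LV) => w.
by case/andP: (UV w) => h1 h2; rewrite ger0_norm.
Qed.

Lemma eq_L1 (U V : T -> R) : (forall w, U w = V w) -> L1 P V -> L1 P U.
Proof. by move=> UV; rewrite (_ : U = V)//; apply/funext. Qed.

Lemma eq_EE (U V : T -> R) : (forall w, U w = V w) -> EE P U = EE P V.
Proof. by move=> UV; rewrite (_ : U = V)//; apply/funext. Qed.

(** In the recursion [psi] is [phi |e|^(2 q - 2)]. The two integrability assumptions make each
    product of an entry of [e] and an entry of [G] integrable against [psi]. *)
Lemma EE_inner0 s t n (psi : T -> R) (e : T -> 'cV[R]_n) (G : T -> 'M[R]_(n, m)) :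
  0 <= s <= t -> adreal (filt_gen s) psi -> advec (filt_gen s) e -> admat (filt_gen s) G ->
  (forall w, 0 <= psi w) ->
  L1 P (fun w => psi w * sqn (e w)) -> L1 P (fun w => psi w * hs2 (G w)) ->
  L1 P (fun w => psi w * inner (e w) (G w *m incr s t w)) /\
  EE P (fun w => psi w * inner (e w) (G w *m incr s t w)) = 0.
Proof.
move=> st apsi ae aG psi0 Le LG.
have E w : psi w * inner (e w) (G w *m incr s t w) =
    \sum_i \sum_j (psi w * (e w i 0 * G w i j)) * dW (W := W) s t j w.
  rewrite /inner mulr_sumr; apply: eq_bigr => i _.
  rewrite mxE !mulr_sumr; apply: eq_bigr => j _.
  by rewrite /dW /incr !mulrA.
have L i j : L1 P (fun w => psi w * (e w i 0 * G w i j)).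
  have me := ad_meas (ae i); have mG := ad_meas (aG i j); have mp := ad_meas apsi.
  apply: (L1_le _ (L1D Le LG)).
    by apply: measurable_funM => //; apply: measurable_funM.
  move=> w; rewrite -mulrDr normrM ger0_norm ?psi0// ler_wpM2l//.
  have h1 := sqn_entry (e w) i; have h2 := hs2_entry (G w) i j.
  by rewrite ler_norml; apply/andP; split; nra.
have A i j : measurable_wrt (filtration P X0 W s) (fun w => psi w * (e w i 0 * G w i j)).
  apply/adrealP; apply: measurable_funM => //.
  by apply: measurable_funM; [exact: ae|exact: aG].
have H i j := EE_adapted_dW hP hW hX0 hind j st (A i j) (L i j).
have Ls i : L1 P (fun w => \sum_j (psi w * (e w i 0 * G w i j)) * dW (W := W) s t j w).
  by apply: L1_sum => j; case: (H i j).
split; first by apply: (eq_L1 E); exact: L1_sum.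
rewrite (eq_EE E) EE_sum//; rewrite big1// => i _.
rewrite EE_sum => [|j]; last by case: (H i j).
by rewrite big1// => j _; case: (H i j).
Qed.

Lemma EE_sqn s t n (psi : T -> R) (G : T -> 'M[R]_(n, m)) :
  0 <= s <= t -> adreal (filt_gen s) psi -> admat (filt_gen s) G ->
  (forall w, 0 <= psi w) -> L1 P (fun w => psi w * hs2 (G w)) ->
  L1 P (fun w => psi w * sqn (G w *m incr s t w)) /\
  EE P (fun w => psi w * sqn (G w *m incr s t w)) = (t - s) * EE P (fun w => psi w * hs2 (G w)).
Proof.
move=> st apsi aG psi0 LG.
have E w : psi w * sqn (G w *m incr s t w) =
    \sum_i \sum_j \sum_k (psi w * (G w i j * G w i k)) * (dW (W := W) s t j w * dW (W := W) s t k w).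
  rewrite sqnE mulr_sumr; apply: eq_bigr => i _.
  rewrite mxE expr2 mulr_suml mulr_sumr; apply: eq_bigr => j _.
  rewrite !mulr_sumr; apply: eq_bigr => k _.
  by rewrite /dW /incr; ring.
have mp := ad_meas apsi.
have L i j k : L1 P (fun w => psi w * (G w i j * G w i k)).
  have mG := ad_meas (aG i j); have mG' := ad_meas (aG i k).
  apply: (L1_le _ LG).
    by apply: measurable_funM => //; apply: measurable_funM.
  move=> w; rewrite normrM ger0_norm ?psi0// ler_wpM2l//.
  have h1 := hs2_entry (G w) i j; have h2 := hs2_entry (G w) i k.
  by rewrite ler_norml; apply/andP; split; nra.
have A i j k : measurable_wrt (filtration P X0 W s) (fun w => psi w * (G w i j * G w i k)).
  apply/adrealP; apply: measurable_funM => //.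
  by apply: measurable_funM; exact: aG.
have H i j k := EE_adapted_dW2 hP hW hX0 hind j k st (A i j k) (L i j k).
have L2 i j : L1 P (fun w => \sum_k (psi w * (G w i j * G w i k)) * (dW (W := W) s t j w * dW (W := W) s t k w)).
  by apply: L1_sum => k; case: (H i j k).
have L3 i : L1 P (fun w => \sum_j \sum_k (psi w * (G w i j * G w i k)) * (dW (W := W) s t j w * dW (W := W) s t k w)).
  by apply: L1_sum.
split; first by apply: (eq_L1 E); exact: L1_sum.
rewrite (eq_EE E) EE_sum//.
have E2 w : psi w * hs2 (G w) = \sum_i \sum_j psi w * (G w i j * G w i j).
  by rewrite /hs2 mulr_sumr; apply: eq_bigr => i _; rewrite mulr_sumr; apply: eq_bigr => j _; rewrite expr2.
rewrite (eq_EE E2) EE_sum; last by move=> i; apply: L1_sum => j; exact: L.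
rewrite mulr_sumr; apply: eq_bigr => i _.
rewrite EE_sum// EE_sum; last by move=> j; exact: L.
rewrite mulr_sumr; apply: eq_bigr => j _.
rewrite EE_sum; last by move=> k; case: (H i j k).
rewrite (bigD1 j)//= big1 => [|k kj].
  by rewrite addr0; have [_ ->] := H i j j; rewrite eqxx mul1r.
by have [_ ->] := H i j k; rewrite eq_sym (negbTE kj) !mul0r.
Qed.

(** Jensen's inequality for uniform weights: when the tangent inequality at the mean [S / n] is
    summed, its linear term cancels. *)
Lemma powR_sum_le (I : Type) (r : seq I) (F : I -> R) (q : R) : 1 <= q -> (forall i, 0 <= F i) ->
  (\sum_(i <- r) F i) `^ q <= (size r)%:R `^ (q - 1) * \sum_(i <- r) F i `^ q.
Proof.
move=> q1 F0; have [r0|r0] := posnP (size r).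
  by rewrite (size0nil r0) !big_nil mulr0 powR0//; apply/eqP => q0; lra.
have n0 : 0 < (size r)%:R :> R by rewrite ltr0n.
set S := \sum_(i <- r) F i; set n := (size r)%:R in n0 *.
have S0 : 0 <= S by rewrite sumr_ge0.
have M0 : 0 <= S / n by rewrite divr_ge0// ltW.
have H : n * (S / n) `^ q <= \sum_(i <- r) F i `^ q.
  apply: (@le_trans _ _ (\sum_(i <- r) ((S / n) `^ q + q * (S / n) `^ (q - 1) * (F i - S / n)))).
    rewrite big_split/= -mulr_sumr sumrB -/S !big_const_seq !count_predT !iter_addr_0.
    rewrite -[(S / n) *+ _]mulr_natl -/n.
    have -> : n * (S / n) = S by rewrite mulrC divfK// gt_eqF.
    by rewrite subrr mulr0 addr0 -mulr_natl.
  by apply: ler_sum => i _; apply: powR_tangent.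
have -> : S `^ q = n `^ (q - 1) * (n * (S / n) `^ q).
  rewrite mulrA [n `^ _ * n]mulrC mulr_powRB1 ?(ltW n0)//; last by lra.
  by rewrite -powRM ?(ltW n0)// mulrC divfK// gt_eqF.
by rewrite ler_wpM2l// powR_ge0.
Qed.

End vector_increments.

Section vector_increment_moments.
Context {R : realType} {disp : measure_display} {T : measurableType disp}.
Variable P : probability T R.
Context {d m : nat} {W : R -> T -> 'cV[R]_m}.
Hypothesis hP : measure_is_complete P.
Hypothesis hW : is_wiener P W.

(** Bounding [|G dW|^2] by [|G|^2 |dW|^2] reduces the claim to scalar increments with the adapted
    factor [psi |G|^(2 q)]. *)
Lemma EE_sqnq (q : R) : 1 <= q -> exists2 C : R, 0 <= C &
  forall X0 : T -> 'cV[R]_d, random_vector X0 -> indep_of_process P X0 W ->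
  forall (s t : R) n (psi : T -> R) (G : T -> 'M[R]_(n, m)),
  0 <= s < t -> adreal (filt_gen P (X0 := X0) (W := W) s) psi -> admat (filt_gen P (X0 := X0) (W := W) s) G ->
  (forall w, 0 <= psi w) -> L1 P (fun w => psi w * hs2 (G w) `^ q) ->
  L1 P (fun w => psi w * sqn (G w *m incr (W := W) s t w) `^ q) /\
  EE P (fun w => psi w * sqn (G w *m incr (W := W) s t w) `^ q) <=
    C * (t - s) `^ q * EE P (fun w => psi w * hs2 (G w) `^ q).
Proof.
move=> q1; have q0 : 0 <= q by lra.
have [C C0 CP] := @EE_adapted_dWq _ _ _ P d m W hP hW q q0.
exists (m%:R `^ (q - 1) * (m%:R * C)); first by rewrite mulr_ge0 ?powR_ge0// mulr_ge0.
move=> X0 hX0 hind s t n psi G st apsi aG psi0 LG.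
have st' : 0 <= s <= t by case/andP: st => -> /ltW ->.
pose U w := psi w * hs2 (G w) `^ q.
have aU : measurable_wrt (filtration P X0 W s) U.
  apply/adrealP; apply: measurable_funM => //; apply: meas_powR; exact: meas_hs2.
have U0 w : 0 <= U w by rewrite mulr_ge0 ?powR_ge0.
have H j := CP X0 hX0 hind s t j U st aU LG U0.
pose V w := m%:R `^ (q - 1) * \sum_j U w * (dW (W := W) s t j w ^+ 2) `^ q.
have LV : L1 P V by apply: L1Z; apply: L1_sum => j; case: (H j).
have UV w : 0 <= psi w * sqn (G w *m incr (W := W) s t w) `^ q <= V w.
  rewrite mulr_ge0 ?powR_ge0//=.
  rewrite /V -mulr_sumr mulrCA /U -mulrA ler_wpM2l//.
  apply: (@le_trans _ _ ((hs2 (G w) * sqn (incr (W := W) s t w)) `^ q)).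
    by apply: ge0_ler_powR; rewrite ?nnegrE ?mulr_ge0 ?hs2_ge0 ?sqn_ge0//; exact: sqn_mulmx.
  rewrite powRM ?hs2_ge0 ?sqn_ge0// ler_wpM2l ?powR_ge0// sqnE.
  have := @powR_sum_le _ _ (enum 'I_m) (fun j => dW (W := W) s t j w ^+ 2) q q1 (fun j => sqr_ge0 _).
  by rewrite size_enum_ord !big_enum.
have mm : measurable_fun setT (fun w => psi w * sqn (G w *m incr (W := W) s t w) `^ q).
  apply: measurable_funM; first exact: (ad_meas hP hW hX0 apsi).
  apply: meas_powR; apply: meas_sqn; apply: meas_mulmx; first exact: (adm_meas hP hW hX0 aG).
  exact: (incr_meas hP hW hX0).
have L := L1_le0 mm LV UV.
split => //; apply: (@le_trans _ _ (EE P V)).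
  by apply: EE_le => // w; case/andP: (UV w).
rewrite /V EEZ; last by apply: L1_sum => j; case: (H j).
rewrite -!mulrA ler_wpM2l ?powR_ge0//.
rewrite EE_sum => [|j]; last by case: (H j).
apply: (@le_trans _ _ (\sum_(j < m) C * (t - s) `^ q * EE P U)).
  by apply: ler_sum => j _; case: (H j).
by rewrite sumr_const card_ord mulr_natl mulrA.
Qed.

End vector_increment_moments.

(** * The Lyapunov recursion *)

Section moment_recursion.
Context {R : realType} {disp : measure_display} {T : measurableType disp}.
Variable P : probability T R.
Context {d m : nat} {W : R -> T -> 'cV[R]_m}.
Hypothesis hP : measure_is_complete P.
Hypothesis hW : is_wiener P W.
Notation FF X0 t := (filt_gen P (X0 := X0) (W := W) t).
Notation dw s t w := (incr (W := W) s t w).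

(** Expanding [|e - h (f x - f y)|^2] and using monotonicity yields this quantity as a lower bound
    ([lyap_step]): it is what one implicit step controls at the new time. *)
Definition lyap (al pst h : R) n (e : 'cV[R]_n) (G : 'M[R]_(n, m)) : R :=
  (1 + 2 * al * h) * sqn e + (2 * pst - 1) * h * hs2 G.

Lemma lyap_ge0 (al pst h : R) n (e : 'cV[R]_n) (G : 'M[R]_(n, m)) :
  0 <= al -> 0 <= h -> 1 <= pst -> 0 <= lyap al pst h e G.
Proof.
move=> al0 h0 p1; rewrite /lyap addr_ge0// mulr_ge0 ?sqn_ge0 ?hs2_ge0//.
  by rewrite addr_ge0// !mulr_ge0.
by rewrite mulr_ge0//; lra.
Qed.

Lemma sqn_le_lyap (al pst h : R) n (e : 'cV[R]_n) (G : 'M[R]_(n, m)) :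
  0 <= al -> 0 <= h -> 1 <= pst -> sqn e <= lyap al pst h e G.
Proof.
move=> al0 h0 p1; have h1 : 0 <= al * h by rewrite mulr_ge0.
have h2 : 0 <= (2 * pst - 1) * h by rewrite mulr_ge0//; lra.
have h3 := mulr_ge0 h2 (hs2_ge0 G); have h4 := mulr_ge0 h1 (sqn_ge0 e).
by rewrite /lyap; lra.
Qed.

Lemma lyap_coef_ge0 (al pst h be : R) : 0 <= al -> 0 <= h -> 1 <= pst -> 0 <= be ->
  0 <= 1 + 2 * al * h + (2 * pst - 1) * h * be.
Proof. by move=> al0 h0 p1 be0; rewrite !addr_ge0// !mulr_ge0//; lra. Qed.

Lemma lyap_coef_le (al pst h be : R) : 0 <= al -> 0 <= h -> h <= 1 -> 1 <= pst -> 0 <= be ->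
  1 + 2 * al * h + (2 * pst - 1) * h * be <= 1 + 2 * al * 1 + (2 * pst - 1) * 1 * be.
Proof.
move=> al0 h0 h1 p1 be0; have p0 : 0 <= 2 * pst - 1 by lra.
by apply: lerD; [rewrite lerD2l ler_wpM2l// mulr_ge0|rewrite ler_wpM2r// ler_wpM2l].
Qed.

Lemma lyap_le (al pst h be : R) n (e : 'cV[R]_n) (G : 'M[R]_(n, m)) :
  0 <= h -> 1 <= pst -> hs2 G <= be * sqn e ->
  lyap al pst h e G <= (1 + 2 * al * h + (2 * pst - 1) * h * be) * sqn e.
Proof.
move=> h0 p1 H; rewrite /lyap [leRHS]mulrDl lerD2l -[leRHS]mulrA ler_wpM2l//.
by rewrite mulr_ge0//; lra.
Qed.

(** Tangent inequality in the direction of the [G] part. The second term has the form of the Hessian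
    term of [moment_step], with [2 pst - 1] in place of [2 q - 1], and will dominate it. *)
Lemma lyap_pow_ge (q al pst h : R) n (e : 'cV[R]_n) (G : 'M[R]_(n, m)) :
  1 <= q -> 0 <= al -> 0 <= h -> 1 <= pst ->
  (1 + 2 * al * h) * sqn e `^ q + q * (2 * pst - 1) * h * (sqn e `^ (q - 1) * hs2 G) <=
  lyap al pst h e G `^ q.
Proof.
move=> q1 al0 h0 p1; have h1 : 0 <= al * h by rewrite mulr_ge0.
have h2 : 0 <= (2 * pst - 1) * h by rewrite mulr_ge0//; lra.
have k0 := mulr_ge0 h2 (hs2_ge0 G).
have a0 : 1 <= 1 + 2 * al * h by lra.
have a0' : 0 <= 1 + 2 * al * h by lra.
have q0 : 0 <= q by lra.
have := @powRD_ge _ q ((1 + 2 * al * h) * sqn e) _ q1 (mulr_ge0 a0' (sqn_ge0 _)) k0.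
rewrite !powRM ?sqn_ge0//; apply: le_trans.
have e1 : 1 + 2 * al * h <= (1 + 2 * al * h) `^ q by exact: le1r_powR.
have e2 : 1 <= (1 + 2 * al * h) `^ (q - 1).
  by rewrite -[leLHS](powRr0 (1 + 2 * al * h)); apply: ler_powR => //; lra.
apply: lerD; first by rewrite ler_wpM2r// powR_ge0.
have -> : q * (2 * pst - 1) * h * (sqn e `^ (q - 1) * hs2 G) =
    q * (1 * sqn e `^ (q - 1)) * ((2 * pst - 1) * h * hs2 G) by ring.
by rewrite ler_wpM2r// ler_wpM2l// ler_wpM2r// powR_ge0.
Qed.

(** With [x = al h <= 1] and [eta = al / 4], [(1 + x) (1 + x / 2) <= 1 + 2 x]: part of the
    dissipation [2 al] becomes the contraction factor, the rest pays for the Young terms and for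
    [M]. The Hessian term fits under the [G] part by the assumption that compares [2 q - 1] with
    [2 pst - 1]. *)
Lemma recursion_arith (EV EV' A B M r1 al be h eta q pst eps : R) :
  0 < h -> 0 < al -> al * h <= 1 -> eta = al / 4 -> 0 <= A -> 0 <= B -> 1 <= q ->
  (1 + al * h) * ((2 * q - 1) * (1 + eps)) <= 2 * pst - 1 ->
  EV' <= (1 + eta * h) * A + q * (2 * q - 1) * (1 + eps) * (h * B) + M + r1 ->
  M <= eta * h * A -> 0 <= r1 ->
  (1 + 2 * al * h) * A + q * (2 * pst - 1) * h * B <= EV ->
  (1 + al * h) * EV' <= EV + 2 * r1.
Proof.
move=> h0 al0 alh etaE A0 B0 q1 ce H M_le r10 VE.
have ah0 : 0 < al * h by rewrite mulr_gt0.
have b1 : (1 + al * h) * ((1 + 2 * eta * h) * A) <= (1 + 2 * al * h) * A.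
  rewrite mulrA ler_wpM2r//.
  have -> : 2 * eta * h = al * h / 2 by rewrite etaE; field.
  by nra.
have b2 : (1 + al * h) * (q * (2 * q - 1) * (1 + eps) * (h * B)) <= q * (2 * pst - 1) * h * B.
  have -> : (1 + al * h) * (q * (2 * q - 1) * (1 + eps) * (h * B)) =
    ((1 + al * h) * ((2 * q - 1) * (1 + eps))) * (q * (h * B)) by ring.
  have -> : q * (2 * pst - 1) * h * B = (2 * pst - 1) * (q * (h * B)) by ring.
  by rewrite ler_wpM2r// !mulr_ge0// ?(ltW h0)//; lra.
have b3 : (1 + al * h) * r1 <= 2 * r1 by rewrite ler_wpM2r//; lra.
have b4 : EV' <= (1 + 2 * eta * h) * A + q * (2 * q - 1) * (1 + eps) * (h * B) + r1 by lra.
have h1 : 0 <= 1 + al * h by lra.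
have := ler_wpM2l h1 b4; rewrite !mulrDr; lra.
Qed.

Lemma small_power (q D eta : R) : 1 < q -> 0 <= D -> 0 < eta ->
  exists2 h0 : R, 0 < h0 & forall h, 0 < h <= h0 -> D * h `^ q <= eta * h.
Proof.
move=> q1 D0 eta0; have D1 : 0 < D + 1 by lra.
have e1 : 0 < eta / (D + 1) by rewrite divr_gt0.
exists ((eta / (D + 1)) `^ (q - 1)^-1); first exact: powR_gt0.
move=> h /andP[h0 hh].
have : h `^ (q - 1) <= eta / (D + 1).
  apply: (@le_trans _ _ (((eta / (D + 1)) `^ (q - 1)^-1) `^ (q - 1))).
    apply: ge0_ler_powR; rewrite ?nnegrE ?powR_ge0 ?(ltW h0)//; lra.
  by rewrite -powRrM mulVf ?powRr1 ?(ltW e1)//; lra.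
rewrite ler_pdivlMr// => H.
have -> : h `^ q = h * h `^ (q - 1) by rewrite mulr_powRB1 ?(ltW h0)//; lra.
have p0 := powR_ge0 h (q - 1).
rewrite mulrCA [eta * h]mulrC ler_pM2l//; nra.
Qed.

(** Of the noise defect [N] only its orthogonality to [|e|^(2 q - 2) e] under the weight is used, so
    it may depend on what happens inside the step. The weight [phi] is known at time [s] and is
    carried along unchanged. *)
Lemma recursion_step (q al pst be : R) : 1 <= q -> q < pst -> 0 < al -> 0 <= be ->
  exists h0 C : R, [/\ 0 < h0, h0 <= 1, 0 <= C &
  forall X0 : T -> 'cV[R]_d, random_vector X0 -> indep_of_process P X0 W ->
  forall (s t : R) (phi : T -> R) n (e e' N r : T -> 'cV[R]_n) (G G' : T -> 'M[R]_(n, m)),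
  0 <= s < t -> t - s <= h0 ->
  adreal (FF X0 s) phi -> (forall w, 0 <= phi w) ->
  advec (FF X0 s) e -> admat (FF X0 s) G -> random_vector e' -> measM G' ->
  random_vector N -> random_vector r ->
  (forall w, hs2 (G w) <= be * sqn (e w)) ->
  (forall w, lyap al pst (t - s) (e' w) (G' w) <= sqn (e w + (G w *m dw s t w + N w + r w))) ->
  L1 P (fun w => phi w * sqn (e w) `^ q) ->
  L1 P (fun w => phi w * sqn (N w) `^ q) -> L1 P (fun w => phi w * sqn (r w) `^ q) ->
  L1 P (fun w => phi w * sqn (e w) `^ (q - 1) * inner (e w) (N w)) ->
  EE P (fun w => phi w * sqn (e w) `^ (q - 1) * inner (e w) (N w)) = 0 ->
  L1 P (fun w => phi w * lyap al pst (t - s) (e' w) (G' w) `^ q) /\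
  (1 + al * (t - s)) * EE P (fun w => phi w * lyap al pst (t - s) (e' w) (G' w) `^ q) <=
    EE P (fun w => phi w * lyap al pst (t - s) (e w) (G w) `^ q) +
    C * ((t - s) `^ (1 - 2 * q) * EE P (fun w => phi w * sqn (r w) `^ q)
       + (t - s) `^ (1 - q) * EE P (fun w => phi w * sqn (N w) `^ q))].
Proof.
move=> q1 qp al0 be0.
pose rho := (2 * pst - 1) / (2 * q - 1).
have q2 : 0 < 2 * q - 1 by lra.
have rhoE : rho * (2 * q - 1) = 2 * pst - 1 by rewrite divfK// gt_eqF.
have rho1 : 1 < rho by rewrite ltr_pdivlMr//; lra.
(* [(1 + eps)^2 <= 1 + 3 eps <= rho]: one factor is for the Hessian term, the other for [1 + al h],
   as [h0 <= eps / al]. *)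
pose eps := Num.min 1 ((rho - 1) / 3).
have eps0 : 0 < eps by rewrite lt_min ltr01/=; lra.
have eps1 : eps <= 1 by rewrite ge_min lexx.
have eps2 : eps <= (rho - 1) / 3 by rewrite ge_min lexx orbT.
have ep0 : 0 <= 1 + eps by lra.
have epsP : (1 + eps) * (1 + eps) <= rho by nra.
have [C1 [C10 C1q C1P]] := @moment_step R q eps q1 eps0.
pose eta := al / 4.
have eta0 : 0 < eta by rewrite divr_gt0.
have [C2 C20 C2P] := C1P eta eta0.
have [C3 C30 C3P] := @EE_sqnq _ _ _ P d m W hP hW q q1.
(* The term [C1 |G dW|^(2 q)] is of order [h^q], which is below [eta h] for small [h] if [q > 1];
   for [q = 1] it is absent. *)
have [h1 h10 h1P] : exists2 h1 : R, 0 < h1 & forall h, 0 < h <= h1 -> C1 * C3 * be `^ q * h `^ q <= eta * h.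
  have [q1'|q1'] := eqVneq q 1.
    by exists 1 => // h /andP[h0 _]; rewrite C1q// !mul0r mulr_ge0// ltW.
  have ql : 1 < q by rewrite lt_def q1'.
  by apply: small_power => //; rewrite !mulr_ge0// powR_ge0.
pose h0 := Num.min 1 (Num.min h1 (eps / al)).
have h00 : 0 < h0 by rewrite !lt_min ltr01 h10 divr_gt0.
have h01 : h0 <= 1 by rewrite ge_min lexx.
have h0h1 : h0 <= h1 by rewrite !ge_min lexx orbT.
have h0e : h0 <= eps / al by rewrite !ge_min lexx !orbT.
exists h0, (2 * C2); split => //; first by rewrite mulr_ge0.
move=> X0 hX0 hind s t phi n e e' N r G G' st th0 aphi phi0 ae aG me' mG' mN mr GE rec Le LN Lr LeN EeN.
set h := t - s in th0 rec *.
have h_gt0 : 0 < h by case/andP: st => _; rewrite subr_gt0.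
have h_le1 : h <= 1 by exact: le_trans th0 h01.
have st' : 0 <= s <= t by case/andP: st => -> /ltW ->.
have alh : al * h <= eps.
  by rewrite mulrC -ler_pdivlMr//; exact: le_trans th0 h0e.
have alh0 : 0 < al * h by rewrite mulr_gt0.
have q0 : 0 < q by exact: lt_le_trans q1.
have pst_1 : 1 <= pst by exact: (le_trans q1 (ltW qp)).
have al_0 := ltW al0; have h_0 := ltW h_gt0.
have mphi := ad_meas hP hW hX0 aphi.
have me := adv_meas hP hW hX0 ae; have mG := adm_meas hP hW hX0 aG.
have mdw : random_vector (fun w => dw s t w) by exact: (incr_meas hP hW hX0).
have mM : random_vector (fun w => G w *m dw s t w) by exact: meas_mulmx.
pose psi w := phi w * sqn (e w) `^ (q - 1).
have psi0 w : 0 <= psi w by rewrite mulr_ge0 ?powR_ge0.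
have apsi : adreal (FF X0 s) psi.
  by apply: measurable_funM => //; apply: meas_powR; exact: meas_sqn.
have psie w : psi w * sqn (e w) = phi w * sqn (e w) `^ q.
  by rewrite /psi -mulrA [_ * sqn _]mulrC mulr_powRB1 ?sqn_ge0.
have Lpe : L1 P (fun w => psi w * sqn (e w)) by exact: (eq_L1 psie).
have LB : L1 P (fun w => psi w * hs2 (G w)).
  apply: (L1_le0 _ (L1Z be Lpe)).
    apply: measurable_funM; first exact: (ad_meas hP hW hX0 apsi).
    exact: meas_hs2.
  by move=> w; rewrite mulr_ge0 ?hs2_ge0//= mulrCA ler_wpM2l.
have [LI EI] := EE_inner0 hP hW hX0 hind st' apsi ae aG psi0 Lpe LB.
have [LM EM] := EE_sqn hP hW hX0 hind st' apsi aG psi0 LB.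
have LGq : L1 P (fun w => phi w * hs2 (G w) `^ q).
  apply: (L1_le0 _ (L1Z (be `^ q) Le)).
    by apply: measurable_funM => //; apply: meas_powR; exact: meas_hs2.
  move=> w; rewrite mulr_ge0 ?powR_ge0//= mulrCA ler_wpM2l//.
  rewrite -powRM ?sqn_ge0//; apply: ge0_ler_powR; rewrite ?nnegrE ?hs2_ge0 ?mulr_ge0 ?sqn_ge0//.
  exact: ltW.
have [LMq EMq] := C3P X0 hX0 hind s t n phi G st aphi aG phi0 LGq.
set hr := h `^ (1 - 2 * q); set hN := h `^ (1 - q).
have hr0 : 0 <= hr by exact: powR_ge0.
have hN0 : 0 <= hN by exact: powR_ge0.
pose U1 w := (1 + eta * h) * (phi w * sqn (e w) `^ q).
pose U2 w := 2 * q * (psi w * inner (e w) (G w *m dw s t w)).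
pose U3 w := 2 * q * (phi w * sqn (e w) `^ (q - 1) * inner (e w) (N w)).
pose U4 w := q * (2 * q - 1) * (1 + eps) * (psi w * sqn (G w *m dw s t w)).
pose U5 w := C1 * (phi w * sqn (G w *m dw s t w) `^ q).
pose U6 w := C2 * (hr * (phi w * sqn (r w) `^ q)).
pose U7 w := C2 * (hN * (phi w * sqn (N w) `^ q)).
have L1_1 : L1 P U1 by exact: L1Z.
have L1_2 : L1 P U2 by exact: L1Z.
have L1_3 : L1 P U3 by exact: L1Z.
have L1_4 : L1 P U4 by exact: L1Z.
have L1_5 : L1 P U5 by exact: L1Z.
have L1_6 : L1 P U6 by do 2 apply: L1Z.
have L1_7 : L1 P U7 by do 2 apply: L1Z.
pose U w := U1 w + (U2 w + (U3 w + (U4 w + (U5 w + (U6 w + U7 w))))).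
have LU : L1 P U by do 6 (apply: L1D => //).
have EU : EE P U = (1 + eta * h) * EE P (fun w => phi w * sqn (e w) `^ q)
   + (q * (2 * q - 1) * (1 + eps) * (h * EE P (fun w => psi w * hs2 (G w)))
   + (C1 * EE P (fun w => phi w * sqn (G w *m dw s t w) `^ q)
   + (C2 * (hr * EE P (fun w => phi w * sqn (r w) `^ q))
   + C2 * (hN * EE P (fun w => phi w * sqn (N w) `^ q))))).
  rewrite /U EED//; last by do 5 (apply: L1D => //).
  rewrite EED//; last by do 4 (apply: L1D => //).
  rewrite EED//; last by do 3 (apply: L1D => //).
  rewrite EED//; last by do 2 (apply: L1D => //).
  rewrite EED//; last by apply: L1D.
  rewrite EED//.
  rewrite /U1 /U2 /U3 /U4 /U5 /U6 /U7 !EEZ//; [|exact: L1Z|exact: L1Z].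
  by rewrite EI EeN EM !mulr0 !add0r.
have lyap0 w : 0 <= lyap al pst h (e' w) (G' w) by exact: lyap_ge0.
have VU w : 0 <= phi w * lyap al pst h (e' w) (G' w) `^ q <= U w.
  rewrite mulr_ge0 ?powR_ge0//=.
  have := C2P n (e w) (G w *m dw s t w) (N w) (r w) h; rewrite h_gt0 h_le1 => /(_ isT) H.
  have H2 : lyap al pst h (e' w) (G' w) `^ q <=
      sqn (e w + (G w *m dw s t w + N w + r w)) `^ q.
    by apply: ge0_ler_powR; rewrite ?nnegrE ?sqn_ge0 ?(ltW q0).
  have := ler_wpM2l (phi0 w) (le_trans H2 H).
  move=> /le_trans; apply; rewrite le_eqVlt; apply/orP; left; apply/eqP.
  rewrite /U /U1 /U2 /U3 /U4 /U5 /U6 /U7 /psi innerDr -/hr -/hN; ring.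
have mV : measurable_fun setT (fun w => phi w * lyap al pst h (e' w) (G' w) `^ q).
  apply: measurable_funM => //; apply: meas_powR; apply: measurable_funD.
    by apply: measurable_funM => //; exact: meas_sqn.
  by apply: measurable_funM => //; exact: meas_hs2.
have LV := L1_le0 mV LU VU.
split => //.
have EV' := EE_le LV LU (fun w => proj2 (andP (VU w))).
have Lly : L1 P (fun w => phi w * lyap al pst h (e w) (G w) `^ q).
  apply: (L1_le0 _ (L1Z ((1 + 2 * al * h + (2 * pst - 1) * h * be) `^ q) Le)).
    apply: measurable_funM => //; apply: meas_powR; apply: measurable_funD.
      by apply: measurable_funM => //; exact: meas_sqn.
    by apply: measurable_funM => //; exact: meas_hs2.
  move=> w; rewrite mulr_ge0 ?powR_ge0//= mulrCA ler_wpM2l//.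
  have k0 := lyap_coef_ge0 al_0 h_0 pst_1 be0.
  rewrite -powRM ?sqn_ge0//; apply: ge0_ler_powR; rewrite ?nnegrE ?(ltW q0) ?mulr_ge0 ?sqn_ge0//.
    exact: lyap_ge0.
  exact: lyap_le.
have EV : (1 + 2 * al * h) * EE P (fun w => phi w * sqn (e w) `^ q)
    + q * (2 * pst - 1) * h * EE P (fun w => psi w * hs2 (G w)) <=
    EE P (fun w => phi w * lyap al pst h (e w) (G w) `^ q).
  rewrite -!EEZ// -EED; [|exact: L1Z|exact: L1Z].
  apply: EE_le => //; first by apply: L1D; exact: L1Z.
  move=> w.
  have := ler_wpM2l (phi0 w) (@lyap_pow_ge q al pst h n (e w) (G w) q1 al_0 h_0 pst_1).
  by apply: le_trans; rewrite le_eqVlt; apply/orP; left; apply/eqP; rewrite /psi; ring.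
have EA0 : 0 <= EE P (fun w => phi w * sqn (e w) `^ q).
  by apply: EE_ge0 => w; rewrite mulr_ge0 ?powR_ge0.
have EB0 : 0 <= EE P (fun w => psi w * hs2 (G w)).
  by apply: EE_ge0 => w; rewrite mulr_ge0 ?hs2_ge0.
have ER0 : 0 <= EE P (fun w => phi w * sqn (r w) `^ q).
  by apply: EE_ge0 => w; rewrite mulr_ge0 ?powR_ge0.
have EN0 : 0 <= EE P (fun w => phi w * sqn (N w) `^ q).
  by apply: EE_ge0 => w; rewrite mulr_ge0 ?powR_ge0.
have MqE : C1 * EE P (fun w => phi w * sqn (G w *m dw s t w) `^ q) <=
    eta * h * EE P (fun w => phi w * sqn (e w) `^ q).
  have k1 : EE P (fun w => phi w * hs2 (G w) `^ q) <= be `^ q * EE P (fun w => phi w * sqn (e w) `^ q).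
    rewrite -EEZ//; apply: EE_le => //; first exact: L1Z.
    move=> w; rewrite mulrCA ler_wpM2l// -powRM ?sqn_ge0//.
    by apply: ge0_ler_powR; rewrite ?nnegrE ?hs2_ge0 ?mulr_ge0 ?sqn_ge0 ?(ltW q0).
  have k2 := h1P h; rewrite h_gt0 (le_trans th0 h0h1) in k2; have {}k2 := k2 isT.
  have k3 : 0 <= C3 * h `^ q by rewrite mulr_ge0 ?powR_ge0.
  have k4 := ler_wpM2l C10 (le_trans EMq (ler_wpM2l k3 k1)).
  apply: (le_trans k4).
  have -> : C1 * (C3 * h `^ q * (be `^ q * EE P (fun w => phi w * sqn (e w) `^ q))) =
    (C1 * C3 * be `^ q * h `^ q) * EE P (fun w => phi w * sqn (e w) `^ q) by ring.
  exact: (ler_wpM2r EA0 k2).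
rewrite EU in EV'.
rewrite -(mulrA 2 C2) (mulrDr C2).
have ah1 : 1 + al * h <= 1 + eps by rewrite lerD2l.
apply: (@recursion_arith _ _ (EE P (fun w => phi w * sqn (e w) `^ q)) (EE P (fun w => psi w * hs2 (G w)))
   (C1 * EE P (fun w => phi w * sqn (G w *m dw s t w) `^ q)) _ al be h eta q pst eps) => //.
- exact: le_trans alh eps1.
- rewrite -rhoE [rho * _]mulrC mulrCA ler_pM2l//; apply: (le_trans _ epsP).
  exact: (ler_wpM2r ep0 ah1).
- by rewrite !addrA in EV' *.
- exact: (addr_ge0 (mulr_ge0 C20 (mulr_ge0 hr0 ER0)) (mulr_ge0 C20 (mulr_ge0 hN0 EN0))).
Qed.


Lemma recursion_step_arith (x X a B c : R) : x <= a + B -> X <= c * B -> 0 <= c * a ->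
  x + X <= (1 + c) * (a + B).
Proof. by move=> h1 h2 h3; rewrite mulrDl mul1r mulrDr; lra. Qed.

Lemma recursion_bound_arith (a x S K c : R) : a <= K * x -> 0 <= K * S -> 0 <= c * x ->
  a + c * S <= (K + c) * (x + S).
Proof. by move=> h1 h2 h3; rewrite mulrDr !mulrDl; lra. Qed.

Lemma natS_step (k : nat) (h : R) : k.+1%:R * h - k%:R * h = h.
Proof. by rewrite -mulrBl -natrB// subSnn mul1r. Qed.

(** Each step contracts by [1 / (1 + al h)] and adds at most a multiple of [h S]. Such a recursion
    has an equilibrium proportional to [S / al], whatever [h] and the number of steps, hence a bound
    uniform in time. *)
Lemma recursion_bound (q al pst be : R) : 1 <= q -> q < pst -> 0 < al -> 0 <= be ->
  exists h0 C : R, [/\ 0 < h0, h0 <= 1, 0 <= C &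
  forall X0 : T -> 'cV[R]_d, random_vector X0 -> indep_of_process P X0 W ->
  forall h (phi : T -> R) n (e N r : nat -> T -> 'cV[R]_n) (G : nat -> T -> 'M[R]_(n, m)) (S : R),
  0 < h <= h0 -> adreal (FF X0 0) phi -> (forall w, 0 <= phi w) ->
  (forall k, advec (FF X0 (k%:R * h)) (e k)) -> (forall k, admat (FF X0 (k%:R * h)) (G k)) ->
  (forall k, random_vector (N k)) -> (forall k, random_vector (r k)) ->
  (forall k w, hs2 (G k w) <= be * sqn (e k w)) ->
  (forall k w, lyap al pst h (e k.+1 w) (G k.+1 w) <=
     sqn (e k w + (G k w *m dw (k%:R * h) (k.+1%:R * h) w + N k w + r k w))) ->
  0 <= S -> L1 P (fun w => phi w * sqn (e 0%N w) `^ q) ->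
  (forall k, L1 P (fun w => phi w * sqn (e k w) `^ q) ->
    [/\ L1 P (fun w => phi w * sqn (N k w) `^ q), L1 P (fun w => phi w * sqn (r k w) `^ q),
     L1 P (fun w => phi w * sqn (e k w) `^ (q - 1) * inner (e k w) (N k w)),
     EE P (fun w => phi w * sqn (e k w) `^ (q - 1) * inner (e k w) (N k w)) = 0 &
     h `^ (1 - 2 * q) * EE P (fun w => phi w * sqn (r k w) `^ q)
       + h `^ (1 - q) * EE P (fun w => phi w * sqn (N k w) `^ q) <= h * S]) ->
  forall k, L1 P (fun w => phi w * sqn (e k w) `^ q) /\
    EE P (fun w => phi w * sqn (e k w) `^ q) <=
      C * (EE P (fun w => phi w * sqn (e 0%N w) `^ q) + S)].
Proof.
move=> q1 qp al0 be0.
have [h0 [C [h00 h01 C0 CP]]] := recursion_step q1 qp al0 be0.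
have q0 : 0 < q by exact: lt_le_trans q1.
have pst_1 : 1 <= pst by exact: (le_trans q1 (ltW qp)).
have al_0 := ltW al0.
pose Kv := 1 + 2 * al * 1 + (2 * pst - 1) * 1 * be.
have Kv0 : 0 <= Kv by exact: lyap_coef_ge0.
exists h0, (Kv `^ q + C / al); split => //; first by rewrite addr_ge0 ?powR_ge0 ?divr_ge0.
move=> X0 hX0 hind h phi n e N r G S /andP[h_gt0 hh0] aphi phi0 ae aG mN mr GE rec S0 Le0 H.
have h_0 := ltW h_gt0; have h_1 := le_trans hh0 h01.
have kh k : 0 <= k%:R * h by rewrite mulr_ge0.
have aphik k : adreal (FF X0 (k%:R * h)) phi by exact: ad_mono aphi.
have mphi := ad_meas hP hW hX0 aphi.
have me k := adv_meas hP hW hX0 (ae k); have mG k := adm_meas hP hW hX0 (aG k).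
pose a k := EE P (fun w => phi w * lyap al pst h (e k w) (G k w) `^ q).
(* Fixed point of the map [x -> (x + C h S) / (1 + al h)]. *)
pose B := C * S / al.
have B0 : 0 <= B by rewrite divr_ge0// mulr_ge0.
have mly k : measurable_fun setT (fun w => phi w * lyap al pst h (e k w) (G k w) `^ q).
  apply: measurable_funM => //; apply: meas_powR; apply: measurable_funD.
    by apply: measurable_funM => //; exact: meas_sqn.
  by apply: measurable_funM => //; exact: meas_hs2.
have lyle k w : phi w * sqn (e k w) `^ q <= phi w * lyap al pst h (e k w) (G k w) `^ q.
  rewrite ler_wpM2l//; apply: ge0_ler_powR; rewrite ?nnegrE ?(ltW q0) ?sqn_ge0//.
    exact: lyap_ge0.
  exact: sqn_le_lyap.
have mse k : measurable_fun setT (fun w => phi w * sqn (e k w) `^ q).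
  by apply: measurable_funM => //; apply: meas_powR; exact: meas_sqn.
have Lse k : L1 P (fun w => phi w * lyap al pst h (e k w) (G k w) `^ q) ->
    L1 P (fun w => phi w * sqn (e k w) `^ q).
  move=> L; apply: (L1_le0 (mse k) L) => w; rewrite lyle andbT.
  by rewrite mulr_ge0 ?powR_ge0.
have lyle0 w : phi w * lyap al pst h (e 0%N w) (G 0%N w) `^ q <= Kv `^ q * (phi w * sqn (e 0%N w) `^ q).
  rewrite mulrCA ler_wpM2l// -powRM ?sqn_ge0//.
  apply: ge0_ler_powR; rewrite ?nnegrE ?(ltW q0) ?mulr_ge0 ?sqn_ge0//; first exact: lyap_ge0.
  apply: (le_trans (lyap_le al h_0 pst_1 (GE 0%N w))); rewrite ler_wpM2r ?sqn_ge0//.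
  exact: lyap_coef_le.
have L0 : L1 P (fun w => phi w * lyap al pst h (e 0%N w) (G 0%N w) `^ q).
  apply: (L1_le0 (mly 0%N) (L1Z (Kv `^ q) Le0)) => w.
  by rewrite lyle0 andbT mulr_ge0 ?powR_ge0.
have a0_le : a 0%N <= Kv `^ q * EE P (fun w => phi w * sqn (e 0%N w) `^ q).
  by rewrite -EEZ//; apply: EE_le => //; exact: L1Z.
have inv k : L1 P (fun w => phi w * lyap al pst h (e k w) (G k w) `^ q) /\ a k <= a 0%N + B.
  elim: k => [|k [Lk ak]]; first by rewrite lerDl.
  have [LN Lr LI EI SB] := H k (Lse k Lk).
  have st : 0 <= k%:R * h < k.+1%:R * h by rewrite kh /= ltr_pM2r// ltr_nat ltnS.
  have := CP X0 hX0 hind _ _ phi n (e k) (e k.+1) (N k) (r k) (G k) (G k.+1) st.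
  rewrite natS_step => /(_ hh0 (aphik k) phi0 (ae k) (aG k) (me _) (mG _) (mN k) (mr k) (GE k) (rec k) (Lse k Lk) LN Lr LI EI).
  move=> [Lk1 ak1]; split; first exact: Lk1.
rewrite -/(a k) -/(a k.+1) in ak1.
  have alh : 0 < 1 + al * h by rewrite addr_gt0// mulr_gt0.
  rewrite -(ler_pM2l alh); apply: (le_trans ak1).
  have b1 := ler_wpM2l C0 SB.
  have b2 : al * h * B = C * (h * S) by rewrite /B; field; rewrite gt_eqF.
  have b3 : 0 <= al * h * a 0%N.
    rewrite mulr_ge0 ?mulr_ge0//; apply: EE_ge0 => w.
    by rewrite mulr_ge0 ?powR_ge0.
  rewrite -b2 in b1; exact: (recursion_step_arith ak b1 b3).
move=> k; have [Lk ak] := inv k; split; first exact: Lse.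
apply: (@le_trans _ _ (a k)); first by apply: EE_le => //; exact: Lse.
apply: (le_trans ak).
have E0 : 0 <= EE P (fun w => phi w * sqn (e 0%N w) `^ q).
  by apply: EE_ge0 => w; rewrite mulr_ge0 ?powR_ge0.
have Ca : 0 <= C / al by rewrite divr_ge0.
have k1 : 0 <= Kv `^ q * S by rewrite mulr_ge0 ?powR_ge0.
have k2 : 0 <= C / al * EE P (fun w => phi w * sqn (e 0%N w) `^ q) by rewrite mulr_ge0.
have BE : B = C / al * S by rewrite /B mulrAC.
rewrite BE; exact: recursion_bound_arith.
Qed.

Lemma L1_young (q : R) (phi a b : T -> R) : 1 <= q -> (forall w, 0 <= phi w) ->
  measurable_fun setT phi -> measurable_fun setT a -> measurable_fun setT b ->
  (forall w, 0 <= a w) -> (forall w, 0 <= b w) ->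
  L1 P (fun w => phi w * a w `^ q) -> L1 P (fun w => phi w * b w `^ q) ->
  L1 P (fun w => phi w * a w `^ (q - 1) * b w).
Proof.
move=> q1 phi0 mphi ma mb a0 b0 La Lb; apply: (L1_le0 _ (L1D La Lb)).
  by apply: measurable_funM => //; apply: measurable_funM => //; exact: meas_powR.
move=> w; rewrite !mulr_ge0 ?powR_ge0//= -mulrA -mulrDr ler_wpM2l//.
by have := @young_powR _ q 1 (a w) (b w) q1 ltr01 (a0 w) (b0 w); rewrite powR1 !mul1r.
Qed.

Lemma inner0r n (x : 'cV[R]_n) : inner x 0 = 0.
Proof. by rewrite -(scale0r 0) innerZr mul0r. Qed.

(* A discrete Burkholder-Davis-Gundy inequality. *)
Lemma martingale_transform_moment (q : R) : 1 <= q -> exists2 C : R, 0 <= C &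
  forall X0 : T -> 'cV[R]_d, random_vector X0 -> indep_of_process P X0 W ->
  forall (n : nat) (t0 del : R) (phi : T -> R) k (G : nat -> T -> 'M[R]_(k, m)) (B : R),
  (0 < n)%N -> 0 <= t0 -> 0 < del -> adreal (FF X0 t0) phi -> (forall w, 0 <= phi w) ->
  (forall j, admat (FF X0 (t0 + j%:R * del)) (G j)) ->
  (forall j, (j < n)%N -> L1 P (fun w => phi w * hs2 (G j w) `^ q) /\
     EE P (fun w => phi w * hs2 (G j w) `^ q) <= B) ->
  forall j, (j <= n)%N ->
   L1 P (fun w => phi w *
      sqn (\sum_(0 <= i < j) G i w *m dw (t0 + i%:R * del) (t0 + i.+1%:R * del) w) `^ q) /\
   EE P (fun w => phi w *
      sqn (\sum_(0 <= i < j) G i w *m dw (t0 + i%:R * del) (t0 + i.+1%:R * del) w) `^ q)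
     <= C * (n%:R * del) `^ q * B.
Proof.
move=> q1; have q0 : 0 < q by exact: lt_le_trans q1.
have [C1 [_ _ /(_ 1 ltr01)[C2 C20 C2P]]] := @moment_step R q 1 q1 ltr01.
have [C3 C30 C3P] := @EE_sqnq _ _ _ P d m W hP hW q q1.
exists (C2 * C3 * expR 1); first by rewrite !mulr_ge0// expR_ge0.
move=> X0 hX0 hind n t0 del phi k G B n0 t00 del0 aphi phi0 aG LG.
pose tt j := t0 + j%:R * del; rewrite -/(tt _) in aG *.
pose M j w := \sum_(0 <= i < j) G i w *m dw (tt i) (tt i.+1) w.
have nR : 0 < n%:R :> R by rewrite ltr0n.
have th0 : 0 < (n%:R : R)^-1 by rewrite invr_gt0.
have th1 : (n%:R : R)^-1 <= 1 by rewrite invf_le1// ler1n.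
have th := introT andP (conj th0 th1).
have tt0 j : 0 <= tt j by rewrite addr_ge0// mulr_ge0// ltW.
have ttS j : tt j < tt j.+1 by rewrite ltrD2l ltr_pM2r// ltr_nat.
have tt_mono i j : (i <= j)%N -> tt i <= tt j by move=> ij; rewrite lerD2l ler_pM2r// ler_nat.
have ttd j : tt j.+1 - tt j = del by rewrite /tt opprD addrACA subrr add0r natS_step.
have st j : 0 <= tt j < tt j.+1 by rewrite tt0 ttS.
have st' j : 0 <= tt j <= tt j.+1 by rewrite tt0 ltW.
have aphij j : adreal (FF X0 (tt j)) phi by apply: ad_mono aphi; rewrite lerDl mulr_ge0// ltW.
have mphi := ad_meas hP hW hX0 aphi.
have aM j : advec (FF X0 (tt j)) (M j).
  elim: j => [|j IH].
    by move=> i; rewrite (_ : (fun w => _) = fun=> 0)//; apply/funext => w; rewrite /M big_nil mxE.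
  rewrite (_ : M j.+1 = fun w => M j w + G j w *m dw (tt j) (tt j.+1) w); last first.
    by apply/funext => w; rewrite /M big_nat_recr.
  apply: meas_vadd; first exact: adv_mono (ltW (ttS j)) IH.
  apply: meas_mulmx; first exact: adm_mono (ltW (ttS j)) (aG j).
  exact: adv_incr.
have mM j := adv_meas hP hW hX0 (aM j).
pose D := C2 * C3 * (n%:R * del) `^ q * B.
have B0 : 0 <= B.
  apply: (le_trans _ (proj2 (LG 0%N n0))); apply: EE_ge0 => w.
  by rewrite mulr_ge0 ?powR_ge0.
have D0 : 0 <= D by rewrite !mulr_ge0 ?powR_ge0.
(* The factor comes from [moment_step] with the artificial step [1 / n]: each of the [n] steps
   multiplies by [1 + 1 / n], and [(1 + 1 / n)^n] is at most [e]. *)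
suff H j : (j <= n)%N -> L1 P (fun w => phi w * sqn (M j w) `^ q) /\
    EE P (fun w => phi w * sqn (M j w) `^ q) <= ((1 + n%:R^-1) ^+ j - 1) * D.
  move=> j jn; have [L E] := H j jn; split => //; apply: (le_trans E).
  rewrite -[leRHS](_ : expR 1 * D = _); last by rewrite /D; ring.
  rewrite ler_wpM2r// lerBlDr (@le_trans _ _ (expR 1))//; last by rewrite lerDl.
  apply: (@le_trans _ _ ((1 + n%:R^-1) ^+ n)).
    by apply: ler_weXn2l => //; rewrite lerDl invr_ge0 ltW.
  have -> : expR (1 : R) = expR ((n%:R : R)^-1) ^+ n by rewrite -expRM_natl mulfV// gt_eqF.
  apply: lerXn2r; rewrite ?nnegrE ?expR_ge0 ?addr_ge0 ?invr_ge0 ?(ltW nR)//.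
  exact: expR_ge1Dx.
elim: j => [_|j IH jn].
  have E w : phi w * sqn (M 0%N w) `^ q = 0.
    by rewrite /M big_nil sqn0 powR0 ?mulr0// gt_eqF.
  split; first by apply: (eq_L1 E); exact: L1_cst.
  by rewrite (eq_EE P E) EE_cst expr0 subrr mul0r.
have [Lj Ej] := IH (ltnW jn).
have [LGj EGj] := LG j jn.
have [LN EN] := C3P X0 hX0 hind _ _ k phi (G j) (st j) (aphij j) (aG j) phi0 LGj.
rewrite ttd in EN.
pose psi w := phi w * sqn (M j w) `^ (q - 1).
have psi0 w : 0 <= psi w by rewrite mulr_ge0 ?powR_ge0.
have apsi : adreal (FF X0 (tt j)) psi.
  by apply: measurable_funM; [exact: aphij|apply: meas_powR; apply: meas_sqn; exact: aM].
have Lpe : L1 P (fun w => psi w * sqn (M j w)).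
  apply: (eq_L1 _ Lj) => w.
  by rewrite /psi -mulrA [_ * sqn _]mulrC mulr_powRB1 ?sqn_ge0.
have LB : L1 P (fun w => psi w * hs2 (G j w)).
  apply: (L1_young q1 phi0 mphi _ _ _ _ Lj LGj); last 2 first.
  - by move=> w; exact: sqn_ge0.
  - by move=> w; exact: hs2_ge0.
  - exact: meas_sqn.
  - by apply: meas_hs2; exact: (adm_meas hP hW hX0 (aG j)).
have [LI EI] := EE_inner0 hP hW hX0 hind (st' j) apsi (aM j) (aG j) psi0 Lpe LB.
pose U w := (1 + n%:R^-1) * (phi w * sqn (M j w) `^ q) +
  (2 * q * (psi w * inner (M j w) (G j w *m dw (tt j) (tt j.+1) w)) +
   C2 * (n%:R^-1 `^ (1 - q) * (phi w * sqn (G j w *m dw (tt j) (tt j.+1) w) `^ q))).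
have LU : L1 P U by apply: L1D; [exact: L1Z|apply: L1D; [exact: L1Z|do 2 apply: L1Z]].
have EU : EE P U = (1 + n%:R^-1) * EE P (fun w => phi w * sqn (M j w) `^ q) +
   C2 * (n%:R^-1 `^ (1 - q) * EE P (fun w => phi w * sqn (G j w *m dw (tt j) (tt j.+1) w) `^ q)).
  rewrite /U EED; [|exact: L1Z|apply: L1D; [exact: L1Z|do 2 apply: L1Z]] => //.
  rewrite EED; [|exact: L1Z|do 2 apply: L1Z] => //.
  rewrite !EEZ//; last exact: L1Z.
  by rewrite EI mulr0 add0r.
have MU w : 0 <= phi w * sqn (M j.+1 w) `^ q <= U w.
  rewrite mulr_ge0 ?powR_ge0//=.
  (* The whole increment plays the role of [N]: the sharp Hessian constant is irrelevant here, and
     the cross term has mean zero. *)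
  have := C2P k (M j w) 0 (G j w *m dw (tt j) (tt j.+1) w) 0 (n%:R^-1) th.
  rewrite !add0r addr0 mul1r sqn0 powR0 ?gt_eqF// !mulr0 !addr0 add0r => H.
  have -> : M j.+1 w = M j w + G j w *m dw (tt j) (tt j.+1) w by rewrite /M big_nat_recr.
  apply: (le_trans (ler_wpM2l (phi0 w) H)).
  by rewrite le_eqVlt; apply/orP; left; apply/eqP; rewrite /U /psi; ring.
have mM1 : measurable_fun setT (fun w => phi w * sqn (M j.+1 w) `^ q).
  by apply: measurable_funM => //; apply: meas_powR; exact: meas_sqn.
have L1M := L1_le0 mM1 LU MU.
split => //; apply: (@le_trans _ _ (EE P U)).
  by apply: EE_le => // w; case/andP: (MU w).
rewrite EU.
have nq : n%:R^-1 `^ (1 - q) * del `^ q = n%:R^-1 * (n%:R * del) `^ q.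
  rewrite powRM ?(ltW del0) ?(ltW nR)// mulrA; congr (_ * _).
  rewrite -powR_inv1 ?(ltW nR)// -powRrM -[RHS]powRD ?(gt_eqF nR) ?implybT//.
  by congr (_ `^ _); ring.
have b1 : C2 * (n%:R^-1 `^ (1 - q) * EE P (fun w => phi w * sqn (G j w *m dw (tt j) (tt j.+1) w) `^ q)) <= n%:R^-1 * D.
  apply: (@le_trans _ _ (C2 * (n%:R^-1 `^ (1 - q) * (C3 * del `^ q * B)))).
    rewrite ler_wpM2l// ler_wpM2l ?powR_ge0//; apply: (le_trans EN).
    by rewrite ler_wpM2l// mulr_ge0 ?powR_ge0.
  have -> : C2 * (n%:R^-1 `^ (1 - q) * (C3 * del `^ q * B)) =
    C2 * C3 * (n%:R^-1 `^ (1 - q) * del `^ q) * B by ring.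
  by rewrite nq /D le_eqVlt; apply/orP; left; apply/eqP; ring.
have n1 : 0 <= 1 + n%:R^-1 :> R by rewrite addr_ge0// invr_ge0 ltW.
have b2 := ler_wpM2l n1 Ej.
have -> : ((1 + n%:R^-1) ^+ j.+1 - 1) * D =
  (1 + n%:R^-1) * (((1 + n%:R^-1) ^+ j - 1) * D) + n%:R^-1 * D by rewrite exprS; ring.
exact: lerD.
Qed.

End moment_recursion.

(** * Interpolation between powers *)

Section scalar_powers.
Context {R : realType}.
Implicit Types s t q r : R.

Lemma powR_le1D r q s : 0 <= r -> r <= q -> 0 <= s -> s `^ r <= 1 + s `^ q.
Proof.
move=> r0 rq s0; have [s1|s1] := leP s 1.
  apply: (@le_trans _ _ 1); last by rewrite lerDl powR_ge0.
  by have := @ge0_ler_powR R r r0 s 1; rewrite powR1 !nnegrE; apply.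
apply: (@le_trans _ _ (s `^ q)); last by rewrite lerDr.
by apply: ler_powR => //; exact: ltW.
Qed.

Lemma le_1DpowR q s : 1 <= q -> 0 <= s -> s <= 1 + s `^ q.
Proof. by move=> q1 s0; have := @powR_le1D 1 q s ler01 q1 s0; rewrite powRr1. Qed.

(** Below the threshold [t] the first term dominates, above it the second. This trades the exponent
    [q] for a smaller [r] at a free scale [t], which will be proportional to the step size. *)
Lemma powR_weight r q s t : 0 < r -> r <= q -> 0 < t -> 0 <= s ->
  s `^ r <= t `^ r + s `^ q * t `^ (r - q).
Proof.
move=> r0 rq t0 s0; have [st|st] := leP s t.
  apply: (@le_trans _ _ (t `^ r)); last by rewrite lerDl mulr_ge0 ?powR_ge0.
  by apply: ge0_ler_powR; rewrite ?nnegrE ?(ltW r0) ?(ltW t0).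
have s1 : 0 < s by exact: lt_trans st.
apply: (@le_trans _ _ (s `^ q * t `^ (r - q))); last by rewrite lerDr powR_ge0.
have -> : s `^ r = s `^ q * s `^ (r - q).
  by rewrite -powRD ?(gt_eqF s1) ?implybT//; congr (_ `^ _); ring.
rewrite ler_wpM2l ?powR_ge0//.
have -> : r - q = - (q - r) by ring.
rewrite !powRN lef_pV2 ?posrE ?powR_gt0//.
by apply: ge0_ler_powR; rewrite ?nnegrE ?subr_ge0 ?(ltW s1) ?(ltW t0) ?(ltW st).
Qed.

(* Young's inequality for the exponents [(2 k - 1) / (k - 1)] and [(2 k - 1) / k],
   in a form that includes [k = 1]. *)
Lemma powR_mul_le (k p a b : R) : 1 <= k -> 0 < p -> 0 < a -> 0 <= b ->
  a `^ ((k - 1) * p) * b `^ p <= a `^ ((2 * k - 1) * p) + b `^ ((2 * k - 1) * p / k).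
Proof.
move=> k1 p0 a0 b0; have k0 : 0 < k by lra.
have ap x : 0 < a `^ x by exact: powR_gt0.
have [ba|ba] := leP b (a `^ k).
  apply: (@le_trans _ _ (a `^ ((2 * k - 1) * p))); last by rewrite lerDl powR_ge0.
  have -> : (2 * k - 1) * p = (k - 1) * p + k * p by ring.
  rewrite [leRHS]powRD ?(gt_eqF a0) ?implybT// ler_wpM2l ?powR_ge0// powRrM.
  by apply: ge0_ler_powR; rewrite ?nnegrE ?powR_ge0 ?(ltW p0).
have bp : 0 < b by exact: lt_trans ba.
apply: (@le_trans _ _ (b `^ ((2 * k - 1) * p / k))); last by rewrite lerDr powR_ge0.
have -> : (2 * k - 1) * p / k = (k - 1) * p / k + p by field; rewrite gt_eqF.
rewrite [leRHS]powRD ?(gt_eqF bp) ?implybT// ler_wpM2r ?powR_ge0//.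
have -> : a `^ ((k - 1) * p) = (a `^ k) `^ ((k - 1) * p / k).
  by rewrite -powRrM; congr (_ `^ _); field; rewrite gt_eqF.
apply: ge0_ler_powR; rewrite ?nnegrE ?powR_ge0 ?(ltW bp) ?(ltW ba)//.
by rewrite divr_ge0 ?(ltW k0)// mulr_ge0 ?(ltW p0)//; lra.
Qed.

End scalar_powers.

(** * Growth and continuity of the coefficients *)

Section drift.
Context {R : realType} {d m : nat}.
Variables (f : 'cV[R]_d -> 'cV[R]_d) (g : 'cV[R]_d -> 'M[R]_(d, m)).
Variables (pst al ka c1 be : R).
Hypothesis pst1 : 1 <= pst.
Hypothesis al0 : 0 < al.
Hypothesis ka1 : 1 <= ka.
Hypothesis c10 : 0 <= c1.
Hypothesis be0 : 0 <= be.
Hypothesis hmon : forall x y,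
  inner (x - y) (f x - f y) + (2 * pst - 1) / 2 * hs2 (g x - g y) <= - al * sqn (x - y).
Hypothesis hf : forall x y,
  sqn (f x - f y) <= c1 * (1 + sqn x `^ (ka - 1) + sqn y `^ (ka - 1)) * sqn (x - y).
Hypothesis hg : forall x y, hs2 (g x - g y) <= be * sqn (x - y).

Lemma drift_mono x y : inner (x - y) (f x - f y) <= 0.
Proof.
have p0 : 0 <= 2 * pst - 1 by rewrite subr_ge0 mulr_ege1// ler1n.
have h1 : 0 <= (2 * pst - 1) / 2 * hs2 (g x - g y) by rewrite mulr_ge0 ?hs2_ge0// divr_ge0.
have h2 : 0 <= al * sqn (x - y) by rewrite mulr_ge0 ?sqn_ge0// ltW.
by have := hmon x y; rewrite mulNr; lra.
Qed.

Lemma drift_lip (M : R) : exists2 L : R, 0 <= L &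
  forall x y, sqn x <= M -> sqn y <= M -> sqn (f x - f y) <= L * sqn (x - y).
Proof.
have ka0 : 0 <= ka - 1 by rewrite subr_ge0.
exists (c1 * (1 + `|M| `^ (ka - 1) + `|M| `^ (ka - 1))).
  by rewrite mulr_ge0// !addr_ge0 ?powR_ge0.
have H x : sqn x <= M -> sqn x `^ (ka - 1) <= `|M| `^ (ka - 1).
  move=> xM; apply: ge0_ler_powR; rewrite ?nnegrE ?sqn_ge0//.
  exact: le_trans xM (ler_norm _).
move=> x y xM yM; apply: (le_trans (hf x y)); rewrite ler_wpM2r ?sqn_ge0// ler_wpM2l//.
by rewrite lerD ?lerD2l ?H.
Qed.

Lemma drift_growth : exists2 C : R, 0 <= C & forall x, sqn (f x) <= C * (1 + sqn x `^ ka).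
Proof.
have ka0 : 0 <= ka - 1 by rewrite subr_ge0.
exists (6 * c1 + 2 * sqn (f 0)); first by rewrite addr_ge0 ?mulr_ge0 ?sqn_ge0.
move=> x; have E : f x = (f x - f 0) + f 0 by rewrite subrK.
rewrite [in leLHS]E; apply: (le_trans (sqnD_le _ _)).
have := hf x 0; rewrite subr0 sqn0.
have s0 := sqn_ge0 x; have f0 := sqn_ge0 (f 0).
have h1 : sqn x `^ (ka - 1) * sqn x = sqn x `^ ka.
  by rewrite mulrC mulr_powRB1//; lra.
have h2 := le_1DpowR ka1 s0.
(* [0^0] is 1, so the power is 1 for [ka = 1] and 0 otherwise. *)
have h3 : (0 : R) `^ (ka - 1) <= 1.
  have [->|k] := eqVneq (ka - 1) 0; first by rewrite powRr0.
  by rewrite powR0.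
have h4 : (0 : R) `^ (ka - 1) * sqn x <= sqn x by rewrite -[leRHS]mul1r ler_wpM2r.
have h5 := powR_ge0 (sqn x) ka.
move: (0 `^ (ka - 1)) (sqn x `^ (ka - 1)) (sqn x `^ ka) h1 h2 h3 h4 h5 => u v z h1 h2 h3 h4 h5 H.
have h6 : sqn (f x - f 0) <= c1 * (3 * (1 + z)).
  apply: (le_trans H); rewrite -mulrA ler_wpM2l// !mulrDl h1; lra.
have h7 : 0 <= sqn (f 0) * z by rewrite mulr_ge0.
by move: (sqn (f 0)) (sqn (f x - f 0)) h6 h7 f0 => a b; lra.
Qed.

Lemma diffusion_growth : exists2 C : R, 0 <= C & forall x, hs2 (g x) <= C * (1 + sqn x).
Proof.
exists (2 * be + 2 * hs2 (g 0)); first by rewrite addr_ge0 ?mulr_ge0 ?hs2_ge0.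
move=> x; have E : g x = (g x - g 0) + g 0 by rewrite subrK.
rewrite [in leLHS]E; apply: (le_trans (hs2D_le _ _)).
have := hg x 0; rewrite subr0.
have s0 := sqn_ge0 x; have f0 := hs2_ge0 (g 0).
have h7 : 0 <= hs2 (g 0) * sqn x by rewrite mulr_ge0.
have h8 : 0 <= be * sqn x by rewrite mulr_ge0.
have b0 := be0.
by move: (hs2 (g 0)) (hs2 (g x - g 0)) h7 f0 => a b; lra.
Qed.

Lemma econt_drift i : econt (fun x => f x i 0).
Proof.
move=> x e e0; have [L L0 LP] := drift_lip (2 * sqn x + 2).
have L1 : 0 < L + 1 by lra.
exists (Num.min 1 (e ^+ 2 / (L + 1))); first by rewrite lt_min ltr01 divr_gt0// exprn_gt0.
move=> y; rewrite lt_min => /andP[y1 y2].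
have yM : sqn y <= 2 * sqn x + 2.
  have -> : y = (y - x) + x by rewrite subrK.
  by apply: (le_trans (sqnD_le _ _)); lra.
have xM : sqn x <= 2 * sqn x + 2 by have := sqn_ge0 x; lra.
rewrite -(@ltr_pXn2r _ 2) ?nnegrE ?normr_ge0 ?(ltW e0)// real_normK ?num_real//.
have := sqn_entry (f y - f x) i; rewrite !mxE => /le_lt_trans; apply.
apply: (le_lt_trans (LP _ _ yM xM)).
rewrite ltr_pdivlMr// in y2; have := sqn_ge0 (y - x).
by move: (sqn (y - x)) y2 => z; nra.
Qed.

Lemma econt_diffusion i j : econt (fun x => g x i j).
Proof.
move=> x e e0; have L1 : 0 < be + 1 by rewrite ltr_wpDl.
exists (e ^+ 2 / (be + 1)); first by rewrite divr_gt0// exprn_gt0.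
move=> y y2.
rewrite -(@ltr_pXn2r _ 2) ?nnegrE ?normr_ge0 ?(ltW e0)// real_normK ?num_real//.
have := hs2_entry (g y - g x) i j; rewrite !mxE => /le_lt_trans; apply.
apply: (le_lt_trans (hg _ _)).
rewrite ltr_pdivlMr// in y2; have := sqn_ge0 (y - x).
by move: (sqn (y - x)) y2 => z; nra.
Qed.

(** The square is expanded and the nonnegative term [h^2 |f x - f y|^2] dropped: an implicit step
    asks for a one-sided bound on [f] only. *)
Lemma lyap_step (h : R) x y : 0 <= h ->
  lyap al pst h (x - y) (g x - g y) <= sqn ((x - y) - h *: (f x - f y)).
Proof.
move=> h0; rewrite sqnB innerZr sqnZ /lyap.
have h1 := ler_wpM2l h0 (hmon x y).
have h2 : 0 <= h ^+ 2 * sqn (f x - f y) by rewrite mulr_ge0 ?sqr_ge0 ?sqn_ge0.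
move: (sqn (x - y)) (inner _ _) (hs2 _) (h ^+ 2 * _) h1 h2 => a b c z.
rewrite mulrDr; have -> : h * ((2 * pst - 1) / 2 * c) = ((2 * pst - 1) * h * c) / 2 by field.
by move: ((2 * pst - 1) * h * c) => y'; lra.
Qed.

End drift.

(** * Comparison of backward Euler schemes *)

Section scheme.
Context {R : realType} {disp : measure_display} {T : measurableType disp}.
Variable P : probability T R.
Context {d m : nat} {W : R -> T -> 'cV[R]_m}.
Variables (f : 'cV[R]_d -> 'cV[R]_d) (g : 'cV[R]_d -> 'M[R]_(d, m)).
Variables (pst al ka c1 be : R).
Hypothesis hP : measure_is_complete P.
Hypothesis hW : is_wiener P W.
Hypothesis pst1 : 1 <= pst.
Hypothesis al0 : 0 < al.
Hypothesis ka1 : 1 <= ka.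
Hypothesis c10 : 0 <= c1.
Hypothesis be0 : 0 <= be.
Hypothesis hmon : forall x y,
  inner (x - y) (f x - f y) + (2 * pst - 1) / 2 * hs2 (g x - g y) <= - al * sqn (x - y).
Hypothesis hf : forall x y,
  sqn (f x - f y) <= c1 * (1 + sqn x `^ (ka - 1) + sqn y `^ (ka - 1)) * sqn (x - y).
Hypothesis hg : forall x y, hs2 (g x - g y) <= be * sqn (x - y).
Notation FF X0 t := (filt_gen P (X0 := X0) (W := W) t).
Notation dw s t w := (incr (W := W) s t w).

Lemma scheme_step X0 h Z k w : is_backward_euler f g W X0 h Z ->
  Z k.+1 w - h *: f (Z k.+1 w) = Z k w + g (Z k w) *m dw (k%:R * h) (k.+1%:R * h) w.
Proof. by move=> [_ H]; rewrite [X in X - _ = _]H /incr addrAC addrK. Qed.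

Let dmono := drift_mono pst1 al0 hmon.
Let dlip := drift_lip ka1 c10 hf.

(** A scheme is given only by its equation; uniqueness identifies each new value with
    [implicit_solve], a continuous function of the data. *)
Lemma scheme_adapted X0 h Z : random_vector X0 -> indep_of_process P X0 W -> 0 < h ->
  is_backward_euler f g W X0 h Z -> forall k, advec (FF X0 (k%:R * h)) (Z k).
Proof.
move=> hX0 hind h0 HZ; have h_0 := ltW h0.
have kh k : 0 <= k%:R * h by rewrite mulr_ge0.
have khS k : k%:R * h <= k.+1%:R * h by rewrite ler_pM2r// ler_nat.
elim=> [|k IH].
  have -> : Z 0%N = X0 by apply/funext => w; case: HZ.
  exact: adv_X0.
have -> : Z k.+1 = fun w => implicit_solve f h (Z k w + g (Z k w) *m dw (k%:R * h) (k.+1%:R * h) w).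
  apply/funext => w; apply: (implicit_unique dmono h0).
  by rewrite (implicit_solveP dmono dlip)// (scheme_step _ _ HZ).
apply: advec_econt; last by move=> i; exact: (implicit_solve_econt dmono dlip).
apply: meas_vadd; first exact: adv_mono IH.
apply: meas_mulmx; last by apply: adv_incr; rewrite kh khS.
by apply: adm_mono (admat_econt IH _) => // i j; exact: (econt_diffusion be0 hg).
Qed.

Lemma diffusion_adapted (X0 : T -> 'cV[R]_d) t (Y : T -> 'cV[R]_d) : advec (FF X0 t) Y ->
  admat (FF X0 t) (fun w => g (Y w)).
Proof. by move=> aY; apply: (admat_econt aY) => i j; exact: (econt_diffusion be0 hg). Qed.

Lemma drift_adapted (X0 : T -> 'cV[R]_d) t (Y : T -> 'cV[R]_d) : advec (FF X0 t) Y ->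
  advec (FF X0 t) (fun w => f (Y w)).
Proof. by move=> aY; apply: (advec_econt aY) => i; exact: (econt_drift ka1 c10 hf). Qed.

Lemma powR_cancel (h a : R) : 0 < h -> h `^ (1 - a) * h `^ a = h.
Proof.
move=> h0; rewrite -powRD ?(gt_eqF h0) ?implybT//.
by rewrite subrK powRr1// ltW.
Qed.

Lemma powR_sqr (h a : R) : 0 <= h -> (h ^+ 2) `^ a = h `^ (2 * a).
Proof. by move=> h0; rewrite powRrM -powR_mulrn. Qed.

(** The comparison is with 0: [G] is [g Z - g 0], while [g 0 dW] and [h f 0] play the roles of [N]
    and [r]. Their [2 q]-th moments are of order [h^q] and [h^(2 q)], so both weighted defects are
    of order [h]. *)
Lemma scheme_moment q : 1 <= q -> q < pst -> exists h0 C : R, [/\ 0 < h0, h0 <= 1, 0 <= C &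
  forall X0 : T -> 'cV[R]_d, random_vector X0 -> indep_of_process P X0 W ->
  forall h Z (phi : T -> R), 0 < h <= h0 -> is_backward_euler f g W X0 h Z ->
  adreal (FF X0 0) phi -> (forall w, 0 <= phi w) -> L1 P phi ->
  L1 P (fun w => phi w * sqn (X0 w) `^ q) -> forall k,
  L1 P (fun w => phi w * sqn (Z k w) `^ q) /\
  EE P (fun w => phi w * sqn (Z k w) `^ q) <=
    C * (EE P phi + EE P (fun w => phi w * sqn (X0 w) `^ q))].
Proof.
move=> q1 qp.
have [h0 [C [h00 h01 C0 CP]]] := @recursion_bound R disp T P d m W hP hW q al pst be q1 qp al0 be0.
have [C3 C30 C3P] := @EE_sqnq _ _ _ P d m W hP hW q q1.
pose Cs := C3 * hs2 (g 0) `^ q + sqn (f 0) `^ q.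
have Cs0 : 0 <= Cs by rewrite addr_ge0 ?mulr_ge0 ?powR_ge0.
exists h0, (C * (1 + Cs)); split => //; first by rewrite mulr_ge0// addr_ge0.
move=> X0 hX0 hind h Z phi hh HZ aphi phi0 Lphi LX0.
have /andP[h_gt0 hh0] := hh; have h_0 := ltW h_gt0.
have kh k : 0 <= k%:R * h by rewrite mulr_ge0.
have st k : 0 <= k%:R * h < k.+1%:R * h by rewrite kh /= ltr_pM2r// ltr_nat ltnS.
have st' k : 0 <= k%:R * h <= k.+1%:R * h by rewrite kh /= ler_pM2r// ler_nat.
have aphik k : adreal (FF X0 (k%:R * h)) phi by exact: ad_mono aphi.
have mphi := ad_meas hP hW hX0 aphi.
have aZ := scheme_adapted hX0 hind h_gt0 HZ.
have mZ k := adv_meas hP hW hX0 (aZ k).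
have Ephi0 : 0 <= EE P phi by exact: EE_ge0.
have EX0 : 0 <= EE P (fun w => phi w * sqn (X0 w) `^ q).
  by apply: EE_ge0 => w; rewrite mulr_ge0 ?powR_ge0.
have LZr (c : R) : L1 P (fun w => phi w * c).
  by apply: (eq_L1 (fun w => mulrC (phi w) c)); exact: L1Z.
have EZr (c : R) : EE P (fun w => phi w * c) = c * EE P phi.
  by rewrite (eq_EE P (fun w => mulrC (phi w) c)) EEZ.
have ag0 k : admat (FF X0 (k%:R * h)) (fun=> g 0) by exact: meas_Mcst.
have Z0E : Z 0%N = X0 by apply/funext => w; case: HZ.
have H := @CP X0 hX0 hind h phi d Z (fun k w => g 0 *m dw (k%:R * h) (k.+1%:R * h) w)
  (fun k w => h *: f 0) (fun k w => g (Z k w) - g 0) (Cs * EE P phi) hh aphi phi0 aZ.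
move=> k.
have [|||||||k' Lk'|] := H _ _ _ _ _ _ _ _ k.
- by move=> k'; apply: meas_Msub => //; exact: diffusion_adapted.
- by move=> k'; apply: meas_mulmx; [exact: meas_Mcst|exact: (incr_meas hP hW hX0)].
- by move=> k' i; exact: measurable_cst.
- by move=> k' w; have := hg (Z k' w) 0; rewrite subr0.
- move=> k' w.
  have := lyap_step hmon (Z k'.+1 w) 0 h_0; rewrite subr0 => /le_trans; apply.
  rewrite scalerBr opprB addrCA (scheme_step _ _ HZ) le_eqVlt; apply/orP; left; apply/eqP.
  congr sqn; rewrite mulmxBl; move: (g (Z k' w) *m _) (g 0 *m _) => a b.
  by vec.
- by rewrite mulr_ge0.
- by rewrite Z0E.
- have [LN EN] := C3P X0 hX0 hind _ _ d phi (fun=> g 0) (st k') (aphik k') (ag0 k') phi0 (LZr _).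
  have [||||||LI EI] := @EE_inner0 _ _ _ P d m X0 W hP hW hX0 hind (k'%:R * h) (k'.+1%:R * h) d
    (fun w => phi w * sqn (Z k' w) `^ (q - 1)) (Z k') (fun=> g 0) (st' k').
  + apply: measurable_funM; first exact: aphik.
    by apply: meas_powR; apply: meas_sqn; exact: aZ.
  + exact: aZ.
  + exact: ag0.
  + by move=> w; rewrite mulr_ge0 ?powR_ge0.
  + apply: (eq_L1 _ Lk') => w; rewrite -mulrA [_ * sqn _]mulrC mulr_powRB1 ?sqn_ge0//.
    exact: lt_le_trans ltr01 q1.
  + apply: (L1_young q1 phi0 mphi _ _ _ _ Lk' (LZr (hs2 (g 0) `^ q))).
    * exact: meas_sqn.
    * exact: measurable_cst.
    * by move=> w; exact: sqn_ge0.
    * by move=> w; exact: hs2_ge0.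
  split => //.
  rewrite natS_step EZr in EN.
  rewrite EZr sqnZ powRM ?sqr_ge0 ?sqn_ge0// powR_sqr//.
  have -> : h `^ (1 - 2 * q) * (h `^ (2 * q) * sqn (f 0) `^ q * EE P phi) =
    h * (sqn (f 0) `^ q * EE P phi) by rewrite !mulrA powR_cancel.
  have e1 := ler_wpM2l (powR_ge0 h (1 - q)) EN.
  rewrite /Cs mulrDl mulrDr addrC lerD//; apply: (le_trans e1).
  have -> : h `^ (1 - q) * (C3 * h `^ q * (hs2 (g 0) `^ q * EE P phi)) =
    (h `^ (1 - q) * h `^ q) * (C3 * hs2 (g 0) `^ q * EE P phi) by ring.
  by rewrite powR_cancel.
move=> Lk Ek; split => //; apply: (le_trans Ek); rewrite Z0E -mulrA ler_wpM2l//.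
by rewrite [EE P phi + _]addrC; apply: recursion_bound_arith; rewrite ?mul1r ?mulr_ge0.
Qed.

Lemma EE_drift_sum (s : R) (phi : T -> R) (F : nat -> T -> 'cV[R]_d) (del A : R) n j :
  1 <= s -> (forall w, 0 <= phi w) -> measurable_fun setT phi ->
  (forall i, random_vector (F i)) -> 0 <= del -> (0 < n)%N -> (j <= n)%N -> 0 <= A ->
  (forall i, (i < j)%N -> L1 P (fun w => phi w * sqn (F i w) `^ s) /\
     EE P (fun w => phi w * sqn (F i w) `^ s) <= A) ->
  L1 P (fun w => phi w * sqn (del *: \sum_(0 <= i < j) F i w) `^ s) /\
  EE P (fun w => phi w * sqn (del *: \sum_(0 <= i < j) F i w) `^ s) <= (n%:R * del) `^ (2 * s) * A.
Proof.
move=> s1 phi0 mphi mF del0 n0 jn A0 H.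
have s0 : 0 <= s by exact: (le_trans ler01).
have nR : 0 < n%:R :> R by rewrite ltr0n.
pose c := (del ^+ 2 * n%:R) `^ s * n%:R `^ (s - 1).
have c0 : 0 <= c by rewrite mulr_ge0 ?powR_ge0.
pose V w := c * \sum_(i < j) phi w * sqn (F i w) `^ s.
have LV : L1 P V by apply: L1Z; apply: L1_sum => i; case: (H i (ltn_ord i)).
have UV w : 0 <= phi w * sqn (del *: \sum_(0 <= i < j) F i w) `^ s <= V w.
  rewrite mulr_ge0 ?powR_ge0//= /V -mulr_sumr mulrCA ler_wpM2l//.
  have jn' : j%:R <= n%:R :> R by rewrite ler_nat.
  have e1 : sqn (del *: \sum_(0 <= i < j) F i w) <= del ^+ 2 * n%:R * \sum_(i < j) sqn (F i w).
    rewrite sqnZ -mulrA ler_wpM2l ?sqr_ge0//.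
    have := sqn_sum (index_iota 0 j) (fun i => F i w); rewrite size_iota subn0 => /le_trans; apply.
    rewrite big_mkord ler_wpM2r// sumr_ge0// => i _; exact: sqn_ge0.
  have S0 : 0 <= \sum_(i < j) sqn (F i w) by apply: sumr_ge0 => i _; exact: sqn_ge0.
  apply: (@le_trans _ _ ((del ^+ 2 * n%:R * \sum_(i < j) sqn (F i w)) `^ s)).
    by apply: ge0_ler_powR; rewrite ?nnegrE ?sqn_ge0 ?mulr_ge0 ?sqr_ge0.
  rewrite powRM ?mulr_ge0 ?sqr_ge0// /c -[leRHS]mulrA ler_wpM2l ?powR_ge0//.
  have := @powR_sum_le _ _ (index_iota 0 j) (fun i => sqn (F i w)) s s1 (fun i => sqn_ge0 _).
  rewrite size_iota subn0 !big_mkord => /le_trans; apply.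
  rewrite ler_wpM2r//; first by apply: sumr_ge0 => i _; exact: powR_ge0.
  by apply: ge0_ler_powR; rewrite ?nnegrE ?subr_ge0.
have mm : measurable_fun setT (fun w => phi w * sqn (del *: \sum_(0 <= i < j) F i w) `^ s).
  apply: measurable_funM => //; apply: meas_powR; apply: meas_sqn; apply: meas_vscale.
  exact: meas_vsum.
have L := L1_le0 mm LV UV; split => //.
apply: (@le_trans _ _ (EE P V)); first by apply: EE_le => // w; case/andP: (UV w).
rewrite /V EEZ; last by apply: L1_sum => i; case: (H i (ltn_ord i)).
rewrite EE_sum; last by move=> i; case: (H i (ltn_ord i)).
have e2 : \sum_(i < j) EE P (fun w => phi w * sqn (F i w) `^ s) <= n%:R * A.
  apply: (@le_trans _ _ (\sum_(i < j) A)); first by apply: ler_sum => i _; case: (H i (ltn_ord i)).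
  by rewrite sumr_const card_ord -[A *+ j]mulr_natl ler_wpM2r// ler_nat.
apply: (le_trans (ler_wpM2l c0 e2)); rewrite mulrA ler_wpM2r//.
rewrite /c -mulrA [_ `^ (s - 1) * _]mulrC mulr_powRB1 ?(ltW nR)//; last exact: lt_le_trans s1.
rewrite -powRM ?mulr_ge0 ?sqr_ge0 ?(ltW nR)// -powR_sqr; last by rewrite mulr_ge0 ?(ltW nR).
by rewrite le_eqVlt; apply/orP; left; apply/eqP; congr (_ `^ _); ring.
Qed.

Lemma scheme_sum X0 h Y i0 j w : is_backward_euler f g W X0 h Y ->
  Y (i0 + j)%N w = Y i0 w + (h *: \sum_(0 <= i < j) f (Y (i0 + i).+1 w) +
    \sum_(0 <= i < j) g (Y (i0 + i)%N w) *m
       dw (i0%:R * h + i%:R * h) (i0%:R * h + i.+1%:R * h) w).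
Proof.
move=> [_ H]; elim: j => [|j IH].
  by rewrite addn0 !big_nil scaler0 !addr0.
have e0 : (i0 + j)%:R * h = i0%:R * h + j%:R * h by rewrite natrD mulrDl.
have e1 : (i0 + j).+1%:R * h = i0%:R * h + j.+1%:R * h by rewrite -addnS natrD mulrDl.
rewrite addnS (H (i0 + j)%N w) [in X in X + _ + _]IH !big_nat_recr//= scalerDr /incr e0 e1.
move: (g (Y (i0 + j)%N w) *m _) (h *: f (Y (i0 + j).+1 w)) (h *: _) (\sum_(0 <= _ < _) _) => a b c e.
by vec.
Qed.

Lemma growth_powR (s a C y : R) : 0 <= s -> 0 <= C -> 0 <= y -> 0 <= a -> a <= C * (1 + y) ->
  a `^ s <= C `^ s * 2 `^ s * (1 + y `^ s).
Proof.
move=> s0 C0 y0 a0 H; have y1 : 0 <= 1 + y by rewrite addr_ge0.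
apply: (@le_trans _ _ ((C * (1 + y)) `^ s)).
  by apply: ge0_ler_powR; rewrite ?nnegrE ?mulr_ge0.
rewrite powRM// -mulrA ler_wpM2l ?powR_ge0//.
by have := powRD_le s0 (@ler01 R) y0; rewrite powR1.
Qed.

Lemma EE_affine (phi U V : T -> R) (K : R) : 0 <= K -> measurable_fun setT U ->
  (forall w, 0 <= phi w) -> (forall w, 0 <= U w <= K * (1 + V w)) ->
  L1 P phi -> L1 P (fun w => phi w * V w) ->
  L1 P (fun w => phi w * U w) /\
  EE P (fun w => phi w * U w) <= K * (EE P phi + EE P (fun w => phi w * V w)).
Proof.
move=> K0 mU phi0 UV Lphi LV.
have LW : L1 P (fun w => K * (phi w + phi w * V w)) by apply: L1Z; exact: L1D.
have H w : 0 <= phi w * U w <= K * (phi w + phi w * V w).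
  case/andP: (UV w) => U0 U1; rewrite mulr_ge0//=.
  by apply: (le_trans (ler_wpM2l (phi0 w) U1)); rewrite mulrCA mulrDr mulr1.
have mm : measurable_fun setT (fun w => phi w * U w).
  by apply: measurable_funM => //; exact: (L1_meas Lphi).
have L := L1_le0 mm LW H; split => //.
rewrite -EED// -EEZ; last exact: L1D.
by apply: EE_le => // w; case/andP: (H w).
Qed.

Lemma sqnD_powR (s : R) (a b : 'cV[R]_d) : 0 <= s ->
  sqn (a + b) `^ s <= 2 `^ s * 2 `^ s * (sqn a `^ s + sqn b `^ s).
Proof.
move=> s0; have e : 2 * sqn a + 2 * sqn b = 2 * (sqn a + sqn b) by rewrite mulrDr.
have ab0 : 0 <= sqn a + sqn b by rewrite addr_ge0 ?sqn_ge0.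
apply: (@le_trans _ _ ((2 * (sqn a + sqn b)) `^ s)).
  apply: ge0_ler_powR; rewrite ?nnegrE ?sqn_ge0 ?mulr_ge0//.
  by rewrite -e; exact: sqnD_le.
rewrite powRM// -mulrA ler_wpM2l ?powR_ge0//.
by apply: powRD_le; rewrite ?sqn_ge0.
Qed.

(** Right-hand side common to the bounds below. The weight stays free until [scheme_rate], where a
    negative power of [1 + |X0|^2] lowers the order of the moment of [X0]. *)
Definition wmom (X0 : T -> 'cV[R]_d) (phi : T -> R) (q : R) : R :=
  EE P phi + EE P (fun w => phi w * sqn (X0 w) `^ q).

Lemma wmom_ge (X0 : T -> 'cV[R]_d) (phi : T -> R) (q : R) : (forall w, 0 <= phi w) ->
  0 <= EE P phi <= wmom X0 phi q.
Proof.
move=> phi0; rewrite EE_ge0//= /wmom lerDl; apply: EE_ge0 => w.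
by rewrite mulr_ge0 ?powR_ge0.
Qed.

Lemma add1_le2 (a b : R) : 0 <= b -> a <= 1 + b -> 1 + a <= 2 * (1 + b).
Proof. by move=> b0 ab; lra. Qed.

(** Since [|f x|^2] grows like [|x|^(2 ka)], its [s]-th power costs a moment [|x|^(2 q)] with
    [q = ka s]; the linear growth of [g] costs no more. *)
Lemma scheme_coef_moment q s : 1 <= q -> q < pst -> 1 <= s -> ka * s = q ->
  exists h0 C : R, [/\ 0 < h0, h0 <= 1, 0 <= C &
  forall X0 : T -> 'cV[R]_d, random_vector X0 -> indep_of_process P X0 W ->
  forall h Z (phi : T -> R), 0 < h <= h0 -> is_backward_euler f g W X0 h Z ->
  adreal (FF X0 0) phi -> (forall w, 0 <= phi w) -> L1 P phi ->
  L1 P (fun w => phi w * sqn (X0 w) `^ q) -> forall k,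
  [/\ L1 P (fun w => phi w * sqn (f (Z k w)) `^ s),
      EE P (fun w => phi w * sqn (f (Z k w)) `^ s) <= C * wmom X0 phi q,
      L1 P (fun w => phi w * hs2 (g (Z k w)) `^ s) &
      EE P (fun w => phi w * hs2 (g (Z k w)) `^ s) <= C * wmom X0 phi q]].
Proof.
move=> q1 qp s1 sE; have s0 : 0 <= s by exact: (le_trans ler01).
have sq : s <= q by rewrite -sE ler_peMl.
have [h0 [C [h00 h01 C0 CP]]] := scheme_moment q1 qp.
have [Cf Cf0 CfP] := drift_growth ka1 c10 hf.
have [Cg Cg0 CgP] := diffusion_growth be0 hg.
pose K1 := Cf `^ s * 2 `^ s; pose K2 := Cg `^ s * 2 `^ s * 2.
have K10 : 0 <= K1 by rewrite !mulr_ge0 ?powR_ge0.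
have K20 : 0 <= K2 by rewrite !mulr_ge0 ?powR_ge0.
have C10' : 0 <= 1 + C by rewrite addr_ge0.
exists h0, ((K1 + K2) * (1 + C)); split => //; first by rewrite mulr_ge0 ?addr_ge0.
move=> X0 hX0 hind h Z phi hh HZ aphi phi0 Lphi LX0 k.
have [LZ EZ] := CP X0 hX0 hind h Z phi hh HZ aphi phi0 Lphi LX0 k.
have h_gt0 : 0 < h by case/andP: hh.
have aZ := scheme_adapted hX0 hind h_gt0 HZ.
have mf : random_vector (fun w => f (Z k w)) := adv_meas hP hW hX0 (drift_adapted (aZ k)).
have mg : measM (fun w => g (Z k w)) := adm_meas hP hW hX0 (diffusion_adapted (aZ k)).
have /andP[B0 B1] := wmom_ge X0 q phi0; have B2 := le_trans B0 B1.
have sum_le : EE P phi + EE P (fun w => phi w * sqn (Z k w) `^ q) <= (1 + C) * wmom X0 phi q.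
  by rewrite mulrDl mul1r lerD.
have mfs : measurable_fun setT (fun w => sqn (f (Z k w)) `^ s).
  by apply: meas_powR; exact: meas_sqn.
have mgs : measurable_fun setT (fun w => hs2 (g (Z k w)) `^ s).
  by apply: meas_powR; exact: meas_hs2.
have fU w : 0 <= sqn (f (Z k w)) `^ s <= K1 * (1 + sqn (Z k w) `^ q).
  rewrite powR_ge0/= -sE powRrM; apply: growth_powR => //; first exact: powR_ge0.
  exact: sqn_ge0.
have gU w : 0 <= hs2 (g (Z k w)) `^ s <= K2 * (1 + sqn (Z k w) `^ q).
  rewrite powR_ge0/=.
  apply: (le_trans (growth_powR s0 Cg0 (sqn_ge0 _) (hs2_ge0 _) (CgP (Z k w)))).
  rewrite /K2 -[leRHS]mulrA ler_wpM2l ?mulr_ge0 ?powR_ge0//.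
  exact: add1_le2 (powR_ge0 _ _) (powR_le1D s0 sq (sqn_ge0 (Z k w))).
have [L1f E1f] := EE_affine K10 mfs phi0 fU Lphi LZ.
have [L1g E1g] := EE_affine K20 mgs phi0 gU Lphi LZ.
have KB0 : 0 <= (1 + C) * wmom X0 phi q by rewrite mulr_ge0.
split; [exact: L1f| |exact: L1g|]; rewrite -mulrA.
- apply: (le_trans E1f); apply: (le_trans (ler_wpM2l K10 sum_le)).
  by rewrite ler_wpM2r// lerDl.
- apply: (le_trans E1g); apply: (le_trans (ler_wpM2l K20 sum_le)).
  by rewrite ler_wpM2r// lerDr.
Qed.

Lemma scheme_increment q s : 1 <= q -> q < pst -> 1 <= s -> ka * s = q ->
  exists h0 C : R, [/\ 0 < h0, h0 <= 1, 0 <= C &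
  forall X0 : T -> 'cV[R]_d, random_vector X0 -> indep_of_process P X0 W ->
  forall h Y (phi : T -> R), 0 < h <= h0 -> is_backward_euler f g W X0 h Y ->
  adreal (FF X0 0) phi -> (forall w, 0 <= phi w) -> L1 P phi ->
  L1 P (fun w => phi w * sqn (X0 w) `^ q) -> forall n i0 j,
  (0 < n)%N -> (j <= n)%N -> n%:R * h <= 1 ->
  L1 P (fun w => phi w * sqn (Y (i0 + j)%N w - Y i0 w) `^ s) /\
  EE P (fun w => phi w * sqn (Y (i0 + j)%N w - Y i0 w) `^ s) <=
    C * (n%:R * h) `^ s * wmom X0 phi q].
Proof.
move=> q1 qp s1 sE; have s0 : 0 <= s by exact: (le_trans ler01).
have [h0 [C [h00 h01 C0 CP]]] := scheme_coef_moment q1 qp s1 sE.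
have [C3 C30 C3P] := @martingale_transform_moment R disp T P d m W hP hW s s1.
have K0 : 0 <= 2 `^ s * 2 `^ s :> R by rewrite mulr_ge0 ?powR_ge0.
exists h0, (2 `^ s * 2 `^ s * (C + C3 * C)); split => //.
  by rewrite mulr_ge0 ?addr_ge0 ?mulr_ge0.
move=> X0 hX0 hind h Y phi hh HY aphi phi0 Lphi LX0 n i0 j n0 jn nh.
have h_gt0 : 0 < h by case/andP: hh.
have h_0 := ltW h_gt0.
have H k := CP X0 hX0 hind h Y phi hh HY aphi phi0 Lphi LX0 k.
have aY := scheme_adapted hX0 hind h_gt0 HY.
have mY k := adv_meas hP hW hX0 (aY k).
have mphi := ad_meas hP hW hX0 aphi.
have /andP[B0 B1] := wmom_ge X0 q phi0; have B2 := le_trans B0 B1.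
have CB0 : 0 <= C * wmom X0 phi q by rewrite mulr_ge0.
have t00 : 0 <= i0%:R * h by rewrite mulr_ge0.
have [||LD ED] := @EE_drift_sum s phi (fun i w => f (Y (i0 + i).+1 w)) h (C * wmom X0 phi q) n j
  s1 phi0 mphi _ h_0 n0 jn CB0.
- by move=> i; exact: (adv_meas hP hW hX0 (drift_adapted (aY _))).
- by move=> i _; case: (H (i0 + i).+1).
have [|||LM EM] := C3P X0 hX0 hind n (i0%:R * h) h phi d (fun i w => g (Y (i0 + i)%N w))
   (C * wmom X0 phi q) n0 t00 h_gt0 _ phi0 _ _ j jn.
- by apply: ad_mono aphi.
- by move=> i; rewrite -mulrDl -natrD; exact: diffusion_adapted.
- by move=> i _; case: (H (i0 + i)%N).
have LV := L1Z (2 `^ s * 2 `^ s) (L1D LD LM).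
have UV w : 0 <= phi w * sqn (Y (i0 + j)%N w - Y i0 w) `^ s <= 2 `^ s * 2 `^ s *
   (phi w * sqn (h *: \sum_(0 <= i < j) f (Y (i0 + i).+1 w)) `^ s +
    phi w * sqn (\sum_(0 <= i < j) g (Y (i0 + i)%N w) *m
       dw (i0%:R * h + i%:R * h) (i0%:R * h + i.+1%:R * h) w) `^ s).
  rewrite mulr_ge0 ?powR_ge0//= -mulrDr mulrCA ler_wpM2l// (scheme_sum _ _ _ HY).
  by rewrite addrAC subrr add0r; exact: sqnD_powR.
have mm : measurable_fun setT (fun w => phi w * sqn (Y (i0 + j)%N w - Y i0 w) `^ s).
  by apply: measurable_funM => //; apply: meas_powR; apply: meas_sqn; exact: meas_vsub.
have L := L1_le0 mm LV UV; split => //.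
apply: (le_trans (EE_le L LV (fun w => proj2 (andP (UV w))))).
rewrite EEZ; last exact: L1D.
rewrite (EED LD LM) -[leRHS]mulrA -[leRHS]mulrA.
apply: (ler_wpM2l K0).
have nh0 : 0 < n%:R * h by rewrite mulr_gt0 ?ltr0n.
(* As [n h <= 1], the drift part, of order [(n h)^(2 s)], is absorbed in the order [(n h)^s] of the
   martingale part. *)
have e1 : (n%:R * h) `^ (2 * s) <= (n%:R * h) `^ s.
  by apply: ger_powR; rewrite ?nh0// ler_peMl ?ler1n.
rewrite mulrDl lerD//.
  apply: (le_trans ED); rewrite [leRHS]mulrCA.
  by rewrite ler_wpM2r.
apply: (le_trans EM); rewrite le_eqVlt; apply/orP; left; apply/eqP; ring.
Qed.

Lemma inner_sumr n (x : 'cV[R]_n) (I : Type) (r : seq I) (F : I -> 'cV[R]_n) :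
  inner x (\sum_(i <- r) F i) = \sum_(i <- r) inner x (F i).
Proof. by apply: (big_morph (inner x) (fun y z => innerDr y z x) (inner0r x)). Qed.

(** The coarse noise takes its coefficient at the left end of the coarse step, the implicit drift at
    the right end. Measured against these, the fine scheme leaves a sum of martingale differences
    and a drift sum, the defects [N] and [r] of the recursion. *)
Lemma scheme_compare X0 (h del : R) n Y Z k w : is_backward_euler f g W X0 h Z ->
  is_backward_euler f g W X0 del Y -> n%:R * del = h ->
  (Y (k.+1 * n)%N w - Z k.+1 w) - h *: (f (Y (k.+1 * n)%N w) - f (Z k.+1 w)) =
  (Y (k * n)%N w - Z k w) +
  ((g (Y (k * n)%N w) - g (Z k w)) *m dw (k%:R * h) (k.+1%:R * h) w +
   \sum_(0 <= i < n) (g (Y (k * n + i)%N w) - g (Y (k * n)%N w)) *m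
       dw (k%:R * h + i%:R * del) (k%:R * h + i.+1%:R * del) w +
   del *: \sum_(0 <= i < n) (f (Y (k * n + i).+1 w) - f (Y (k.+1 * n)%N w))).
Proof.
move=> HZ HY nd; have E1 := scheme_step k w HZ.
have E2 := scheme_sum (k * n) n w HY.
have kn : (k * n)%:R * del = k%:R * h by rewrite natrM -mulrA nd.
have kn1 : (k.+1 * n = k * n + n)%N by rewrite mulSn addnC.
have E3 : \sum_(0 <= i < n) (g (Y (k * n + i)%N w) - g (Y (k * n)%N w)) *m
       dw (k%:R * h + i%:R * del) (k%:R * h + i.+1%:R * del) w =
   \sum_(0 <= i < n) g (Y (k * n + i)%N w) *m
       dw (k%:R * h + i%:R * del) (k%:R * h + i.+1%:R * del) w -
   g (Y (k * n)%N w) *m dw (k%:R * h) (k.+1%:R * h) w.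
  have -> : dw (k%:R * h) (k.+1%:R * h) w =
      \sum_(0 <= i < n) dw (k%:R * h + i%:R * del) (k%:R * h + i.+1%:R * del) w.
    rewrite /incr telescope_sumr// mul0r addr0 nd.
    by congr (W _ w - _); rewrite -natr1 mulrDl mul1r.
  rewrite mulmx_sumr -sumrB; apply: eq_bigr => i _; exact: mulmxBl.
have E4 : del *: \sum_(0 <= i < n) (f (Y (k * n + i).+1 w) - f (Y (k.+1 * n)%N w)) =
   del *: \sum_(0 <= i < n) f (Y (k * n + i).+1 w) - h *: f (Y (k.+1 * n)%N w).
  by rewrite sumrB scalerBr sumr_const_nat subn0 -scaler_nat scalerA mulrC nd.
rewrite E4 E3 mulmxBl; rewrite kn -kn1 in E2.
have {}E1 : Z k.+1 w = Z k w + g (Z k w) *m dw (k%:R * h) (k.+1%:R * h) w + h *: f (Z k.+1 w).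
  by rewrite -E1 subrK.
rewrite [in LHS]scalerBr [X in X - Z k.+1 w]E2 [X in _ - X - _]E1.
move: (h *: f (Y (k.+1 * n)%N w)) (h *: f (Z k.+1 w)) (g (Z k w) *m _) (g (Y (k * n)%N w) *m _).
move: (\sum_(0 <= i < n) _ *m _) (del *: _) => a b c e u v.
by vec.
Qed.

(** The squared increment is divided by [h], its typical size, before [powR_mul_le] is applied, so
    that both resulting terms are of order 1. The increment then carries the exponent [q / ka], the
    one that [scheme_increment] provides. *)
Lemma drift_diff_powR p q h x y : 1 <= p -> (2 * ka - 1) * p = q -> 0 < h ->
  sqn (f x - f y) `^ p <= (3 * c1) `^ p * h `^ p *
    (4 `^ q * (1 + sqn x `^ q + sqn y `^ q) + h `^ (- (q / ka)) * sqn (x - y) `^ (q / ka)).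
Proof.
move=> p1 qE h0; have p0 : 0 < p by exact: lt_le_trans p1.
have ka_1 := ka1; have q0 : 0 <= q by rewrite -qE mulr_ge0 ?(ltW p0)//; lra.
have kq : q / ka = (2 * ka - 1) * p / ka by rewrite qE.
set a := 1 + sqn x + sqn y.
have x0 := sqn_ge0 x; have y0 := sqn_ge0 y; have z0 := sqn_ge0 (x - y).
have a0 : 0 < a by rewrite /a; lra.
have ka0 : 0 <= ka - 1 by lra.
have h1 : 1 + sqn x `^ (ka - 1) + sqn y `^ (ka - 1) <= 3 * a `^ (ka - 1).
  have b1 : 1 <= a `^ (ka - 1).
    by rewrite -[leLHS](powRr0 a); apply: ler_powR => //; rewrite /a; lra.
  have b2 : sqn x `^ (ka - 1) <= a `^ (ka - 1).
    by apply: ge0_ler_powR; rewrite ?nnegrE ?(ltW a0)// /a; lra.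
  have b3 : sqn y `^ (ka - 1) <= a `^ (ka - 1).
    by apply: ge0_ler_powR; rewrite ?nnegrE ?(ltW a0)// /a; lra.
  by move: (a `^ _) (sqn x `^ _) (sqn y `^ _) b1 b2 b3 => u v w; lra.
have h2 : sqn (f x - f y) <= 3 * c1 * (a `^ (ka - 1) * sqn (x - y)).
  apply: (le_trans (hf x y)).
  have -> : 3 * c1 * (a `^ (ka - 1) * sqn (x - y)) = c1 * (3 * a `^ (ka - 1)) * sqn (x - y) by ring.
  by rewrite ler_wpM2r// ler_wpM2l.
have c30 : 0 <= 3 * c1 by rewrite mulr_ge0.
have as0 : 0 <= a `^ (ka - 1) * sqn (x - y) by rewrite mulr_ge0 ?powR_ge0.
apply: (@le_trans _ _ ((3 * c1 * (a `^ (ka - 1) * sqn (x - y))) `^ p)).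
  apply: ge0_ler_powR; rewrite ?nnegrE ?sqn_ge0 ?(ltW p0)//.
  exact: mulr_ge0.
rewrite powRM// -[leRHS]mulrA ler_wpM2l ?powR_ge0// powRM ?powR_ge0// -powRrM.
pose b := sqn (x - y) / h.
have b0 : 0 <= b by rewrite divr_ge0 ?(ltW h0).
have bE : sqn (x - y) = h * b by rewrite /b mulrC divfK// gt_eqF.
have -> : sqn (x - y) `^ p = h `^ p * b `^ p by rewrite bE powRM ?(ltW h0).
rewrite mulrCA ler_wpM2l ?powR_ge0//.
apply: (le_trans (powR_mul_le ka1 p0 a0 b0)); rewrite -kq qE lerD//.
  have e1 := powRD_le q0 x0 y0.
  have e2 := powRD_le q0 (@ler01 R) (addr_ge0 x0 y0).
  rewrite powR1 addrA -/a in e2; apply: (le_trans e2).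
  have -> : 4 `^ q = 2 `^ q * 2 `^ q :> R by rewrite -powRM//; congr (_ `^ _); ring.
  rewrite -mulrA ler_wpM2l ?powR_ge0//.
  have e3 : 1 <= 2 `^ q :> R by rewrite -[leLHS](powRr0 2); apply: ler_powR => //; rewrite ler1n.
  by rewrite -addrA mulrDr mulr1 lerD.
by rewrite /b powRM ?invr_ge0 ?(ltW h0)// mulrC -(powR_inv1 (ltW h0)) -powRrM mulN1r.
Qed.

(** Increments are controlled with an exponent [s >= p]; [powR_weight] at the threshold [h] passes
    to [p] and keeps the order [h^p]. *)
Lemma noise_moment p q s h del n i0 (X0 : T -> 'cV[R]_d) (Y : nat -> T -> 'cV[R]_d) (phi : T -> R) C :
  1 <= p -> p <= s -> 0 < h -> 0 <= C ->
  measurable_fun setT phi -> (forall w, 0 <= phi w) -> L1 P phi ->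
  (forall k, random_vector (Y k)) -> n%:R * del = h ->
  (forall j, (j <= n)%N -> L1 P (fun w => phi w * sqn (Y (i0 + j)%N w - Y i0 w) `^ s) /\
    EE P (fun w => phi w * sqn (Y (i0 + j)%N w - Y i0 w) `^ s) <= C * h `^ s * wmom X0 phi q) ->
  forall j, (j <= n)%N ->
  L1 P (fun w => phi w * hs2 (g (Y (i0 + j)%N w) - g (Y i0 w)) `^ p) /\
  EE P (fun w => phi w * hs2 (g (Y (i0 + j)%N w) - g (Y i0 w)) `^ p) <=
    be `^ p * (1 + C) * h `^ p * wmom X0 phi q.
Proof.
move=> p1 ps h0 C0 mphi phi0 Lphi mY nd H j jn; have [L E] := H j jn.
have p0 : 0 < p by exact: lt_le_trans p1.
have bp0 : 0 <= be `^ p by exact: powR_ge0.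
have /andP[B0 B1] := wmom_ge X0 q phi0.
pose V w := be `^ p * (h `^ p * phi w +
  h `^ (p - s) * (phi w * sqn (Y (i0 + j)%N w - Y i0 w) `^ s)).
have LV : L1 P V by apply: L1Z; apply: L1D; exact: L1Z.
have UV w : 0 <= phi w * hs2 (g (Y (i0 + j)%N w) - g (Y i0 w)) `^ p <= V w.
  rewrite mulr_ge0 ?powR_ge0//=.
  have e1 : hs2 (g (Y (i0 + j)%N w) - g (Y i0 w)) `^ p <=
      be `^ p * sqn (Y (i0 + j)%N w - Y i0 w) `^ p.
    rewrite -powRM ?sqn_ge0//; apply: ge0_ler_powR; rewrite ?nnegrE ?hs2_ge0 ?(ltW p0)//.
    by rewrite mulr_ge0 ?sqn_ge0.
  have e2 := powR_weight p0 ps h0 (sqn_ge0 (Y (i0 + j)%N w - Y i0 w)).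
  have e3 := le_trans e1 (ler_wpM2l bp0 e2).
  apply: (le_trans (ler_wpM2l (phi0 w) e3)).
  by rewrite le_eqVlt; apply/orP; left; apply/eqP; rewrite /V; ring.
have mg : measurable_fun setT (fun w => hs2 (g (Y (i0 + j)%N w) - g (Y i0 w)) `^ p).
  apply: meas_powR; apply: meas_hs2.
  have mgY k : measM (fun w => g (Y k w)).
    by move=> a b; exact: (measurable_econt (phi := fun x => g x a b) (mY k) (econt_diffusion be0 hg a b)).
  by apply: meas_Msub; exact: mgY.
have LU := L1_le0 (measurable_funM mphi mg) LV UV; split; first exact: LU.
apply: (le_trans (EE_le LU LV (fun w => proj2 (andP (UV w))))).
rewrite /V EEZ; last by apply: L1D; exact: L1Z.
rewrite (EED (L1Z _ Lphi) (L1Z _ L)) !EEZ// -!mulrA ler_wpM2l//.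
rewrite mulrA mulrDl mul1r [leRHS]mulrDl; apply: lerD.
  by rewrite ler_wpM2l ?powR_ge0.
apply: (le_trans (ler_wpM2l (powR_ge0 h (p - s)) E)).
rewrite !mulrA [h `^ (p - s) * C]mulrC -[C * _ * _]mulrA -powRD ?(gt_eqF h0) ?implybT//.
by rewrite subrK.
Qed.

Lemma drift_moment_arith (a b c B C K : R) : 0 <= K -> a <= B -> b <= C * B -> c <= C * B ->
  K * (a + b + c) <= K * (1 + C + C) * B.
Proof.
move=> K0 aB bB cB; rewrite -mulrA; apply: (ler_wpM2l K0).
by rewrite !mulrDl mul1r; lra.
Qed.

Lemma drift_moment p q s h n i0 (X0 : T -> 'cV[R]_d) (Y : nat -> T -> 'cV[R]_d) (phi : T -> R) C C' :
  1 <= p -> (2 * ka - 1) * p = q -> s = q / ka -> 0 < h -> 0 <= C -> 0 <= C' ->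
  measurable_fun setT phi -> (forall w, 0 <= phi w) -> L1 P phi ->
  (forall k, random_vector (Y k)) ->
  (forall k, L1 P (fun w => phi w * sqn (Y k w) `^ q) /\
     EE P (fun w => phi w * sqn (Y k w) `^ q) <= C' * wmom X0 phi q) ->
  (forall i, (i < n)%N -> L1 P (fun w => phi w * sqn (Y (i0 + n)%N w - Y (i0 + i).+1 w) `^ s) /\
    EE P (fun w => phi w * sqn (Y (i0 + n)%N w - Y (i0 + i).+1 w) `^ s) <= C * h `^ s * wmom X0 phi q) ->
  forall i, (i < n)%N ->
  L1 P (fun w => phi w * sqn (f (Y (i0 + i).+1 w) - f (Y (i0 + n)%N w)) `^ p) /\
  EE P (fun w => phi w * sqn (f (Y (i0 + i).+1 w) - f (Y (i0 + n)%N w)) `^ p) <=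
    (3 * c1) `^ p * h `^ p * ((4 `^ q * (1 + C' + C') + C) * wmom X0 phi q).
Proof.
move=> p1 qE sE h0 C0 C0' mphi phi0 Lphi mY HY H i ilt; have [L E] := H i ilt.
have [L1' E1] := HY (i0 + i).+1; have [L2 E2] := HY (i0 + n)%N.
have /andP[B0 B1] := wmom_ge X0 q phi0.
set K := (3 * c1) `^ p * h `^ p.
have K0 : 0 <= K by rewrite mulr_ge0 ?powR_ge0.
have q40 : 0 <= 4 `^ q :> R by exact: powR_ge0.
pose V w := K * (4 `^ q * (phi w + phi w * sqn (Y (i0 + i).+1 w) `^ q + phi w * sqn (Y (i0 + n)%N w) `^ q)
   + h `^ (- s) * (phi w * sqn (Y (i0 + n)%N w - Y (i0 + i).+1 w) `^ s)).
have LY : L1 P (fun w => phi w + phi w * sqn (Y (i0 + i).+1 w) `^ q + phi w * sqn (Y (i0 + n)%N w) `^ q).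
  by apply: L1D => //; exact: L1D.
have LV : L1 P V by apply: L1Z; apply: L1D; exact: L1Z.
have UV w : 0 <= phi w * sqn (f (Y (i0 + i).+1 w) - f (Y (i0 + n)%N w)) `^ p <= V w.
  rewrite mulr_ge0 ?powR_ge0//=.
  have e := drift_diff_powR (Y (i0 + i).+1 w) (Y (i0 + n)%N w) p1 qE h0.
  rewrite -sE -/K -(sqnN (Y (i0 + i).+1 w - _)) opprB in e.
  apply: (le_trans (ler_wpM2l (phi0 w) e)).
  by rewrite le_eqVlt; apply/orP; left; apply/eqP; rewrite /V; ring.
have mf : measurable_fun setT (fun w => sqn (f (Y (i0 + i).+1 w) - f (Y (i0 + n)%N w)) `^ p).
  apply: meas_powR; apply: meas_sqn.
  have mfY k : random_vector (fun w => f (Y k w)).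
    by move=> a; exact: (measurable_econt (phi := fun x => f x a 0) (mY k) (econt_drift ka1 c10 hf a)).
  by apply: meas_vsub; exact: mfY.
have LU := L1_le0 (measurable_funM mphi mf) LV UV; split; first exact: LU.
apply: (le_trans (EE_le LU LV (fun w => proj2 (andP (UV w))))).
rewrite /V EEZ; last by apply: L1D; exact: L1Z.
apply: (ler_wpM2l K0).
rewrite (EED (L1Z _ LY) (L1Z _ L)) (EEZ _ LY) (EEZ _ L) (EED (L1D Lphi L1') L2) (EED Lphi L1').
rewrite (mulrDl (4 `^ q * (1 + C' + C')) C); apply: lerD.
  exact: (drift_moment_arith q40 B1 E1 E2).
apply: (le_trans (ler_wpM2l (powR_ge0 h (- s)) E)).
rewrite !mulrA [h `^ (- s) * C]mulrC -[C * _ * _]mulrA -powRD ?(gt_eqF h0) ?implybT//.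
by rewrite addNr powRr0 mulr1.
Qed.

(** Supplies the orthogonality assumption of the recursion: [e] is known at [t0], hence before each
    increment of the sum. *)
Lemma EE_inner_transform p (X0 : T -> 'cV[R]_d) t0 del (phi : T -> R) (e : T -> 'cV[R]_d)
    (G : nat -> T -> 'M[R]_(d, m)) n : random_vector X0 -> indep_of_process P X0 W ->
  1 <= p -> 0 <= t0 -> 0 <= del -> adreal (FF X0 t0) phi -> (forall w, 0 <= phi w) ->
  advec (FF X0 t0) e -> (forall i, admat (FF X0 (t0 + i%:R * del)) (G i)) ->
  L1 P (fun w => phi w * sqn (e w) `^ p) ->
  (forall i, (i < n)%N -> L1 P (fun w => phi w * hs2 (G i w) `^ p)) ->
  L1 P (fun w => phi w * sqn (e w) `^ (p - 1) * inner (e w)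
     (\sum_(0 <= i < n) G i w *m dw (t0 + i%:R * del) (t0 + i.+1%:R * del) w)) /\
  EE P (fun w => phi w * sqn (e w) `^ (p - 1) * inner (e w)
     (\sum_(0 <= i < n) G i w *m dw (t0 + i%:R * del) (t0 + i.+1%:R * del) w)) = 0.
Proof.
move=> hX0 hind p1 t00 del0 aphi phi0 ae aG Le LG.
have p0 : 0 < p by exact: lt_le_trans p1.
have mphi := ad_meas hP hW hX0 aphi.
have me := adv_meas hP hW hX0 ae.
pose psi w := phi w * sqn (e w) `^ (p - 1).
have psi0 w : 0 <= psi w by rewrite mulr_ge0 ?powR_ge0.
have apsi : adreal (FF X0 t0) psi.
  by apply: measurable_funM; [exact: aphi|apply: meas_powR; exact: meas_sqn].
have Lpe : L1 P (fun w => psi w * sqn (e w)).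
  apply: (eq_L1 _ Le) => w.
  by rewrite /psi -mulrA [_ * sqn _]mulrC mulr_powRB1 ?sqn_ge0.
have tt i : t0 <= t0 + i%:R * del by rewrite lerDl mulr_ge0.
have st i : 0 <= t0 + i%:R * del <= t0 + i.+1%:R * del.
  by rewrite addr_ge0 ?mulr_ge0//= lerD2l ler_wpM2r// ler_nat.
have H (i : 'I_n) : L1 P (fun w => psi w * inner (e w)
      (G i w *m dw (t0 + i%:R * del) (t0 + i.+1%:R * del) w)) /\
    EE P (fun w => psi w * inner (e w)
      (G i w *m dw (t0 + i%:R * del) (t0 + i.+1%:R * del) w)) = 0.
  apply: (EE_inner0 hP hW hX0 hind (st i) (ad_mono (tt i) apsi) (adv_mono (tt i) ae) (aG i) psi0 Lpe).
  apply: (L1_young p1 phi0 mphi _ _ _ _ Le (LG i (ltn_ord i))).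
  - exact: meas_sqn.
  - by apply: meas_hs2; exact: (adm_meas hP hW hX0 (aG i)).
  - by move=> w; exact: sqn_ge0.
  - by move=> w; exact: hs2_ge0.
have E w : phi w * sqn (e w) `^ (p - 1) * inner (e w)
     (\sum_(0 <= i < n) G i w *m dw (t0 + i%:R * del) (t0 + i.+1%:R * del) w) =
   \sum_(i < n) psi w * inner (e w) (G i w *m dw (t0 + i%:R * del) (t0 + i.+1%:R * del) w).
  by rewrite big_mkord inner_sumr mulr_sumr.
split; first by apply: (eq_L1 E); apply: L1_sum => i; case: (H i).
rewrite (eq_EE P E) EE_sum; last by move=> i; case: (H i).
by apply: big1 => i _; case: (H i).
Qed.

(** The recursion runs on the coarse grid with initial error 0. The differences of coefficients have
    moments bounded by [A1] and [A2], both of order [h^p]; those of [N] and [r] are then of order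
    [h^p A1] and [h^(2 p) A2]. The weights [h^(1 - p)] and [h^(1 - 2 p)] bring both to [h^(1 + p)],
    so [S] is of order [h^p], and [n] has disappeared. *)
Lemma scheme_error p q : 1 <= p -> (2 * ka - 1) * p = q -> q < pst ->
  exists h0 C : R, [/\ 0 < h0, h0 <= 1, 0 <= C &
  forall X0 : T -> 'cV[R]_d, random_vector X0 -> indep_of_process P X0 W ->
  forall h del n Y Z (phi : T -> R), 0 < h <= h0 -> (0 < n)%N -> n%:R * del = h ->
  is_backward_euler f g W X0 h Z -> is_backward_euler f g W X0 del Y ->
  adreal (FF X0 0) phi -> (forall w, 0 <= phi w) -> L1 P phi ->
  L1 P (fun w => phi w * sqn (X0 w) `^ q) -> forall k,
  L1 P (fun w => phi w * sqn (Y (k * n)%N w - Z k w) `^ p) /\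
  EE P (fun w => phi w * sqn (Y (k * n)%N w - Z k w) `^ p) <= C * h `^ p * wmom X0 phi q].
Proof.
move=> p1 qE qp; have p0 : 0 < p by exact: lt_le_trans p1.
have ka_1 := ka1; have ka0 : 0 < ka by lra.
have q_p : p <= q by rewrite -qE ler_peMl ?(ltW p0)//; lra.
have q1 : 1 <= q by exact: le_trans q_p.
have p_pst : p < pst by exact: le_lt_trans qp.
pose s := q / ka; have sE : ka * s = q by rewrite /s mulrC divfK// gt_eqF.
have ps : p <= s.
  by rewrite /s ler_pdivlMr// -qE mulrC ler_wpM2r ?(ltW p0)//; lra.
have s1 : 1 <= s by exact: le_trans ps.
have [ha [Ca [ha0 ha1 Ca0 CaP]]] := scheme_moment q1 qp.
have [hb [Cb [hb0 hb1 Cb0 CbP]]] := scheme_increment q1 qp s1 sE.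
have [hc [Cc [hc0 hc1 Cc0 CcP]]] := @recursion_bound R disp T P d m W hP hW p al pst be p1 p_pst al0 be0.
have [C4 C40 C4P] := @martingale_transform_moment R disp T P d m W hP hW p p1.
pose h0 := Num.min ha (Num.min hb hc).
have h00 : 0 < h0 by rewrite !lt_min ha0 hb0 hc0.
have h0a : h0 <= ha by rewrite ge_min lexx.
have h0b : h0 <= hb by rewrite !ge_min lexx orbT.
have h0c : h0 <= hc by rewrite !ge_min lexx !orbT.
pose K1 := be `^ p * (1 + Cb).
pose K2 := (3 * c1) `^ p * (4 `^ q * (1 + Ca + Ca) + Cb).
have K10 : 0 <= K1 by rewrite mulr_ge0 ?powR_ge0 ?addr_ge0.
have K20 : 0 <= K2 by rewrite mulr_ge0 ?powR_ge0// addr_ge0// mulr_ge0 ?powR_ge0// !addr_ge0.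
exists h0, (Cc * (K2 + C4 * K1)); split => //.
- exact: le_trans h0a ha1.
- by rewrite mulr_ge0// addr_ge0// mulr_ge0.
move=> X0 hX0 hind h del n Y Z phi /andP[h_gt0 hh0] n0 nd HZ HY aphi phi0 Lphi LX0.
have h_0 := ltW h_gt0; have nR : 0 < n%:R :> R by rewrite ltr0n.
have del0 : 0 < del by rewrite -(pmulr_rgt0 _ nR) nd.
have del_0 := ltW del0.
have delh : del <= h by rewrite -nd ler_peMl ?ler1n.
have hh1 : n%:R * del <= 1 by rewrite nd; exact: le_trans hh0 (le_trans h0a ha1).
have da : 0 < del <= ha by rewrite del0 (le_trans delh (le_trans hh0 h0a)).
have db : 0 < del <= hb by rewrite del0 (le_trans delh (le_trans hh0 h0b)).
have hhc : 0 < h <= hc by rewrite h_gt0 (le_trans hh0 h0c).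
have MY := CaP X0 hX0 hind del Y phi da HY aphi phi0 Lphi LX0.
have IY i0 j jn := CbP X0 hX0 hind del Y phi db HY aphi phi0 Lphi LX0 n i0 j n0 jn hh1.
rewrite nd in IY.
have aY := scheme_adapted hX0 hind del0 HY.
have aZ := scheme_adapted hX0 hind h_gt0 HZ.
have mY k := adv_meas hP hW hX0 (aY k).
have mZ k := adv_meas hP hW hX0 (aZ k).
have mphi := ad_meas hP hW hX0 aphi.
have /andP[B0 B1] := wmom_ge X0 q phi0; have B2 := le_trans B0 B1.
have kh k : 0 <= k%:R * h by rewrite mulr_ge0.
have kn k : (k * n)%:R * del = k%:R * h by rewrite natrM -mulrA nd.
have aYk k : advec (FF X0 (k%:R * h)) (Y (k * n)%N) by rewrite -kn.
have aYi k i : advec (FF X0 (k%:R * h + i%:R * del)) (Y (k * n + i)%N).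
  by rewrite -kn -mulrDl -natrD.
have aphik k : adreal (FF X0 (k%:R * h)) phi by exact: ad_mono aphi.
have aG k i : admat (FF X0 (k%:R * h + i%:R * del)) (fun w => g (Y (k * n + i)%N w) - g (Y (k * n)%N w)).
  apply: meas_Msub; apply: diffusion_adapted; first exact: aYi.
  by apply: adv_mono (aYk k); rewrite lerDl mulr_ge0.
have NM k := noise_moment p1 ps h_gt0 Cb0 mphi phi0 Lphi mY nd (IY (k * n)%N).
have DM k : forall i, (i < n)%N ->
    L1 P (fun w => phi w * sqn (f (Y (k * n + i).+1 w) - f (Y (k.+1 * n)%N w)) `^ p) /\
    EE P (fun w => phi w * sqn (f (Y (k * n + i).+1 w) - f (Y (k.+1 * n)%N w)) `^ p) <=
    (3 * c1) `^ p * h `^ p * ((4 `^ q * (1 + Ca + Ca) + Cb) * wmom X0 phi q).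
  have -> : (k.+1 * n = k * n + n)%N by rewrite mulSn addnC.
  apply: (drift_moment p1 qE (erefl s) h_gt0 Cb0 Ca0 mphi phi0 Lphi mY MY) => i ilt.
  have -> : (k * n + n = (k * n + i).+1 + (n - i.+1))%N by rewrite -addnS -addnA subnKC.
  exact: IY (leq_subr _ _).
pose N k w := \sum_(0 <= i < n) (g (Y (k * n + i)%N w) - g (Y (k * n)%N w)) *m
       dw (k%:R * h + i%:R * del) (k%:R * h + i.+1%:R * del) w.
pose r k w := del *: \sum_(0 <= i < n) (f (Y (k * n + i).+1 w) - f (Y (k.+1 * n)%N w)).
pose A1 := K1 * h `^ p * wmom X0 phi q.
pose A2 := K2 * h `^ p * wmom X0 phi q.
have A10 : 0 <= A1 := mulr_ge0 (mulr_ge0 K10 (powR_ge0 h p)) B2.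
have A20 : 0 <= A2 := mulr_ge0 (mulr_ge0 K20 (powR_ge0 h p)) B2.
have HN k : L1 P (fun w => phi w * sqn (N k w) `^ p) /\
    EE P (fun w => phi w * sqn (N k w) `^ p) <= C4 * h `^ p * A1.
  have := C4P X0 hX0 hind n (k%:R * h) del phi d
    (fun i w => g (Y (k * n + i)%N w) - g (Y (k * n)%N w)) A1 n0 (kh k) del0 (aphik k) phi0 (aG k).
  rewrite nd => H; apply: (H _ n (leqnn n)) => j jn.
  exact: (NM k j (ltnW jn)).
have mfY k : random_vector (fun w => f (Y k w)) := adv_meas hP hW hX0 (drift_adapted (aY k)).
have Hr k : L1 P (fun w => phi w * sqn (r k w) `^ p) /\
    EE P (fun w => phi w * sqn (r k w) `^ p) <= h `^ (2 * p) * A2.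
  rewrite -[X in X `^ (2 * p)]nd; apply: (EE_drift_sum p1 phi0 mphi _ del_0 n0 (leqnn n) A20).
    by move=> i; apply: meas_vsub; exact: mfY.
  move=> i ilt; have [L E] := DM k i ilt; split; first exact: L.
  by apply: (le_trans E); rewrite le_eqVlt; apply/orP; left; apply/eqP; rewrite /A2 /K2; ring.
have mNk k : random_vector (N k).
  apply: meas_vsum => i; apply: meas_mulmx; first exact: (adm_meas hP hW hX0 (aG k i)).
  apply: (incr_meas hP hW hX0); rewrite addr_ge0 ?mulr_ge0//=.
  by rewrite lerD2l ler_pM2r// ler_nat.
have mrk k : random_vector (r k).
  by apply: meas_vscale; apply: meas_vsum => i; apply: meas_vsub; exact: mfY.
pose e k w := Y (k * n)%N w - Z k w.
have e0 w : e 0%N w = 0 by rewrite /e mul0n (proj1 HY) (proj1 HZ) subrr.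
have ae k : advec (FF X0 (k%:R * h)) (e k) by apply: meas_vsub; [exact: aYk|exact: aZ].
have E0 w : phi w * sqn (e 0%N w) `^ p = 0.
  by rewrite e0 sqn0 powR0 ?mulr0// gt_eqF.
have H := @CcP X0 hX0 hind h phi d e N r (fun k w => g (Y (k * n)%N w) - g (Z k w))
  (C4 * A1 + A2) hhc aphi phi0 ae.
move=> k.
have [|||||||k' Lk'|Lk Ek] := H _ _ _ _ _ _ _ _ k.
- by move=> k'; apply: meas_Msub; apply: diffusion_adapted; [exact: aYk|exact: aZ].
- exact: mNk.
- exact: mrk.
- by move=> k' w; exact: hg.
- move=> k' w; apply: (le_trans (lyap_step hmon _ _ h_0)).
  by rewrite (scheme_compare k' w HZ HY nd).
- exact: (addr_ge0 (mulr_ge0 C40 A10) A20).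
- by apply: (eq_L1 E0); exact: L1_cst.
- have [LN EN] := HN k'; have [Lr Er] := Hr k'.
  have LGk i : (i < n)%N ->
      L1 P (fun w => phi w * hs2 (g (Y (k' * n + i)%N w) - g (Y (k' * n)%N w)) `^ p).
    by move=> ilt; case: (NM k' i (ltnW ilt)).
  have [LI EI] := EE_inner_transform hX0 hind p1 (kh k') del_0 (aphik k') phi0 (ae k') (aG k') Lk' LGk.
  split; [exact: LN|exact: Lr|exact: LI|exact: EI|].
  apply: (le_trans (lerD (ler_wpM2l (powR_ge0 h _) Er) (ler_wpM2l (powR_ge0 h _) EN))).
  rewrite mulrA powR_cancel// mulrDr addrC lerD//.
  have -> : h `^ (1 - p) * (C4 * h `^ p * A1) = (h `^ (1 - p) * h `^ p) * (C4 * A1) by ring.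
  by rewrite powR_cancel.
split; first exact: Lk.
apply: (le_trans Ek); rewrite (eq_EE P E0) EE_cst add0r.
by rewrite le_eqVlt; apply/orP; left; apply/eqP; rewrite /A1 /A2; ring.
Qed.

(* For exponents below the critical one, the weight [(1 + |X0|^2)^(- a)] converts the
   bound of [scheme_error] into one involving only the moment of the right order. *)
Lemma scheme_rate q : 1 <= q -> q < pst -> exists2 h0 : R, 0 < h0 <= 1 &
  forall p, 1 <= p -> (2 * ka - 1) * p <= q -> exists2 C : R, 0 <= C &
  forall X0 : T -> 'cV[R]_d, random_vector X0 -> indep_of_process P X0 W ->
  L1 P (fun w => sqn (X0 w) `^ q) ->
  forall h del n Y Z, 0 < h <= h0 -> (0 < n)%N -> n%:R * del = h ->
  is_backward_euler f g W X0 h Z -> is_backward_euler f g W X0 del Y -> forall k,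
  L1 P (fun w => sqn (Y (k * n)%N w - Z k w) `^ p) /\
  EE P (fun w => sqn (Y (k * n)%N w - Z k w) `^ p) <=
     C * h `^ p * EE P (fun w => (1 + sqn (X0 w)) `^ ((2 * ka - 1) * p)).
Proof.
move=> q1 qp; have k1 : 1 <= 2 * ka - 1 by have := ka1; lra.
have k0 : 0 < 2 * ka - 1 by exact: lt_le_trans k1.
pose pb := q / (2 * ka - 1).
have pbE : (2 * ka - 1) * pb = q by rewrite /pb mulrC divfK// gt_eqF.
(* [pb] is the critical exponent. If it is below 1, no [p] is admissible and any [h0] will do. *)
have [pb1|pb1] := ltP pb 1.
  exists 1; rewrite ?ltr01 ?lexx// => p p1 hpq; have ppb : p <= pb by rewrite ler_pdivlMr// mulrC.
  by have := lt_le_trans pb1 (le_trans p1 ppb); rewrite ltxx.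
have [h0 [C [h00 h01 C0 CP]]] := scheme_error pb1 pbE qp.
exists h0; first by rewrite h00.
move=> p p1 hpq; have ppb : p <= pb by rewrite ler_pdivlMr// mulrC.
have p0 : 0 < p by exact: lt_le_trans p1.
exists (1 + 2 * C); first by rewrite addr_ge0// mulr_ge0.
move=> X0 hX0 hind LX0 h del n Y Z hh n0 nd HZ HY k.
have h_gt0 : 0 < h by case/andP: hh.
(* Chosen so that [phi b^q = b^((2 ka - 1) p)]. *)
pose a := (2 * ka - 1) * (pb - p).
have pbp : 0 <= pb - p by rewrite subr_ge0.
have a0 : 0 <= a := mulr_ge0 (ltW k0) pbp.
pose b w := 1 + sqn (X0 w).
have b1 w : 1 <= b w by rewrite lerDl sqn_ge0.
have b0 w : 0 < b w by exact: lt_le_trans (b1 w).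
pose phi w := b w `^ (- a).
have ab : adreal (FF X0 0) b.
  by apply: measurable_funD => //; apply: meas_sqn; exact: adv_X0.
have aphi : adreal (FF X0 0) phi by exact: meas_powR.
have mphi := ad_meas hP hW hX0 aphi; have mb := ad_meas hP hW hX0 ab.
have phi0 w : 0 <= phi w by exact: powR_ge0.
have phi1 w : phi w <= 1.
  by rewrite -[leRHS](powRr0 (b w)); apply: ler_powR => //; rewrite oppr_le0.
have Lphi : L1 P phi.
  by apply: (L1_le0 mphi (L1_cst P 1)) => w; rewrite phi0 phi1.
have mX : measurable_fun setT (fun w => sqn (X0 w) `^ q) by exact: L1_meas LX0.
have LpX : L1 P (fun w => phi w * sqn (X0 w) `^ q).
  apply: (L1_le0 (measurable_funM mphi mX) LX0) => w.
  by rewrite mulr_ge0 ?powR_ge0//= ler_piMl ?powR_ge0.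
have [L E] := CP X0 hX0 hind h del n Y Z phi hh n0 nd HZ HY aphi phi0 Lphi LpX k.
set r := (2 * ka - 1) * p.
have r0 : 0 <= r by rewrite mulr_ge0 ?(ltW k0) ?(ltW p0).
have rq : r <= q by rewrite -pbE ler_wpM2l// ltW.
have q0 : 0 <= q by exact: le_trans r0 rq.
have Lb : L1 P (fun w => b w `^ r).
  apply: (L1_le0 (meas_powR _ mb) (L1Z (2 `^ q) (L1D (L1_cst P 1) LX0))) => w.
  rewrite powR_ge0/=; apply: (@le_trans _ _ (b w `^ q)); first exact: ler_powR.
  by have := powRD_le q0 (@ler01 R) (sqn_ge0 (X0 w)); rewrite powR1.
have phib w : phi w * b w `^ q = b w `^ r.
  rewrite /phi -powRD ?(gt_eqF (b0 w)) ?implybT//; congr (_ `^ _).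
  by rewrite /a /r -pbE; ring.
have bq w : 1 <= b w `^ q by rewrite -[leLHS](powRr0 (b w)); exact: ler_powR.
have wle : wmom X0 phi q <= 2 * EE P (fun w => b w `^ r).
  rewrite mulr_natl mulr2n; apply: lerD; apply: EE_le => // w; rewrite -phib.
    by rewrite ler_peMr.
  rewrite ler_wpM2l//; apply: ge0_ler_powR; rewrite ?nnegrE ?sqn_ge0 ?(ltW (b0 w))//.
  by rewrite lerDr.
pose V w := h `^ p * b w `^ r + h `^ (p - pb) * (phi w * sqn (Y (k * n)%N w - Z k w) `^ pb).
have LV : L1 P V by apply: L1D; exact: L1Z.
have UV w : 0 <= sqn (Y (k * n)%N w - Z k w) `^ p <= V w.
  (* The threshold [h b^(2 ka - 1)] makes the first term of [powR_weight] equal to [h^p b^r] and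
     turns the power of [b] in the second into the weight [phi]. *)
  rewrite powR_ge0/=; have th0 : 0 < h * b w `^ (2 * ka - 1) by rewrite mulr_gt0 ?powR_gt0.
  apply: (le_trans (powR_weight p0 ppb th0 (sqn_ge0 _))).
  rewrite !powRM ?powR_ge0 ?(ltW h_gt0)// -!powRrM -/r.
  have -> : (2 * ka - 1) * (p - pb) = - a by rewrite /a; ring.
  by rewrite /V -/(phi w) le_eqVlt; apply/orP; left; apply/eqP; ring.
have aY := scheme_adapted hX0 hind _ HY; have aZ := scheme_adapted hX0 hind h_gt0 HZ.
have del0 : 0 < del by rewrite -(pmulr_rgt0 _ (_ : 0 < n%:R)) ?nd// ltr0n.
have mU : measurable_fun setT (fun w => sqn (Y (k * n)%N w - Z k w) `^ p).
  apply: meas_powR; apply: meas_sqn; apply: meas_vsub; last exact: (adv_meas hP hW hX0 (aZ k)).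
  exact: (adv_meas hP hW hX0 (aY del0 _)).
have LU := L1_le0 mU LV UV; split; first exact: LU.
apply: (le_trans (EE_le LU LV (fun w => proj2 (andP (UV w))))).
rewrite (EED (L1Z _ Lb) (L1Z _ L)) (EEZ _ Lb) (EEZ _ L).
have e1 := ler_wpM2l (powR_ge0 h (p - pb)) E.
have e2 : h `^ (p - pb) * (C * h `^ pb * wmom X0 phi q) = h `^ p * (C * wmom X0 phi q).
  have -> : h `^ p = h `^ (p - pb) * h `^ pb by rewrite -powRD ?subrK// (gt_eqF h_gt0) implybT.
  by ring.
rewrite e2 in e1; apply: (le_trans (lerD (lexx _) e1)).
rewrite -mulrDr [_ * h `^ p]mulrC -[leRHS]mulrA ler_wpM2l ?powR_ge0// mulrDl mul1r lerD2l.
by rewrite [2 * C]mulrC -mulrA ler_wpM2l.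
Qed.

End scheme.

(** * Lenglart's inequality and Ito sums *)

Section probability_bounds.
Context {R : realType} {disp : measure_display} {T : measurableType disp}.
Variable P : probability T R.

Lemma prob_le (A B : set T) : measurable A -> measurable B -> A `<=` B -> fine (P A) <= fine (P B).
Proof.
move=> mA mB AB; apply: fine_le; rewrite ?fin_num_measure//.
by apply: le_measure; rewrite ?inE.
Qed.

Lemma prob_le_U (A B C : set T) : measurable A -> measurable B -> measurable C ->
  A `<=` B `|` C -> fine (P A) <= fine (P B) + fine (P C).
Proof.
move=> mA mB mC AB; have mU := measurableU _ _ mB mC.
apply: (le_trans (prob_le mA mU AB)).
rewrite -fineD ?fin_num_measure//; apply: fine_le; rewrite ?fin_numD ?fin_num_measure//.
exact: measureU2.
Qed.

Lemma chebyshev2 (S : T -> R) (eta : R) : 0 < eta -> L1 P (fun w => S w ^+ 2) ->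
  measurable_fun setT S ->
  fine (P [set w | eta <= `|S w|]) <= EE P (fun w => S w ^+ 2) / eta ^+ 2.
Proof.
move=> e0 LS mS; have e2 : 0 < eta ^+ 2 by rewrite exprn_gt0.
have mA : measurable [set w | eta <= `|S w|].
  rewrite -[X in measurable X]setTI; apply: measurable_fun_le => //.
  exact: measurableT_comp.
rewrite -(EE_indic P mA) mulrC -EEZ//; apply: EE_le; [exact: L1_indic|exact: L1Z|].
move=> w; rewrite indicE; case: (boolP (w \in _)) => [|_]; last by rewrite mulr_ge0 ?invr_ge0 ?sqr_ge0.
rewrite inE/= => H; rewrite mulrC ler_pdivlMr// mul1r -[leRHS]real_normK ?num_real//.
by rewrite lerXn2r// ?nnegrE ?(ltW e0).
Qed.

End probability_bounds.

(** * Common refinements of partitions *)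

Section mesh.
Context {R : realType}.

Lemma sorted_mesh (s0 : seq R) (t : R) : (forall x, x \in s0 -> x <= t) ->
  exists (n : nat) (u : nat -> R), [/\ {homo u : i j / (i <= j)%N >-> i <= j},
    forall x, x \in s0 -> exists2 k, (k < n)%N & u k = x,
    forall k, u k \in s0 \/ u k = t & forall k, (n <= k)%N -> u k = t].
Proof.
move=> st; set s := sort <=%R s0.
have ss : sorted <=%R s by exact: (sort_sorted (@le_total _ R)).
have ms x : (x \in s) = (x \in s0) by rewrite mem_sort.
exists (size s), (nth t s); split.
- move=> i j ij; have [js|js] := ltnP j (size s).
    by apply: (sorted_leq_nth (@le_trans _ R) (@lexx _ R)) => //; exact: leq_ltn_trans js.
  rewrite (nth_default _ js); have [is_|is_] := ltnP i (size s); last by rewrite nth_default.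
  by apply: st; rewrite -ms mem_nth.
- move=> x; rewrite -ms => xs; exists (index x s); first by rewrite index_mem.
  exact: nth_index.
- move=> k; have [ks|ks] := ltnP k (size s); last by right; rewrite nth_default.
  by left; rewrite -ms mem_nth.
- by move=> k; exact: nth_default.
Qed.

Lemma mesh_trichotomy (u : nat -> R) k l : {homo u : i j / (i <= j)%N >-> i <= j} ->
  u k <= u l \/ u l.+1 <= u k.
Proof. by move=> hu; have [kl|kl] := leqP k l; [left|right]; apply: hu. Qed.

Lemma clip_telescope (V : zmodType) (B : R -> V) (u : nat -> R) n a b ka kb :
  {homo u : i j / (i <= j)%N >-> i <= j} -> u ka = a -> u kb = b -> a <= b ->
  b <= u n -> u 0%N <= a ->
  \sum_(l < n) (if (a < u l.+1) && (u l.+1 <= b) then B (u l.+1) - B (u l) else 0) = B b - B a.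
Proof.
move=> hu ua ub ab bn u0a.
(* Clipping to [[a, b]] turns each summand into [B (c (u l.+1)) - B (c (u l))], because [a] and [b]
   are mesh points and no cell straddles them; the sum telescopes. *)
pose c r := Num.max a (Num.min r b).
have E (l : 'I_n) : (if (a < u l.+1) && (u l.+1 <= b) then B (u l.+1) - B (u l) else 0) =
    B (c (u l.+1)) - B (c (u l)).
  have ull : u l <= u l.+1 by apply: hu.
  have [k1|k1] := mesh_trichotomy ka l hu; rewrite ua in k1; last first.
    rewrite ltNge k1/= /c !min_l ?max_l ?subrr//.
    - exact: le_trans ull k1.
    - exact: le_trans ull (le_trans k1 ab).
    - exact: le_trans k1 ab.
  have [k2|k2] := mesh_trichotomy kb l hu; rewrite ub in k2; last first.
    rewrite k2 andbT /c !min_l ?(le_trans ull k2)// !max_r//; last exact: le_trans k1 ull.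
    rewrite lt_def (le_trans k1 ull) andbT; case: eqVneq => //= e.
    have -> : u l = u l.+1 by apply/le_anti; rewrite ull e k1.
    by rewrite subrr.
  rewrite /c !min_r ?(le_trans k2 ull)// subrr.
  case: ifP => // /andP[h1 h2].
  have -> : u l = u l.+1 by apply/le_anti; rewrite ull (le_trans h2 k2).
  by rewrite subrr.
under eq_bigr do rewrite E.
rewrite -(big_mkord xpredT (fun l => B (c (u l.+1)) - B (c (u l)))) telescope_sumr//.
by rewrite /c (min_r bn) (max_r ab) (min_l (le_trans u0a ab)) max_l.
Qed.


Definition iind (x y r : R) : R := (((x < r)%R && (r <= y)%R) : nat)%:R.

Lemma iindE x y : iind x y = \1_(`]x, y]%classic : set R).
Proof.
apply/funext => r; rewrite indicE /iind; congr (nat_of_bool _)%:R.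
by apply/idP/idP; rewrite inE/= in_itv.
Qed.

Lemma measurable_iind (D : set R) x y : measurable_fun D (iind x y).
Proof. by rewrite iindE; apply: measurable_indic; exact: measurable_itv. Qed.

Lemma iind_ge0 x y r : 0 <= iind x y r. Proof. by rewrite /iind. Qed.

Lemma mesh_indic (u : nat -> R) n (v : nat -> R) (F : R -> R) r :
  {homo u : i j / (i <= j)%N >-> i <= j} -> 0 <= F r ->
  (forall l, (l < n)%N -> u l < r <= u l.+1 -> F r = v l) ->
  \sum_(l < n) v l * iind (u l) (u l.+1) r <= F r.
Proof.
move=> hu F0 Fv.
have [l Hl|H] := pickP (fun l : 'I_n => u l < r <= u l.+1); last first.
  by rewrite big1// => l _; rewrite /iind H mulr0.
rewrite (bigD1 l)//= {1}/iind Hl mulr1 big1 ?addr0 ?(Fv l)// => k kl.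
case: (ltngtP k l) => [kl'|lk|/val_inj e]; last by rewrite e eqxx in kl.
- have k1 : u k.+1 <= u l by apply: hu.
  have [h1 h2] := andP Hl.
  by rewrite /iind [r <= _]leNgt (le_lt_trans k1 h1) andbF mulr0.
- have k1 : u l.+1 <= u k by apply: hu.
  have [h1 h2] := andP Hl.
  by rewrite /iind ltNge (le_trans h2 k1) mulr0.
Qed.

(** An inequality only, because the mesh may leave out parts of [[0, t]] at both ends. *)
Lemma mesh_integral_le (u : nat -> R) n (v : nat -> R) (F : R -> R) t :
  {homo u : i j / (i <= j)%N >-> i <= j} -> 0 <= u 0%N -> u n <= t ->
  (forall l, 0 <= v l) -> (forall r, 0 <= F r) ->
  measurable_fun `[0, t]%classic F ->
  (forall l r, (l < n)%N -> u l < r <= u l.+1 -> F r = v l) ->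
  ((\sum_(l < n) v l * (u l.+1 - u l))%:E <=
    \int[lebesgue_measure]_(r in `[0%R, t]%classic) (F r)%:E)%E.
Proof.
move=> hu u0 ut v0 F0 mF Fv.
have mD : measurable (`[0, t]%classic : set R) by exact: measurable_itv.
have mI l : measurable_fun `[0, t]%classic (fun r : R => (v l * iind (u l) (u l.+1) r)%:E).
  by apply/measurable_EFinP; apply: measurable_funM => //; exact: measurable_iind.
apply: (@le_trans _ _ (\int[lebesgue_measure]_(r in `[0%R, t]%classic)
   (\sum_(l < n) (v l * iind (u l) (u l.+1) r)%:E))%E); last first.
  apply: ge0_le_integral => //.
  - by move=> r _; apply: sume_ge0 => l _; rewrite lee_fin mulr_ge0 ?iind_ge0.
  - by apply: emeasurable_sum => l _; exact: mI.
  - exact/measurable_EFinP.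
  - by move=> r _; rewrite sumEFin lee_fin; apply: mesh_indic => // l ln; exact: Fv.
rewrite ge0_integral_sum; [|exact: mD|by move=> l; exact: mI|by move=> l r _; rewrite lee_fin mulr_ge0 ?iind_ge0].
rewrite -sumEFin; apply: lee_sum => l _.
have ul : 0 <= u l by apply: (le_trans u0); apply: hu.
have ult : u l.+1 <= t by apply: (le_trans _ ut); apply: hu.
have ull : u l <= u l.+1 by apply: hu.
under eq_integral do rewrite EFinM.
rewrite ge0_integralZl//; last 3 first.
- by apply/measurable_EFinP; exact: measurable_iind.
- by move=> r _; rewrite lee_fin iind_ge0.
- by rewrite lee_fin.
rewrite EFinM lee_wpmul2l// ?lee_fin//.
rewrite iindE.
rewrite integral_indic//.
rewrite (_ : `]u l, u l.+1]%classic `&` `[0, t]%classic = `]u l, u l.+1]%classic); last first.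
  apply/seteqP; split => r /=; first by case.
  rewrite !in_itv/= => /andP[h1 h2]; split; first by rewrite h1.
  by rewrite (le_trans ul (ltW h1)) (le_trans h2 ult).
suff : ((u l.+1 - u l)%:E <= lebesgue_measure (`]u l, u l.+1]%classic : set R))%E by [].
rewrite lebesgue_measure_itv/= lte_fin; case: ltP => // h.
by rewrite lee_fin subr_le0.
Qed.

End mesh.

(** * Lenglart's inequality for elementary integrals *)

Section lenglart.
Context {R : realType} {disp : measure_display} {T : measurableType disp}.
Variable P : probability T R.
Context {d m : nat} {X0 : T -> 'cV[R]_d} {W : R -> T -> 'cV[R]_m}.
Hypothesis hP : measure_is_complete P.
Hypothesis hW : is_wiener P W.
Hypothesis hX0 : random_vector X0.
Hypothesis hind : indep_of_process P X0 W.
Variable j : 'I_m.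
Notation FF t := (filt_gen P (X0 := X0) (W := W) t).
Notation dB s t w := (dW (W := W) s t j w).

Section transform.
Variables (u : nat -> R) (y : nat -> T -> R) (c : R).
Hypothesis hu : {homo u : i j / (i <= j)%N >-> i <= j}.
Hypothesis u0 : 0 <= u 0%N.
Hypothesis ay : forall l, adreal (FF (u l)) (y l).
Hypothesis c0 : 0 <= c.

Let A (n : nat) (w : T) : R := \sum_(l < n) y l w ^+ 2 * (u l.+1 - u l).
(** The transform is switched off before [A] exceeds [c]. The test includes the current term, so [Q]
    stays below [c], and yet it is known at time [u l]. *)
Let z (l : nat) (w : T) : R := \1_(`]-oo, c]%classic : set R) (A l.+1 w) * y l w.
Let M (n : nat) (w : T) : R := \sum_(l < n) z l w * dB (u l) (u l.+1) w.
Let Q (n : nat) (w : T) : R := \sum_(l < n) z l w ^+ 2 * (u l.+1 - u l).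

Let du l : 0 <= u l.+1 - u l. Proof. by rewrite subr_ge0; apply: hu. Qed.

Let A_mono k n w : (k <= n)%N -> A k w <= A n w.
Proof.
move=> kn; rewrite /A -(subnKC kn) big_split_ord/= lerDl sumr_ge0// => i _.
by rewrite mulr_ge0 ?sqr_ge0.
Qed.

Let zE l w : z l w = if A l.+1 w <= c then y l w else 0.
Proof.
rewrite /z indicE.
have -> : (A l.+1 w \in `]-oo, c]%classic) = (A l.+1 w <= c).
  by apply/idP/idP; rewrite inE/= in_itv.
case: ifP => _; first by rewrite mul1r.
by rewrite mul0r.
Qed.

Let Q_bound n w : 0 <= Q n w <= c.
Proof.
have z0 l : 0 <= z l w ^+ 2 * (u l.+1 - u l) by rewrite mulr_ge0 ?sqr_ge0.
rewrite sumr_ge0//=; elim: n => [|n IH]; first by rewrite /Q big_ord0.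
rewrite /Q big_ord_recr/= -/(Q n w) zE; case: ifP => An; last by rewrite expr0n/= mul0r addr0.
apply: (le_trans _ An); rewrite /A big_ord_recr/= lerD2r; apply: ler_sum => l _.
by rewrite zE; case: ifP => // _; rewrite expr0n/= mul0r mulr_ge0 ?sqr_ge0.
Qed.

Let aA l : adreal (FF (u l)) (A l.+1).
Proof.
apply: measurable_sum => k; apply: measurable_funM => //; apply: measurable_funX.
have H : adreal (FF (u l)) (y k) by apply: ad_mono (@ay k); apply: hu; rewrite -ltnS.
exact: H.
Qed.

Let az l : adreal (FF (u l)) (z l).
Proof.
apply: measurable_funM; last exact: (@ay l).
by apply: measurableT_comp; [exact: measurable_indic|exact: aA].
Qed.

Let mz l : measurable_fun setT (z l). Proof. exact: (ad_meas hP hW hX0 (@az l)). Qed.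

Let ul0 l : 0 <= u l. Proof. by apply: (le_trans u0); apply: hu. Qed.

Let st l : 0 <= u l <= u l.+1. Proof. by rewrite ul0/=; apply: hu. Qed.

Let mQ n : measurable_fun setT (Q n).
Proof.
by apply: measurable_sum => l; apply: measurable_funM => //; apply: measurable_funX.
Qed.

Let LQ n : L1 P (Q n).
Proof. by apply: (L1_le0 (mQ n) (L1_cst P c)) => w; exact: Q_bound. Qed.

Let aM n : adreal (FF (u n)) (M n).
Proof.
apply: measurable_sum => l; apply: measurable_funM.
  have H : adreal (FF (u n)) (z l) by apply: ad_mono (@az l); apply: hu; exact: ltnW.
  exact: H.
have H : adreal (FF (u l.+1)) (dW (W := W) (u l) (u l.+1) j).
  by apply/adrealP; exact: (@adapted_dW _ _ _ P d m X0 W (u l) (u l.+1) j (st l)).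
have H' : adreal (FF (u n)) (dW (W := W) (u l) (u l.+1) j) by apply: ad_mono H; apply: hu.
exact: H'.
Qed.

(** Discrete Ito isometry for the truncated transform; the truncation also supplies the bounds
    behind integrability. *)
Lemma transform_L2 n : L1 P (fun w => M n w ^+ 2) /\ EE P (fun w => M n w ^+ 2) <= c.
Proof.
suff [L E] : L1 P (fun w => M n w ^+ 2) /\ EE P (fun w => M n w ^+ 2) = EE P (Q n).
  split => //; rewrite E -[leRHS](EE_cst P); apply: EE_le => //; first exact: L1_cst.
  by move=> w; case/andP: (Q_bound n w).
elim: n => [|n [LM EM]].
  have E w : M 0%N w ^+ 2 = 0 by rewrite /M big_ord0 expr0n.
  have E' w : Q 0%N w = 0 by rewrite /Q big_ord0.
  split; first by apply: (eq_L1 E); exact: L1_cst.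
  by rewrite (eq_EE P E) (eq_EE P E').
have ME w : M n.+1 w = M n w + z n w * dB (u n) (u n.+1) w by rewrite /M big_ord_recr.
have QE w : Q n.+1 w = Q n w + z n w ^+ 2 * (u n.+1 - u n) by rewrite /Q big_ord_recr.
(* Mesh points may repeat. On a cell of positive length [Q <= c] bounds [z]; on a degenerate one it
   says nothing about [z], but nothing is added to [M]. *)
have := du n; rewrite le_eqVlt => /orP[/eqP D0|D0].
  have un : u n = u n.+1 by apply/esym/subr0_eq.
  have E w : M n.+1 w ^+ 2 = M n w ^+ 2 by rewrite ME -un dW_refl mulr0 addr0.
  have E' w : Q n.+1 w = Q n w by rewrite QE -D0 mulr0 addr0.
  by split; [exact: (eq_L1 E)|rewrite (eq_EE P E) (eq_EE P E')].
have z2 w : 0 <= z n w ^+ 2 <= c / (u n.+1 - u n).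
  rewrite sqr_ge0/= ler_pdivlMr//; have /andP[_ H] := Q_bound n.+1 w.
  apply: (le_trans _ H); rewrite QE lerDr; by case/andP: (Q_bound n w).
have Lz2 : L1 P (fun w => z n w ^+ 2).
  by apply: (L1_le0 _ (L1_cst P (c / (u n.+1 - u n)))) => //; apply: measurable_funX.
have mM k : measurable_fun setT (M k) by exact: (ad_meas hP hW hX0 (@aM k)).
have LMz : L1 P (fun w => M n w * z n w).
  apply: (L1_le _ (L1D LM Lz2)); first exact: measurable_funM.
  move=> w; rewrite normrM -(real_normK (num_real (M n w))) -(real_normK (num_real (z n w))).
  by move: (normr_ge0 (M n w)) (normr_ge0 (z n w)); move: `|M n w| `|z n w| => a b; nra.
have [L1' E1'] := EE_adapted_dW hP hW hX0 hind j (st n)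
  (proj1 (adrealP _ _) (measurable_funM (@aM n) (@az n))) LMz.
have [L2' E2'] := EE_adapted_dW2 hP hW hX0 hind j j (st n)
  (proj1 (adrealP _ _) (measurable_funX 2 (@az n))) Lz2.
rewrite eqxx mul1r in E2'.
have E w : M n.+1 w ^+ 2 = M n w ^+ 2 + (2 * ((M n w * z n w) * dB (u n) (u n.+1) w) +
    z n w ^+ 2 * (dB (u n) (u n.+1) w * dB (u n) (u n.+1) w)) by rewrite ME; ring.
have L3 := L1D (L1Z 2 L1') L2'.
split; first by apply: (eq_L1 E); exact: L1D.
rewrite (eq_EE P E) (EED LM L3) (EED (L1Z 2 L1') L2') (EEZ 2 L1') E1' mulr0 add0r E2' EM.
have QE' w : Q n.+1 w = Q n w + (u n.+1 - u n) * z n w ^+ 2 by rewrite QE mulrC.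
by rewrite (eq_EE P QE') (EED (LQ n) (L1Z _ Lz2)) (EEZ _ Lz2).
Qed.

(** On [G] the truncation never acts, so the two sums coincide there; the truncated one has second
    moment at most [c], and Chebyshev's inequality applies. *)
Lemma transform_lenglart n (eta : R) (G : set T) : 0 < eta -> measurable G ->
  (forall w, G w -> \sum_(l < n) y l w ^+ 2 * (u l.+1 - u l) <= c) ->
  fine (P [set w | eta <= `|\sum_(l < n) y l w * dB (u l) (u l.+1) w|]) <=
    c / eta ^+ 2 + fine (P (~` G)).
Proof.
move=> e0 mG GA; have [L E] := transform_L2 n.
have mM : measurable_fun setT (M n) by exact: (ad_meas hP hW hX0 (@aM n)).
have mSy : measurable_fun setT (fun w => \sum_(l < n) y l w * dB (u l) (u l.+1) w).
  apply: measurable_sum => l; apply: measurable_funM; first exact: (ad_meas hP hW hX0 (@ay l)).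
  exact: (dW_measurable hP hW hX0 j (st l)).
have mset (S : T -> R) : measurable_fun setT S -> measurable [set w | eta <= `|S w|].
  move=> mS; rewrite -[X in measurable X]setTI; apply: measurable_fun_le => //.
  exact: measurableT_comp.
have sub : [set w | eta <= `|\sum_(l < n) y l w * dB (u l) (u l.+1) w|] `<=`
    [set w | eta <= `|M n w|] `|` ~` G.
  move=> w /= H; have [Gw|] := pselect (G w); last by right.
  left; rewrite /= (_ : M n w = \sum_(l < n) y l w * dB (u l) (u l.+1) w)//.
  apply: eq_bigr => l _; rewrite zE (le_trans _ (GA w Gw))//.
  exact: A_mono.
apply: (le_trans (prob_le_U P (mset _ mSy) (mset _ mM) (measurableC mG) sub)).
rewrite lerD2r; apply: (le_trans (chebyshev2 e0 L mM)).
by rewrite ler_wpM2r// invr_ge0 sqr_ge0.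
Qed.

End transform.

Section elementary.
Variables (I : finType) (a b : I -> R) (xi : I -> T -> R) (t : R).
Hypothesis t0 : 0 <= t.
Hypothesis ab : forall i, 0 <= a i <= b i.
Hypothesis bt : forall i, b i <= t.
Hypothesis axi : forall i, adreal (FF (a i)) (xi i).

Definition estep (r : R) (w : T) : R := \sum_i xi i w * iind (a i) (b i) r.

(** The intervals may overlap, as they do for the difference of two simple processes with unrelated
    partitions; the sum is rewritten on a common mesh. *)
Lemma elementary_lenglart (eta c : R) (G : set T) : 0 < eta -> 0 <= c -> measurable G ->
  (forall w, G w ->
     (\int[lebesgue_measure]_(r in `[0%R, t]%classic) (estep r w ^+ 2)%:E <= c%:E)%E) ->
  fine (P [set w | eta <= `|\sum_i xi i w * dB (a i) (b i) w|]) <= c / eta ^+ 2 + fine (P (~` G)).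
Proof.
move=> e0 c0 mG GI.
pose s0 := [seq a i | i <- enum I] ++ [seq b i | i <- enum I].
have s0t x : x \in s0 -> 0 <= x <= t.
  rewrite mem_cat => /orP[] /mapP[i _ ->].
    by case/andP: (ab i) => h1 h2; rewrite h1 (le_trans h2).
  by case/andP: (ab i) => h1 h2; rewrite (le_trans h1 h2) bt.
have [n [u [hu us us0 un]]] := sorted_mesh (fun x xs => proj2 (andP (s0t x xs))).
have u0 k : 0 <= u k by case: (us0 k) => [/s0t/andP[]//|->].
have ut k : u k <= t by case: (us0 k) => [/s0t/andP[]//|->].
have ua i : exists2 k, (k < n)%N & u k = a i.
  by apply: us; rewrite mem_cat map_f ?mem_enum.
have ub i : exists2 k, (k < n)%N & u k = b i.
  by apply: us; rewrite mem_cat [X in _ || X]map_f ?orbT ?mem_enum.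
have tri_a i l : a i <= u l \/ u l.+1 <= a i.
  by have [k _ <-] := ua i; exact: mesh_trichotomy.
have tri_b i l : b i <= u l \/ u l.+1 <= b i.
  by have [k _ <-] := ub i; exact: mesh_trichotomy.
have est l r w : u l < r <= u l.+1 -> estep r w = estep (u l.+1) w.
  move=> /andP[r1 r2]; apply: eq_bigr => i _; congr (_ * _); rewrite /iind; congr (nat_of_bool _)%:R.
  apply/idP/idP => /andP[h1 h2]; apply/andP; split.
  - exact: lt_le_trans h1 r2.
  - by case: (tri_b i l) => // h; have := lt_le_trans (le_lt_trans h r1) h2; rewrite ltxx.
  - by case: (tri_a i l) => h; [exact: le_lt_trans r1|rewrite ltNge h in h1].
  - exact: le_trans r2 h2.
(* The value at the right end of a cell, which is the value on the whole half-open cell. It is known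
   at the left end, since an interval that covers the cell begins no later than [u l]. *)
pose y l := estep (u l.+1).
have ay l : adreal (FF (u l)) (y l).
  apply: measurable_sum => i; rewrite /iind; case: (boolP (a i < u l.+1 <= b i)) => H /=; last first.
    by under eq_fun do rewrite mulr0; exact: measurable_cst.
  under eq_fun do rewrite mulr1.
  have H' : adreal (FF (u l)) (xi i).
    apply: ad_mono (@axi i); case: (tri_a i l) => // h.
    by case/andP: H => h1 _; rewrite ltNge h in h1.
  exact: H'.
have SE w : \sum_i xi i w * dB (a i) (b i) w = \sum_(l < n) y l w * dB (u l) (u l.+1) w.
  under [RHS]eq_bigr do rewrite /y /estep mulr_suml.
  rewrite exchange_big/=; apply: eq_bigr => i _.
  have [ka kan ka_] := ua i; have [kb kbn kb_] := ub i.
  have /andP[_ abi] := ab i.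
  have := @clip_telescope R R (fun r => W r w j 0) u n (a i) (b i) ka kb hu ka_ kb_ abi.
  rewrite un// => /(_ (bt i)) H.
  rewrite -(_ : W (b i) w j 0 - W (a i) w j 0 = dB (a i) (b i) w); last by rewrite /dW !mxE.
  rewrite -H; last by rewrite -ka_; apply: hu.
  rewrite mulr_sumr; apply: eq_bigr => l _; rewrite -mulrA; congr (_ * _).
  by rewrite /iind; case: ifP => _; rewrite ?mul1r ?mul0r// /dW !mxE.
have -> : [set w | eta <= `|\sum_i xi i w * dB (a i) (b i) w|] =
   [set w | eta <= `|\sum_(l < n) y l w * dB (u l) (u l.+1) w|].
  by apply/seteqP; split => w /=; rewrite SE.
apply: (transform_lenglart hu (u0 0%N) ay c0 e0 mG) => w Gw.
rewrite -lee_fin; apply: (le_trans _ (GI w Gw)).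
apply: (mesh_integral_le (v := fun l => y l w ^+ 2) (F := fun r => estep r w ^+ 2)) => //.
- by move=> l; exact: sqr_ge0.
- by move=> r; exact: sqr_ge0.
- apply: measurable_funX; apply: measurable_sum => i; apply: measurable_funM => //.
  exact: measurable_iind.
- by move=> l r ln H; rewrite /y (est l r w H).
Qed.

End elementary.

End lenglart.

(** * Moduli of continuity of paths *)

Section modulus.
Context {R : realType}.

Notation rq q := (ratr q : R).

Definition rcont (f : R -> R) := {within `[0, +oo[%classic, continuous f}.

Lemma rcont_ball (f : R -> R) x e : rcont f -> 0 <= x -> 0 < e ->
  exists2 r : R, 0 < r & forall y, 0 <= y -> `|y - x| < r -> `|f y - f x| < e.
Proof.
move=> /subspace_continuousP cf x0 e0.
have xA : `[0, +oo[%classic x by rewrite /= in_itv/= x0.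
have /cvgrPdist_lt/(_ e e0) := cf x xA.
rewrite near_withinE => /nbhs_ballP[r/= r0 H]; exists r => // y y0 yx.
rewrite distrC; apply: H; last by rewrite /= in_itv/= y0.
by rewrite /ball/= distrC.
Qed.

(** Compactness of [[0, t]] gives one index for all times. It serves for the modulus as
    [1 / (n + 1)] and for the bound as [n], so the condition weakens as [n] grows. *)
Lemma rcont_modulus (f : R -> R) (t om : R) : rcont f -> 0 <= t -> 0 < om -> exists n : nat,
  (forall r s, 0 <= r <= t -> 0 <= s <= t -> `|r - s| <= n.+1%:R^-1 -> `|f r - f s| <= om) /\
  (forall r, 0 <= r <= t -> `|f r| <= n%:R).
Proof.
move=> cf t0 om0.
pose Q (i : nat) (x : R) := (forall s, 0 <= s -> `|x - s| <= i.+1%:R^-1 -> `|f x - f s| <= om) /\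
  `|f x| <= i%:R.
have /compact_near_coveringP/near_covering_withinP K := @segment_compact R 0 t.
have [x|n _ H] := K nat \oo Q _.
  rewrite /= in_itv/= => /andP[x0 xt].
  have om2 : 0 < om / 2 by rewrite divr_gt0.
  have [r r0 Hr] := rcont_ball cf x0 om2.
  have r2 : 0 < r / 2 by rewrite divr_gt0.
  exists ([set y | `|y - x| < r / 2], [set i | i.+1%:R^-1 < r / 2 /\ `|f x| + om <= i%:R]).
    split; first by apply/nbhs_ballP; exists (r / 2) => // y /=; rewrite /ball/= distrC.
    apply: filterI; first exact: (near_infty_natSinv_lt (PosNum r2)).
    exact: nbhs_infty_ger.
  move=> [y i]/= [yx [ir fi]]; rewrite in_itv/= => /andP[y0 yt].
  have yr : `|y - x| < r by rewrite (lt_trans yx)// ltr_pdivrMr// ltr_pMr// ltr1n.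
  have h1 := Hr y y0 yr; split.
    move=> s s0 ys.
    have sx : `|s - x| < r.
      rewrite [r]splitr -(subrKA y) (le_lt_trans (ler_normD _ _))// ltrD//.
      by rewrite distrC; exact: le_lt_trans ys ir.
    have h2 := Hr s s0 sx.
    rewrite -(subrKA (f x)) (le_trans (ler_normD _ _))// [om]splitr lerD// ltW//.
    by rewrite distrC.
  apply: le_trans fi; rewrite -[f y](subrK (f x)) addrC (le_trans (ler_normD _ _))// lerD2l.
  by rewrite (le_trans (ltW h1))// ler_pdivrMr// ler_peMr// ?ler1n// ltW.
exists n; have {}H x : 0 <= x <= t -> Q n x by move=> xt; apply: (H n (leqnn n)); rewrite /= in_itv.
split; first by move=> r s rt /andP[s0 _] rs; exact: (proj1 (H r rt)).
by move=> r rt; exact: (proj2 (H r rt)).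
Qed.

Lemma rcont_rat (f : R -> R) (t om : R) (n : nat) : rcont f -> 0 <= t ->
  (forall q1 q2 : rat, 0 <= rq q1 <= t + 1 -> 0 <= rq q2 <= t + 1 ->
     `|rq q1 - rq q2| <= n.+1%:R^-1 -> `|f (rq q1) - f (rq q2)| <= om) ->
  (forall q : rat, 0 <= rq q <= t + 1 -> `|f (rq q)| <= n%:R) ->
  (forall r s, 0 <= r <= t -> 0 <= s <= t -> `|r - s| <= n.+1%:R^-1 / 2 -> `|f r - f s| <= om) /\
  (forall r, 0 <= r <= t -> `|f r| <= n%:R).
Proof.
move=> cf t0 H1 H2.
have n1 : 0 < n.+1%:R^-1 :> R by rewrite invr_gt0 ltr0n.
have n2 : n.+1%:R^-1 <= 1 :> R by rewrite invf_le1 ?ltr0n// ler1n.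
have pick (r e : R) : 0 <= r <= t -> 0 < e -> exists q : rat,
    [/\ 0 <= rq q <= t + 1, `|rq q - r| <= n.+1%:R^-1 / 4 & `|f (rq q) - f r| < e].
  move=> /andP[r0 rt] e0; have [d d0 Hd] := rcont_ball cf r0 e0.
  pose d' := Num.min d (n.+1%:R^-1 / 4).
  have d'0 : 0 < d' by rewrite lt_min d0 divr_gt0.
  have rd : r < r + d' by rewrite ltrDl.
  have [q] := rat_in_itvoo rd; rewrite in_itv/= => /andP[q1 q2].
  have qr : 0 < rq q - r by rewrite subr_gt0.
  have qd : rq q - r < d' by rewrite ltrBlDl.
  have dn : d' <= n.+1%:R^-1 / 4 by rewrite ge_min lexx orbT.
  have q0 : 0 <= rq q by exact: ltW (le_lt_trans r0 q1).
  exists q; split.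
  - rewrite q0/=; apply: (le_trans (ltW q2)); apply: lerD => //; apply: (le_trans dn).
    by rewrite ler_pdivrMr// mul1r (le_trans n2)// ler1n.
  - by rewrite ger0_norm ?(ltW qr)// (le_trans (ltW qd)).
  - by apply: Hd => //; rewrite gtr0_norm// (lt_le_trans qd)// ge_min lexx.
split.
  move=> r s rt st rs; apply/ler_addgt0Pr => e e0.
  have e2 : 0 < e / 2 by rewrite divr_gt0.
  have [q1 [a1 b1 c1]] := pick r _ rt e2; have [q2 [a2 b2 c2]] := pick s _ st e2.
  have h : `|f (rq q1) - f (rq q2)| <= om.
    apply: H1 => //.
    have -> : rq q1 - rq q2 = (rq q1 - r) + ((r - s) - (rq q2 - s)) by ring.
    apply: (le_trans (ler_normD _ _)); apply: (le_trans (lerD b1 (ler_normB _ _))).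
    move: (n.+1%:R^-1) (`|r - s|) (`|rq q2 - s|) rs b2 => a b' c' rs' b2'; lra.
  have -> : f r - f s = (f (rq q1) - f (rq q2)) + ((f (rq q2) - f s) - (f (rq q1) - f r)) by ring.
  apply: (le_trans (ler_normD _ _)); apply: lerD => //.
  apply: (le_trans (ler_normB _ _)); rewrite [e]splitr; exact: lerD (ltW c2) (ltW c1).
move=> r rt; apply/ler_addgt0Pr => e e0; have [q [a b c]] := pick r _ rt e0.
rewrite -(subKr (f (rq q)) (f r)).
apply: (le_trans (ler_normB _ _)); apply: lerD; [exact: H2|exact: ltW].
Qed.

End modulus.

Section path_modulus.
Context {R : realType} {disp : measure_display} {T : measurableType disp}.
Variable P : probability T R.
Notation rq q := (ratr q : R).

Lemma prob_nondecreasing (F : nat -> set T) (eps : R) : (forall n, measurable (F n)) ->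
  nondecreasing_seq F -> P (\bigcup_n F n) = 1%E -> 0 < eps ->
  exists n, fine (P (~` F n)) <= eps.
Proof.
move=> mF ndF F1 e0.
have mU : measurable (\bigcup_n F n) by exact: bigcupT_measurable.
have cvF : P \o F @ \oo --> 1%E by rewrite -F1; exact: nondecreasing_cvg_mu.
have /fine_cvg/cvgrPdist_lt/(_ _ e0) := cvF.
case=> n _ /(_ n (leqnn n)) /= H; exists n.
rewrite probability_setC// fineB// ?fin_num_measure//=.
by apply: (le_trans (ler_norm _)); exact: ltW.
Qed.

(** The events on which the index [n] serves as modulus and bound increase to a set of full measure,
    so a single [n] works outside an event of probability at most [eps]. *)
Lemma path_modulus (x : R -> T -> R) (t eps om : R) :
  (forall r, 0 <= r -> measurable_fun setT (x r)) ->
  {ae P, forall w, rcont (fun r => x r w)} -> 0 <= t -> 0 < eps -> 0 < om ->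
  exists (del M : R) (G : set T), [/\ 0 < del, 0 <= M, measurable G, fine (P (~` G)) <= eps &
   forall w, G w -> [/\ rcont (fun r => x r w),
     forall r s, 0 <= r <= t -> 0 <= s <= t -> `|r - s| <= del -> `|x r w - x s w| <= om &
     forall r, 0 <= r <= t -> `|x r w| <= M]].
Proof.
move=> mx [N [mN N0 HN]] t0 e0 om0.
have t10 : 0 <= t + 1 by rewrite addr_ge0.
pose inT (q : rat) := 0 <= rq q <= t + 1.
pose B n (q : rat * rat) :=
  [set w | [&& inT q.1, inT q.2 & `|rq q.1 - rq q.2| <= n.+1%:R^-1] ->
     `|x (rq q.1) w - x (rq q.2) w| <= om] `&`
  [set w | inT q.1 -> `|x (rq q.1) w| <= n%:R].
have mimp (b : bool) (U : T -> R) c : (b -> measurable_fun setT U) ->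
    measurable [set w | b -> `|U w| <= c].
  case: b => mU; last by rewrite (_ : mkset _ = setT)//; apply/seteqP; split.
  rewrite (_ : mkset _ = [set w | `|U w| <= c]); last by apply/seteqP; split => w /=; [exact|].
  rewrite -[X in measurable X]setTI; apply: measurable_fun_le => //.
  by apply: measurableT_comp => //; exact: mU.
have mB n q : measurable (B n q).
  apply: measurableI; apply: mimp.
    by move=> /and3P[/andP[q1 _] /andP[q2 _] _]; apply: measurable_funB; exact: mx.
  by move=> /andP[q1 _]; exact: mx.
pose A n := \bigcap_k (if unpickle k is Some q then B n q else setT).
have mA n : measurable (A n).
  by apply: bigcapT_measurable => k; case: unpickle.
have AP n w : A n w <-> forall q, B n q w.
  split=> [H q|H k _]; last by case: unpickle.
  by have := H (pickle q) I; rewrite pickleK.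
pose F n := A n `&` ~` N.
have mF n : measurable (F n) by apply: measurableI => //; exact: measurableC.
have ndF : nondecreasing_seq F.
  move=> i j ij; apply/subsetPset => w [Aw Nw]; split => //.
  apply/AP => q; have /AP/(_ q)[h1 h2] := Aw; split => /=.
    move=> /and3P[i1 i2 h]; apply: h1; apply/and3P; split => //; apply: (le_trans h).
    by rewrite lef_pV2 ?posrE ?ltr0n// ler_nat.
  by move=> i1; apply: (le_trans (h2 i1)); rewrite ler_nat.
have FU : \bigcup_n F n = ~` N.
  apply/seteqP; split => [w [n _ []]//|w Nw].
  have cw : rcont (fun r => x r w) by apply: contrapT => h; apply: Nw; exact: HN.
  have [n [h1 h2]] := rcont_modulus cw t10 om0.
  exists n => //; split => //; apply/AP => q; split => /=.
    by move=> /and3P[i1 i2 h]; exact: h1.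
  by move=> i1; exact: h2.
have FU1 : P (\bigcup_n F n) = 1%E by rewrite FU probability_setC// N0 sube0.
have [n Hn] := prob_nondecreasing mF ndF FU1 e0.
exists (n.+1%:R^-1 / 2), n%:R, (F n); split => //.
move=> w [/AP Aw Nw].
have cw : rcont (fun r => x r w) by apply: contrapT => h; apply: Nw; exact: HN.
have [|q|h1 h2] := @rcont_rat _ (fun r => x r w) t om n cw t0.
- move=> q1 q2 a1 a2 h; have [/= H _] := Aw (q1, q2).
  by apply: H; rewrite /inT a1 a2 h.
- by move=> a1; have [_ /= H] := Aw (q, q); exact: H.
by split.
Qed.

End path_modulus.

(** * Ito sums and Ito integrals *)

Section ito_sum.
Context {R : realType} {disp : measure_display} {T : measurableType disp}.
Variable P : probability T R.
Context {d m : nat} {X0 : T -> 'cV[R]_d} {W : R -> T -> 'cV[R]_m}.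
Hypothesis hP : measure_is_complete P.
Hypothesis hW : is_wiener P W.
Hypothesis hX0 : random_vector X0.
Hypothesis hind : indep_of_process P X0 W.
Variable j : 'I_m.
Notation FF t := (filt_gen P (X0 := X0) (W := W) t).
Notation dB s t w := (dW (W := W) s t j w).

Lemma cvg_to0_prob (U : nat -> T -> \bar R) (e eps : R) : cvg_to0_in_probability P U ->
  0 < e -> 0 < eps -> \forall n \near \oo, fine (P [set w | (e%:E <= U n w)%E]) < eps.
Proof.
move=> [mU /(_ e)] H e0 eps0; have /fine_cvg/cvgrPdist_lt/(_ _ eps0) := H e0.
apply: filterS => n /=; rewrite sub0r normrN; exact: le_lt_trans (ler_norm _).
Qed.

Lemma sp_time_mono (F : R -> set (set T)) t (H : simple_process F t) i k :
  (i <= k)%N -> (k <= sp_size H)%N -> sp_time H i <= sp_time H k.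
Proof.
move=> ik; elim: k ik => [|k IH]; first by rewrite leqn0 => /eqP ->.
rewrite leq_eqVlt => /orP[/eqP ->//|ik] kn.
by apply: (le_trans (IH ik (ltnW kn))); exact: sp_time_le.
Qed.

Lemma grid_locate (del r : R) n : 0 < r -> r <= n%:R * del -> exists l : 'I_n,
  l%:R * del < r <= l.+1%:R * del.
Proof.
move=> r0; elim: n => [|n IH] rn; first by move: rn; rewrite mul0r leNgt r0.
have [h|h] := leP r (n%:R * del); last by exists ord_max; rewrite h rn.
by have [l hl] := IH h; exists (widen_ord (leqnSn n) l).
Qed.

(** Subtracting the step process of [Y] from a simple process that approximates the integrand gives
    an elementary process whose square integral is small on a large event. [elementary_lenglart]
    then bounds its stochastic integral in probability, without moments of [Y]. *)
Lemma ito_sum_close (J : T -> R) (Y : R -> T -> R) (n : nat) (del t om c eta eps : R) (G0 : set T) :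
  0 <= del -> t = n%:R * del ->
  is_ito_integral P (filtration P X0 W) (fun s w => W s w j 0) Y t J ->
  (forall l, (l < n)%N -> adreal (FF (l%:R * del)) (Y (l%:R * del))) ->
  measurable G0 -> (forall w, G0 w -> measurable_fun `[0, t]%classic (fun r => Y r w)) ->
  (forall w l r, G0 w -> (l < n)%N -> l%:R * del < r <= l.+1%:R * del ->
     (Y r w - Y (l%:R * del) w) ^+ 2 <= om) ->
  0 < eta -> 0 < c -> 0 < eps -> 4 * om * t <= c -> 0 <= om ->
  fine (P [set w | 2 * eta <= `|J w - \sum_(l < n) Y (l%:R * del) w * dB (l%:R * del) (l.+1%:R * del) w|])
   <= c / eta ^+ 2 + fine (P (~` G0)) + 2 * eps.
Proof.
move=> del0 tE [mJ [H [cU cV]]] aY mG0 mY osc eta0 c0 eps0 omt om0.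
(* The square integral of the difference is at most [2 (c / 4) + 2 om t], which [4 om t <= c] makes
   at most [c]. *)
have c4 : 0 < c / 4 by rewrite divr_gt0.
have [N _ HN] := filterI (cvg_to0_prob cU c4 eps0) (cvg_to0_prob cV eta0 eps0).
have [UN VN] := HN N (leqnn N); move: (H N) (proj1 cU N) (proj1 cV N) UN VN => {HN cU cV H} H mU mV UN VN.
have t0 : 0 <= t by rewrite tE mulr_ge0.
pose ns := sp_size H.
pose I := ('I_ns + 'I_n)%type.
pose a (i : I) := match i with inl k => sp_time H k | inr l => l%:R * del end.
pose b (i : I) := match i with inl k => sp_time H k.+1 | inr l => l.+1%:R * del end.
pose xi (i : I) := match i with inl k => sp_val H k | inr l => (fun w => - Y (l%:R * del) w) end.
have sp0 k : (k <= ns)%N -> 0 <= sp_time H k.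
  by move=> kn; rewrite -(sp_time0 H); exact: sp_time_mono.
have spt k : (k <= ns)%N -> sp_time H k <= t.
  by move=> kn; apply: (le_trans (sp_time_mono kn (leqnn _))); rewrite sp_time_size.
have lt_ l : (l <= n)%N -> l%:R * del <= t by move=> ln; rewrite tE ler_wpM2r// ler_nat.
have ab i : 0 <= a i <= b i.
  case: i => [k|l] /=; first by rewrite sp0 ?(ltnW (ltn_ord k))//=; exact: sp_time_le.
  by rewrite mulr_ge0//= ler_wpM2r// ler_nat.
have bt i : b i <= t by case: i => [k|l] /=; [exact: spt|exact: lt_].
have axi i : adreal (FF (a i)) (xi i).
  case: i => [k|l] /=; first by apply/adrealP; exact: (sp_meas (ltn_ord k)).
  have aYl := aY l (ltn_ord l).
  by apply: (measurableT_comp (f := fun x : R => - x) _ aYl); exact: oppr_measurable.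
pose G := G0 `&` ~` [set w | ((c / 4)%:E <=
    \int[lebesgue_measure]_(r in `[0%R, t]%classic) ((sp_fun H r w - Y r w) ^+ 2)%:E)%E].
have mSU : measurable [set w | ((c / 4)%:E <=
    \int[lebesgue_measure]_(r in `[0%R, t]%classic) ((sp_fun H r w - Y r w) ^+ 2)%:E)%E].
  by rewrite -[X in measurable X]setTI; exact: emeasurable_fun_c_infty.
have mSV : measurable [set w | (eta%:E <= `|sp_integral H (fun s w => W s w j 0) w - J w|%:E)%E].
  by rewrite -[X in measurable X]setTI; exact: emeasurable_fun_c_infty.
have mG : measurable G by apply: measurableI => //; exact: measurableC.
have spE r w : sp_fun H r w = \sum_(k < ns) sp_val H k w * iind (sp_time H k) (sp_time H k.+1) r.
  by apply: eq_bigr => k _; rewrite iindE.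
have estE r w : estep a b xi r w = sp_fun H r w - \sum_(l < n) Y (l%:R * del) w * iind (l%:R * del) (l.+1%:R * del) r.
  rewrite /estep big_sumType/= spE -sumrN; congr (_ + _); apply: eq_bigr => l _.
  by rewrite mulNr.
have est_le w r : G0 w -> 0 <= r <= t ->
    estep a b xi r w ^+ 2 <= 2 * (sp_fun H r w - Y r w) ^+ 2 + 2 * om.
  (* Time 0 lies in none of the left-open intervals: the step process vanishes there. *)
  move=> Gw /andP[r0 rt]; have [->|rn0] := eqVneq r 0.
    have -> : estep a b xi 0 w = 0.
      rewrite /estep big1// => i _; have /andP[ai _] := ab i.
      by rewrite /iind ltNge ai mulr0.
    by rewrite expr0n/= addr_ge0// mulr_ge0 ?sqr_ge0.
  have r_gt0 : 0 < r by rewrite lt_def rn0.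
  rewrite tE in rt; have [l hl] := grid_locate r_gt0 rt.
  have E : \sum_(k < n) Y (k%:R * del) w * iind (k%:R * del) (k.+1%:R * del) r = Y (l%:R * del) w.
    rewrite (bigD1 l)//= big1 ?addr0 => [|k kl]; first by rewrite /iind hl mulr1.
    have [h1 h2] := andP hl; rewrite /iind.
    case: (ltngtP k l) => [kl'|lk|/val_inj e]; last by rewrite e eqxx in kl.
    - have k1 : k.+1%:R * del <= l%:R * del by rewrite ler_wpM2r// ler_nat.
      by rewrite [r <= _]leNgt (le_lt_trans k1 h1) andbF mulr0.
    - have k1 : l.+1%:R * del <= k%:R * del by rewrite ler_wpM2r// ler_nat.
      by rewrite ltNge (le_trans h2 k1) mulr0.
  have := osc w l r Gw (ltn_ord l) hl; rewrite estE E.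
  move: (sp_fun H r w) (Y r w) (Y (l%:R * del) w) => x y z h.
  have := sqr_ge0 ((x - y) - (y - z)).
  have -> : x - z = (x - y) + (y - z) by ring.
  by move: (x - y) (y - z) h => u v h; nra.
have mD : measurable (`[0, t]%classic : set R) by exact: measurable_itv.
have msp w D : measurable_fun D (fun r => sp_fun H r w).
  under eq_fun do rewrite spE.
  by apply: measurable_sum => k; apply: measurable_funM => //; exact: measurable_iind.
have mest w D : measurable_fun D (fun r => estep a b xi r w).
  by apply: measurable_sum => k; apply: measurable_funM => //; exact: measurable_iind.
have Gint w : G w -> (\int[lebesgue_measure]_(r in `[0%R, t]%classic) (estep a b xi r w ^+ 2)%:E <= c%:E)%E.
  move=> [Gw /negP/=]; rewrite -ltNge => Uw.
  have mdiff : measurable_fun `[0, t]%classic (fun r => (sp_fun H r w - Y r w) ^+ 2).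
    by apply: measurable_funX; apply: measurable_funB; [exact: msp|exact: mY].
  apply: (@le_trans _ _ (\int[lebesgue_measure]_(r in `[0%R, t]%classic)
     ((2 * (sp_fun H r w - Y r w) ^+ 2)%:E + (2 * om)%:E))%E).
    apply: ge0_le_integral => //.
    - by move=> r _; rewrite lee_fin sqr_ge0.
    - by apply/measurable_EFinP; apply: measurable_funX; exact: mest.
    - apply: emeasurable_funD => //; apply/measurable_EFinP; exact: measurable_funM.
    - move=> r; rewrite /= in_itv/= => rt; rewrite -EFinD lee_fin; exact: est_le.
  rewrite ge0_integralD//; last first.
  - by move=> r _; rewrite lee_fin mulr_ge0.
  - by apply/measurable_EFinP; exact: measurable_funM.
  - by move=> r _; rewrite lee_fin mulr_ge0 ?sqr_ge0.
  under eq_integral do rewrite EFinM.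
  rewrite ge0_integralZl//; last first.
  - by move=> r _; rewrite lee_fin sqr_ge0.
  - exact/measurable_EFinP.
  rewrite (_ : (\int[lebesgue_measure]_(r in `[0%R, t]%classic) (2 * om)%:E = (2 * om * t)%:E)%E); last first.
    transitivity ((2 * om)%:E * lebesgue_measure (`[0%R, t]%classic : set R))%E.
      exact: integral_cst.
    rewrite lebesgue_measure_itv/= lte_fin.
    case: ltP => [_|h]; first by rewrite oppr0 adde0 -EFinM.
    have -> : t = 0 by apply/le_anti; rewrite t0 h.
    by rewrite mule0 mulr0.
  have h1 := ltW Uw.
  apply: (@le_trans _ _ (2%:E * (c / 4)%:E + (2 * om * t)%:E)%E).
    by apply: leeD => //; apply: lee_wpmul2l.
  rewrite -EFinM -EFinD lee_fin; lra.
have LG := @elementary_lenglart R disp T P d m X0 W hP hW hX0 hind j I a b xi t t0 ab bt axi eta c G eta0 (ltW c0) mG Gint.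
have SE w : \sum_i xi i w * dB (a i) (b i) w =
    sp_integral H (fun s w => W s w j 0) w - \sum_(l < n) Y (l%:R * del) w * dB (l%:R * del) (l.+1%:R * del) w.
  rewrite big_sumType/= -sumrN; congr (_ + _); apply: eq_bigr => l _; last by rewrite mulNr.
  by rewrite /dW !mxE.
have mdB l : measurable_fun setT (dW (W := W) (l%:R * del) (l.+1%:R * del) j).
  apply: (dW_measurable hP hW hX0 j (s := l%:R * del) (t := l.+1%:R * del)).
  by rewrite mulr_ge0//= ler_wpM2r// ler_nat.
have mS : measurable_fun setT (fun w => \sum_(l < n) Y (l%:R * del) w * dB (l%:R * del) (l.+1%:R * del) w).
  by apply: measurable_sum => l; apply: measurable_funM => //; exact: (ad_meas hP hW hX0 (aY l (ltn_ord l))).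
have mxi : measurable_fun setT (fun w => \sum_i xi i w * dB (a i) (b i) w).
  apply: measurable_sum => i; apply: measurable_funM; first exact: (ad_meas hP hW hX0 (axi i)).
  exact: (dW_measurable hP hW hX0 j (ab i)).
have mset (S : T -> R) e : measurable_fun setT S -> measurable [set w | e <= `|S w|].
  move=> mS'; rewrite -[X in measurable X]setTI; apply: measurable_fun_le => //.
  exact: measurableT_comp.
have mA : measurable [set w | eta <= `|\sum_i xi i w * dB (a i) (b i) w|] by apply: mset; exact: mxi.
have mB : measurable [set w | 2 * eta <= `|J w - \sum_(l < n) Y (l%:R * del) w * dB (l%:R * del) (l.+1%:R * del) w|].
  by apply: mset; exact: measurable_funB.
have sub : [set w | 2 * eta <= `|J w - \sum_(l < n) Y (l%:R * del) w * dB (l%:R * del) (l.+1%:R * del) w|] `<=`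
   [set w | eta <= `|\sum_i xi i w * dB (a i) (b i) w|] `|`
   [set w | (eta%:E <= `|sp_integral H (fun s w => W s w j 0) w - J w|%:E)%E].
  move=> w /= h; rewrite lee_fin SE.
  have [h1|h1] := leP eta `|sp_integral H (fun s w => W s w j 0) w - J w|; first by right.
  left; move: h h1; move: (sp_integral _ _ _) (J w) (\sum_(l < n) _) => x y z h h1.
  have : `|y - z| <= `|x - z| + `|x - y|.
    have -> : y - z = (x - z) - (x - y) by ring.
    exact: ler_normB.
  lra.
apply: (le_trans (prob_le_U P mB mA mSV sub)).
have sub2 : ~` G `<=` ~` G0 `|` [set w | ((c / 4)%:E <=
    \int[lebesgue_measure]_(r in `[0%R, t]%classic) ((sp_fun H r w - Y r w) ^+ 2)%:E)%E].
  move=> w nG; have [Gw|] := pselect (G0 w); last by left.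
  by right; apply: contrapT => h; apply: nG.
have h3 := prob_le_U P (measurableC mG) (measurableC mG0) mSU sub2.
have h4 := ltW UN; have h5 := ltW VN.
apply: (le_trans (lerD LG h5)); rewrite mulr_natl mulr2n addrA lerD2r -!addrA lerD2l.
by apply: (le_trans h3); rewrite lerD2l.
Qed.

End ito_sum.

(** * Riemann sums *)

Section riemann.
Context {R : realType}.

Lemma lebesgue_oc (a b : R) : a <= b ->
  fine (lebesgue_measure (`]a, b]%classic : set R)) = b - a.
Proof.
move=> ab; rewrite lebesgue_measure_itv/= lte_fin; case: ltP => //= ba.
by apply/esym/eqP; rewrite subr_eq0; apply/eqP/le_anti; rewrite ab ba.
Qed.

Lemma lebesgue_oc_fin (a b : R) : (lebesgue_measure (`]a, b]%classic : set R) < +oo)%E.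
Proof. by rewrite lebesgue_measure_itv/=; case: ifP => _; rewrite ?ltry// -EFinB ltry. Qed.

Lemma Rintegral_oc_close (phi : R -> R) (a b c om : R) : a <= b ->
  lebesgue_measure.-integrable `]a, b]%classic (EFin \o phi) ->
  (forall r, a < r <= b -> `|phi r - c| <= om) ->
  `|(\int[lebesgue_measure]_(r in `]a, b]%classic) phi r) - (b - a) * c| <= (b - a) * om.
Proof.
move=> ab iphi H; have mD : measurable (`]a, b]%classic : set R) by exact: measurable_itv.
have icst (k : R) : lebesgue_measure.-integrable (`]a, b]%classic : set R) (EFin \o (fun=> k)).
  apply: measurable_bounded_integrable => //; first exact: lebesgue_oc_fin.
  exists `|k|; split; first exact: num_real.
  by move=> x kx y _; exact: ltW.
have Rc (k : R) : (\int[lebesgue_measure]_(r in `]a, b]%classic) k) = (b - a) * k.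
  by rewrite Rintegral_cst// (lebesgue_oc ab) mulrC.
have h1 : (b - a) * (c - om) <= \int[lebesgue_measure]_(r in `]a, b]%classic) phi r.
  rewrite -Rc; apply: le_Rintegral => // r; rewrite /= in_itv/= => rab.
  by have := H r rab; rewrite ler_norml => /andP[]; lra.
have h2 : \int[lebesgue_measure]_(r in `]a, b]%classic) phi r <= (b - a) * (c + om).
  rewrite -Rc; apply: le_Rintegral => // r; rewrite /= in_itv/= => rab.
  by have := H r rab; rewrite ler_norml => /andP[]; lra.
move: (Rintegral _ _ _) h1 h2 => x h1 h2; clear -h1 h2.
by rewrite ler_norml; rewrite mulrBr in h1; rewrite mulrDr in h2; lra.
Qed.

(** Right endpoints, to match the implicit drift. *)
Lemma riemann_close (phi : R -> R) (del om : R) n : 0 <= del ->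
  lebesgue_measure.-integrable `[0, n%:R * del]%classic (EFin \o phi) ->
  (forall l r, (l < n)%N -> l%:R * del < r <= l.+1%:R * del -> `|phi r - phi (l.+1%:R * del)| <= om) ->
  `|(\int[lebesgue_measure]_(r in `[0, n%:R * del]%classic) phi r) -
     \sum_(0 <= l < n) del * phi (l.+1%:R * del)| <= n%:R * del * om.
Proof.
move=> del0; elim: n => [|n IH] iphi H.
  by rewrite big_nil subr0 mul0r set_itv1 Rintegral_set1 normr0 mul0r.
have mD k : measurable (`[0, k%:R * del]%classic : set R) by exact: measurable_itv.
have n0 : 0 <= n%:R * del by rewrite mulr_ge0.
have nS : n%:R * del <= n.+1%:R * del by rewrite ler_wpM2r// ler_nat.
have S1 : `[0, n%:R * del]%classic `<=` (`[0, n.+1%:R * del]%classic : set R).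
  by move=> r /=; rewrite !in_itv/= => /andP[-> h]; exact: le_trans nS.
have S2 : `]n%:R * del, n.+1%:R * del]%classic `<=` (`[0, n.+1%:R * del]%classic : set R).
  by move=> r /=; rewrite !in_itv/= => /andP[h ->]; rewrite (le_trans n0 (ltW h)).
have i1 : lebesgue_measure.-integrable `[0, n%:R * del]%classic (EFin \o phi).
  by apply: integrableS iphi; [exact: mD|exact: mD|exact: S1].
have i2 : lebesgue_measure.-integrable `]n%:R * del, n.+1%:R * del]%classic (EFin \o phi).
  by apply: integrableS iphi; [exact: mD|exact: measurable_itv|exact: S2].
have E : (\int[lebesgue_measure]_(r in `[0, n.+1%:R * del]%classic) phi r) =
    (\int[lebesgue_measure]_(r in `[0, n%:R * del]%classic) phi r) +
    (\int[lebesgue_measure]_(r in `]n%:R * del, n.+1%:R * del]%classic) phi r).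
  rewrite -(Rintegral_itvB (x := n%:R * del) iphi); last 2 first.
  - by rewrite bnd_simp.
  - by rewrite bnd_simp.
  by rewrite addrC subrK.
have h1 := IH i1 (fun l r ln => H l r (ltnW ln)).
have h2 := Rintegral_oc_close nS i2 (fun r hr => H n r (ltnSn n) hr).
rewrite natS_step in h2.
rewrite E big_nat_recr//=.
move: (Rintegral _ _ _) (Rintegral _ _ _) (\sum_(0 <= l < n) _) h1 h2 => y x s h1 h2.
have -> : x + y - (s + del * phi (n.+1%:R * del)) = (x - s) + (y - del * phi (n.+1%:R * del)) by ring.
apply: (le_trans (ler_normD _ _)); apply: (le_trans (lerD h1 h2)).
by have -> : n.+1%:R * del * om = n%:R * del * om + del * om by rewrite -natr1; ring.
Qed.

End riemann.

Section vector_modulus.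
Context {R : realType} {disp : measure_display} {T : measurableType disp}.
Variable P : probability T R.

Lemma prob_le_sum (I : finType) (A : set T) (B : I -> set T) : measurable A ->
  (forall i, measurable (B i)) -> (forall w, A w -> exists i, B i w) ->
  fine (P A) <= \sum_i fine (P (B i)).
Proof.
move=> mA mB AB; rewrite -(EE_indic P mA).
have L i : L1 P (\1_(B i) : T -> R) by exact: L1_indic.
have -> : \sum_i fine (P (B i)) = EE P (fun w => \sum_i (\1_(B i) w : R)).
  by rewrite EE_sum//; apply: eq_bigr => i _; rewrite -(EE_indic P (mB i)).
apply: EE_le; [exact: L1_indic|exact: L1_sum|] => w.
have S0 : 0 <= \sum_i (\1_(B i) w : R) by apply: sumr_ge0 => i _; rewrite indicE.
rewrite indicE; case: (boolP (w \in A)) => // /set_mem/AB[i Bi].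
rewrite (bigD1 i)//= indicE mem_set//= lerDl; apply: sumr_ge0 => k _; by rewrite indicE.
Qed.

Lemma vector_modulus n (x : R -> T -> 'cV[R]_n) (t eps om : R) :
  (forall r, 0 <= r -> random_vector (x r)) ->
  {ae P, forall w, forall i, rcont (fun r => x r w i 0)} -> 0 <= t -> 0 < eps -> 0 < om ->
  exists (del M : R) (G : set T), [/\ 0 < del, 0 <= M, measurable G, fine (P (~` G)) <= eps &
   forall w, G w -> [/\ forall i, rcont (fun r => x r w i 0),
     forall r s, 0 <= r <= t -> 0 <= s <= t -> `|r - s| <= del -> sqn (x r w - x s w) <= om &
     forall r, 0 <= r <= t -> sqn (x r w) <= M]].
Proof.
move=> mx cx t0 e0 om0.
(* Shares [eps] and [om] among the coordinates; the added 1 covers dimension 0. *)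
pose n1 : R := n%:R + 1.
have n10 : 0 < n1 by rewrite ltr_wpDl.
pose om1 := Num.min 1 (om / n1).
have om10 : 0 < om1 by rewrite lt_min ltr01 divr_gt0.
have om1_le : n%:R * om1 ^+ 2 <= om.
  have h1 : om1 <= 1 by rewrite ge_min lexx.
  have h2 : om1 <= om / n1 by rewrite ge_min lexx orbT.
  have h3 : om1 ^+ 2 <= om1 by rewrite expr2 ler_piMl// ltW.
  apply: (@le_trans _ _ (n%:R * (om / n1))).
    by rewrite ler_wpM2l// (le_trans h3).
  by rewrite mulrCA ler_piMr ?(ltW om0)// ler_pdivrMr// mul1r lerDl.
have cxi i : {ae P, forall w, rcont (fun r => x r w i 0)}.
  by apply: filterS cx => w; exact.
have H i := @path_modulus R disp T P (fun r w => x r w i 0) t (eps / n1) om1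
  (fun r r0 => mx r r0 i) (cxi i) t0 (divr_gt0 e0 n10) om10.
suff [del [M [G [del0 M0 mG PG GP]]]] : exists (del M : R) (G : 'I_n -> set T),
    [/\ 0 < del, 0 <= M, forall i, measurable (G i), forall i, fine (P (~` G i)) <= eps / n1 &
   forall i w, G i w -> [/\ rcont (fun r => x r w i 0),
     forall r s, 0 <= r <= t -> 0 <= s <= t -> `|r - s| <= del -> `|x r w i 0 - x s w i 0| <= om1 &
     forall r, 0 <= r <= t -> `|x r w i 0| <= M]].
  exists del, (n%:R * M ^+ 2), (\bigcap_(i in [set: 'I_n]) G i).
  have mbG : measurable (\bigcap_(i in [set: 'I_n]) G i).
    by apply: fin_bigcap_measurable => //; exact: finite_finset.
  split => //.
  - by rewrite mulr_ge0 ?sqr_ge0.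
  - apply: (@le_trans _ _ (\sum_i fine (P (~` G i)))).
      apply: prob_le_sum; first exact: measurableC.
        by move=> i; exact: measurableC.
      move=> w nG; apply: contrapT => h; apply: nG => i _; apply: contrapT => nGi.
      by apply: h; exists i.
    apply: (@le_trans _ _ (\sum_(i < n) eps / n1)); first by apply: ler_sum => i _; exact: PG.
    rewrite sumr_const card_ord -[_ *+ n]mulr_natl mulrCA ler_piMr ?(ltW e0)//.
    by rewrite ler_pdivrMr// mul1r lerDl.
  - move=> w Gw; split.
    + by move=> i; have [] := GP i w (Gw i I).
    + move=> r s rt st rs; apply: (le_trans _ om1_le); rewrite sqnE.
      apply: (@le_trans _ _ (\sum_(i < n) om1 ^+ 2)); last by rewrite sumr_const card_ord -[_ *+ n]mulr_natl.
      apply: ler_sum => i _; rewrite !mxE -real_normK ?num_real// lerXn2r ?nnegrE ?(ltW om10)//.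
      by have [_ h _] := GP i w (Gw i I); exact: h.
    + move=> r rt; rewrite sqnE.
      apply: (@le_trans _ _ (\sum_(i < n) M ^+ 2)); last by rewrite sumr_const card_ord -[_ *+ n]mulr_natl.
      apply: ler_sum => i _; rewrite -real_normK ?num_real// lerXn2r ?nnegrE//.
      by have [_ _ h] := GP i w (Gw i I); exact: h.
have /choice[dl Hdl] := H.
have /choice[Ml HMl] := Hdl.
have /choice[Gl HGl] := HMl.
exists (\big[Num.min/1]_i dl i), (\sum_i Ml i), Gl.
have Ml0 i : 0 <= Ml i by case: (HGl i).
split.
- by elim/big_ind : _ => // [a b a0 b0|i _]; [rewrite lt_min a0|case: (HGl i)].
- by apply: sumr_ge0 => i _.
- by move=> i; case: (HGl i).
- by move=> i; case: (HGl i).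
move=> i w Gw; have [_ _ _ _ /(_ w Gw)[h1 h2 h3]] := HGl i; split => //.
  move=> r s rt st rs; apply: h2 => //; apply: (le_trans rs).
  by rewrite (bigD1 i)//= ge_min lexx.
move=> r rt; apply: (le_trans (h3 r rt)); rewrite (bigD1 i)//= lerDl.
by apply: sumr_ge0.
Qed.

End vector_modulus.

(** * The Euler recursion along the solution *)

Section euler_sum.
Context {R : realType} {disp : measure_display} {T : measurableType disp}.
Variable P : probability T R.
Context {d m : nat} {X0 : T -> 'cV[R]_d} {W : R -> T -> 'cV[R]_m}.
Variables (f : 'cV[R]_d -> 'cV[R]_d) (g : 'cV[R]_d -> 'M[R]_(d, m)).
Variables (ka c1 be : R) (X : R -> T -> 'cV[R]_d).
Hypothesis hP : measure_is_complete P.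
Hypothesis hW : is_wiener P W.
Hypothesis hX0 : random_vector X0.
Hypothesis hind : indep_of_process P X0 W.
Hypothesis ka1 : 1 <= ka.
Hypothesis c10 : 0 <= c1.
Hypothesis be0 : 0 <= be.
Hypothesis hf : forall x y,
  sqn (f x - f y) <= c1 * (1 + sqn x `^ (ka - 1) + sqn y `^ (ka - 1)) * sqn (x - y).
Hypothesis hg : forall x y, hs2 (g x - g y) <= be * sqn (x - y).
Hypothesis hX : is_sde_solution P f g W X0 X.
Notation FF t := (filt_gen P (X0 := X0) (W := W) t).
Notation dw s t w := (incr (W := W) s t w).

(** The backward Euler recursion with the solution inserted in both coefficients. It stands between
    [X], from which it differs by errors of Riemann and Ito sums, and the scheme, whose recursion it
    shares up to the arguments of the coefficients. *)
Definition euler_sum (del : R) (k : nat) (w : T) : 'cV[R]_d :=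
  X0 w + (del *: \sum_(0 <= l < k) f (X (l.+1%:R * del) w) +
    \sum_(0 <= l < k) g (X (l%:R * del) w) *m dw (l%:R * del) (l.+1%:R * del) w).

Lemma solution_adapted t : 0 <= t -> advec (FF t) (X t).
Proof. by move=> t0; apply/advecP => i; exact: (sde_adapted hX). Qed.

Lemma solution_meas t : 0 <= t -> random_vector (X t).
Proof. by move=> t0; exact: (adv_meas hP hW hX0 (solution_adapted t0)). Qed.

Lemma solution_cont : {ae P, forall w, forall i, rcont (fun r => X r w i 0)}.
Proof. exact: (sde_cont hX). Qed.

(** The path is continuous on the half-line only; cutting off its coordinates outside [[0, t]] makes
    it measurable on the whole line, where [measurable_econt] applies. *)
Lemma coef_measurable n (x : R -> 'cV[R]_n) (phi : 'cV[R]_n -> R) (t : R) :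
  (forall i, rcont (fun r => x r i 0)) -> econt phi ->
  measurable_fun `[0, t]%classic (fun r => phi (x r)).
Proof.
move=> cx ephi; pose D := `[0, t]%classic : set R.
have mD : measurable D by exact: measurable_itv.
pose y r : 'cV[R]_n := \col_i ((fun r => x r i 0) \_ D) r.
have my i : measurable_fun setT (fun r => y r i 0).
  under eq_fun do rewrite mxE.
  apply/(measurable_restrictT _ mD); apply: subspace_continuous_measurable_fun => //.
  have sub : D `<=` (`[0, +oo[%classic : set R).
    by move=> r; rewrite /D /= !in_itv/= => /andP[-> _].
  exact: (continuous_subspaceW sub (cx i)).
have m1 : measurable_fun D (fun r => phi (y r)).
  by apply: measurable_funTS; exact: (measurable_econt (phi := phi) my ephi).
apply: (eq_measurable_fun (fun r => phi (y r))) m1 => r rD; congr phi.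
by apply/colP => i; rewrite mxE patchE rD.
Qed.

Lemma euler_sumS del k w : euler_sum del k.+1 w = euler_sum del k w +
   (del *: f (X (k.+1%:R * del) w) + g (X (k%:R * del) w) *m dw (k%:R * del) (k.+1%:R * del) w).
Proof.
rewrite /euler_sum !big_nat_recr//= scalerDr.
move: (g _ *m _) (del *: f (X (k.+1%:R * del) w)) (del *: _) (\sum_(0 <= _ < _) _) => a b c e.
by vec.
Qed.

Lemma euler_sum_adapted del k : 0 <= del -> advec (FF (k%:R * del)) (euler_sum del k).
Proof.
move=> del0; have t0 l : 0 <= l%:R * del by rewrite mulr_ge0.
have tm l l' : (l <= l')%N -> l%:R * del <= l'%:R * del by move=> h; rewrite ler_wpM2r// ler_nat.
elim: k => [|k IH].
  rewrite (_ : euler_sum del 0 = X0); first exact: adv_X0.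
  by apply/funext => w; rewrite /euler_sum !big_nil scaler0 !addr0.
rewrite (_ : euler_sum del k.+1 = fun w => euler_sum del k w + del *: f (X (k.+1%:R * del) w) +
   g (X (k%:R * del) w) *m dw (k%:R * del) (k.+1%:R * del) w); last first.
  by apply/funext => w; rewrite euler_sumS addrA.
apply: meas_vadd; first apply: meas_vadd.
- by apply: adv_mono IH; exact: tm.
- apply: meas_vscale; apply: (advec_econt (solution_adapted (t0 k.+1))) => i.
  exact: (econt_drift ka1 c10 hf).
- apply: meas_mulmx; last by apply: adv_incr; rewrite t0 tm.
  apply: (adm_mono (tm _ _ (leqnSn k))).
  by apply: (admat_econt (solution_adapted (t0 k))) => i j; exact: (econt_diffusion be0 hg).
Qed.

Lemma euler_sum_close (t eta eps : R) : 0 <= t -> 0 < eta -> 0 < eps ->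
  exists2 del1 : R, 0 < del1 & forall del k, 0 < del <= del1 -> k%:R * del <= t ->
  fine (P [set w | eta <= sqn (X (k%:R * del) w - euler_sum del k w)]) <= eps.
Proof.
move=> t0 eta0 eps0.
pose nd : R := d%:R; pose nm : R := m%:R.
have nd0 : 0 <= nd by exact: ler0n.
have nm0 : 0 <= nm by exact: ler0n.
have dm0 : 0 <= nd * nm by exact: mulr_ge0.
(* Each of the [d m] Ito sums may fail with probability [4 e1], and the path modulus with
   probability [e1]. *)
pose e1 := eps / (4 * (nd * nm) + 2).
have den0 : 0 < 4 * (nd * nm) + 2 by lra.
have e10 : 0 < e1 by rewrite divr_gt0.
have e1E : e1 * (4 * (nd * nm) + 2) = eps by rewrite /e1 divfK// gt_eqF.
(* Per coordinate, the Riemann sum contributes [eta'] and each of the [m] Ito sums [2 eta']. *)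
pose K := 1 + 2 * nm.
have K1 : 1 <= K by rewrite lerDl mulr_ge0.
have K2 : 0 < (nd + 1) * K ^+ 2 by rewrite mulr_gt0 ?exprn_gt0//; lra.
pose eta' := Num.min 1 (eta / ((nd + 1) * K ^+ 2)).
have eta'0 : 0 < eta' by rewrite lt_min ltr01 divr_gt0.
have etaP : nd * (K * eta') ^+ 2 < eta.
  have h1 : eta' ^+ 2 <= eta' by rewrite expr2 ler_piMl ?(ltW eta'0)// ge_min lexx.
  have h2 : eta' * ((nd + 1) * K ^+ 2) <= eta.
    by rewrite -ler_pdivlMr// ge_min lexx orbT.
  have K20 : 0 < K ^+ 2 by rewrite exprn_gt0//; lra.
  rewrite exprMn; apply: (@lt_le_trans _ _ ((nd + 1) * K ^+ 2 * eta')); last by rewrite mulrC.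
  rewrite mulrA; apply: (@le_lt_trans _ _ (nd * K ^+ 2 * eta')).
    by rewrite ler_wpM2l// mulr_ge0// ltW.
  by rewrite ltr_pM2r// ltr_pM2r// ltrDl.
pose c := e1 * eta' ^+ 2.
have c0 : 0 < c by rewrite mulr_gt0 ?exprn_gt0.
(* A bound [M] for the paths comes first, since the Lipschitz constant of the drift depends on it;
   only then can the oscillation [om] be fixed and a second modulus be chosen. *)
have [delA [M [G1 [_ M0 mG1 PG1 G1P]]]] :=
  vector_modulus solution_meas solution_cont t0 (divr_gt0 e10 (ltr0n R 2)) ltr01.
have [L L0 LP] := drift_lip ka1 c10 hf M.
have t1 : 0 < t + 1 by lra.
pose om1 := eta' / (t + 1).
have om10 : 0 < om1 by rewrite divr_gt0.
have L1' : 0 < L + 1 by lra.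
have bt0 : 0 <= be * t by rewrite mulr_ge0.
have bt1 : 0 < 4 * (be * t) + 1 by lra.
(* The first entry keeps the oscillation of the drift below [om1], for the Riemann sums; the second
   meets the smallness condition of [ito_sum_close], used with [be om] in place of [om]. *)
pose om := Num.min (om1 ^+ 2 / (L + 1)) (c / (4 * (be * t) + 1)).
have om0 : 0 < om by rewrite lt_min !divr_gt0// exprn_gt0.
have omL : L * om <= om1 ^+ 2.
  apply: (@le_trans _ _ ((L + 1) * om)); first by rewrite ler_wpM2r ?(ltW om0)// lerDl.
  by rewrite mulrC -ler_pdivlMr// ge_min lexx.
have ombe s : 0 <= s <= t -> 4 * (be * om) * s <= c.
  move=> /andP[s0 st].
  have h : om * (4 * (be * t) + 1) <= c by rewrite -ler_pdivlMr// ge_min lexx orbT.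
  apply: (le_trans _ h); rewrite mulrDr mulr1.
  have := ler_wpM2l (mulr_ge0 be0 (ltW om0)) st; have := om0.
  by move=> h1 h2; apply: (@le_trans _ _ (4 * (be * om * t))); [rewrite -mulrA; lra|nra].
have [del1 [MB [G2 [del10 _ mG2 PG2 G2P]]]] :=
  vector_modulus solution_meas solution_cont t0 (divr_gt0 e10 (ltr0n R 2)) om0.
exists del1 => // del k /andP[del0 deld] kt.
have del_0 := ltW del0.
pose G := G1 `&` G2.
have mG : measurable G by exact: measurableI.
have PG : fine (P (~` G)) <= e1.
  have sub : ~` G `<=` ~` G1 `|` ~` G2 by rewrite /G setCI.
  have h := prob_le_U P (measurableC mG) (measurableC mG1) (measurableC mG2) sub.
  by apply: (le_trans h); have := lerD PG1 PG2; rewrite -splitr.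
have tl l : (l <= k)%N -> 0 <= l%:R * del <= t.
  by move=> lk; rewrite mulr_ge0//= (le_trans _ kt)// ler_wpM2r// ler_nat.
have osc w l r : G w -> (l < k)%N -> l%:R * del < r <= l.+1%:R * del ->
    [/\ 0 <= r <= t, sqn (X r w - X (l%:R * del) w) <= om & sqn (X r w - X (l.+1%:R * del) w) <= om].
  move=> [_ Gw] lk /andP[r1 r2]; have [_ H _] := G2P w Gw.
  have /andP[a1 _] := tl l (ltnW lk); have /andP[_ a2] := tl l.+1 lk.
  have rt : 0 <= r <= t by rewrite (ltW (le_lt_trans a1 r1)) (le_trans r2 a2).
  have rl : r - l%:R * del <= del by rewrite lerBlDl -[X in _ <= _ + X]mul1r -mulrDl natr1.
  have rl' : l.+1%:R * del - r <= del.
    by rewrite -natr1 mulrDl mul1r; lra.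
  split => //; apply: H => //; try exact: tl (ltnW lk); try exact: tl.
    by rewrite ger0_norm ?subr_ge0 ?(ltW r1)// (le_trans rl).
  by rewrite distrC ger0_norm ?subr_ge0// (le_trans rl').
have [J [HJ aeJ]] := sde_eq hX (proj1 (andP (tl k (leqnn k)))).
have aeD : {ae P, forall w, forall i, lebesgue_measure.-integrable `[0, k%:R * del]%classic
    (EFin \o (fun s : R => f (X s w) i 0))}.
  have H i := sde_drift_integrable hX (proj1 (andP (tl k (leqnn k)))) i.
  (* Coordinates are indexed by all naturals to use a countable intersection of almost sure events;
     indices from [d] on impose nothing. *)
  have H' n : {ae P, forall w, forall i : 'I_d, i = n :> nat ->
      lebesgue_measure.-integrable `[0, k%:R * del]%classic (EFin \o (fun s : R => f (X s w) i 0))}.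
    have [ltnd|ledn] := ltnP n d.
      by apply: filterS (H (Ordinal ltnd)) => w hw i e; rewrite (val_inj (e : val i = val (Ordinal ltnd))).
    by apply: aeW => w i e; have := ltn_ord i; rewrite e ltnNge ledn.
  by apply: filterS (ae_foralln H') => w hw i; exact: (hw i i).
have [N [mN N0 HN]] := filterI aeJ aeD.
pose Bad (ij : 'I_d * 'I_m) := [set w | 2 * eta' <= `|J ij.1 ij.2 w -
   \sum_(l < k) g (X (l%:R * del) w) ij.1 ij.2 * dW (W := W) (l%:R * del) (l.+1%:R * del) ij.2 w|].
have agX l i j : adreal (FF (l%:R * del)) (fun w => g (X (l%:R * del) w) i j).
  have h : 0 <= l%:R * del by rewrite mulr_ge0.
  exact: (admat_econt (solution_adapted h) (fun i j => econt_diffusion be0 hg i j) i j).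
have PBad ij : fine (P (Bad ij)) <= 4 * e1.
  case: ij => i j.
  have := @ito_sum_close R disp T P d m X0 W hP hW hX0 hind j (J i j) (fun s w => g (X s w) i j)
    k del (k%:R * del) (be * om) c eta' e1 G del_0 erefl (HJ i j) (fun l _ => agX l i j) mG.
  move=> H; apply: (le_trans (H _ _ eta'0 c0 e10 _ _)).
  - move=> w [Gw _]; have [cw _ _] := G1P w Gw.
    exact: (@coef_measurable d (fun r => X r w) (fun x => g x i j) (k%:R * del) cw
      (econt_diffusion be0 hg i j)).
  - move=> w l r Gw lk hr; have [_ h _] := osc w l r Gw lk hr.
    have := hs2_entry (g (X r w) - g (X (l%:R * del) w)) i j; rewrite !mxE => /le_trans; apply.
    by apply: (le_trans (hg _ _)); rewrite ler_wpM2l.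
  - exact: ombe (tl k (leqnn k)).
  - by rewrite mulr_ge0// ltW.
  have -> : c / eta' ^+ 2 = e1 by rewrite /c mulfK// gt_eqF// exprn_gt0.
  by lra.
have mBad ij : measurable (Bad ij).
  rewrite -[X in measurable X]setTI; apply: measurable_fun_le => //.
  apply: measurableT_comp => //; apply: measurable_funB; first by have [] := HJ ij.1 ij.2.
  apply: measurable_sum => l; apply: measurable_funM.
    exact: (ad_meas hP hW hX0 (agX l ij.1 ij.2)).
  apply: (dW_measurable hP hW hX0 ij.2 (s := l%:R * del) (t := l.+1%:R * del)).
  by rewrite mulr_ge0//= ler_wpM2r// ler_nat.
pose B (o : (bool + ('I_d * 'I_m))%type) :=
  match o with inl true => N | inl false => ~` G | inr ij => Bad ij end.
have mB o : measurable (B o).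
  by case: o => [[]|ij] //=; exact: measurableC.
have mA : measurable [set w | eta <= sqn (X (k%:R * del) w - euler_sum del k w)].
  rewrite -[X in measurable X]setTI; apply: measurable_fun_le => //.
  apply: meas_sqn; apply: meas_vsub.
    by apply: solution_meas; rewrite mulr_ge0.
  exact: (adv_meas hP hW hX0 (@euler_sum_adapted del k del_0)).
have AB w : eta <= sqn (X (k%:R * del) w - euler_sum del k w) -> exists o, B o w.
  move=> Aw; apply: contrapT => nB.
  have nN : ~ N w by move=> h; apply: nB; exists (inl true).
  have Gw : G w by apply: contrapT => h; apply: nB; exists (inl false).
  have nBad ij : ~ Bad ij w by move=> h; apply: nB; exists (inr ij).
  have [E I] : [set w | forall i,
      X (k%:R * del) w i 0 = X0 w i 0
        + (\int[lebesgue_measure]_(s in `[0%R, k%:R * del]%classic) f (X s w) i 0)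
        + \sum_(j < m) J i j w] w /\ (forall i, lebesgue_measure.-integrable `[0, k%:R * del]%classic
    (EFin \o (fun s : R => f (X s w) i 0))).
    by apply: contrapT => h; apply: nN; exact: HN.
  suff H i : `|(X (k%:R * del) w - euler_sum del k w) i 0| <= K * eta'.
    have : sqn (X (k%:R * del) w - euler_sum del k w) <= nd * (K * eta') ^+ 2.
      rewrite sqnE; apply: (@le_trans _ _ (\sum_(i < d) (K * eta') ^+ 2)).
        apply: ler_sum => i _; rewrite -real_normK ?num_real// lerXn2r ?nnegrE//.
        by rewrite mulr_ge0 ?(ltW eta'0)//; lra.
      by rewrite sumr_const card_ord -[_ *+ d]mulr_natl.
    by move=> h; have := lt_le_trans (le_lt_trans h etaP) Aw; rewrite ltxx.
  pose phi (s : R) : R := f (X s w) i 0.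
  have Rc : `|(\int[lebesgue_measure]_(r in `[0, k%:R * del]%classic) phi r) -
     \sum_(0 <= l < k) del * phi (l.+1%:R * del)| <= k%:R * del * om1.
    apply: (riemann_close (phi := phi) del_0 (I i)) => l r lk hr; have [rt _ h] := osc w l r Gw lk hr.
    have [_ _ bd] := G1P w (proj1 Gw).
    have h1 := LP _ _ (bd r rt) (bd _ (tl l.+1 lk)).
    rewrite -(@ler_pXn2r _ 2) ?nnegrE ?(ltW om10)// real_normK ?num_real//.
    have := sqn_entry (f (X r w) - f (X (l.+1%:R * del) w)) i; rewrite !mxE => /le_trans; apply.
    by apply: (le_trans h1); apply: (le_trans _ omL); rewrite ler_wpM2l.
  have Rc' : k%:R * del * om1 <= eta'.
    apply: (@le_trans _ _ ((t + 1) * om1)); first by rewrite ler_wpM2r ?(ltW om10)//; lra.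
    by rewrite /om1 mulrC divfK// gt_eqF.
  have Sj j : `|J i j w - \sum_(l < k) g (X (l%:R * del) w) i j *
      dW (W := W) (l%:R * del) (l.+1%:R * del) j w| <= 2 * eta'.
    by have /negP := nBad (i, j); rewrite /= -ltNge => /ltW.
  have -> : (X (k%:R * del) w - euler_sum del k w) i 0 =
     ((\int[lebesgue_measure]_(r in `[0, k%:R * del]%classic) phi r) -
     \sum_(0 <= l < k) del * phi (l.+1%:R * del)) +
     \sum_(j < m) (J i j w - \sum_(l < k) g (X (l%:R * del) w) i j *
      dW (W := W) (l%:R * del) (l.+1%:R * del) j w).
    rewrite !mxE E !summxE sumrB.
    have -> : \sum_(0 <= l < k) (g (X (l%:R * del) w) *m dw (l%:R * del) (l.+1%:R * del) w) i 0 =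
       \sum_(j < m) \sum_(l < k) g (X (l%:R * del) w) i j * dW (W := W) (l%:R * del) (l.+1%:R * del) j w.
      rewrite exchange_big big_mkord; apply: eq_bigr => l _; rewrite mxE; apply: eq_bigr => j _ //.
    rewrite -mulr_sumr /phi.
    by move: (Rintegral _ _ _) (\sum_(j < m) J i j w) (\sum_(j < m) _) (\sum_(0 <= l < k) _) => a b e q; ring.
  apply: (le_trans (ler_normD _ _)); rewrite /K mulrDl mul1r lerD ?(le_trans Rc)//.
  apply: (le_trans (ler_norm_sum _ _ _)).
  apply: (@le_trans _ _ (\sum_(j < m) 2 * eta')); first exact: ler_sum.
  by rewrite sumr_const card_ord -[_ *+ m]mulr_natl /nm mulrCA mulrA.
apply: (le_trans (prob_le_sum P mA mB AB)).
rewrite big_sumType/= big_bool/= N0 /= add0r.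
have h : \sum_(ij : 'I_d * 'I_m) fine (P (Bad ij)) <= (nd * nm) * (4 * e1).
  apply: (@le_trans _ _ (\sum_(ij : 'I_d * 'I_m) 4 * e1)); first exact: ler_sum.
  by rewrite sumr_const card_prod !card_ord -[_ *+ _]mulr_natl natrM.
apply: (le_trans (lerD PG h)); rewrite -e1E mulrDr.
have : 0 <= e1 * (nd * nm) by rewrite mulr_ge0// ltW.
by move: (nd * nm) => q; lra.
Qed.

End euler_sum.

(** * Convergence in probability *)

Section scaling.
Context {R : realType} {disp : measure_display} {T : measurableType disp}.

Lemma hs2Z n k (c : R) (M : 'M[R]_(n, k)) : hs2 (c *: M) = c ^+ 2 * hs2 M.
Proof.
rewrite /hs2 mulr_sumr; apply: eq_bigr => i _; rewrite mulr_sumr; apply: eq_bigr => l _.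
by rewrite mxE exprMn.
Qed.

Lemma meas_scalev n (c : T -> R) (Y : T -> 'cV[R]_n) : measurable_fun setT c ->
  random_vector Y -> random_vector (fun w => c w *: Y w).
Proof. by move=> mc mY i; under eq_fun do rewrite mxE; exact: measurable_funM. Qed.

Lemma meas_scaleM n k (c : T -> R) (Y : T -> 'M[R]_(n, k)) : measurable_fun setT c ->
  measM Y -> measM (fun w => c w *: Y w).
Proof. by move=> mc mY i l; under eq_fun do rewrite mxE; exact: measurable_funM. Qed.

End scaling.

Section convergence.
Context {R : realType} {disp : measure_display} {T : measurableType disp}.
Variable P : probability T R.
Context {d m : nat} {X0 : T -> 'cV[R]_d} {W : R -> T -> 'cV[R]_m}.
Variables (f : 'cV[R]_d -> 'cV[R]_d) (g : 'cV[R]_d -> 'M[R]_(d, m)).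
Variables (pst al ka c1 be : R) (X : R -> T -> 'cV[R]_d).
Hypothesis hP : measure_is_complete P.
Hypothesis hW : is_wiener P W.
Hypothesis hX0 : random_vector X0.
Hypothesis hind : indep_of_process P X0 W.
Hypothesis pst1 : 1 < pst.
Hypothesis al0 : 0 < al.
Hypothesis ka1 : 1 <= ka.
Hypothesis c10 : 0 <= c1.
Hypothesis be0 : 0 <= be.
Hypothesis hmon : forall x y,
  inner (x - y) (f x - f y) + (2 * pst - 1) / 2 * hs2 (g x - g y) <= - al * sqn (x - y).
Hypothesis hf : forall x y,
  sqn (f x - f y) <= c1 * (1 + sqn x `^ (ka - 1) + sqn y `^ (ka - 1)) * sqn (x - y).
Hypothesis hg : forall x y, hs2 (g x - g y) <= be * sqn (x - y).
Hypothesis hX : is_sde_solution P f g W X0 X.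
Notation FF t := (filt_gen P (X0 := X0) (W := W) t).
Notation dw s t w := (incr (W := W) s t w).
Notation Xt del k w := (euler_sum (X0 := X0) (W := W) f g X del k w).

Section stopping.
Variables (M del : R) (L : nat).
Hypothesis del0 : 0 < del.
Notation Xk k w := (X (k%:R * del) w).

(* Indicator of the event that neither the initial value nor the solution at the
   grid times up to [k] leaves the ball of squared radius [M], and [k <= L]. *)
Fixpoint stop (k : nat) (w : T) : R :=
  if k is k'.+1 then stop k' w * ((k <= L)%N%:R * ((sqn (Xk k w) <= M)%R : nat)%:R)
  else ((sqn (X0 w) <= M)%R : nat)%:R * ((sqn (Xk 0%N w) <= M)%R : nat)%:R.

Lemma stop01 k w : stop k w = 0 \/ stop k w = 1.
Proof.
elim: k => [|k IH] /=.
  by case: (_ <= _); case: (_ <= _); rewrite ?mulr0 ?mul0r ?mulr1; [right|left|left|left].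
case: IH => ->; first by left; rewrite mul0r.
rewrite mul1r; case: ltnP => _ /=; last by left; rewrite mul0r.
by case: leP => _ /=; [right; rewrite mulr1|left; rewrite mulr0].
Qed.

Lemma stop_ge0 k w : 0 <= stop k w.
Proof. by case: (stop01 k w) => ->. Qed.

Lemma stop_sqr k w : stop k w ^+ 2 = stop k w.
Proof. by case: (stop01 k w) => ->; rewrite ?expr0n ?expr1n. Qed.

Lemma stopS k w : stop k.+1 w = 1 -> [/\ stop k w = 1, (k < L)%N & sqn (Xk k.+1 w) <= M].
Proof.
rewrite /=; case: (stop01 k w) => ->; first by rewrite mul0r => /eqP; rewrite eq_sym oner_eq0.
case: ltnP => /= h; last by rewrite mul0r mulr0 => /eqP; rewrite eq_sym oner_eq0.
case: leP => /= h2 //; by rewrite !mulr0 => /eqP; rewrite eq_sym oner_eq0.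
Qed.

Lemma stop_prev k l w : (l <= k)%N -> stop k w = 1 -> stop l w = 1.
Proof.
elim: k => [|k IH]; first by rewrite leqn0 => /eqP ->.
by rewrite leq_eqVlt => /orP[/eqP ->//|lk] /stopS[h _ _]; exact: IH.
Qed.

Lemma stop1_bound k w : stop k w = 1 -> sqn (X0 w) <= M /\ sqn (Xk k w) <= M.
Proof.
move=> h; have := stop_prev (leq0n k) h; rewrite /=.
case: leP => h0 /=; last by rewrite mul0r => /eqP; rewrite eq_sym oner_eq0.
case: leP => h1 /=; last by rewrite mulr0 => /eqP; rewrite eq_sym oner_eq0.
by split => //; case: k h => [//|k] /stopS[].
Qed.

Lemma stop_intro k w : (k <= L)%N -> sqn (X0 w) <= M ->
  (forall l, (l <= k)%N -> sqn (Xk l w) <= M) -> stop k w = 1.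
Proof.
move=> + h0; elim: k => [|k IH] kL H /=; first by rewrite h0 H ?mulr1.
by rewrite kL H ?leqnn// IH ?mulr1//; [exact: ltnW|move=> l lk; apply: H; exact: leqW].
Qed.

Lemma stop_gt k w : (L < k)%N -> stop k w = 0.
Proof. by case: k => [//|k]; rewrite ltnS /= => Lk; rewrite ltnNge Lk mul0r mulr0. Qed.

Lemma meas_le_indic d' (T' : measurableType d') (U : T' -> R) : measurable_fun setT U ->
  measurable_fun setT (fun w => ((U w <= M)%R : nat)%:R : R).
Proof.
move=> mU; rewrite (_ : (fun w => _) = \1_(`]-oo, M]%classic : set R) \o U); last first.
  apply/funext => w /=; rewrite indicE; congr (nat_of_bool _)%:R.
  by apply/idP/idP; rewrite inE/= in_itv.
by apply: measurableT_comp => //; apply: measurable_indic; exact: measurable_itv.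
Qed.

Lemma grid_ge0 k : 0 <= k%:R * del.
Proof. by rewrite mulr_ge0// ltW. Qed.

Lemma grid_le k l : (k <= l)%N -> k%:R * del <= l%:R * del.
Proof. by move=> h; rewrite ler_pM2r// ler_nat. Qed.

Lemma stop_adapted k : adreal (FF (k%:R * del)) (stop k).
Proof.
elim: k => [|k IH].
  apply: measurable_funM; apply: meas_le_indic; apply: meas_sqn; first exact: adv_X0.
  by apply: (solution_adapted hX); rewrite mul0r.
apply: measurable_funM; first exact: (ad_mono (grid_le (leqnSn k)) IH).
apply: measurable_funM => //; apply: meas_le_indic; apply: meas_sqn.
exact: (solution_adapted hX (grid_ge0 k.+1)).
Qed.

End stopping.

(** Before stopping, the coefficients along [X] are bounded in terms of [M], so the drift sum is
    bounded outright. In the noise sum each coefficient may carry its own indicator, as [stop k = 1]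
    forces [stop l = 1] for [l <= k]; it thus becomes a martingale transform of bounded
    coefficients. *)
Lemma stopped_moment (M t s : R) : 1 <= s -> 0 <= M -> 0 <= t -> exists2 C : R, 0 <= C &
  forall del L, 0 < del -> L%:R * del <= t -> forall k,
  L1 P (fun w => stop M del L k w * sqn (Xt del k w) `^ s) /\
  EE P (fun w => stop M del L k w * sqn (Xt del k w) `^ s) <= C.
Proof.
move=> s1 M0 t0; have s0 : 0 <= s by exact: (le_trans ler01).
have [Cf Cf0 CfP] := drift_growth ka1 c10 hf.
have [Cg Cg0 CgP] := diffusion_growth be0 hg.
have [C3 C30 C3P] := @martingale_transform_moment R disp T P d m W hP hW s s1.
pose F := Cf * (1 + M `^ ka); pose B := (Cg * (1 + M)) `^ s.
have F0 : 0 <= F by rewrite mulr_ge0 ?addr_ge0 ?powR_ge0.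
have B0 : 0 <= B by exact: powR_ge0.
pose K : R := 2 `^ s * 2 `^ s.
have K0 : 0 <= K by rewrite mulr_ge0 ?powR_ge0.
have tF0 : 0 <= (t ^+ 2 * F) `^ s by exact: powR_ge0.
have D0 : 0 <= C3 * t `^ s * B by rewrite !mulr_ge0 ?powR_ge0.
have KM0 : 0 <= M `^ s + K * (t ^+ 2 * F) `^ s by rewrite addr_ge0 ?mulr_ge0 ?powR_ge0.
have C'0 : 0 <= K * (M `^ s + K * (t ^+ 2 * F) `^ s) + K * K * (C3 * t `^ s * B).
  exact: (addr_ge0 (mulr_ge0 K0 KM0) (mulr_ge0 (mulr_ge0 K0 K0) D0)).
exists (K * (M `^ s + K * (t ^+ 2 * F) `^ s) + K * K * (C3 * t `^ s * B)).
  exact: C'0.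
move=> del L del0 Lt k; have del_0 := ltW del0.
set chi := stop M del L.
have chi0 w : 0 <= chi k w by exact: stop_ge0.
have achi l : adreal (FF (l%:R * del)) (chi l) by exact: stop_adapted.
pose S k w := \sum_(0 <= l < k) (chi l w *: g (X (l%:R * del) w)) *m dw (l%:R * del) (l.+1%:R * del) w.
have hchi l w : hs2 (chi l w *: g (X (l%:R * del) w)) <= Cg * (1 + M).
  rewrite hs2Z stop_sqr; case: (stop01 M del L l w) => h; rewrite /chi h ?mul0r ?mul1r.
    by rewrite mulr_ge0 ?addr_ge0.
  have [_ h1] := stop1_bound h; apply: (le_trans (CgP _)).
  by rewrite ler_wpM2l// lerD2l.
have aG l : admat (FF (l%:R * del)) (fun w => chi l w *: g (X (l%:R * del) w)).
  apply: meas_scaleM; first exact: achi.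
  have h := solution_adapted hX (grid_ge0 del0 l).
  by apply: (admat_econt h) => i j; exact: (econt_diffusion be0 hg).
have LS : L1 P (fun w => sqn (S k w) `^ s) /\ ((k <= L)%N -> EE P (fun w => sqn (S k w) `^ s) <= C3 * t `^ s * B).
  have [k0|k0] := posnP k.
    have E w : sqn (S k w) `^ s = 0.
      by rewrite k0 /S big_nil sqn0 powR0// gt_eqF// (lt_le_trans ltr01).
    by split; [apply: (eq_L1 E); exact: L1_cst|rewrite (eq_EE P E) EE_cst].
  have [||||L1' E1'] := C3P X0 hX0 hind k 0 del (fun=> 1) d (fun l w => chi l w *: g (X (l%:R * del) w)) B
    k0 (lexx 0) del0 _ _ _ _ k (leqnn k).
  - exact: measurable_cst.
  - by [].
  - by move=> l; rewrite add0r; exact: aG.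
  - move=> l lk; have hl w : 0 <= 1 * hs2 (chi l w *: g (X (l%:R * del) w)) `^ s <= B.
      rewrite mul1r powR_ge0/=; apply: ge0_ler_powR; rewrite ?nnegrE ?hs2_ge0//.
      by rewrite mulr_ge0 ?addr_ge0.
    have mh : measurable_fun setT (fun w => 1 * hs2 (chi l w *: g (X (l%:R * del) w)) `^ s).
      apply: measurable_funM => //; apply: meas_powR; apply: meas_hs2.
      exact: (adm_meas hP hW hX0 (aG l)).
    have Lh := L1_le0 mh (L1_cst P B) hl; split; first exact: Lh.
    rewrite -[leRHS](EE_cst P); apply: EE_le => //; first exact: L1_cst.
    by move=> w; case/andP: (hl w).
  have E w : sqn (S k w) `^ s = 1 * sqn (\sum_(0 <= i < k) (chi i w *: g (X (i%:R * del) w)) *m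
       dw (0 + i%:R * del) (0 + i.+1%:R * del) w) `^ s.
    by rewrite mul1r /S; congr (sqn _ `^ _); apply: eq_bigr => l _; rewrite !add0r.
  split; first exact: (eq_L1 E).
  move=> kL; rewrite (eq_EE P E); apply: (le_trans E1'); rewrite ler_wpM2r// ler_wpM2l//.
  apply: ge0_ler_powR; rewrite ?nnegrE// ?grid_ge0//.
  by apply: (le_trans _ Lt); exact: grid_le.
have [LS1 ES] := LS.
pose V w := K * (M `^ s + K * (t ^+ 2 * F) `^ s) + K * K * sqn (S k w) `^ s.
have LV : L1 P V by apply: L1D; [exact: L1_cst|exact: L1Z].
have V0 w : 0 <= V w := addr_ge0 (mulr_ge0 K0 KM0) (mulr_ge0 (mulr_ge0 K0 K0) (powR_ge0 _ _)).
have UV w : 0 <= chi k w * sqn (Xt del k w) `^ s <= V w.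
  rewrite mulr_ge0 ?powR_ge0//=.
  case: (stop01 M del L k w) => h; rewrite /chi h ?mul0r ?mul1r//.
  have kL : (k <= L)%N.
    by rewrite leqNgt; apply/negP => Lk; move: h; rewrite stop_gt// => /eqP; rewrite eq_sym oner_eq0.
  have [X0M _] := stop1_bound h.
  have SE : S k w = \sum_(0 <= l < k) g (X (l%:R * del) w) *m dw (l%:R * del) (l.+1%:R * del) w.
    apply: eq_big_nat => l /andP[_ lk].
    by rewrite /chi (stop_prev (ltnW lk) h) scale1r.
  have DF : sqn (del *: \sum_(0 <= l < k) f (X (l.+1%:R * del) w)) <= t ^+ 2 * F.
    have h1 : \sum_(0 <= l < k) sqn (f (X (l.+1%:R * del) w)) <= k%:R * F.
      apply: (@le_trans _ _ (\sum_(0 <= l < k) F)); last by rewrite sumr_const_nat subn0 mulr_natl.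
      rewrite big_nat [leRHS]big_nat; apply: ler_sum => l /andP[_ lk].
      have [_ h2] := stop1_bound (stop_prev lk h).
      apply: (le_trans (CfP _)); rewrite ler_wpM2l// lerD2l.
      by apply: ge0_ler_powR; rewrite ?nnegrE ?sqn_ge0// (le_trans ler01).
    have h2 := sqn_sum (index_iota 0 k) (fun l => f (X (l.+1%:R * del) w)).
    rewrite size_iota subn0 in h2.
    rewrite sqnZ; apply: (@le_trans _ _ (del ^+ 2 * (k%:R * (k%:R * F)))).
      by rewrite ler_wpM2l ?sqr_ge0// (le_trans h2)// ler_wpM2l.
    have -> : del ^+ 2 * (k%:R * (k%:R * F)) = (k%:R * del) ^+ 2 * F by ring.
    rewrite ler_wpM2r// lerXn2r ?nnegrE ?grid_ge0//.
    by apply: (le_trans _ Lt); exact: grid_le.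
  rewrite /euler_sum -SE; apply: (le_trans (sqnD_powR _ _ s0)).
  rewrite /V -/K mulrDr -[K * K * _]mulrA -!mulrDr ler_wpM2l// -addrA; apply: lerD.
    by apply: ge0_ler_powR; rewrite ?nnegrE ?sqn_ge0.
  apply: (le_trans (sqnD_powR _ _ s0)); rewrite -/K -mulrDr ler_wpM2l// lerD2r.
  by apply: ge0_ler_powR; rewrite ?nnegrE ?sqn_ge0// mulr_ge0 ?sqr_ge0.
have mU : measurable_fun setT (fun w => chi k w * sqn (Xt del k w) `^ s).
  apply: measurable_funM; first exact: (ad_meas hP hW hX0 (achi k)).
  apply: meas_powR; apply: meas_sqn.
  exact: (adv_meas hP hW hX0 (euler_sum_adapted ka1 c10 be0 hf hg hX (k := k) del_0)).
have LU := L1_le0 mU LV UV; split; first exact: LU.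
have [kL|Lk] := leqP k L; last first.
  have E w : chi k w * sqn (Xt del k w) `^ s = 0 by rewrite /chi stop_gt// mul0r.
  by rewrite (eq_EE P E) EE_cst.
apply: (le_trans (EE_le LU LV (fun w => proj2 (andP (UV w))))).
rewrite (EED (L1_cst P _) (L1Z _ LS1)) EE_cst (EEZ _ LS1) lerD2l.
by rewrite ler_wpM2l ?mulr_ge0// ES.
Qed.

Notation Psi M del L k w := (stop M del L k w * (be * sqn (X (k%:R * del) w - Xt del k w) +
  sqn (f (X (k%:R * del) w) - f (Xt del k w)))).

(** [x] is confined to a ball but [y] is not, so the defect is controlled only through a power of
    [|y|]. The square is what the uniform integrability argument of [stopped_defect] uses. *)
Lemma defect_growth (M : R) : 0 <= M -> exists2 K : R, 0 <= K & forall x y,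
  sqn x <= M -> (be * sqn (x - y) + sqn (f x - f y)) ^+ 2 <= K * (1 + sqn y `^ (2 * ka)).
Proof.
move=> M0; have [Cf Cf0 CfP] := drift_growth ka1 c10 hf.
have ka0 : 0 <= ka by exact: (le_trans ler01).
pose A := 2 * be * (M + 1) + 2 * Cf * (2 + M `^ ka).
have Mk0 := powR_ge0 M ka.
have A0 : 0 <= A by rewrite addr_ge0 ?mulr_ge0 ?addr_ge0.
exists (2 * A ^+ 2); first by rewrite mulr_ge0 ?sqr_ge0.
move=> x y xM; set z := sqn y `^ ka.
have z0 : 0 <= z by exact: powR_ge0.
have yz : sqn y <= 1 + z := le_1DpowR ka1 (sqn_ge0 y).
have h1 : sqn (x - y) <= 2 * sqn x + 2 * sqn y.
  by have := sqnD_le x (- y); rewrite sqnN.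
have h2 : sqn (f x - f y) <= 2 * sqn (f x) + 2 * sqn (f y).
  by have := sqnD_le (f x) (- f y); rewrite sqnN.
have h3 : sqn (f x) <= Cf * (1 + M `^ ka).
  apply: (le_trans (CfP x)); rewrite ler_wpM2l// lerD2l.
  by apply: ge0_ler_powR; rewrite ?nnegrE ?sqn_ge0.
have h4 : sqn (f y) <= Cf * (1 + z) by exact: CfP.
have H : be * sqn (x - y) + sqn (f x - f y) <= A * (1 + z).
  have e1 : be * sqn (x - y) <= 2 * be * (M + 1) * (1 + z).
    apply: (@le_trans _ _ (be * (2 * (M + 1) * (1 + z)))); last first.
      by rewrite le_eqVlt; apply/orP; left; apply/eqP; ring.
    rewrite ler_wpM2l//; apply: (le_trans h1).
    have Mz : 0 <= M * z by rewrite mulr_ge0.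
    by move: (sqn x) (sqn y) xM yz => a b xM yz; nra.
  have e2 : sqn (f x - f y) <= 2 * Cf * (2 + M `^ ka) * (1 + z).
    apply: (le_trans h2).
    have h5 : 2 * sqn (f x) + 2 * sqn (f y) <= Cf * (2 * (1 + M `^ ka) + 2 * (1 + z)).
      have -> : Cf * (2 * (1 + M `^ ka) + 2 * (1 + z)) = 2 * (Cf * (1 + M `^ ka)) + 2 * (Cf * (1 + z)) by ring.
      by apply: lerD; rewrite ler_wpM2l.
    apply: (le_trans h5).
    have -> : 2 * Cf * (2 + M `^ ka) * (1 + z) = Cf * (2 * (2 + M `^ ka) * (1 + z)) by ring.
    rewrite ler_wpM2l//; have Mz : 0 <= M `^ ka * z by rewrite mulr_ge0.
    by move: (M `^ ka) Mk0 Mz => u; lra.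
  by rewrite /A mulrDl lerD.
have P0 : 0 <= be * sqn (x - y) + sqn (f x - f y) by rewrite addr_ge0 ?mulr_ge0 ?sqn_ge0.
apply: (@le_trans _ _ ((A * (1 + z)) ^+ 2)).
  by rewrite lerXn2r// ?nnegrE// mulr_ge0// addr_ge0.
have -> : sqn y `^ (2 * ka) = z ^+ 2 by rewrite mulrC powRrM powR_mulrn// powR_ge0.
rewrite -subr_ge0; have -> : 2 * A ^+ 2 * (1 + z ^+ 2) - (A * (1 + z)) ^+ 2 = (A * (1 - z)) ^+ 2 by ring.
exact: sqr_ge0.
Qed.

Lemma defect_local (M : R) : 0 <= M -> exists2 L : R, 0 <= L & forall x y,
  sqn x <= M -> sqn (x - y) <= 1 ->
  be * sqn (x - y) + sqn (f x - f y) <= L * sqn (x - y).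
Proof.
move=> M0; have [L L0 LP] := drift_lip ka1 c10 hf (2 * M + 2).
exists (be + L); first by rewrite addr_ge0.
move=> x y xM xy; rewrite mulrDl lerD2l; apply: LP.
  by apply: (le_trans xM); lra.
have -> : y = x + - (x - y) by rewrite opprB addrC subrK.
by apply: (le_trans (sqnD_le _ _)); rewrite sqnN; lra.
Qed.

(** Convergence in probability becomes convergence in mean by uniform integrability. Where
    [|x - y|^2 < eta] the defect [D] is at most [L0 eta]; elsewhere it is at most
    [lam D^2 + 1 / (4 lam)]. A small [lam] handles the square through the moment bound, then a small
    probability of the exceptional event handles the rest. Each part receives [S / 3]. *)
Lemma stopped_defect (M t S : R) : 0 <= M -> 0 <= t -> 0 < S -> exists2 del1 : R, 0 < del1 &
  forall del L, 0 < del <= del1 -> L%:R * del <= t -> forall k,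
  L1 P (fun w => Psi M del L k w) /\ EE P (fun w => Psi M del L k w) <= S.
Proof.
move=> M0 t0 S0.
have s1 : 1 <= 2 * ka by rewrite mulr_ege1// ler1n.
have [C C0 CP] := stopped_moment s1 M0 t0.
have [K K0 KP] := defect_growth M0.
have [L0 L00 L0P] := defect_local M0.
pose Q := K * (1 + C) + 1.
have Q0 : 0 < Q by rewrite ltr_wpDl// mulr_ge0 ?addr_ge0.
pose lam := S / (3 * Q).
have lam0 : 0 < lam by rewrite divr_gt0// mulr_gt0.
pose eta := Num.min 1 (S / (3 * (L0 + 1))).
have L01 : 0 < L0 + 1 by rewrite ltr_wpDl.
have eta0 : 0 < eta by rewrite lt_min ltr01 divr_gt0// mulr_gt0.
have eta1 : eta <= 1 by rewrite ge_min lexx.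
have Leta : L0 * eta <= S / 3.
  apply: (@le_trans _ _ ((L0 + 1) * eta)); first by rewrite ler_wpM2r ?(ltW eta0)// lerDl.
  have : eta <= S / (3 * (L0 + 1)) by rewrite ge_min lexx orbT.
  by rewrite invfM mulrA ler_pdivlMr// mulrC.
pose eps := 4 * lam * (S / 3).
have S3 : 0 < S / 3 by rewrite divr_gt0.
have eps0 : 0 < eps by apply: mulr_gt0 => //; apply: mulr_gt0.
have [del1 del10 H] := euler_sum_close hP hW hX0 hind ka1 c10 be0 hf hg hX t0 eta0 eps0.
exists del1 => // del L /andP[del0 dd] Lt k; have del_0 := ltW del0.
have dd' : 0 < del <= del1 by rewrite del0.
pose chi := stop M del L k.
pose x w := X (k%:R * del) w; pose y w := Xt del k w.
pose D w := be * sqn (x w - y w) + sqn (f (x w) - f (y w)).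
have D0 w : 0 <= D w by rewrite addr_ge0 ?mulr_ge0 ?sqn_ge0.
have chi0 w : 0 <= chi w by exact: stop_ge0.
have [LC EC] := CP del L del0 Lt k.
have achi : adreal (FF (k%:R * del)) chi by exact: stop_adapted.
have mchi := ad_meas hP hW hX0 achi.
have ax : advec (FF (k%:R * del)) x by exact: (solution_adapted hX (grid_ge0 del0 k)).
have ay : advec (FF (k%:R * del)) y.
  exact: (euler_sum_adapted ka1 c10 be0 hf hg hX (k := k) del_0).
have mx := adv_meas hP hW hX0 ax; have my := adv_meas hP hW hX0 ay.
have afv (v : T -> 'cV[R]_d) : advec (FF (k%:R * del)) v -> random_vector (fun w => f (v w)).
  move=> av; apply: (adv_meas hP hW hX0 (t := k%:R * del)).
  by apply: (advec_econt av) => i; exact: (econt_drift ka1 c10 hf).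
have mD : measurable_fun setT D.
  apply: measurable_funD.
    by apply: measurable_funM => //; apply: meas_sqn; exact: meas_vsub.
  by apply: meas_sqn; apply: meas_vsub; exact: afv.
have mU : measurable_fun setT (fun w => chi w * D w) by exact: measurable_funM.
have xM w : chi w = 1 -> sqn (x w) <= M by move=> h; case: (stop1_bound h).
pose A := [set w | eta <= sqn (x w - y w)].
have mA : measurable A.
  rewrite -[X in measurable X]setTI; apply: measurable_fun_le => //.
  by apply: meas_sqn; exact: meas_vsub.
pose V w := L0 * eta + (lam * (K * (1 + chi w * sqn (y w) `^ (2 * ka))) + (4 * lam)^-1 * \1_A w).
have LA : L1 P (\1_A : T -> R) by exact: L1_indic.
have LB : L1 P (fun w => lam * (K * (1 + chi w * sqn (y w) `^ (2 * ka)))).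
  by do 2 apply: L1Z; apply: L1D; [exact: L1_cst|exact: LC].
have LV : L1 P V by apply: L1D; [exact: L1_cst|apply: L1D; [exact: LB|exact: L1Z]].
have UV w : 0 <= chi w * D w <= V w.
  rewrite mulr_ge0//=.
  have B0 : 0 <= lam * (K * (1 + chi w * sqn (y w) `^ (2 * ka))).
    by apply: mulr_ge0 (ltW lam0) _; apply: mulr_ge0 => //; rewrite addr_ge0 ?mulr_ge0 ?powR_ge0.
  have Le0 : 0 <= L0 * eta by rewrite mulr_ge0// ltW.
  have l40 : 0 < 4 * lam by rewrite mulr_gt0.
  have I0 : 0 <= (4 * lam)^-1 * (\1_A w : R) by rewrite mulr_ge0 ?invr_ge0 ?(ltW l40)// indicE.
  case: (stop01 M del L k w) => h; rewrite /V -/chi in h *.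
    rewrite {1}h mul0r; exact: (addr_ge0 Le0 (addr_ge0 B0 I0)).
  have h' : chi w = 1 by [].
  rewrite h' !mul1r.
  have [he|he] := ltP (sqn (x w - y w)) eta.
    have h1 := L0P _ _ (xM w h') (ltW (lt_le_trans he eta1)).
    have h2 := ler_wpM2l L00 (ltW he).
    rewrite h' mul1r in B0.
    exact: (le_trans (le_trans h1 h2) (ler_wpDr (addr_ge0 B0 I0) (lexx _))).
  have -> : \1_A w = 1 :> R by rewrite indicE mem_set.
  have h1 := ler_wpM2l (ltW lam0) (KP _ (y w) (xM w h')).
  have h2 : D w <= lam * D w ^+ 2 + (4 * lam)^-1.
    have := sqr_ge0 (2 * lam * D w - 1).
    have e : lam * D w ^+ 2 + (4 * lam)^-1 - D w = (2 * lam * D w - 1) ^+ 2 / (4 * lam).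
      by field; rewrite gt_eqF.
    by move=> s0; rewrite -subr_ge0 e divr_ge0// ltW.
  rewrite mulr1; apply: (le_trans h2); apply: (le_trans (lerD h1 (lexx _))).
  by rewrite lerDr.
have LU := L1_le0 mU LV UV; split; first exact: LU.
have [kL|Lk] := leqP k L; last first.
  have E w : chi w * D w = 0 by rewrite /chi stop_gt// mul0r.
  by rewrite (eq_EE P E) EE_cst ltW.
apply: (le_trans (EE_le LU LV (fun w => proj2 (andP (UV w))))).
rewrite (EED (L1_cst P _) (L1D LB (L1Z _ LA))) EE_cst (EED LB (L1Z _ LA)) (EEZ _ LA).
rewrite (EEZ _ (L1Z K (L1D (L1_cst P 1) LC))) (EEZ _ (L1D (L1_cst P 1) LC)) (EED (L1_cst P 1) LC) EE_cst.
rewrite (EE_indic P mA).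
have kt : k%:R * del <= t by apply: (le_trans _ Lt); exact: grid_le.
have PA : fine (P A) <= eps by exact: H.
have h1 : lam * (K * (1 + EE P (fun w => chi w * sqn (y w) `^ (2 * ka)))) <= S / 3.
  apply: (@le_trans _ _ (lam * Q)).
    rewrite ler_wpM2l ?(ltW lam0)// /Q (@le_trans _ _ (K * (1 + C)))// ?lerDl//.
    by rewrite ler_wpM2l// lerD2l.
  by rewrite /lam invfM mulrA divfK// gt_eqF.
have h2 : (4 * lam)^-1 * fine (P A) <= S / 3.
  have l4 : 0 < 4 * lam by apply: mulr_gt0.
  by rewrite (ler_pdivrMl _ _ l4).
apply: (le_trans (lerD Leta (lerD h1 h2))); lra.
Qed.

(* The energy estimate for [Xt - Y] only uses one-sided bounds at the points [Xt] and [Y],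
   so that [Y] need not be stopped. *)
Lemma scheme_convergence (t eta eps : R) : 0 <= t -> 0 < eta -> 0 < eps ->
  exists2 del1 : R, 0 < del1 & forall del L Y, 0 < del <= del1 -> L%:R * del <= t ->
  is_backward_euler f g W X0 del Y ->
  fine (P [set w | eta <= sqn (X (L%:R * del) w - Y L w)]) <= eps.
Proof.
move=> t0 eta0 eps0.
have pst_1 : 1 <= pst by exact: ltW.
have e4 : 0 < eps / 4 by rewrite divr_gt0.
have eta4 : 0 < eta / 4 by rewrite divr_gt0.
have [delA [M [G [_ M0 mG PG GP]]]] :=
  vector_modulus (solution_meas hP hW hX0 hX) (solution_cont hX) t0 e4 ltr01.
have [h0 [C [h00 h01 C0 CP]]] := @recursion_bound R disp T P d m W hP hW 1 al pst be (lexx 1) pst1 al0 be0.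
(* The recursion bounds the second moment of [e] by [C (2 S)]; with this [S], Markov's inequality at
   level [eta / 4] returns [eps / 4]. *)
pose S := eps / 4 * (eta / 4) / (2 * C + 1).
have C1 : 0 < 2 * C + 1 by rewrite ltr_wpDl// mulr_ge0.
have S0 : 0 < S by rewrite divr_gt0// mulr_gt0.
have CS : C * (2 * S) <= eps / 4 * (eta / 4).
  have : S * (2 * C + 1) = eps / 4 * (eta / 4) by rewrite /S divfK// gt_eqF.
  by move=> <-; have := ltW S0; nra.
have [dB dB0 HB] := stopped_defect M0 t0 S0.
have [dC dC0 HC] := euler_sum_close hP hW hX0 hind ka1 c10 be0 hf hg hX t0 eta4 e4.
pose del1 := Num.min h0 (Num.min dB dC).
have del10 : 0 < del1 by rewrite !lt_min h00 dB0.
exists del1 => // del L Y /andP[del0 dd] Lt HY; have del_0 := ltW del0.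
have d1 : 0 < del <= h0 by rewrite del0 (le_trans dd)// ge_min lexx.
have d2 : 0 < del <= dB by rewrite del0 (le_trans dd)// !ge_min lexx orbT.
have d3 : 0 < del <= dC by rewrite del0 (le_trans dd)// !ge_min lexx !orbT.
pose chi := stop M del L.
pose x k w := X (k%:R * del) w; pose y k w := Xt del k w.
have achi k : adreal (FF (k%:R * del)) (chi k) by exact: stop_adapted.
have mchi k := ad_meas hP hW hX0 (@achi k).
have ax k : advec (FF (k%:R * del)) (x k) by exact: (solution_adapted hX (grid_ge0 del0 k)).
have ay k : advec (FF (k%:R * del)) (y k).
  exact: (euler_sum_adapted ka1 c10 be0 hf hg hX (k := k) del_0).
have aY := scheme_adapted pst_1 al0 ka1 c10 be0 hmon hf hg hX0 hind del0 HY.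
have mx k := adv_meas hP hW hX0 (@ax k); have my k := adv_meas hP hW hX0 (@ay k).
have agv (v : T -> 'cV[R]_d) k : advec (FF (k%:R * del)) v -> admat (FF (k%:R * del)) (fun w => g (v w)).
  by move=> av; apply: (admat_econt av) => i j; exact: (econt_diffusion be0 hg).
have mfv (v : T -> 'cV[R]_d) k : advec (FF (k%:R * del)) v -> random_vector (fun w => f (v w)).
  move=> av; apply: (adv_meas hP hW hX0 (t := k%:R * del)).
  by apply: (advec_econt av) => i; exact: (econt_drift ka1 c10 hf).
pose e k w := chi k w *: (y k w - Y k w).
pose GG k w := chi k w *: (g (y k w) - g (Y k w)).
pose HH k w := chi k w *: (g (x k w) - g (y k w)).
pose N k w := HH k w *m dw (k%:R * del) (k.+1%:R * del) w.
(* The indicator is that of [k.+1] because the drift is taken at the new time; the recursion asks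
   [r] only to be measurable, so looking ahead is harmless. *)
pose r k w := chi k.+1 w *: (del *: (f (x k.+1 w) - f (y k.+1 w))).
have ae k : advec (FF (k%:R * del)) (e k).
  by apply: meas_scalev; [exact: achi|apply: meas_vsub; [exact: ay|exact: aY]].
have aGG k : admat (FF (k%:R * del)) (GG k).
  by apply: meas_scaleM; [exact: achi|apply: meas_Msub; apply: agv; [exact: ay|exact: aY]].
have aHH k : admat (FF (k%:R * del)) (HH k).
  by apply: meas_scaleM; [exact: achi|apply: meas_Msub; apply: agv; [exact: ax|exact: ay]].
have st k : 0 <= k%:R * del <= k.+1%:R * del by rewrite grid_ge0//= grid_le.
have mN k : random_vector (N k).
  by apply: meas_mulmx; [exact: (adm_meas hP hW hX0 (aHH k))|exact: (incr_meas hP hW hX0 (st k))].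
have mr k : random_vector (r k).
  apply: meas_scalev; first exact: mchi.
  by apply: meas_vscale; apply: meas_vsub; [exact: mfv (ax _)|exact: mfv (ay _)].
have e00 w : e 0%N w = 0.
  rewrite /e /y /euler_sum !big_nil scaler0 !addr0 (proj1 HY) subrr scaler0 //.
have chi2 k w : chi k w ^+ 2 = chi k w by exact: stop_sqr.
have LPsi k := proj1 (HB del L d2 Lt k); have EPsi k := proj2 (HB del L d2 Lt k).
pose Ps k w := chi k w * (be * sqn (x k w - y k w) + sqn (f (x k w) - f (y k w))).
have hs2H k w : 0 <= hs2 (HH k w) <= Ps k w.
  rewrite hs2_ge0/= hs2Z chi2 /Ps ler_wpM2l ?stop_ge0//.
  by apply: (le_trans (hg _ _)); rewrite lerDl sqn_ge0.
have LH k : L1 P (fun w => hs2 (HH k w)).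
  apply: (L1_le0 _ (LPsi k) (hs2H k)).
  by apply: meas_hs2; exact: (adm_meas hP hW hX0 (aHH k)).
have mul1E (U : T -> R) w : 1 * U w = U w by rewrite mul1r.
have LH1 k : L1 P (fun w => 1 * hs2 (HH k w)) by apply: (eq_L1 (mul1E _)).
have a1 (t' : R) : adreal (FF t') (fun=> (1 : R)) by exact: measurable_cst.
have NE k w : 1 * sqn (N k w) `^ 1 = 1 * sqn (N k w) by rewrite powRr1 ?sqn_ge0.
have rE k w : 1 * sqn (r k w) `^ 1 = del ^+ 2 * (chi k.+1 w * sqn (f (x k.+1 w) - f (y k.+1 w))).
  by rewrite mul1r powRr1 ?sqn_ge0// /r !sqnZ chi2; ring.
have eE k w : 1 * sqn (e k w) `^ 1 = sqn (e k w) by rewrite mul1r powRr1 ?sqn_ge0.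
have rPs k w : 0 <= chi k w * sqn (f (x k w) - f (y k w)) <= Ps k w.
  rewrite mulr_ge0 ?stop_ge0 ?sqn_ge0//= ler_wpM2l ?stop_ge0// lerDr.
  by rewrite mulr_ge0 ?sqn_ge0.
have Lr k : L1 P (fun w => chi k w * sqn (f (x k w) - f (y k w))).
  apply: (L1_le0 _ (LPsi k) (rPs k)); apply: measurable_funM; first exact: mchi.
  by apply: meas_sqn; apply: meas_vsub; [exact: mfv (ax _)|exact: mfv (ay _)].
have E0 w : 1 * sqn (e 0%N w) `^ 1 = 0 by rewrite eE e00 sqn0.
have H := @CP X0 hX0 hind del (fun=> 1) d e N r GG (2 * S) d1 (a1 0) (fun=> ler01) ae aGG mN mr.
have [||||k Lk|Le Ee] := H _ _ _ _ _ L.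
- move=> k w; rewrite hs2Z sqnZ mulrCA ler_wpM2l ?sqr_ge0//; exact: hg.
(* Once stopped, the new error and coefficient difference are 0 and the inequality is trivial;
   otherwise both indicators are 1 and it reduces to [lyap_step]. *)
- move=> k w; have [h|h] := stop01 M del L k.+1 w; rewrite -/chi in h.
    rewrite /e /GG h !scale0r /lyap sqn0 (_ : hs2 0 = 0) ?mulr0 ?addr0 ?sqn_ge0//.
    by rewrite -(scale0r 0) hs2Z expr0n/= mul0r.
  have [h' _ _] := stopS h; rewrite -/chi in h'.
  rewrite /e /GG /N /HH /r h h' !scale1r.
  apply: (le_trans (lyap_step hmon _ _ del_0)).
  rewrite le_eqVlt; apply/orP; left; apply/eqP; congr sqn.
  have E1 : y k.+1 w = y k w + (del *: f (x k.+1 w) + g (x k w) *m dw (k%:R * del) (k.+1%:R * del) w).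
    exact: euler_sumS.
  have E2 : Y k.+1 w = Y k w + g (Y k w) *m dw (k%:R * del) (k.+1%:R * del) w + del *: f (Y k.+1 w).
    by rewrite -(scheme_step k w HY) subrK.
  rewrite !mulmxBl !scalerBr [X in X - Y k.+1 w]E1 [X in _ - X - _]E2.
  move: (del *: f (x k.+1 w)) (del *: f (y k.+1 w)) (del *: f (Y k.+1 w)) => u1 u2 u3.
  move: (g (x k w) *m _) (g (y k w) *m _) (g (Y k w) *m _) => v1 v2 v3.
  by vec.
- by rewrite mulr_ge0// ltW.
- by apply: (eq_L1 E0); exact: L1_cst.
- have Le1 : L1 P (fun w => 1 * sqn (e k w)).
    by apply: (eq_L1 _ Lk) => w; rewrite eE mul1r.
  have [LN EN] := EE_sqn hP hW hX0 hind (st k) (a1 _) (aHH k) (fun=> ler01) (LH1 k).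
  have [LI EI] := EE_inner0 hP hW hX0 hind (st k) (a1 _) (ae k) (aHH k) (fun=> ler01) Le1 (LH1 k).
  have IE w : 1 * sqn (e k w) `^ (1 - 1) * inner (e k w) (N k w) = 1 * inner (e k w) (N k w).
    by rewrite subrr powRr0 mulr1.
  split.
  + exact: (eq_L1 (NE k)).
  + by apply: (eq_L1 (rE k)); apply: L1Z; exact: Lr.
  + exact: (eq_L1 IE).
  + by rewrite (eq_EE P IE).
  rewrite (eq_EE P (NE k)) EN (eq_EE P (rE k)) (EEZ _ (Lr k.+1)) natS_step (eq_EE P (mul1E _)).
  have b1 : EE P (fun w => chi k.+1 w * sqn (f (x k.+1 w) - f (y k.+1 w))) <= S.
    apply: (le_trans _ (EPsi k.+1)); apply: EE_le; [exact: Lr|exact: LPsi|].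
    by move=> w; case/andP: (rPs k.+1 w).
  have b2 : EE P (fun w => hs2 (HH k w)) <= S.
    apply: (le_trans _ (EPsi k)); apply: EE_le; [exact: LH|exact: LPsi|].
    by move=> w; case/andP: (hs2H k w).
  have -> : 1 - 2 * 1 = -1 :> R by ring.
  rewrite subrr powRr0 mul1r (powR_inv1 del_0).
  have -> : del^-1 * (del ^+ 2 * EE P (fun w => chi k.+1 w * sqn (f (x k.+1 w) - f (y k.+1 w)))) =
     del * EE P (fun w => chi k.+1 w * sqn (f (x k.+1 w) - f (y k.+1 w))).
    by field; rewrite gt_eqF.
  by rewrite -mulrDr ler_wpM2l// mulr_natl mulr2n lerD.
have {}Ee : EE P (fun w => sqn (e L w)) <= eps / 4 * (eta / 4).
  rewrite -(eq_EE P (eE L)); apply: (le_trans Ee).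
  by rewrite (eq_EE P E0) EE_cst add0r.
have Le' : L1 P (fun w => sqn (e L w)) by apply: (eq_L1 _ Le) => w; rewrite eE.
have Ltl l : (l <= L)%N -> 0 <= l%:R * del <= t.
  by move=> lL; rewrite grid_ge0//= (le_trans _ Lt)// grid_le.
have [N0 [mN0 PN0 HN0]] := sde_start hX.
pose A1 := [set w | eta / 4 <= sqn (x L w - y L w)].
pose A2 := [set w | eta / 4 <= sqn (e L w)].
have mset (U : T -> R) c : measurable_fun setT U -> measurable [set w | c <= U w].
  by move=> mU; rewrite -[X in measurable X]setTI; apply: measurable_fun_le.
have mA1 : measurable A1 by apply: mset; apply: meas_sqn; apply: meas_vsub; [exact: mx|exact: my].
have mA2 : measurable A2 by apply: mset; apply: meas_sqn; exact: (adv_meas hP hW hX0 (ae L)).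
have PA1 : fine (P A1) <= eps / 4 by exact: HC.
have PA2 : fine (P A2) <= eps / 4.
  rewrite -(EE_indic P mA2); apply: (@le_trans _ _ ((eta / 4)^-1 * EE P (fun w => sqn (e L w)))).
    rewrite -(EEZ _ Le'); apply: EE_le; [exact: L1_indic|exact: L1Z|] => w.
    rewrite indicE; case: (boolP (w \in A2)) => [/set_mem h|_] /=.
      by rewrite ler_pdivlMl// mulr1.
    by rewrite mulr_ge0 ?sqn_ge0// invr_ge0 ltW.
  by rewrite ler_pdivrMl// mulrC.
have mY : random_vector (Y L) by exact: (adv_meas hP hW hX0 (aY L)).
have mA : measurable [set w | eta <= sqn (X (L%:R * del) w - Y L w)].
  by apply: mset; apply: meas_sqn; apply: meas_vsub => //; exact: mx.
pose B (o : (bool * bool)%type) := match o with (true, true) => N0 | (true, false) => ~` G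
   | (false, true) => A1 | (false, false) => A2 end.
have mB o : measurable (B o) by case: o => [[] []] //=; exact: measurableC.
have AB w : eta <= sqn (X (L%:R * del) w - Y L w) -> exists o, B o w.
  move=> Aw; apply: contrapT => nB.
  have nN : ~ N0 w by move=> h; apply: nB; exists (true, true).
  have Gw : G w by apply: contrapT => h; apply: nB; exists (true, false).
  have nA1 : ~ A1 w by move=> h; apply: nB; exists (false, true).
  have nA2 : ~ A2 w by move=> h; apply: nB; exists (false, false).
  have X0E : X 0 w = X0 w by apply: contrapT => h; apply: nN; exact: HN0.
  have [_ _ bd] := GP w Gw.
  have ch1 : chi L w = 1.
    apply: stop_intro => //; first by rewrite -X0E bd// lexx t0.
    by move=> l lL; apply: bd; exact: Ltl.
  move: nA1 nA2; rewrite /A1 /A2 /= => /negP; rewrite -ltNge => h1 /negP; rewrite -ltNge => h2.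
  rewrite /e ch1 scale1r in h2.
  have := sqnD_le (x L w - y L w) (y L w - Y L w); rewrite subrKA => h3.
  have := le_trans Aw h3; lra.
apply: (le_trans (prob_le_sum P mA mB AB)).
have -> : \sum_o fine (P (B o)) = \sum_i \sum_j fine (P (B (i, j))).
  by rewrite pair_bigA; apply: eq_bigr => -[].
rewrite !big_bool/= PN0 /= add0r.
apply: (le_trans (lerD PG (lerD PA1 PA2))); lra.
Qed.

End convergence.

(** * The rate *)

Section fatou.
Context {R : realType} {disp : measure_display} {T : measurableType disp}.
Variable P : probability T R.

(** Fatou's lemma without subsequences: truncating [D] at [n] gives a mean of at most [E V + n P A],
    where [A] is chosen after [n]; monotone convergence removes the truncation. *)
Lemma fatou_probability (D : T -> R) (B : R) : measurable_fun setT D -> (forall w, 0 <= D w) ->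
  (forall eps, 0 < eps -> exists A V, [/\ measurable A, fine (P A) <= eps, L1 P V,
     EE P V <= B + eps & forall w, 0 <= V w /\ (~ A w -> D w <= V w)]) ->
  L1 P D /\ EE P D <= B.
Proof.
move=> mD D0 H; pose Dn n w := Num.min (D w) n%:R.
have mDn n : measurable_fun setT (Dn n) by apply: measurable_minr.
have Dn0 n w : 0 <= Dn n w by rewrite le_min D0 ler0n.
have LDn n : L1 P (Dn n).
  by apply: (L1_le0 (mDn n) (L1_cst P n%:R)) => w; rewrite Dn0 ge_min lexx orbT.
have EDn n : EE P (Dn n) <= B.
  apply/ler_addgt0Pr => e e0; pose eps := e / n.+1%:R.
  have eps0 : 0 < eps by rewrite divr_gt0.
  have [A [V [mA PA LV EV AV]]] := H _ eps0.
  have V0 w := proj1 (AV w).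
  have LA := L1_indic P mA.
  apply: (@le_trans _ _ (EE P (fun w => V w + n%:R * \1_A w))).
    apply: EE_le => [//||w]; first by apply: L1D => //; exact: L1Z.
    rewrite indicE; case: (boolP (w \in A)) => [_|/negP h] /=.
      by rewrite mulr1; apply: (@le_trans _ _ n%:R); [rewrite ge_min lexx orbT|rewrite lerDr].
    rewrite mulr0 addr0 ge_min (proj2 (AV w))// => Aw; apply: h; exact: mem_set.
  rewrite (EED LV (L1Z _ LA)) (EEZ _ LA) (EE_indic P mA).
  have h1 : n%:R * fine (P A) <= n%:R * eps by rewrite ler_wpM2l.
  apply: (le_trans (lerD EV h1)).
  have : n.+1%:R * eps = e by rewrite /eps mulrC divfK.
  by rewrite -natr1; move: (n%:R : R) => u; lra.
have I : (\int[P]_w (D w)%:E <= B%:E)%E.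
  have cv : ((\int[P]_w (Dn n w)%:E) @[n --> \oo] --> \int[P]_w (limn (fun n => (Dn n w)%:E)))%E.
    apply: cvg_monotone_convergence => //.
    - by move=> n; exact/measurable_EFinP.
    - by move=> n w _; rewrite lee_fin.
    - by move=> w _ a b ab; rewrite lee_fin /Dn le_min !ge_min lexx/= ler_nat ab orbT.
  have -> : (\int[P]_w (D w)%:E = \int[P]_w (limn (fun n => (Dn n w)%:E)))%E.
    apply: eq_integral => w _; apply/esym/cvg_lim => //.
    apply: cvg_near_cst; near=> n.
    rewrite /Dn min_l//; apply: ltW; near: n; exact: nbhs_infty_gtr.
  rewrite -(cvg_lim _ cv)//; apply: lime_le; first by apply/cvg_ex; eexists; exact: cv.
  by near=> n; rewrite -EFin_EE// lee_fin.
have LD : L1 P D by apply: L1_fin_ge0 => //; apply: (le_lt_trans I); rewrite ltry.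
by split=> //; rewrite -lee_fin (EFin_EE LD).
Unshelve. all: by end_near.
Qed.

End fatou.

Section rate.
Context {R : realType} {disp : measure_display} {T : measurableType disp}.
Variable P : probability T R.
Context {d m : nat} {W : R -> T -> 'cV[R]_m}.
Variables (f : 'cV[R]_d -> 'cV[R]_d) (g : 'cV[R]_d -> 'M[R]_(d, m)).
Variables (pst al ka c1 be : R).
Hypothesis hP : measure_is_complete P.
Hypothesis hW : is_wiener P W.
Hypothesis pst1 : 1 < pst.
Hypothesis al0 : 0 < al.
Hypothesis ka1 : 1 <= ka.
Hypothesis c10 : 0 <= c1.
Hypothesis be0 : 0 <= be.
Hypothesis hmon : forall x y,
  inner (x - y) (f x - f y) + (2 * pst - 1) / 2 * hs2 (g x - g y) <= - al * sqn (x - y).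
Hypothesis hf : forall x y,
  sqn (f x - f y) <= c1 * (1 + sqn x `^ (ka - 1) + sqn y `^ (ka - 1)) * sqn (x - y).
Hypothesis hg : forall x y, hs2 (g x - g y) <= be * sqn (x - y).

Let pst_1 : 1 <= pst. Proof. exact: ltW. Qed.

Lemma scheme_exists (X0 : T -> 'cV[R]_d) h : 0 < h -> exists Y, is_backward_euler f g W X0 h Y.
Proof.
move=> h0.
pose fix Y k : T -> 'cV[R]_d := if k is k'.+1 then fun w =>
  implicit_solve f h (Y k' w + g (Y k' w) *m (W (k'.+1%:R * h) w - W (k'%:R * h) w)) else X0.
exists Y; split=> // k w; have := implicit_solveP (drift_mono pst_1 al0 hmon) (drift_lip ka1 c10 hf)
  (Y k w + g (Y k w) *m (W (k.+1%:R * h) w - W (k%:R * h) w)) h0.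
rewrite -/(Y k.+1 w) => /eqP; rewrite subr_eq => /eqP E.
by rewrite [LHS]E addrAC.
Qed.

Lemma solution_rate q : 1 <= q -> q < pst -> exists2 h0 : R, 0 < h0 <= 1 &
  forall p, 1 <= p -> (2 * ka - 1) * p <= q -> exists2 C : R, 0 <= C &
  forall X0 X, random_vector X0 -> indep_of_process P X0 W ->
  L1 P (fun w => sqn (X0 w) `^ q) -> is_sde_solution P f g W X0 X ->
  forall h Z, 0 < h <= h0 -> is_backward_euler f g W X0 h Z -> forall k,
  L1 P (fun w => sqn (X (k%:R * h) w - Z k w) `^ p) /\
  EE P (fun w => sqn (X (k%:R * h) w - Z k w) `^ p) <=
     C * h `^ p * EE P (fun w => (1 + sqn (X0 w)) `^ ((2 * ka - 1) * p)).
Proof.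
move=> q1 qp.
have [h0 h01 H] := scheme_rate hP hW pst_1 al0 ka1 c10 be0 hmon hf hg q1 qp.
exists h0 => // p p1 pq; have [C C0 CP] := H p p1 pq.
have p0 : 0 < p by exact: lt_le_trans p1.
pose c : R := 2 `^ p * 2 `^ p.
have c0 : 0 < c by rewrite mulr_gt0// powR_gt0.
exists (c * C) => [|X0 X hX0 hind LX0 hX h Z hh HZ k]; first by rewrite mulr_ge0// ltW.
have [h_0 _] := andP hh; have h_0' := ltW h_0.
have kh0 : 0 <= k%:R * h by rewrite mulr_ge0.
have mX := solution_meas hP hW hX0 hX kh0.
have mBE l del Y : 0 < del -> is_backward_euler f g W X0 del Y -> random_vector (Y l).
  move=> d0 HY; apply: (adv_meas hP hW hX0).
  exact: (scheme_adapted pst_1 al0 ka1 c10 be0 hmon hf hg hX0 hind d0 HY).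
have mZ := mBE k h Z h_0 HZ.
apply: fatou_probability => [|w|eps eps0]; last 2 first.
- exact: powR_ge0.
- pose u := eps / c; have u0 : 0 < u by rewrite divr_gt0.
  pose eta := u `^ p^-1; have eta0 : 0 < eta by rewrite powR_gt0.
  have etaE : c * eta `^ p = eps.
    by rewrite /eta -powRrM mulVf ?gt_eqF// powRr1 ?(ltW u0)// /u mulrC divfK// gt_eqF.
  have [del1 del10 HD] := scheme_convergence hP hW hX0 hind pst1 al0 ka1 c10 be0 hmon hf hg hX
    kh0 eta0 eps0.
  (* The successor makes [n] positive and [h / n <= del1]; the constant [C] of the error bound does
     not depend on this [n]. *)
  pose n := (Num.trunc (h / del1)).+1; pose del := h / n%:R.
  have del0 : 0 < del by rewrite divr_gt0.
  have nh : n%:R * del = h by rewrite /del mulrC divfK// pnatr_eq0.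
  have dd : del <= del1.
    rewrite /del ler_pdivrMr// mulrC -ler_pdivrMr//; apply: ltW.
    by rewrite /n truncnS_gt.
  have [Y HY] := scheme_exists X0 del0.
  have [LV EV] := CP X0 hX0 hind LX0 h del n Y Z hh isT nh HZ HY k.
  have E : (k * n)%:R * del = k%:R * h by rewrite natrM -mulrA nh.
  have PA : fine (P [set w | eta <= sqn (X (k%:R * h) w - Y (k * n)%N w)]) <= eps.
    by rewrite -E; apply: HD; rewrite ?del0// E.
  have mY := mBE (k * n)%N del Y del0 HY.
  exists [set w | eta <= sqn (X (k%:R * h) w - Y (k * n)%N w)].
  exists (fun w => c * (eta `^ p + sqn (Y (k * n)%N w - Z k w) `^ p)).
  have LV' : L1 P (fun w => eta `^ p + sqn (Y (k * n)%N w - Z k w) `^ p).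
    by apply: L1D; [exact: L1_cst|exact: LV].
  split => //.
  + rewrite -[X in measurable X]setTI; apply: measurable_fun_le => //.
    by apply: meas_sqn; exact: meas_vsub.
  + exact: L1Z.
  + rewrite (EEZ _ LV') (EED (L1_cst P _) LV) EE_cst mulrDr etaE addrC lerD2r.
    have := ler_wpM2l (ltW c0) EV; rewrite !mulrA; exact.
  + move=> w; split; first by rewrite mulr_ge0 ?(ltW c0)// addr_ge0 ?powR_ge0.
    move=> /negP; rewrite -ltNge => h1.
    have -> : X (k%:R * h) w - Z k w = (X (k%:R * h) w - Y (k * n)%N w) + (Y (k * n)%N w - Z k w).
      by rewrite subrKA.
    apply: (le_trans (sqnD_powR _ _ (ltW p0))); rewrite ler_wpM2l ?(ltW c0)// lerD2r.
    by apply: ge0_ler_powR; rewrite ?nnegrE ?sqn_ge0 ?(ltW p0) ?(ltW eta0) ?(ltW h1).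
- by apply: meas_powR; apply: meas_sqn; exact: meas_vsub.
Qed.

End rate.

Theorem theorem3p9 (R : realType) (disp : measure_display)
    (T : measurableType disp) (P : probability T R) (d m : nat)
    (W : R -> T -> 'cV[R]_m)
    (f : 'cV[R]_d -> 'cV[R]_d) (g : 'cV[R]_d -> 'M[R]_(d, m))
    (pstar alpha1 kappa c1 beta1 : R)
    (hP : measure_is_complete P)
    (hW : is_wiener P W)
    (hpstar : 1 <= pstar) (hpstar_int : pstar \isn't a Num.int)
    (halpha1 : 0 < alpha1) (hkappa : 1 <= kappa)
    (hc1 : 0 < c1) (hbeta1 : 0 < beta1)
    (hmon : forall x y : 'cV[R]_d,
      inner (x - y) (f x - f y)
        + (2 * pstar - 1) / 2 * hsnorm (g x - g y) ^+ 2
      <= - alpha1 * enorm (x - y) ^+ 2)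
    (hf : forall x y : 'cV[R]_d,
      enorm (f x - f y) ^+ 2
      <= c1 * (1 + enorm x `^ (2 * kappa - 2) + enorm y `^ (2 * kappa - 2))
           * enorm (x - y) ^+ 2)
    (hg : forall x y : 'cV[R]_d,
      hsnorm (g x - g y) ^+ 2 <= beta1 * enorm (x - y) ^+ 2) :
  exists2 h0 : R, 0 < h0 <= 1 &
  forall p : R, 1 <= p <= (Num.floor pstar)%:~R / (2 * kappa - 1) ->
  exists K : R,
  forall (X0 : T -> 'cV[R]_d) (X : R -> T -> 'cV[R]_d),
    random_vector X0 ->
    indep_of_process P X0 W ->
    ('E_P[fun w => (enorm (X0 w) `^ (2 * pstar))%R] < +oo)%E ->
    is_sde_solution P f g W X0 X ->
  forall (N : nat) (h : R) (Z : nat -> T -> 'cV[R]_d),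
    (1 <= N)%N -> h = 1 / N%:R ->
    h <= Num.min (1 / (p * alpha1)) h0 ->
    is_backward_euler f g W X0 h Z ->
  forall k : nat,
    ('E_P[fun w => (enorm (X (k%:R * h) w - Z k w) `^ (2 * p))%R]
       `^ (1 / (2 * p))%R
     <= K%:E
        * 'E_P[fun w => (1 + enorm (X0 w) `^ ((5 * kappa - 3) * p))%R]
            `^ (1 / (2 * p))%R
        * (h `^ (1 / 2))%:E)%E.

Proof.
have hmon' x y : inner (x - y) (f x - f y) + (2 * pstar - 1) / 2 * hs2 (g x - g y) <=
    - alpha1 * sqn (x - y) by have := hmon x y; rewrite hsnorm_sqr enorm_sqr.
have k2E : 2 * kappa - 2 = 2 * (kappa - 1) by ring.
have hf' x y : sqn (f x - f y) <=
    c1 * (1 + sqn x `^ (kappa - 1) + sqn y `^ (kappa - 1)) * sqn (x - y).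
  by have := hf x y; rewrite !enorm_sqr k2E !enorm_powR.
have hg' x y : hs2 (g x - g y) <= beta1 * sqn (x - y).
  by have := hg x y; rewrite hsnorm_sqr enorm_sqr.
(* Non-integrality excludes 1; the recursion with [q = 1] behind [scheme_convergence] asks for the
   strict inequality. *)
have pst1 : 1 < pstar.
  rewrite lt_neqAle hpstar andbT; apply/eqP => E; move/negP: hpstar_int; apply.
  by rewrite -E rpred1.
pose q : R := (Num.floor pstar)%:~R.
have q1 : 1 <= q by rewrite (ler1z R) floor_ge_int.
have qp : q < pstar.
  rewrite lt_neqAle ge_floor andbT; apply/eqP => E; move/negP: hpstar_int; apply.
  by rewrite -E intr_int.
have k1 : 1 <= 2 * kappa - 1 by move: hkappa; clear; lra.
have k0 : 0 < 2 * kappa - 1 by exact: lt_le_trans k1.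
have [h0 h01 H] := solution_rate hP hW pst1 halpha1 hkappa (ltW hc1) (ltW hbeta1) hmon' hf' hg' q1 qp.
exists h0 => // p /andP[p1 pq].
have p0 : 0 < p by exact: lt_le_trans p1.
have pq' : (2 * kappa - 1) * p <= q by rewrite mulrC -ler_pdivlMr.
have [C C0 CP] := H p p1 pq'.
(* As powers of squared norms, [a] is the exponent of the bound obtained and [b] that of the
   statement; [a <= b] amounts to [4 kappa - 2 <= 5 kappa - 3], that is, [1 <= kappa]. *)
pose a := (2 * kappa - 1) * p; pose b := (5 * kappa - 3) / 2 * p.
have a0 : 0 < a by rewrite mulr_gt0.
have ab : a <= b by rewrite ler_pM2r// ler_pdivlMr//; move: hkappa; clear; lra.
pose c : R := C * (2 `^ a * 2).
have c0 : 0 <= c by rewrite mulr_ge0// mulr_ge0// powR_ge0.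
exists (c `^ (1 / (2 * p))) => X0 X hX0 hind LX0 hX N h Z N1 hE hh HZ k.
have h_0 : 0 < h by rewrite hE divr_gt0// ltr0n.
have hh0 : 0 < h <= h0 by rewrite h_0 (le_trans hh)// ge_min lexx orbT.
have mX0 : measurable_fun setT (fun w => sqn (X0 w)) by exact: meas_sqn.
have Lp : L1 P (fun w => sqn (X0 w) `^ pstar).
  apply: L1_fin_ge0 => [|w|]; [exact: meas_powR|exact: powR_ge0|].
  by move: LX0; rewrite unlock; under eq_integral do rewrite enorm_powR.
have Lq : L1 P (fun w => sqn (X0 w) `^ q).
  apply: (L1_le0 _ (L1D (L1_cst P 1) Lp)) => [|w]; first exact: meas_powR.
  by rewrite powR_ge0 powR_le1D ?sqn_ge0 ?(ltW qp) ?(le_trans ler01 q1).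
have s1 w : 0 <= 1 + sqn (X0 w) by rewrite addr_ge0 ?sqn_ge0.
have aD w t : a <= t -> (1 + sqn (X0 w)) `^ a <= 2 `^ a * 2 * (1 + sqn (X0 w) `^ t).
  move=> at_; apply: (le_trans (powRD_le (ltW a0) ler01 (sqn_ge0 _))).
  rewrite powR1 -mulrA ler_wpM2l ?powR_ge0//.
  have := powR_le1D (ltW a0) at_ (sqn_ge0 (X0 w)); have := powR_ge0 (sqn (X0 w)) t.
  by move: (sqn _ `^ _) (sqn _ `^ _) => u v; lra.
have La : L1 P (fun w => (1 + sqn (X0 w)) `^ a).
  apply: (L1_le0 _ (L1Z (2 `^ a * 2) (L1D (L1_cst P 1) Lq))) => [|w].
    by apply: meas_powR; exact: measurable_funD.
  by rewrite powR_ge0 aD.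
have [LD ED] := CP X0 X hX0 hind Lq hX h Z hh0 HZ k.
have bE w : 1 + enorm (X0 w) `^ ((5 * kappa - 3) * p) = 1 + sqn (X0 w) `^ b.
  by rewrite -enorm_powR; congr (_ + _ `^ _); rewrite /b; field.
have E0 : (0 <= 'E_P[fun w => (1 + enorm (X0 w) `^ ((5 * kappa - 3) * p))%R])%E.
  by apply: expectation_ge0 => w; rewrite addr_ge0 ?powR_ge0.
(* The moment in the statement may be infinite, as [b] may exceed [pstar]; the comparison is
   therefore made in the extended reals. *)
have Ea : ((EE P (fun w => (1 + sqn (X0 w)) `^ a))%:E <= (2 `^ a * 2)%:E *
    'E_P[fun w => (1 + enorm (X0 w) `^ ((5 * kappa - 3) * p))%R])%E.
  rewrite (EFin_EE La) unlock -ge0_integralZl//; last 2 first.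
  - apply/measurable_EFinP; under eq_fun do rewrite bE.
    by apply: measurable_funD => //; exact: meas_powR.
  - by move=> w _; rewrite lee_fin addr_ge0 ?powR_ge0.
  apply: ge0_le_integral => //.
  - by move=> w _; rewrite lee_fin powR_ge0.
  - by apply/measurable_EFinP; exact: (L1_meas La).
  - apply/measurable_EFinP; apply: measurable_funM => //; under eq_fun do rewrite bE.
    by apply: measurable_funD => //; exact: meas_powR.
  - by move=> w _; rewrite lee_fin bE aD.
have D : ('E_P[fun w => (enorm (X (k%:R * h) w - Z k w) `^ (2 * p))%R] <=
    (c * h `^ p)%:E * 'E_P[fun w => (1 + enorm (X0 w) `^ ((5 * kappa - 3) * p))%R])%E.
  have -> : ('E_P[fun w => (enorm (X (k%:R * h) w - Z k w) `^ (2 * p))%R] =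
      (EE P (fun w => sqn (X (k%:R * h) w - Z k w) `^ p))%:E)%E.
    by rewrite unlock (EFin_EE LD); under eq_integral do rewrite enorm_powR.
  apply: (@le_trans _ _ (C * h `^ p * EE P (fun w => (1 + sqn (X0 w)) `^ a))%:E).
    by rewrite lee_fin.
  have -> : c * h `^ p = C * h `^ p * (2 `^ a * 2) by rewrite /c; ring.
  rewrite EFinM [X in (_ <= X * _)%E]EFinM -muleA; apply: lee_wpmul2l Ea.
  by rewrite lee_fin mulr_ge0// powR_ge0.
have r0 : 0 <= 1 / (2 * p) := divr_ge0 ler01 (mulr_ge0 (ler0n R 2) (ltW p0)).
apply: (@le_trans _ _ (((c * h `^ p)%:E * 'E_P[fun w => (1 + enorm (X0 w) `^ ((5 * kappa - 3) * p))%R])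
    `^ (1 / (2 * p)))%E).
  apply: gt0_ler_poweR => //; rewrite in_itv/= leey andbT.
    by apply: expectation_ge0 => w; exact: powR_ge0.
  by rewrite mule_ge0// lee_fin mulr_ge0// powR_ge0.
rewrite poweRM//; last by rewrite lee_fin mulr_ge0// powR_ge0.
rewrite poweR_EFin powRM ?powR_ge0// -powRrM.
have -> : p * (1 / (2 * p)) = 1 / 2 by field; rewrite gt_eqF.
by rewrite EFinM -!muleA [X in (_ * X)%E]muleC.
Qed.
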